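(* Suppose that $H:\mathbb{R}^{2d}\to\mathbb{R}$ has continuous bounded derivatives up to order $4$, and let $\theta\in[0,1]$. Then for every $t\in[0,T]$, the normalized error $U^{N,\theta}_t=N(X_t-X^{N,\theta}_t)$ of the $\theta$ method converges in distribution, as $N\to\infty$, to $U^\theta_t$, where the process $U^\theta$ satisfies $$\begin{aligned} U_t^\theta=&\int_{0}^{t}Db(X_s)U_s^\theta\,\mathrm{d}s+\frac{(1-2\theta)T}{2}\int_{0}^{t}Db(X_s)b(X_s)\,\mathrm{d}s\\ &+\frac{(1-2\theta)T}{2}\int_{0}^{t}Db(X_s)\sigma\,\mathrm{d}W_s+\frac{\sqrt 3}{6}T\int_{0}^{t}Db(X_s)\sigma\,\mathrm{d}\widetilde{W}_s\\ &+\frac{(1-2\theta^2)T}{4}\sum_{k=1}^{m}\int_{0}^{t}D^2b(X_s)(\sigma_{\cdot,k},\sigma_{\cdot,k})\,\mathrm{d}s,\qquad t\in[0,T], \end{aligned}$$ and $\{\widetilde W_t,t\in[0,T]\}$ is an $m$-dimensional standard Brownian motion independent of $\{W_t,t\in[0,T]\}$.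
   Context: Let $T>0$, $d,m\in\mathbb{N}_+$, and let $W$ be an $m$-dimensional standard Brownian motion on a complete filtered probability space $(\Omega,\mathcal F,\{\mathcal F_t\}_{t\in[0,T]},\mathbb P)$ satisfying the usual conditions. Let $\sigma\in\mathbb{R}^{2d\times m}$ be a constant matrix with columns $\sigma_{\cdot,1},\dots,\sigma_{\cdot,m}$, let $H:\mathbb{R}^{2d}\to\mathbb{R}$, and put $b:=J\nabla H$ with $J=\begin{pmatrix}0&I_d\\-I_d&0\end{pmatrix}$. The process $X$ is the solution of $\mathrm{d}X_t=b(X_t)\,\mathrm{d}t+\sigma\,\mathrm{d}W_t$, $t\in[0,T]$, with deterministic initial value $X_0\in\mathbb{R}^{2d}$. $Db(x)$ is the Jacobian matrix and $D^2b(x)(u,v)=\sum_{i,j}\partial_i\partial_j b(x)u_iv_j$. ''Derivatives up to order 4'' means the partial derivatives of orders $1,\dots,4$. $\theta$ method: for $N\in\mathbb{N}_+$ put $h=T/N$, $\Delta W_k=W_{(k+1)h}-W_{kh}$, and $\widehat X^{N,\theta}_{k+1}=\widehat X^{N,\theta}_k+h\,b\big(\theta\widehat X^{N,\theta}_{k+1}+(1-\theta)\widehat X^{N,\theta}_k\big)+\sigma\Delta W_k$, $k=0,\dots,N-1$, $\widehat X^{N,\theta}_0=X_0$ ($N$ is large enough that this implicit equation is uniquely solvable). Its continuous version is $X^{N,\theta}_t=X_0+\int_0^t b(Z^{N,\theta}_s)\,\mathrm{d}s+\int_0^t\sigma\,\mathrm{d}W_s$, where $Z^{N,\theta}_s=\theta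 X^{N,\theta}_{R(s)}+(1-\theta)X^{N,\theta}_{L(s)}$, $L(s)=\lfloor s/h\rfloor h$, $R(s)=\lceil s/h\rceil h$; thus $X^{N,\theta}_{kh}=\widehat X^{N,\theta}_k$. The Brownian motion $\widetilde W$ may be defined on an extension of the probability space. *)

(* Defs.v *)
From HB Require Import structures.
From mathcomp Require Import all_boot all_order all_algebra.
From mathcomp Require Import all_classical all_reals all_analysis.
Set Implicit Arguments.
Unset Strict Implicit.
Unset Printing Implicit Defensive.
Import Order.TTheory GRing.Theory Num.Theory.
Import numFieldNormedType.Exports.
Local Open Scope classical_set_scope.
Local Open Scope ring_scope.

Section Calculus.
Context {R : realType}.

Definition pderiv (n : nat) (i : 'I_n) (f : 'cV[R]_n -> R) (x : 'cV[R]_n) : R :=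
  'D_(delta_mx i 0) f x.

Definition iter_pderiv (n : nat) (s : seq 'I_n) (f : 'cV[R]_n -> R) :
  'cV[R]_n -> R := foldr (@pderiv n) f s.

(* The orders are 1, ..., r: [f] itself need not be bounded. *)
Definition bounded_derivs_upto (n r : nat) (f : 'cV[R]_n -> R) : Prop :=
  (forall (s : seq 'I_n) (i : 'I_n) (x : 'cV[R]_n), (size s < r)%N ->
     derivable (iter_pderiv s f) x (delta_mx i 0)) /\
  (forall s : seq 'I_n, (0 < size s <= r)%N ->
     continuous (iter_pderiv s f) /\
     exists C : R, forall x, `|iter_pderiv s f x| <= C).

Definition gradient (n : nat) (f : 'cV[R]_n -> R) (x : 'cV[R]_n) : 'cV[R]_n :=
  \col_i pderiv i f x.

Definition symplJ (d : nat) : 'M[R]_(d + d) :=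
  block_mx 0 1%:M (- 1%:M) 0.

Definition hamiltonian_field (d : nat) (H : 'cV[R]_(d + d) -> R)
    (x : 'cV[R]_(d + d)) : 'cV[R]_(d + d) :=
  symplJ d *m gradient H x.

Definition jacobian_mx (n : nat) (b : 'cV[R]_n -> 'cV[R]_n) (x : 'cV[R]_n) :
    'M[R]_n :=
  \matrix_(i, j) pderiv j (fun y => b y i 0) x.

Definition second_deriv (n : nat) (b : 'cV[R]_n -> 'cV[R]_n) (x : 'cV[R]_n)
    (u v : 'cV[R]_n) : 'cV[R]_n :=
  \col_l \sum_i \sum_j
    pderiv i (pderiv j (fun y => b y l 0)) x * u i 0 * v j 0.

Definition time_integral (n : nat) (t : R) (f : R -> 'cV[R]_n) : 'cV[R]_n :=
  \col_i \int[lebesgue_measure]_(s in `[0, t]) (f s i 0).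

Definition continuous_path (T : R) (n : nat) (f : R -> 'cV[R]_n) : Prop :=
  {within `[0, T], continuous f}.

Definition sqnorm (n m : nat) (A : 'M[R]_(n, m)) : R :=
  \sum_i \sum_j A i j ^+ 2.

End Calculus.

Section Stochastics.
Context {R : realType} {disp : measure_display} {Omega : measurableType disp}.
Variable P : probability Omega R.

Definition sub_measurable (G : set (set Omega)) (X : Omega -> R) : Prop :=
  forall B : set R, measurable B -> G (X @^-1` B).

Definition random_vector (n : nat) (X : Omega -> 'cV[R]_n) : Prop :=
  forall i, measurable_fun setT (fun w => X w i 0).

Definition sigma_of (I : Type) (D : set I) (X : I -> Omega -> R) :
    set (set Omega) :=
  <<s [set A | exists i, D i /\
         exists2 B : set R, measurable B & A = X i @^-1` B] >>.

Definition indep_families (A B : set (set Omega)) : Prop :=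
  forall E1 E2, A E1 -> B E2 -> P (E1 `&` E2) = (P E1 * P E2)%E.

Definition sigma_process (T : R) (n : nat) (W : R -> Omega -> 'cV[R]_n) :
    set (set Omega) :=
  sigma_of [set p : R * 'I_n | p.1 \in `[0, T]]
           (fun p w => W p.1 w p.2 0).

Definition independent_processes (T : R) (n n' : nat)
    (W : R -> Omega -> 'cV[R]_n) (W' : R -> Omega -> 'cV[R]_n') : Prop :=
  indep_families (sigma_process T W) (sigma_process T W').

(* Filtrations are indexed by [R], but only the times in [0, T] matter. *)
Definition filtration (T : R) (F : R -> set (set Omega)) : Prop :=
  (forall t, t \in `[0, T] -> sigma_algebra setT (F t)) /\
  (forall t, t \in `[0, T] -> F t `<=` measurable) /\
  (forall s t, 0 <= s -> s <= t -> t <= T -> F s `<=` F t).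

Definition usual_conditions (T : R) (F : R -> set (set Omega)) : Prop :=
  measure_is_complete P /\
  (forall A, P.-negligible A -> F 0 A) /\
  (forall t, 0 <= t -> t < T ->
     F t = \bigcap_(s in [set s | t < s /\ s <= T]) F s).

Definition adapted (T : R) (F : R -> set (set Omega)) (n : nat)
    (X : R -> Omega -> 'cV[R]_n) : Prop :=
  forall t, t \in `[0, T] -> forall i, sub_measurable (F t) (fun w => X t w i 0).

(* The second parameter of [normal_prob] is the standard deviation. *)
Definition brownian_motion (T : R) (F : R -> set (set Omega)) (m : nat)
    (W : R -> Omega -> 'cV[R]_m) : Prop :=
  adapted T F W /\
  {ae P, forall w, W 0 w = 0} /\
  {ae P, forall w, continuous_path T (W ^~ w)} /\
  (forall s t, 0 <= s -> s < t -> t <= T ->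
     forall B : 'I_m -> set R, (forall i, measurable (B i)) ->
       P [set w | forall i, B i ((W t w - W s w) i 0)] =
       (\prod_(i < m) normal_prob 0%R (Num.sqrt (t - s)%R) (B i))%E) /\
  (forall s t, 0 <= s -> s < t -> t <= T ->
     indep_families
       (sigma_of setT (fun (i : 'I_m) w => (W t w - W s w) i 0)) (F s)).

Record simple_integrand (n m : nat) := SimpleIntegrand {
  si_size : nat;
  si_time : nat -> R;
  si_coef : nat -> Omega -> 'M[R]_(n, m) }.

Definition is_simple_integrand (T : R) (F : R -> set (set Omega)) (n m : nat)
    (phi : simple_integrand n m) : Prop :=
  si_time phi 0 = 0 /\ si_time phi (si_size phi) = T /\
  (forall k, (k < si_size phi)%N ->
     si_time phi k <= si_time phi k.+1 /\
     (forall i j, sub_measurable (F (si_time phi k))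
                    (fun w => si_coef phi k w i j)) /\
     exists C : R, forall w i j, `|si_coef phi k w i j| <= C).

Definition si_eval (n m : nat) (phi : simple_integrand n m) (s : R) (w : Omega) :
    'M[R]_(n, m) :=
  \sum_(k < si_size phi | si_time phi k < s <= si_time phi k.+1)
    si_coef phi k w.

Definition si_integral (n m : nat) (phi : simple_integrand n m)
    (W : R -> Omega -> 'cV[R]_m) (t : R) (w : Omega) : 'cV[R]_n :=
  \sum_(k < si_size phi)
    si_coef phi k w *m (W (Num.min (si_time phi k.+1) t) w
                        - W (Num.min (si_time phi k) t) w).

(* [I] is (a continuous version of) the Ito integral of [Phi] against the
   [F]-Brownian motion [W] on [0, T]: the L^2 limit of the integrals of
   simple integrands converging to [Phi] in L^2(Omega x [0, T]). *)
Definition ito_integral (T : R) (F : R -> set (set Omega)) (n m : nat)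
    (W : R -> Omega -> 'cV[R]_m) (Phi : R -> Omega -> 'M[R]_(n, m))
    (I : R -> Omega -> 'cV[R]_n) : Prop :=
  (forall t, t \in `[0, T] -> random_vector (I t)) /\
  {ae P, forall w, continuous_path T (I ^~ w)} /\
  exists phi : nat -> simple_integrand n m,
    (forall k, is_simple_integrand T F (phi k)) /\
    (fun k => \int[P]_w \int[lebesgue_measure]_(s in `[0%R, T])
                (sqnorm (Phi s w - si_eval (phi k) s w))%:E)%E @ \oo --> 0%E /\
    (forall t, t \in `[0, T] ->
      (fun k => \int[P]_w
                (sqnorm (I t w - si_integral (phi k) W t w))%:E)%E @ \oo --> 0%E).

(* As [W] starts from 0, the integral of the constant matrix [sigma] against
   [W] over [0, t] is [sigma *m W t]. *)
Definition sde_solution (T : R) (F : R -> set (set Omega)) (n m : nat)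
    (b : 'cV[R]_n -> 'cV[R]_n) (sigma : 'M[R]_(n, m)) (x0 : 'cV[R]_n)
    (W : R -> Omega -> 'cV[R]_m) (X : R -> Omega -> 'cV[R]_n) : Prop :=
  adapted T F X /\
  {ae P, forall w, continuous_path T (X ^~ w)} /\
  {ae P, forall w, forall t, t \in `[0, T] ->
     X t w = x0 + time_integral t (fun s => b (X s w)) + sigma *m W t w}.

End Stochastics.

Section ThetaMethod.
Context {R : realType}.
Variables (T theta : R) (n m : nat) (b : 'cV[R]_n -> 'cV[R]_n)
  (sigma : 'M[R]_(n, m)) (x0 : 'cV[R]_n) (N : nat).

Let h : R := T / N%:R.

Definition theta_scheme (w : R -> 'cV[R]_m) (y : nat -> 'cV[R]_n) : Prop :=
  y 0 = x0 /\
  forall k, (k < N)%N ->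
    y k.+1 = y k + h *: b (theta *: y k.+1 + (1 - theta) *: y k)
             + sigma *m (w (k.+1%:R * h) - w (k%:R * h)).

Definition grid_left (s : R) : R := (Num.floor (s / h))%:~R * h.
Definition grid_right (s : R) : R := (Num.ceil (s / h))%:~R * h.

(* Continuous version [x] of the scheme [y], both driven by the path [w]. *)
Definition theta_interpolation (w : R -> 'cV[R]_m) (y : nat -> 'cV[R]_n)
    (x : R -> 'cV[R]_n) : Prop :=
  (forall k, (k <= N)%N -> x (k%:R * h) = y k) /\
  forall t, t \in `[0, T] ->
    x t = x0
      + time_integral t (fun s =>
          b (theta *: x (grid_right s) + (1 - theta) *: x (grid_left s)))
      + sigma *m w t.

End ThetaMethod.

Section Limit.
Context {R : realType}.

(* The random vectors may live on different probability spaces. *)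
Definition cvg_in_distribution (disp disp' : measure_display)
    (Omega : measurableType disp) (Omega' : measurableType disp')
    (P : probability Omega R) (P' : probability Omega' R) (n : nat)
    (V : nat -> Omega -> 'cV[R]_n) (V' : Omega' -> 'cV[R]_n) : Prop :=
  forall f : 'cV[R]_n -> R, continuous f ->
    (exists C : R, forall x, `|f x| <= C) ->
    ('E_P[fun w => f (V N w)])%E @[N --> \oo] --> ('E_P'[fun w => f (V' w)])%E.

Definition space_extension (disp disp' : measure_display)
    (Omega : measurableType disp) (Omega' : measurableType disp')
    (P : probability Omega R) (P' : probability Omega' R)
    (T : R) (F : R -> set (set Omega)) (F' : R -> set (set Omega'))
    (proj : Omega' -> Omega) : Prop :=
  measurable_fun setT proj /\
  (forall A, measurable A -> P' (proj @^-1` A) = P A) /\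
  filtration T F' /\
  (forall t, t \in `[0, T] -> forall A, F t A -> F' t (proj @^-1` A)).

Definition limit_equation (disp : measure_display)
    (Omega : measurableType disp) (P : probability Omega R)
    (T theta : R) (F : R -> set (set Omega)) (n m : nat)
    (b : 'cV[R]_n -> 'cV[R]_n) (sigma : 'M[R]_(n, m))
    (W W' : R -> Omega -> 'cV[R]_m) (X U : R -> Omega -> 'cV[R]_n) : Prop :=
  exists I I' : R -> Omega -> 'cV[R]_n,
    let Dbsigma := fun s w => jacobian_mx b (X s w) *m sigma in
    ito_integral P T F W Dbsigma I /\
    ito_integral P T F W' Dbsigma I' /\
    {ae P, forall w, forall t, t \in `[0, T] ->
      U t w =
        time_integral t (fun s => jacobian_mx b (X s w) *m U s w)
        + ((1 - 2 * theta) * T / 2) *: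
            time_integral t (fun s => jacobian_mx b (X s w) *m b (X s w))
        + ((1 - 2 * theta) * T / 2) *: I t w
        + (Num.sqrt 3 / 6 * T) *: I' t w
        + ((1 - 2 * theta ^+ 2) * T / 4) *:
            \sum_(k < m) time_integral t (fun s =>
               second_deriv b (X s w) (col k sigma) (col k sigma))}.

End Limit.

(* Main.v *)
(** On a cell of length [h = T / N], expanding [b] along the solution and along
    the scheme shows that the normalised error [N (X - Xhat)] at the grid points
    is, up to [O(sqrt h)] in mean, the solution of a linear recursion
    [V_{k+1} = V_k + h Db(x_k) V_k + noise_k], where [x] is the explicit Euler
    scheme and the noise involves the Brownian increment [D_k] over the cell and
    the centred area [N \int (W_s - W_{t_k}) ds - (T / 2) D_k]. The second-order
    iterated integrals are orthogonal martingale increments and disappear, except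
    for their compensators, which produce the second derivatives of [b].

    The areas are Gaussian, uncorrelated with the increments, of variance
    [T^2 h / 12]: jointly with the increments they have the law of
    [(sqrt 3 / 6) T D'_k], where [D'] are the increments of an independent
    Brownian motion. This follows by writing them as limits of weighted sums of
    increments over finer grids and using the rotation invariance of normal
    laws. After this change of noise the recursion is an Euler scheme for the
    limit equation, which is linear in [U] and is solved path by path by Picard
    iteration. Lipschitz bounded test functions suffice for convergence in
    distribution, and for these an error bound in mean is enough; it requires no
    measurability of the scheme. *)

Require Import Defs.
From HB Require Import structures.
From mathcomp Require Import all_boot all_order all_algebra.
From mathcomp Require Import all_classical all_reals all_analysis.
From mathcomp Require Import measurable_realfun ring lra.
Import Order.TTheory GRing.Theory Num.Theory.
Import numFieldNormedType.Exports.
Local Open Scope classical_set_scope.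
Local Open Scope ring_scope.
Set Implicit Arguments.
Unset Strict Implicit.
Unset Printing Implicit Defensive.

(** The recursion is linearised around the Euler scheme rather than the solution, because it is then
    a function of finitely many increments and areas: an identity of finite-dimensional laws carries
    it to another probability space, where it is compared back with the solution. The constants
    arise on one cell by subtracting [T] times the expansion of [b] at the evaluation point of the
    scheme from [N] times the integral of the expansion along the solution: the drift gives
    [T h / 2 - theta T h], the increments [T / 2 - theta T], the compensators of the quadratic terms
    [T h / 4 - theta^2 T h / 2]. The obstacle is the lack of a good moment bound for the normalised
    error. The scheme is only known to be [O(sqrt h)] close in mean square, so [N] times its error
    could be of order [h^(-1/2)], and its products with other small random quantities need not
    vanish. The linear term is therefore estimated in two ways and the smaller bound is kept.
    Exceptional null sets are removed by changing the sample point, so that all path properties hold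
    everywhere. *)

Local Notation Db := jacobian_mx (only parsing).
Local Notation mfT := (measurable_fun setT) (only parsing).

(** * Expectations and independence *)

Section RealSequences.
Context {R : realType}.

Lemma cvg_cst_le (u : nat -> R) (l c : R) : u @ \oo --> l -> (forall n, c <= u n) -> c <= l.
Proof.
move=> ul cu; rewrite -(cvg_lim _ ul)//; apply: limr_ge; first by apply/cvg_ex; exists l.
exact: nearW.
Qed.

Lemma cvg_le_cst (u : nat -> R) (l c : R) : u @ \oo --> l -> (forall n, u n <= c) -> l <= c.
Proof.
move=> ul cu; rewrite -(cvg_lim _ ul)//; apply: limr_le; first by apply/cvg_ex; exists l.
exact: nearW.
Qed.

End RealSequences.

Section Expectation.
Context {R : realType} {disp : measure_display} {O : measurableType disp}.
Variable P : probability O R.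
Implicit Types f g : O -> R.

Definition summable f : Prop := P.-integrable setT (EFin \o f).
Definition Ex f : R := \int[P]_w f w.
(** The integral is the extended one, so a single predicate carries measurability, sign and
    finiteness; bounds can then be added, scaled and passed to limits without integrability side
    conditions. *)
Definition Eb f (v : R) : Prop :=
  [/\ mfT f, forall w, 0 <= f w &
      (\int[P]_w (f w)%:E <= v%:E)%E].

Lemma Eb_summable f v : Eb f v -> summable f.
Proof.
move=> [mf f0 fv]; apply/integrableP; split; first exact/measurable_EFinP.
under eq_integral do rewrite /= ger0_norm ?f0//.
by rewrite (le_lt_trans fv)// ltry.
Qed.

Lemma ExE f : summable f -> (\int[P]_w (f w)%:E)%E = (Ex f)%:E.
Proof. by move=> fi; rewrite /Ex /Rintegral fineK//; exact: integrable_fin_num. Qed.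

Lemma Eb_Ex f v : Eb f v -> Ex f <= v.
Proof. by move=> fE; have [_ _] := fE; rewrite ExE ?lee_fin//; exact: Eb_summable fE. Qed.

Lemma summable_meas f : summable f -> mfT f.
Proof. by move=> /measurable_int/measurable_EFinP. Qed.

Lemma EbI f v : summable f -> (forall w, 0 <= f w) -> Ex f <= v -> Eb f v.
Proof.
move=> fi f0 fv; split => //; first exact: summable_meas.
by rewrite ExE// lee_fin.
Qed.

Lemma Eb_ge0 f v : Eb f v -> 0 <= v.
Proof.
move=> [_ f0 fv]; rewrite -lee_fin (le_trans _ fv)//.
by apply: integral_ge0 => w _; rewrite lee_fin.
Qed.

Lemma Eb_le g f v : mfT f -> (forall w, 0 <= f w) ->
  (forall w, f w <= g w) -> Eb g v -> Eb f v.
Proof.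
move=> mf f0 fg [mg g0 gv]; split => //; apply: le_trans gv.
apply: ge0_le_integral => //=; [|exact/measurable_EFinP|exact/measurable_EFinP|].
- by move=> w _; rewrite lee_fin.
- by move=> w _; rewrite lee_fin.
Qed.

Lemma Eb_weak v v' f : v <= v' -> Eb f v -> Eb f v'.
Proof. by move=> vv' [mf f0 fv]; split => //; rewrite (le_trans fv)// lee_fin. Qed.

Lemma Eb_add f g v v' : Eb f v -> Eb g v' -> Eb (fun w => f w + g w) (v + v').
Proof.
move=> [mf f0 fv] [mg g0 gv]; split; first exact: measurable_funD.
  by move=> w; rewrite addr_ge0.
under eq_integral do rewrite EFinD.
rewrite ge0_integralD//; try exact/measurable_EFinP; last 2 first.
- by move=> w _; rewrite lee_fin.
- by move=> w _; rewrite lee_fin.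
by rewrite EFinD leeD.
Qed.

Lemma Eb_scale c f v : 0 <= c -> Eb f v -> Eb (fun w => c * f w) (c * v).
Proof.
move=> c0 [mf f0 fv]; split; first exact: measurable_funM.
  by move=> w; rewrite mulr_ge0.
under eq_integral do rewrite EFinM.
rewrite ge0_integralZl_EFin//; last 2 first.
- by move=> w _; rewrite lee_fin.
- exact/measurable_EFinP.
by rewrite EFinM lee_wpmul2l.
Qed.

Lemma Eb_cst c : 0 <= c -> Eb (fun=> c) c.
Proof. by move=> c0; split => //; rewrite integral_cst//= probability_setT mule1. Qed.

Lemma Eb_sum (I : Type) (s : seq I) (Q : pred I) (f : I -> O -> R) (v : I -> R) :
  (forall i, Q i -> Eb (f i) (v i)) ->
  Eb (fun w => \sum_(i <- s | Q i) f i w) (\sum_(i <- s | Q i) v i).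
Proof.
move=> fv; elim: s => [|i s IH].
  rewrite big_nil (_ : (fun _ => _) = (fun=> 0)); first exact: Eb_cst.
  by apply/funext => w; rewrite big_nil.
rewrite big_cons (_ : (fun _ => _) = (fun w => if Q i then f i w + \sum_(i <- s | Q i) f i w
   else \sum_(i <- s | Q i) f i w)); last by apply/funext => w; rewrite big_cons.
by case: ifPn => // Qi; apply: Eb_add => //; exact: fv.
Qed.

Lemma Eb_ext f g v : f =1 g -> Eb f v -> Eb g v.
Proof. by move=> /funext ->. Qed.

(** Fatou's lemma: through it, bounds proved for finite sums reach path integrals and Ito
    integrals. *)
Lemma Eb_fatou (f_ : nat -> O -> R) f v : (forall n, Eb (f_ n) v) ->
  (forall w, f_ ^~ w @ \oo --> f w) -> Eb f v.
Proof.
move=> fv cf.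
have mf : mfT f.
  by apply: (measurable_fun_cvg (h := f_)) => // n; have [] := fv n.
have f0 w : 0 <= f w.
  by apply: (cvg_cst_le (cf w)) => n; have [] := fv n.
split=> //.
have H := @fatou _ _ _ P setT measurableT (fun n w => (f_ n w)%:E).
apply: (le_trans _ (le_trans (H _ _) _)).
- apply: ge0_le_integral => //=.
  + by move=> w _; rewrite lee_fin.
  + exact/measurable_EFinP.
  + rewrite (_ : (fun x => _) = (fun x => - limn_esup (-%E \o (fun n => (f_ n x)%:E)))%E); last first.
      by apply/funext => x; rewrite limn_esupN oppeK.
    apply: measurableT_comp => //; apply: measurable_fun_limn_esup => n.
    by apply: measurableT_comp => //; apply/measurable_EFinP; have [] := fv n.
  + move=> w _; have : (EFin \o f_ ^~ w) @ \oo --> (f w)%:E.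
      by apply/cvg_EFin; [exact: nearW|exact: cf].
    by move=> /cvg_limn_einf_sup [-> _].
- by move=> n; apply/measurable_EFinP; have [] := fv n.
- by move=> n x _; rewrite lee_fin; have [] := fv n.
rewrite limn_einf_lim; apply: lime_le; first exact: is_cvg_einfs.
apply: nearW => n; apply: (@le_trans _ _ (\int[P]_w (f_ n w)%:E)%E); last by have [] := fv n.
by apply: ereal_inf_lbound; exists n => /=.
Qed.

(** Young's inequality [2 |f| <= e + f^2 / e]; no square root of [v] has to be taken. *)
Lemma Eb_mean_abs f v e : 0 < e -> Eb (fun w => f w ^+ 2) v -> mfT f ->
  Eb (fun w => `|f w|) ((e + v / e) / 2).
Proof.
move=> e0 fv mf; apply: (@Eb_le (fun w => (e + f w ^+ 2 / e) / 2)) => //.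
- exact: measurableT_comp.
- move=> w; have : 0 <= (e - `|f w|) ^+ 2 / e by rewrite divr_ge0 ?sqr_ge0// ltW.
  rewrite -[f w ^+2]real_normK ?num_real//; set a := `|f w|.
  have -> : (e - a) ^+ 2 / e = e + a^+2/e - 2 * a by field; rewrite gt_eqF.
  by lra.
- apply: (@Eb_ext (fun w => 2^-1 * (e + e^-1 * f w ^+ 2))).
    by move=> w; rewrite mulrC [f w ^+ 2 / e]mulrC.
  rewrite mulrC [v / e]mulrC; apply: Eb_scale => //; apply: Eb_add; first exact/Eb_cst/ltW.
  by apply: Eb_scale => //; rewrite invr_ge0 ltW.
Qed.

(** Cauchy-Schwarz against the constant 1: the double sum of [(x_i - x_j)^2] is twice the difference
    of the two sides. *)
Lemma sqr_sum_le (I : finType) (x : I -> R) :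
  (\sum_i x i) ^+ 2 <= #|I|%:R * \sum_i x i ^+ 2.
Proof.
have H : 0 <= \sum_i \sum_j (x i - x j) ^+ 2.
  by apply: sumr_ge0 => i _; apply: sumr_ge0 => j _; exact: sqr_ge0.
have E : \sum_i \sum_j (x i - x j) ^+ 2 =
    2 * (#|I|%:R * \sum_i x i ^+ 2 - (\sum_i x i) ^+ 2).
  transitivity (\sum_i (#|I|%:R * x i ^+ 2 + \sum_j x j ^+ 2 - 2 * x i * \sum_j x j)).
    apply: eq_bigr => i _; rewrite mulr_sumr -sumrN.
    rewrite (_ : #|I|%:R * x i ^+ 2 = \sum_(j : I) x i ^+ 2); last by rewrite sumr_const mulr_natl.
    by rewrite -!big_split/=; apply: eq_bigr => j _; ring.
  rewrite big_split big_split/= -mulr_sumr sumr_const -[_ *+ #|I|]mulr_natl sumrN -mulr_suml -mulr_sumr.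
  ring.
by move: H; rewrite E; lra.
Qed.

Lemma Eb_sqr_sum (I : finType) (f : I -> O -> R) v :
  (forall i, mfT (f i)) ->
  (forall i, Eb (fun w => f i w ^+ 2) v) ->
  Eb (fun w => (\sum_i f i w) ^+ 2) (#|I|%:R ^+ 2 * v).
Proof.
move=> mf fv; apply: (@Eb_le (fun w => #|I|%:R * \sum_i f i w ^+ 2)).
- by apply: measurable_funX; exact: measurable_sum.
- by move=> w; exact: sqr_ge0.
- by move=> w; exact: sqr_sum_le.
- rewrite expr2 -mulrA; apply: Eb_scale => //.
  rewrite (_ : _ * v = \sum_(i : I) v); last by rewrite sumr_const mulr_natl.
  exact: Eb_sum.
Qed.

Lemma summableD f g : summable f -> summable g -> summable (fun w => f w + g w).
Proof. by move=> fi gi; apply: (integrableD measurableT fi gi). Qed.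

Lemma summableZ c f : summable f -> summable (fun w => c * f w).
Proof. by move=> fi; apply: (integrableZl measurableT c fi). Qed.

Lemma ExD f g : summable f -> summable g -> Ex (fun w => f w + g w) = Ex f + Ex g.
Proof. by move=> fi gi; rewrite /Ex RintegralD. Qed.

Lemma ExZ c f : summable f -> Ex (fun w => c * f w) = c * Ex f.
Proof. by move=> fi; rewrite /Ex RintegralZl. Qed.

Lemma summable_le f g : mfT f -> (forall w, `|f w| <= g w) ->
  summable g -> summable f.
Proof.
move=> mf fg gi; apply: (le_integrable measurableT _ _ gi); first exact/measurable_EFinP.
by move=> w _ /=; rewrite lee_fin (le_trans (fg w))// ler_norm.
Qed.

Lemma summable_bounded f C : mfT f -> (forall w, `|f w| <= C) -> summable f.
Proof.
move=> mf fC; apply: (@summable_le _ (fun=> `|C|)) => //.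
  by move=> w; rewrite (le_trans (fC w))// ler_norm.
by have := Eb_summable (Eb_cst (normr_ge0 C)).
Qed.

Lemma Ex_le f g : summable f -> summable g -> (forall w, f w <= g w) -> Ex f <= Ex g.
Proof. by move=> fi gi fg; apply: le_Rintegral. Qed.

Lemma Ex_sub f g : summable f -> summable g -> Ex (fun w => f w - g w) = Ex f - Ex g.
Proof. by move=> fi gi; rewrite /Ex RintegralB. Qed.

Lemma summable_sub f g : summable f -> summable g -> summable (fun w => f w - g w).
Proof. by move=> fi gi; apply: (integrableB measurableT fi gi). Qed.

Lemma Ex_cst c : Ex (fun=> c) = c.
Proof. by rewrite /Ex Rintegral_cst//= probability_setT mulr1. Qed.

Lemma Ex_ge0 f : (forall w, 0 <= f w) -> 0 <= Ex f.
Proof. by move=> f0; apply: Rintegral_ge0. Qed.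

Lemma summable_sqr_abs f v : mfT f -> Eb (fun w => f w ^+ 2) v -> summable f.
Proof.
move=> mf fv; apply: summable_le (Eb_summable (Eb_mean_abs ltr01 fv mf)) => // w.
Qed.

Lemma summable_mul_sqr f g v v' : mfT f -> mfT g ->
  Eb (fun w => f w ^+ 2) v -> Eb (fun w => g w ^+ 2) v' -> summable (fun w => f w * g w).
Proof.
move=> mf mg fv gv.
apply: (@summable_le _ (fun w => f w ^+ 2 + g w ^+ 2)).
- exact: measurable_funM.
- move=> w; rewrite normrM -[f w ^+ 2]real_normK ?num_real// -[g w ^+ 2]real_normK ?num_real//.
  have := sqr_ge0 (`|f w| - `|g w|); have := sqr_ge0 (`|f w|); have := sqr_ge0 (`|g w|).
  rewrite sqrrB; lra.
- exact: Eb_summable (Eb_add fv gv).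
Qed.

End Expectation.

(** * Independence of random variables *)

Section Independence.
Context {R : realType} {disp : measure_display} {O : measurableType disp}.
Variable P : probability O R.

Definition indep_rv d1 d2 (T1 : measurableType d1) (T2 : measurableType d2)
    (X : O -> T1) (Y : O -> T2) : Prop :=
  forall A B, measurable A -> measurable B ->
    P (X @^-1` A `&` Y @^-1` B) = (P (X @^-1` A) * P (Y @^-1` B))%E.

Lemma law_pair d1 d2 (T1 : measurableType d1) (T2 : measurableType d2)
    (X : {RV P >-> T1}) (Y : {RV P >-> T2}) (Z : {RV P >-> (T1 * T2)%type}) :
  Z =1 (fun w => (X w, Y w)) -> indep_rv X Y ->
  forall C, measurable C -> (distribution P X \x distribution P Y)%E C = distribution P Z C.
Proof.
move=> ZE XY C mC; apply: product_measure_unique => //= A B mA mB.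
rewrite /distribution /= /pushforward/= -XY//; congr (P _); apply/seteqP; split => w /=.
  by rewrite /preimage/= ZE.
by rewrite /preimage/= ZE.
Qed.

(** The pair has the product law because the two agree on rectangles; Tonelli then integrates over
    an independent copy of [Y] with [X] frozen. *)
Lemma indep_tonelli d1 d2 (T1 : measurableType d1) (T2 : measurableType d2)
    (X : O -> T1) (Y : O -> T2) (f : T1 * T2 -> \bar R) :
  mfT X -> mfT Y -> indep_rv X Y ->
  mfT f -> (forall z, 0 <= f z)%E ->
  (\int[P]_w f (X w, Y w) = \int[P]_w \int[P]_w' f (X w, Y w'))%E.
Proof.
move=> mX mY XY mf f0.
have mZ : mfT (fun w => (X w, Y w)) by exact: measurable_fun_pair.
pose X' : {RV P >-> T1} := mfun_Sub (mem_set mX).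
pose Y' : {RV P >-> T2} := mfun_Sub (mem_set mY).
pose Z' : {RV P >-> (T1 * T2)%type} := mfun_Sub (mem_set mZ).
have E1 : (\int[P]_w f (X w, Y w) = \int[distribution P Z']_z f z)%E.
  by rewrite ge0_integral_distribution.
rewrite E1.
rewrite -(@eq_measure_integral _ _ _ _ (distribution P Z') (distribution P X' \x distribution P Y')%E).
  rewrite fubini_tonelli1//.
  rewrite ge0_integral_distribution//=; last 2 first.
  - exact: measurable_fun_fubini_tonelli_F.
  - by move=> x; apply: integral_ge0.
  apply: eq_integral => w _ /=; rewrite /fubini_F.
  rewrite ge0_integral_distribution//=.
  exact: (measurableT_comp mf (measurable_fun_pair (measurable_cst _) (@measurable_id _ _ _))).
by move=> A mA _; apply: (law_pair (X := X') (Y := Y')).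
Qed.

Lemma indep_Eb_mul (X Y : O -> R) a b : Eb P X a -> Eb P Y b -> indep_rv X Y ->
  Eb P (fun w => X w * Y w) (a * b).
Proof.
move=> Xa Yb XY; have [mX X0 _] := Xa; have [mY Y0 _] := Yb.
split; [exact: measurable_funM|by move=> w; rewrite mulr_ge0|].
have E : (\int[P]_w (X w * Y w)%:E = \int[P]_w \int[P]_w' (X w * Y w')%:E)%E.
  (* Tonelli wants an integrand that is nonnegative on the whole plane, hence the absolute value; it
     disappears at the sample points. *)
  have H := @indep_tonelli _ _ _ _ X Y (fun z => `|z.1 * z.2|%:E) mX mY XY.
  transitivity (\int[P]_w `|X w * Y w|%:E)%E.
    by apply: eq_integral => w _; rewrite ger0_norm// mulr_ge0.
  rewrite H; last 2 first.
  - apply/measurable_EFinP; apply: measurableT_comp => //.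
    by apply: measurable_funM; [exact: measurable_fst|exact: measurable_snd].
  - by move=> z; rewrite lee_fin.
  apply: eq_integral => w _; apply: eq_integral => w' _ /=.
  by rewrite ger0_norm// mulr_ge0.
rewrite E.
have E2 w : (\int[P]_w' (X w * Y w')%:E = (Ex P Y * X w)%:E)%E.
  under eq_integral do rewrite EFinM.
  rewrite ge0_integralZl_EFin//; last 2 first.
  - by move=> w' _; rewrite lee_fin.
  - exact/measurable_EFinP.
  by rewrite ExE ?EFinM; [rewrite muleC|exact: Eb_summable Yb].
under eq_integral do rewrite E2.
have EY0 : 0 <= Ex P Y by exact: Ex_ge0.
have [_ _ h] := Eb_scale EY0 Xa.
rewrite (le_trans h)// lee_fin mulrC ler_wpM2l//; first exact: Eb_ge0 Xa.
exact: Eb_Ex.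
Qed.

Lemma indep_comp d1 d2 (T1 : measurableType d1) (T2 : measurableType d2)
    d3 d4 (T3 : measurableType d3) (T4 : measurableType d4)
    (X : O -> T1) (Y : O -> T2) (f : T1 -> T3) (g : T2 -> T4) :
  mfT f -> mfT g -> indep_rv X Y ->
  indep_rv (f \o X) (g \o Y).
Proof.
move=> mf mg XY A B mA mB; apply: (XY (f @^-1` A) (g @^-1` B)).
  by rewrite -[X in measurable X]setTI; apply: mf.
by rewrite -[X in measurable X]setTI; apply: mg.
Qed.

(** For each frozen value of [X], its product with an independent copy of [Y] has mean zero, so
    positive and negative parts have equal means; Tonelli applies to each part. *)
Lemma indep_Ex_mul0 (X Y : O -> R) : summable P X -> summable P Y -> indep_rv X Y ->
  Ex P Y = 0 -> summable P (fun w => X w * Y w) /\ Ex P (fun w => X w * Y w) = 0.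
Proof.
move=> Xi Yi XY Y0.
have mX := summable_meas Xi; have mY := summable_meas Yi.
have absE (Z : O -> R) : summable P Z -> Eb P (fun w => `|Z w|) (Ex P (fun w => `|Z w|)).
  move=> Zi; apply: EbI => //; apply: summable_le (integrable_norm Zi) => [|w].
    by apply: measurableT_comp => //; exact: summable_meas Zi.
  by rewrite normr_id.
have XYabs : summable P (fun w => `|X w| * `|Y w|).
  apply: Eb_summable (indep_Eb_mul (absE _ Xi) (absE _ Yi) _).
  by apply: (indep_comp (f := fun x : R => `|x|) (g := fun x : R => `|x|)).
have XYi : summable P (fun w => X w * Y w).
  apply: summable_le XYabs => [|w]; first exact: measurable_funM.
  by rewrite normrM.
split=> //.
pose gp (x : R) := (`|x| + x) / 2; pose gn (x : R) := (`|x| - x) / 2.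
have gp0 x : 0 <= gp x by rewrite /gp; have := ler_norm (- x); rewrite normrN; lra.
have gn0 x : 0 <= gn x by rewrite /gn; have := ler_norm x; lra.
have mgp : mfT gp.
  by apply: measurable_funM => //; apply: measurable_funD => //; exact: measurableT_comp.
have mgn : mfT gn.
  by apply: measurable_funM => //; apply: measurable_funB => //; exact: measurableT_comp.
have gi (Z : O -> R) : summable P Z -> summable P (gp \o Z) /\ summable P (gn \o Z).
  move=> Zi; have mZ := summable_meas Zi; split.
    apply: summable_le (integrable_norm Zi) => [|w]; first exact: measurableT_comp.
    by rewrite ger0_norm//= /gp; have := ler_norm (Z w); lra.
  apply: summable_le (integrable_norm Zi) => [|w]; first exact: measurableT_comp.
  by rewrite ger0_norm//= /gn; have := ler_norm (- Z w); rewrite normrN; lra.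
have [pi ni] := gi _ XYi.
have -> : (fun w => X w * Y w) = (fun w => (gp \o (fun w => X w * Y w)) w - (gn \o (fun w => X w * Y w)) w).
  by apply/funext => w /=; rewrite /gp /gn; lra.
rewrite Ex_sub//; apply/eqP; rewrite subr_eq0; apply/eqP; congr fine.
have mM : mfT (fun z : R * R => z.1 * z.2).
  by apply: measurable_funM; [exact: measurable_fst|exact: measurable_snd].
have Hp := @indep_tonelli _ _ _ _ X Y (fun z => (gp (z.1 * z.2))%:E) mX mY XY.
have Hn := @indep_tonelli _ _ _ _ X Y (fun z => (gn (z.1 * z.2))%:E) mX mY XY.
rewrite /= in Hp Hn *; rewrite Hp; last 2 first.
- by apply/measurable_EFinP; apply: measurableT_comp.
- by move=> z; rewrite lee_fin.
rewrite Hn; last 2 first.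
- by apply/measurable_EFinP; apply: measurableT_comp.
- by move=> z; rewrite lee_fin.
apply: eq_integral => w _.
have XwY : summable P (fun w' => X w * Y w') by exact: summableZ.
have [pi' ni'] := gi _ XwY.
rewrite (ExE pi') (ExE ni'); congr EFin; apply/eqP; rewrite -subr_eq0 -Ex_sub//.
rewrite (_ : (fun _ => _) = (fun w' => X w * Y w')).
  by rewrite ExZ// Y0 mulr0.
by apply/funext => w' /=; rewrite /gp /gn; lra.
Qed.

End Independence.

(** * Measurability with respect to a sub-sigma-algebra *)

Section SubSigmaAlgebra.
Context {R : realType} {disp : measure_display} {O : measurableType disp}.
Implicit Types G : set (set O).

(** Measurability for the sigma-algebra generated by [G], in a form to which the closure properties
    of measurable functions apply directly; when [G] is a sigma-algebra it is [sub_measurable]. *)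
Variant smeas G (X : O -> R) : Prop := Smeas of
  measurable_fun (setT : set (g_sigma_algebraType G)) (X : g_sigma_algebraType G -> R).

Lemma smeasW G X : smeas G X ->
  measurable_fun (setT : set (g_sigma_algebraType G)) (X : g_sigma_algebraType G -> R).
Proof. by case. Qed.

Lemma smeasP G X : sigma_algebra setT G -> smeas G X <-> sub_measurable G X.
Proof.
move=> sG; have GE : <<s G >> = G by exact: sigma_algebra_id.
split=> [[mX] B mB|mX]; last by split=> _ B mB; rewrite setTI /measurable/= GE; exact: mX.
by have := mX measurableT B mB; rewrite setTI /measurable/= GE.
Qed.

Lemma smeas_meas G X : G `<=` measurable -> smeas G X -> mfT X.
Proof.
move=> Gm [mX] _ B mB; have := mX measurableT B mB; rewrite !setTI /measurable/= => H.
have sm : sigma_algebra setT (measurable : set (set O)) by exact: sigma_algebra_measurable.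
by move: H; apply: (smallest_sub sm).
Qed.

Lemma smeasS G G' X : G `<=` G' -> smeas G X -> smeas G' X.
Proof.
move=> GG' [mX]; split => _ B mB; have := mX measurableT B mB; rewrite !setTI /measurable/=.
by apply: smallest_sub; [exact: smallest_sigma_algebra|apply: subset_trans GG' _; exact: sub_sigma_algebra].
Qed.

Lemma smeas_set G X B : sigma_algebra setT G -> smeas G X -> measurable B -> G (X @^-1` B).
Proof. by move=> sG /(smeasP _ sG); apply. Qed.

Lemma smeas_indic G E : G E -> smeas G (\1_E : O -> R).
Proof.
move=> GE; split; apply: (measurable_indic (T := g_sigma_algebraType G)).
exact: sub_sigma_algebra.
Qed.

Lemma smeas_cst G c : smeas G (fun=> c).
Proof. by split; exact: measurable_cst. Qed.

Lemma smeasD G X Y : smeas G X -> smeas G Y -> smeas G (fun w => X w + Y w).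
Proof. by move=> [mX] [mY]; split; exact: measurable_funD. Qed.

Lemma smeasB G X Y : smeas G X -> smeas G Y -> smeas G (fun w => X w - Y w).
Proof. by move=> [mX] [mY]; split; exact: measurable_funB. Qed.

Lemma smeasM G X Y : smeas G X -> smeas G Y -> smeas G (fun w => X w * Y w).
Proof. by move=> [mX] [mY]; split; exact: measurable_funM. Qed.

Lemma smeas_comp G X (f : R -> R) : mfT f -> smeas G X -> smeas G (fun w => f (X w)).
Proof. by move=> mf [mX]; split; exact: measurableT_comp. Qed.

Lemma smeas_sum G (I : Type) (s : seq I) (f : I -> O -> R) :
  (forall i, smeas G (f i)) -> smeas G (fun w => \sum_(i <- s) f i w).
Proof.
move=> mf; split; apply: (measurable_sum (T := g_sigma_algebraType G)) => i; exact: smeasW.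
Qed.

Lemma smeas_cvg G (f : nat -> O -> R) g : (forall i, smeas G (f i)) ->
  (forall w, f ^~ w @ \oo --> g w) -> smeas G g.
Proof.
move=> mf fg; split; apply: (measurable_fun_cvg (T := g_sigma_algebraType G) (h := f)) => // i.
exact: smeasW.
Qed.

(** Independence from the past, event by event. Together with centring it takes the place of
    conditional expectations. *)
Definition indep_of (P : probability O R) (G0 : set (set O)) (Y : O -> R) : Prop :=
  forall B E, measurable B -> G0 E -> P (Y @^-1` B `&` E) = (P (Y @^-1` B) * P E)%E.

Lemma indep_of_rv (P : probability O R) G0 X Y : sigma_algebra setT G0 ->
  smeas G0 X -> indep_of P G0 Y -> indep_rv P X Y.
Proof.
move=> s0 mX XY A B mA mB; have := XY B _ mB (smeas_set s0 mX mA).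
by rewrite setIC muleC.
Qed.

End SubSigmaAlgebra.

(** * Discrete martingale transforms and the maximal inequality *)

Section DiscreteMartingale.
Context {R : realType} {disp : measure_display} {O : measurableType disp}.
Variable P : probability O R.
Variable G : nat -> set (set O).
Hypotheses (sG : forall k, sigma_algebra setT (G k)) (Gm : forall k, G k `<=` measurable)
 (Gmono : forall k, G k `<=` G k.+1).

Lemma G_le j k : (j <= k)%N -> G j `<=` G k.
Proof.
move=> /subnK <-; elim: (k - j)%N => [|i IH]//=.
by rewrite addSn; exact: subset_trans (@Gmono _).
Qed.

Variables A phi : nat -> O -> R.
Variables al v : nat -> R.
Hypotheses (mA : forall k, smeas (G k) (A k)) (mphi : forall k, smeas (G k.+1) (phi k))
 (iphi : forall k, indep_of P (G k) (phi k)) (phi0 : forall k, Ex P (phi k) = 0)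
 (Aal : forall k, Eb P (fun w => A k w ^+ 2) (al k)) (phiv : forall k, Eb P (fun w => phi k w ^+ 2) (v k)).

(** A martingale transform: [A k] is known at time [k], while [phi k] is centred, known at time
    [k + 1] and independent of the past. *)
Definition mtrans (K : nat) (w : O) : R := \sum_(k < K) A k w * phi k w.

Lemma mtransS K w : mtrans K.+1 w = mtrans K w + A K w * phi K w.
Proof. by rewrite /mtrans big_ord_recr. Qed.

Lemma mtrans_meas K : smeas (G K) (mtrans K).
Proof.
apply: smeas_sum => k; apply: smeasM.
  exact: smeasS (G_le (ltnW (ltn_ord k))) (mA k).
exact: smeasS (G_le (ltn_ord k)) (mphi k).
Qed.

Lemma phi_summable k : summable P (phi k).
Proof.
by apply: summable_sqr_abs (phiv k); exact: smeas_meas (@Gm k.+1) (mphi k).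
Qed.

Lemma mdiff_sqr k : Eb P (fun w => (A k w * phi k w) ^+ 2) (al k * v k).
Proof.
apply: (@Eb_ext _ _ _ _ (fun w => A k w ^+ 2 * phi k w ^+ 2)).
  by move=> w; rewrite exprMn.
apply: indep_Eb_mul => //.
apply: (indep_comp (f := fun x : R => x ^+ 2) (g := fun x : R => x ^+ 2)) => //.
exact: (indep_of_rv (sG k) (mA k) (@iphi k)).
Qed.

(** [B] and [A k] are both known at time [k], so their product is independent of the centred
    [phi k]. *)
Lemma mdiff_orth (B : O -> R) b k : smeas (G k) B -> Eb P (fun w => B w ^+ 2) b ->
  summable P (fun w => B w * (A k w * phi k w)) /\
  Ex P (fun w => B w * (A k w * phi k w)) = 0.
Proof.
move=> mB Bb.
have -> : (fun w => B w * (A k w * phi k w)) = (fun w => (B w * A k w) * phi k w).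
  by apply/funext => w; rewrite mulrA.
apply: indep_Ex_mul0; [|exact: phi_summable| |exact: phi0].
- apply: summable_mul_sqr Bb (Aal k); first exact: smeas_meas (@Gm k) mB.
  exact: smeas_meas (@Gm k) (mA k).
- exact: (indep_of_rv (sG k) (smeasM mB (mA k)) (@iphi k)).
Qed.

(** The cross term of the expanded square vanishes by [mdiff_orth] with [B] the previous partial
    sum, so second moments add up. *)
Lemma mtrans_sqr K : Eb P (fun w => mtrans K w ^+ 2) (\sum_(k < K) al k * v k).
Proof.
elim: K => [|K IH].
  apply: (@Eb_ext _ _ _ _ (fun=> 0)); last by rewrite big_ord0; exact: Eb_cst.
  by move=> w; rewrite /mtrans big_ord0 expr0n.
rewrite big_ord_recr/=.
have [oS o0] := mdiff_orth (mtrans_meas K) IH.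
have sS := Eb_summable IH; have sD := Eb_summable (mdiff_sqr K).
have E : (fun w => mtrans K.+1 w ^+ 2) = (fun w => mtrans K w ^+ 2 +
    (2 * (mtrans K w * (A K w * phi K w)) + (A K w * phi K w) ^+ 2)).
  by apply/funext => w; rewrite mtransS; ring.
rewrite E; apply: EbI.
- by apply: summableD => //; apply: summableD => //; exact: summableZ.
- by move=> w; have <- := congr1 (@^~ w) E; exact: sqr_ge0.
- rewrite ExD ?ExD ?ExZ ?o0 ?mulr0 ?add0r//; last 2 first.
  + exact: summableZ.
  + by apply: summableD => //; exact: summableZ.
  by apply: lerD; [exact: Eb_Ex IH|exact: Eb_Ex (mdiff_sqr K)].
Qed.

Lemma mtrans_orth (B : O -> R) b j K : (j <= K)%N ->
  smeas (G j) B -> Eb P (fun w => B w ^+ 2) b ->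
  summable P (fun w => B w * (mtrans K w - mtrans j w)) /\
  Ex P (fun w => B w * (mtrans K w - mtrans j w)) = 0.
Proof.
move=> /subnKC <- mB Bb; elim: (K - j)%N => [|i [iS i0]].
  rewrite addn0 (_ : (fun _ => _) = fun=> 0); first by rewrite Ex_cst; split => //; exact: Eb_summable (Eb_cst _ (lexx 0)).
  by apply/funext => w; rewrite subrr mulr0.
have mB' : smeas (G (j + i)) B by exact: smeasS (G_le (leq_addr _ _)) mB.
have [dS d0] := mdiff_orth mB' Bb.
rewrite addnS (_ : (fun _ => _) = (fun w => B w * (mtrans (j + i) w - mtrans j w) +
   B w * (A (j + i) w * phi (j + i) w))); last first.
  by apply/funext => w; rewrite mtransS; ring.
by rewrite ExD// i0 d0 addr0; split => //; exact: summableD.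
Qed.

(** The event that the level [lam] is first reached at index [j]. *)
Let first (lam : R) (j : nat) : set O :=
  [set w | lam <= `|mtrans j w| /\ forall i, (i < j)%N -> `|mtrans i w| < lam].

Let first_G lam j : G j (first lam j).
Proof.
have -> : first lam j = (fun w => `|mtrans j w|) @^-1` `[lam, +oo[%classic `&`
    \big[setI/setT]_(i < j) ((fun w => `|mtrans i w|) @^-1` `]-oo, lam[%classic).
  rewrite -(bigcap_mkord j (fun i => (fun w => `|mtrans i w|) @^-1` `]-oo, lam[%classic)).
  apply/seteqP; split => w /=; rewrite in_itv/= andbT.
    by move=> [a b]; split => // i /= ij; rewrite in_itv/=; exact: b.
  by move=> [a b]; split => // i ij; have := b i ij; rewrite /= in_itv/=.
have sGj := sG j.
have GE : <<s G j >> = G j by exact: sigma_algebra_id.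
have key (i : nat) B : (i <= j)%N -> measurable B -> <<s G j>> ((fun w => `|mtrans i w|) @^-1` B).
  move=> ij mB; rewrite GE; apply: smeas_set => //; apply: smeas_comp => //.
  exact: smeasS (G_le ij) (mtrans_meas i).
rewrite -GE; apply: (@measurableI _ (g_sigma_algebraType (G j))).
  exact: key.
apply: (@bigsetI_measurable _ (g_sigma_algebraType (G j))) => i _.
by apply: key => //; exact: ltnW.
Qed.

(** Kolmogorov's maximal inequality, decomposed along the first passage [i]. With [S] the transform,
    [S_K^2 = S_i^2 + 2 S_i (S_K - S_i) + (S_K - S_i)^2], and the middle term, cut to the event of
    first passage at [i], has mean zero. *)
Lemma kolmogorov_max (lam : R) K : 0 < lam ->
  Eb P (\1_[set w | exists2 j, (j <= K)%N & lam <= `|mtrans j w|])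
    ((\sum_(k < K) al k * v k) / lam ^+ 2).
Proof.
move=> lam0; set U := [set w | _].
have mf j : measurable (first lam j) by exact: (Gm (first_G lam j)).
pose one j : O -> R := \1_(first lam j).
have mone j : mfT (one j) by exact: measurable_indic.
(* First-passage events are disjoint, so [N] is the indicator of [U]. *)
pose N w := \sum_(j < K.+1) one j w.
pose B j w := one j w * mtrans j w.
have mB j : smeas (G j) (B j).
  by apply: smeasM (mtrans_meas j); apply: smeas_indic; exact: first_G.
have Bb j : Eb P (fun w => B j w ^+ 2) (\sum_(k < j) al k * v k).
  apply: Eb_le (mtrans_sqr j) => [|w|w]; last 2 first.
  - exact: sqr_ge0.
  - rewrite /B /one indicE exprMn; case: (_ \in _); rewrite ?expr1n ?mul1r// expr0n mul0r; exact: sqr_ge0.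
  by apply: measurable_funX; exact: smeas_meas (@Gm j) (mB j).
have orth (j : 'I_K.+1) := mtrans_orth (ltn_ord j : (j <= K)%N) (mB j) (Bb j).
have uniq_first i j w : first lam i w -> first lam j w -> i = j.
  move=> [a b] [c d]; case: (ltngtP i j) => // ij.
    by have := d _ ij; rewrite ltNge a.
  by have := b _ ij; rewrite ltNge c.
have inU w : U w -> exists2 i : 'I_K.+1, first lam i w & forall j : 'I_K.+1, j != i -> one j w = 0.
  move=> [j jK H].
  have ex : exists i, lam <= `|mtrans i w| by exists j.
  have [i Hi imin] := ex_minnP ex.
  have fi : first lam i w.
    split=> // l li; rewrite ltNge; apply/negP => /imin; by rewrite leqNgt li.
  have iK : (i < K.+1)%N by rewrite ltnS (leq_trans (imin j H)).
  exists (Ordinal iK) => //= l li; rewrite /one indicE memNset// => fl.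
  by move/eqP: li; apply; apply: val_inj => /=; exact: uniq_first fl fi.
have notU w : ~ U w -> forall j : 'I_K.+1, one j w = 0.
  move=> nU j; rewrite /one indicE memNset// => -[a _]; apply: nU; exists j => //.
  by rewrite -ltnS.
have NU w : \1_U w = N w.
  have [Uw|nUw] := pselect (U w).
    have [i fi oi] := inU w Uw.
    by rewrite indicE mem_set// /N (bigD1 i)//= big1// addr0 /one indicE mem_set.
  by rewrite indicE memNset// /N big1// => j _; exact: notU.
(* After first passage at [i] the right-hand side is [S_i^2 + (S_K - S_i)^2], and [S_i^2 >= lam^2];
   off [U] only a square remains. *)
have ptw w : lam ^+ 2 * N w <= mtrans K w ^+ 2 - 2 * \sum_(j < K.+1) B j w * (mtrans K w - mtrans j w).
  have [Uw|nUw] := pselect (U w).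
    have [i fi oi] := inU w Uw.
    have -> : N w = 1 by rewrite -NU indicE mem_set.
    have -> : \sum_(j < K.+1) B j w * (mtrans K w - mtrans j w) = B i w * (mtrans K w - mtrans i w).
      by rewrite (bigD1 i)//= big1 ?addr0// => j /oi ji; rewrite /B ji !mul0r.
    rewrite /B /one indicE mem_set// mul1r mulr1.
    have : lam ^+ 2 <= mtrans i w ^+ 2.
      rewrite -(real_normK (num_real (mtrans i w))) lerXn2r ?nnegrE//; first exact: ltW.
      by case: fi.
    have := sqr_ge0 (mtrans K w - mtrans i w); set a := mtrans K w; set b := mtrans i w.
    by rewrite sqrrB; lra.
  rewrite /N big1; last by move=> j _; exact: notU.
  rewrite big1; last by move=> j _; rewrite /B notU// !mul0r.
  by rewrite !mulr0 subr0 sqr_ge0.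
have Ni : summable P N.
  have := @Eb_sum _ _ _ P _ (index_enum 'I_K.+1) xpredT (fun j => one j) (fun=> 1).
  move=> H; apply: (Eb_summable (H _)) => j _.
  apply: (@Eb_le _ _ _ P (fun=> 1)) => //; last exact: Eb_cst.
  by move=> w; rewrite /one indicE lern1 leq_b1.
have Si : summable P (fun w => \sum_(j < K.+1) B j w * (mtrans K w - mtrans j w)) /\
    Ex P (fun w => \sum_(j < K.+1) B j w * (mtrans K w - mtrans j w)) = 0.
  elim: (index_enum _) => [|i l [IH1 IH2]].
    rewrite (_ : (fun _ => _) = fun=> 0); last by apply/funext => w; rewrite big_nil.
    by split; [exact: Eb_summable (Eb_cst _ (lexx 0))|exact: Ex_cst].
  rewrite (_ : (fun _ => _) = (fun w => B i w * (mtrans K w - mtrans i w) +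
     \sum_(j <- l) B j w * (mtrans K w - mtrans j w))); last by apply/funext => w; rewrite big_cons.
  have [q1 q2] := orth i.
  by split; [exact: summableD|rewrite ExD// q2 IH2 addr0].
have [Si1 Si2] := Si.
have SK := Eb_summable (mtrans_sqr K).
rewrite (_ : (\1_U : O -> R) = N); last by apply/funext.
apply: EbI => //.
  by move=> w; rewrite -NU indicE; case: (_ \in _).
rewrite ler_pdivlMr ?exprn_gt0// mulrC -ExZ//.
apply: le_trans (Ex_le _ _ ptw) _.
- exact: summableZ.
- by apply: summable_sub => //; exact: summableZ.
- rewrite Ex_sub// ?ExZ// ?Si2 ?mulr0 ?subr0; [exact: Eb_Ex (mtrans_sqr K)|exact: summableZ].
Qed.

End DiscreteMartingale.

(** * Taylor expansions *)

Section L1norm.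
Context {R : realType} {n : nat}.
Implicit Types v : 'cV[R]_n.

(** The l1 norm fits partial derivatives: a move made one coordinate at a time has this total
    length. *)
Definition nrm v : R := \sum_i `|v i 0|.

Lemma nrm_ge0 v : 0 <= nrm v.
Proof. by apply: sumr_ge0. Qed.

Lemma nrm0 : nrm 0 = 0.
Proof. by rewrite /nrm big1// => i _; rewrite mxE normr0. Qed.

Lemma nrmD u v : nrm (u + v) <= nrm u + nrm v.
Proof. by rewrite /nrm -big_split/=; apply: ler_sum => i _; rewrite mxE ler_normD. Qed.

Lemma nrmZ c v : nrm (c *: v) = `|c| * nrm v.
Proof. by rewrite /nrm mulr_sumr; apply: eq_bigr => i _; rewrite mxE normrM. Qed.

Lemma nrmN v : nrm (- v) = nrm v.
Proof. by rewrite /nrm; apply: eq_bigr => i _; rewrite mxE normrN. Qed.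

Lemma nrmC u v : nrm (u - v) = nrm (v - u).
Proof. by rewrite -nrmN opprB. Qed.

Lemma nrm_sub_trans u v w : nrm (u - w) <= nrm (u - v) + nrm (v - w).
Proof. by rewrite (le_trans _ (nrmD _ _))// addrA subrK. Qed.

Lemma coord_le_nrm v i : `|v i 0| <= nrm v.
Proof. by rewrite /nrm (bigD1 i)//= lerDl sumr_ge0. Qed.

Lemma nrm_le v c : (forall i, `|v i 0| <= c) -> nrm v <= n%:R * c.
Proof.
move=> vc; rewrite (_ : n%:R * c = \sum_(i < n) c).
  by apply: ler_sum => i _; exact: vc.
by rewrite sumr_const card_ord mulr_natl.
Qed.

Lemma nrm_sum (I : Type) (s : seq I) (Q : pred I) (f : I -> 'cV[R]_n) :
  nrm (\sum_(i <- s | Q i) f i) <= \sum_(i <- s | Q i) nrm (f i).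
Proof.
elim/big_rec2: _ => [|i y z _ H]; first by rewrite nrm0.
by rewrite (le_trans (nrmD _ _))// lerD2l.
Qed.

Lemma mx_norm_le_nrm v : `|v| <= nrm v.
Proof.
rewrite [`|v|]mx_normrE; apply/bigmax_leP; split; first exact: nrm_ge0.
by move=> [i j] _ /=; rewrite (ord1 j); exact: coord_le_nrm.
Qed.

End L1norm.

Lemma nrm_mulmx (R : realType) (n p : nat) (A : 'M[R]_(n, p)) (v : 'cV[R]_p) c :
  (forall i j, `|A i j| <= c) -> nrm (A *m v) <= n%:R * (c * nrm v).
Proof.
move=> Ac; apply: nrm_le => i; rewrite mxE (le_trans (ler_norm_sum _ _ _))//.
rewrite /nrm mulr_sumr; apply: ler_sum => j _.
by rewrite normrM ler_wpM2r.
Qed.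

Section Calculus1.
Context {R : realType}.

(** A quadratic error bound at every increment [e] gives the derivative, so functions can be
    differentiated along curves without a chain rule. *)
Lemma is_derive_quadratic (f : R -> R) (t l C : R) :
  (forall e, `|f (t + e) - f t - e * l| <= C * e ^+ 2) -> is_derive t 1 f l.
Proof.
move=> H.
have lim : (fun h => h^-1 *: ((f \o shift t) (h *: (1 : R)) - f t)) @ 0^' --> l.
  apply/cvgrPdist_le => e e0; near=> h.
  have h0 : h != 0 by near: h; exact: nbhs_dnbhs_neq.
  have := H h; rewrite /= /shift/= [h%:A]mulr1 (addrC h) => Hh.
  have -> : l - h^-1 *: (f (t + h) - f t) = - (h^-1 * (f (t + h) - f t - h * l)).
    by rewrite -[_ *: _]/(_ * _) [in RHS]mulrBr mulrA mulVf// mul1r opprB.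
  rewrite normrN normrM normfV ler_pdivrMl ?normr_gt0// (le_trans Hh)//.
  rewrite -real_normK ?num_real// expr2 mulrA [leRHS]mulrC.
  rewrite ler_wpM2r//; have : `|C| * `|h| <= e.
    have C1 : 0 < `|C| + 1 by rewrite ltr_wpDl.
    apply: (@le_trans _ _ ((`|C| + 1) * `|h|)); first by rewrite ler_wpM2r// lerDl.
    rewrite mulrC -ler_pdivlMr//; near: h; apply: dnbhs0_le; exact: divr_gt0.
  by apply: le_trans; rewrite ler_wpM2r// ler_norm.
split; last exact: cvg_lim lim.
by apply/cvg_ex; exists l.
Unshelve. all: by end_near. Qed.

Lemma MVT_bound (f df : R -> R) (K b : R) :
  (forall s : R, is_derive s (1 : R) f (df s)) ->
  (forall l, 0 <= l <= 1 -> `|df (l * b)| <= K) -> `|f b - f 0| <= K * `|b|.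
Proof.
move=> fd dK.
have cf : continuous f.
  move=> s; apply: differentiable_continuous; apply/derivable1_diffP.
  by have [] := fd s.
have wc a c : {within `[a, c], continuous f} by apply: continuous_subspaceT.
have [->|b0] := eqVneq b 0; first by rewrite subrr normr0 mulr0.
have dK' c : 0 <= c / b <= 1 -> `|df c| <= K.
  by move=> /dK; rewrite divfK.
case: (ltP 0 b) => bp.
  have [c cb ->] := MVT_segment (ltW bp) (fun s _ => fd s) (wc 0 b).
  rewrite subr0 normrM ler_wpM2r// dK'//.
  move: cb; rewrite in_itv/= => /andP[c0 cb].
  by apply/andP; split; [rewrite divr_ge0// ltW|rewrite ler_pdivrMr// mul1r].
have bn : b < 0 by rewrite lt_neqAle b0.
have [c cb] := MVT_segment bp (fun s _ => fd s) (wc b 0).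
rewrite distrC => ->; rewrite sub0r normrM normrN ler_wpM2r// dK'//.
move: cb; rewrite in_itv/= => /andP[bc c0].
by rewrite ler_ndivrMr// mul1r bc mulr_le0// invr_le0 ltW.
Qed.

End Calculus1.

Section Taylor.
Context {R : realType} {n : nat}.
Implicit Types (g : 'cV[R]_n -> R) (x y z c u v : 'cV[R]_n).
Local Notation e_ i := (delta_mx i 0 : 'cV[R]_n).

Lemma pderiv_line g x (i : 'I_n) (s : R) : derivable g (x + s *: e_ i) (e_ i) ->
  is_derive s 1 (fun t => g (x + t *: e_ i)) (pderiv i g (x + s *: e_ i)).
Proof.
move=> dg.
have E : (fun h : R => h^-1 *: (((fun t => g (x + t *: e_ i)) \o shift s) (h *: (1 : R)) - g (x + s *: e_ i))) =
  (fun h => h^-1 *: ((g \o shift (x + s *: e_ i)) (h *: e_ i) - g (x + s *: e_ i))).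
  apply/funext => h; rewrite /= [h%:A]mulr1.
  by rewrite scalerDl addrCA.
split; first by rewrite /derivable E.
by rewrite /derive E.
Qed.

(** Weaker than lying on the segment: it holds for the corners of the broken path that changes one
    coordinate at a time, and still bounds the distance to any centre. *)
Definition between x y u : Prop :=
  forall j (c : R), `|u j 0 - c| <= `|x j 0 - c| + `|y j 0 - c|.

Lemma between_nrm x y u c : between x y u -> nrm (u - c) <= nrm (x - c) + nrm (y - c).
Proof.
move=> b; rewrite /nrm -big_split/=; apply: ler_sum => i _.
by rewrite !mxE; exact: b.
Qed.

(** Only partial derivatives are available, so the path from [x] to [y] moves one coordinate at a
    time and the one-dimensional mean value theorem is applied on each leg. *)
Lemma mean_value g x y (K : R) : (forall i u, derivable g u (e_ i)) ->
  (forall i u, between x y u -> `|pderiv i g u| <= K) ->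
  `|g y - g x| <= K * nrm (y - x).
Proof.
move=> dg gK.
(* The first [k] coordinates have already moved to [y]. *)
pose z k : 'cV[R]_n := \col_j (if (j < k)%N then y j 0 else x j 0).
have z0 : z 0 = x by apply/matrixP => i j; rewrite (ord1 j) mxE.
have zn : z n = y by apply/matrixP => i j; rewrite (ord1 j) mxE ltn_ord.
have zS (k : 'I_n) : z k.+1 = z k + (y k 0 - x k 0) *: e_ k.
  apply/matrixP => i j; rewrite (ord1 j) !mxE eqxx andbT ltnS leq_eqVlt.
  case: (eqVneq i k) => [->|ik]; first by rewrite eqxx ltnn mulr1 addrC subrK.
  by rewrite (_ : (i == k :> nat) = false) ?mulr0 ?addr0//; apply/negbTE.
have step (k : 'I_n) : `|g (z k.+1) - g (z k)| <= K * `|(y - x) k 0|.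
  rewrite zS -{2}[z k]addr0 -{1}(scale0r (e_ k)) !mxE.
  apply: (@MVT_bound R (fun t => g (z k + t *: e_ k)) (fun t => pderiv k g (z k + t *: e_ k))).
    by move=> s; exact: pderiv_line.
  move=> l /andP[l0 l1]; apply: gK => j c; rewrite !mxE eqxx andbT.
  case: (eqVneq j k) => [->|jk]; last first.
    rewrite mulr0 addr0; case: ifPn => _; first by rewrite lerDr.
    by rewrite lerDl.
  rewrite ltnn mulr1.
  have -> : x k 0 + l * (y k 0 - x k 0) - c = (1 - l) * (x k 0 - c) + l * (y k 0 - c) by ring.
  rewrite (le_trans (ler_normD _ _))// !normrM (ger0_norm l0) ger0_norm ?subr_ge0//.
  by apply: lerD; rewrite ler_piMl// gerBl.
have E : g y - g x = \sum_(k < n) (g (z k.+1) - g (z k)).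
  by rewrite -(big_mkord xpredT (fun k => g (z k.+1) - g (z k))) telescope_sumr// z0 zn.
rewrite E (le_trans (ler_norm_sum _ _ _))// /nrm mulr_sumr.
by apply: ler_sum => k _; exact: step.
Qed.

Lemma lipschitz_of_pderiv g (K : R) : (forall i u, derivable g u (e_ i)) ->
  (forall i u, `|pderiv i g u| <= K) -> forall x y, `|g y - g x| <= K * nrm (y - x).
Proof. by move=> dg gK x y; apply: mean_value => // i u _. Qed.

(** The regularity of a component of [b]: it is, up to sign, a first derivative of [H], hence
    bounded itself, and it has three further bounded derivatives. *)
Record C3b g (K : R) : Prop := C3B {
  C3b_d1 : forall i u, derivable g u (e_ i);
  C3b_d2 : forall i j u, derivable (pderiv j g) u (e_ i);
  C3b_d3 : forall i j k u, derivable (pderiv j (pderiv k g)) u (e_ i);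
  C3b_0 : forall u, `|g u| <= K;
  C3b_1 : forall i u, `|pderiv i g u| <= K;
  C3b_2 : forall i j u, `|pderiv i (pderiv j g) u| <= K;
  C3b_3 : forall i j k u, `|pderiv i (pderiv j (pderiv k g)) u| <= K }.

Arguments C3b_d1 {g K}.
Arguments C3b_d2 {g K}.
Arguments C3b_d3 {g K}.

Lemma is_derive_affine (a : 'I_n -> R) (b : R) u (i : 'I_n) :
  is_derive u (e_ i) (fun z => b - \sum_j a j * z j 0) (- a i).
Proof.
have H (j : 'I_n) : is_derive u (e_ i) (fun z : 'cV[R]_n => z j 0) ((e_ i) j 0).
  have E : (fun h : R => h^-1 *: (((fun z : 'cV[R]_n => z j 0) \o shift u) (h *: e_ i) - u j 0)) @ 0^' --> (e_ i) j 0.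
    apply: cvg_near_cst; near=> h.
    have h0 : h != 0 by near: h; exact: nbhs_dnbhs_neq.
    rewrite /= 3!mxE addrK -[_ *: _]/(_ * _) mulrA mulVf ?mul1r//; by rewrite mxE.
  split; last exact: cvg_lim E.
  by apply/cvg_ex; eexists; exact: E.
have -> : (fun z : 'cV[R]_n => b - \sum_j a j * z j 0) =
    cst b - \sum_j ((a j) \*: (fun z : 'cV[R]_n => z j 0)).
  apply/funext => z; rewrite !fctE/= fct_sumE; congr (_ - _).
apply: is_derive_eq.
rewrite sub0r (bigD1 i)//= big1.
  by rewrite mxE !eqxx addr0 [_ *: _]mulr1.
by move=> j ji; rewrite mxE (negbTE ji) /= scaler0.
Unshelve. all: by end_near. Qed.

Lemma pderiv_sub_affine g c (a : 'I_n -> R) (b : R) (i : 'I_n) u : derivable g u (e_ i) ->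
  derivable (fun z => g z - \sum_j a j * (z - c) j 0 - b) u (e_ i) /\
  pderiv i (fun z => g z - \sum_j a j * (z - c) j 0 - b) u = pderiv i g u - a i.
Proof.
move=> dg.
have A := is_derive_affine a (\sum_j a j * c j 0 - b) u i.
have -> : (fun z : 'cV[R]_n => g z - \sum_j a j * (z - c) j 0 - b) =
   g + (fun z => \sum_j a j * c j 0 - b - \sum_j a j * z j 0).
  apply/funext => z; rewrite !fctE/=.
  rewrite (_ : \sum_j a j * (z - c) j 0 = \sum_j a j * z j 0 - \sum_j a j * c j 0).
    by rewrite opprB; lra.
  rewrite -sumrB; apply: eq_bigr => j _; by rewrite !mxE mulrBr.
by have [D1 D2] := is_deriveD (derivableP dg) A; split.
Qed.

(** Mean value bound for [g] minus its linear part at [c]: each partial derivative of the difference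
    at [u] is at most [K * nrm (u - c)], and points between [x] and [y] are no farther from [c] than
    both together. *)
Lemma taylor1 g (K : R) : C3b g K -> forall x y c,
  `|g y - g x - \sum_j pderiv j g c * (y - x) j 0| <=
  K * (nrm (x - c) + nrm (y - c)) * nrm (y - x).
Proof.
move=> gK x y c.
pose h z := g z - \sum_j pderiv j g c * (z - c) j 0 - 0.
have -> : g y - g x - \sum_j pderiv j g c * (y - x) j 0 = h y - h x.
  rewrite /h !subr0.
  rewrite (_ : \sum_j pderiv j g c * (y - x) j 0 =
    \sum_j pderiv j g c * (y - c) j 0 - \sum_j pderiv j g c * (x - c) j 0); first by lra.
  rewrite -sumrB; apply: eq_bigr => j _; rewrite !mxE; ring.
have dh i u := pderiv_sub_affine c (fun j => pderiv j g c) 0 (C3b_d1 gK i u).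
apply: mean_value => i u; first by have [] := dh i u.
move=> b; have [_ ->] := dh i u.
apply: (le_trans (lipschitz_of_pderiv (C3b_d2 gK ^~ i) (C3b_2 gK ^~ i) c u)).
rewrite ler_wpM2l//; last exact: between_nrm.
by rewrite (le_trans _ (C3b_0 gK 0)).
Qed.

(* Both endpoints stay close to the expansion point [c], which lies off the segment. *)
Definition C2b_part g (K : R) := forall i, forall x y c,
  `|pderiv i g y - pderiv i g x - \sum_j pderiv j (pderiv i g) c * (y - x) j 0| <=
  K * (nrm (x - c) + nrm (y - c)) * nrm (y - x).

Lemma taylor1_pderiv g (K : R) : C3b g K -> C2b_part g K.
Proof.
move=> gK i x y c; set g' := pderiv i g.
pose h z := g' z - \sum_j pderiv j g' c * (z - c) j 0 - 0.
have -> : g' y - g' x - \sum_j pderiv j g' c * (y - x) j 0 = h y - h x.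
  rewrite /h !subr0.
  rewrite (_ : \sum_j pderiv j g' c * (y - x) j 0 =
    \sum_j pderiv j g' c * (y - c) j 0 - \sum_j pderiv j g' c * (x - c) j 0); first by lra.
  rewrite -sumrB; apply: eq_bigr => j _; rewrite !mxE; ring.
have dh k u := pderiv_sub_affine c (fun j => pderiv j g' c) 0 (C3b_d2 gK k i u).
apply: mean_value => k u; first by have [] := dh k u.
move=> b; have [_ ->] := dh k u.
apply: (le_trans (lipschitz_of_pderiv (fun l => C3b_d3 gK l k i) (fun l => C3b_3 gK l k i) c u)).
rewrite ler_wpM2l//; last exact: between_nrm.
by rewrite (le_trans _ (C3b_0 gK 0)).
Qed.

(** The remainder along the segment, [psi], has a derivative of size [K |v|^3] by the first-order
    expansion of the partial derivatives; the mean value bound on [[0, 1]] concludes. *)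
Lemma taylor2 g (K : R) : C3b g K -> forall x v,
  `|g (x + v) - g x - \sum_j pderiv j g x * v j 0
    - 2^-1 * \sum_i \sum_j pderiv i (pderiv j g) x * v i 0 * v j 0| <= K * nrm v ^+ 3.
Proof.
move=> gK x v.
have K0 : 0 <= K by rewrite (le_trans _ (C3b_0 gK 0)).
pose a (s : R) := \sum_j pderiv j g (x + s *: v) * v j 0.
pose q := \sum_i \sum_j pderiv i (pderiv j g) x * v i 0 * v j 0.
(* [g] is only given with partial derivatives; its derivative along [v] is read off the quadratic
   bound of [taylor1]. *)
have dphi (s : R) : is_derive s (1 : R) (fun s => g (x + s *: v)) (a s).
  apply: (@is_derive_quadratic _ _ _ _ (K * nrm v ^+ 2)) => e.
  have := taylor1 gK (x + s *: v) (x + (s + e) *: v) (x + s *: v).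
  rewrite subrr nrm0 add0r.
  have -> : x + (s + e) *: v - (x + s *: v) = e *: v.
    by rewrite scalerDl addrA [LHS]addrC addKr.
  rewrite nrmZ -(real_normK (num_real e)) => H.
  have -> : e * a s = \sum_j pderiv j g (x + s *: v) * (e *: v) j 0.
    by rewrite /a mulr_sumr; apply: eq_bigr => j _; rewrite mxE; ring.
  by rewrite (le_trans H)//; rewrite le_eqVlt; apply/orP; left; apply/eqP; ring.
pose psi (s : R) := g (x + s *: v) - (s * a 0 + s ^+ 2 * (2^-1 * q)).
pose psi' (s : R) := a s - (a 0 + s * q).
have dpsi (s : R) : is_derive s (1 : R) psi (psi' s).
  have D2 : is_derive s (1 : R) (fun s : R => s * a 0 + s ^+ 2 * (2^-1 * q)) (a 0 + s * q).
    apply: (@is_derive_quadratic _ _ _ _ (`|2^-1 * q|)) => e.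
    have -> : (s + e) * a 0 + (s + e) ^+ 2 * (2^-1 * q) - (s * a 0 + s ^+ 2 * (2^-1 * q)) - e * (a 0 + s * q)
      = (2^-1 * q) * e ^+ 2 by field.
    by rewrite normrM [`|e ^+ 2|]ger0_norm ?sqr_ge0.
  have D1 := dphi s.
  exact: (is_deriveB D1 D2).
have bound (s : R) : 0 <= s <= 1 -> `|psi' s| <= K * nrm v ^+ 3.
  move=> /andP[s0 s1].
  have -> : psi' s = \sum_j (pderiv j g (x + s *: v) - pderiv j g x -
      \sum_i pderiv i (pderiv j g) x * (s *: v) i 0) * v j 0.
    rewrite /psi' /a /q scale0r addr0 exchange_big mulr_sumr -big_split/= -sumrB.
    apply: eq_bigr => j _; rewrite mulr_sumr !mulrBl opprD addrA; congr (_ - _ - _).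
    rewrite mulr_suml; apply: eq_bigr => i _; rewrite mxE; ring.
  rewrite (le_trans (ler_norm_sum _ _ _))//.
  apply: (@le_trans _ _ (\sum_j (K * nrm v ^+ 2) * `|v j 0|)); last first.
    by rewrite -mulr_sumr -/(nrm v) -mulrA -exprSr.
  apply: ler_sum => j _; rewrite normrM ler_wpM2r//.
  have := taylor1_pderiv gK j x (x + s *: v) x.
  rewrite (_ : x + s *: v - x = s *: v); last by rewrite addrC addKr.
  rewrite subrr nrm0 add0r nrmZ (ger0_norm s0) => H.
  apply: (le_trans H); rewrite expr2 -mulrA ler_wpM2l// ler_pM ?mulr_ge0 ?nrm_ge0//.
    by rewrite ler_piMl// nrm_ge0.
  by rewrite ler_piMl// nrm_ge0.
have := MVT_bound (K := K * nrm v ^+ 3) (b := 1) dpsi.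
move=> /(_ _)/wrap[]; first by move=> l; rewrite mulr1; exact: bound.
rewrite normr1 mulr1 /psi scale1r scale0r addr0 mul1r expr1n !mul0r expr0n mul0r addr0 mul1r subr0.
rewrite /a scale0r addr0 -/q => H; apply: le_trans H.
by rewrite le_eqVlt; apply/orP; left; apply/eqP; congr `|_|; lra.
Qed.


Lemma pderiv_lin (f g : 'cV[R]_n -> R) (c : R) (i : 'I_n) :
  (forall u, derivable f u (e_ i)) -> (forall u, derivable g u (e_ i)) ->
  (forall u, derivable (fun x => c * f x + g x) u (e_ i)) /\
  pderiv i (fun x => c * f x + g x) = (fun x => c * pderiv i f x + pderiv i g x).
Proof.
move=> df dg.
have D u : is_derive u (e_ i) (fun x => c * f x + g x) (c * pderiv i f u + pderiv i g u).
  exact: (is_deriveD (is_deriveZ c (derivableP (df u))) (derivableP (dg u))).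
by split=> [u|]; [have [] := D u|apply/funext => u; have [_] := D u].
Qed.

Lemma C3b_lin f g (c K K' : R) : C3b f K -> C3b g K' ->
  C3b (fun x => c * f x + g x) (`|c| * K + K').
Proof.
move=> fK gK.
have bnd (a b : R) : `|a| <= K -> `|b| <= K' -> `|c * a + b| <= `|c| * K + K'.
  by move=> aK bK; rewrite (le_trans (ler_normD _ _))// lerD// normrM ler_wpM2l.
have E1 i := (pderiv_lin c (C3b_d1 fK i) (C3b_d1 gK i)).2.
have E2 i j := (pderiv_lin c (C3b_d2 fK i j) (C3b_d2 gK i j)).2.
have E3 i j k := (pderiv_lin c (C3b_d3 fK i j k) (C3b_d3 gK i j k)).2.
split.
- by move=> i; exact: (pderiv_lin c (C3b_d1 fK i) (C3b_d1 gK i)).1.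
- by move=> i j; rewrite E1; exact: (pderiv_lin c (C3b_d2 fK i j) (C3b_d2 gK i j)).1.
- by move=> i j k; rewrite E1 E2; exact: (pderiv_lin c (C3b_d3 fK i j k) (C3b_d3 gK i j k)).1.
- by move=> u; exact: bnd (C3b_0 fK _) (C3b_0 gK _).
- by move=> i u; rewrite E1; exact: bnd (C3b_1 fK _ _) (C3b_1 gK _ _).
- by move=> i j u; rewrite E1 E2; exact: bnd (C3b_2 fK _ _ _) (C3b_2 gK _ _ _).
- by move=> i j k u; rewrite E1 E2 E3; exact: bnd (C3b_3 fK _ _ _ _) (C3b_3 gK _ _ _ _).
Qed.

Lemma C3b_zero : C3b (fun=> 0) 0.
Proof.
have E i : pderiv i (fun _ : 'cV[R]_n => 0 : R) = fun=> 0.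
  by apply/funext => u; rewrite /pderiv derive_cst.
by split => *; rewrite ?E ?normr0//; exact: derivable_cst.
Qed.

Lemma C3b_sum (I : Type) (s : seq I) (f : I -> 'cV[R]_n -> R) (c K : I -> R) :
  (forall i, C3b (f i) (K i)) ->
  C3b (fun x => \sum_(i <- s) c i * f i x) (\sum_(i <- s) `|c i| * K i).
Proof.
move=> fK; elim: s => [|i s IH].
  rewrite big_nil (_ : (fun _ => _) = fun=> 0); first exact: C3b_zero.
  by apply/funext => x; rewrite big_nil.
rewrite big_cons (_ : (fun _ => _) = fun x => c i * f i x + \sum_(i <- s) c i * f i x).
  exact: C3b_lin.
by apply/funext => x; rewrite big_cons.
Qed.

Lemma C3b_weak f (K K' : R) : K <= K' -> C3b f K -> C3b f K'.
Proof.
move=> KK' [d1 d2 d3 b0 b1 b2 b3].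
by split => // *; [rewrite (le_trans (b0 _))|rewrite (le_trans (b1 _ _))|
  rewrite (le_trans (b2 _ _ _))|rewrite (le_trans (b3 _ _ _ _))].
Qed.

Lemma C3b_pderiv (H : 'cV[R]_n -> R) (i : 'I_n) : bounded_derivs_upto 4 H ->
  exists K, C3b (pderiv i H) K.
Proof.
move=> [dH bH].
(* A bound is attached to every multi-index, with the default 0 outside orders 1 to 4, so that
   [choice] yields one function of the multi-index. *)
have bd (s : seq 'I_n) : exists C, (0 < size s <= 4)%N -> forall x, `|iter_pderiv s H x| <= C.
  have [/bH[_ [C HC]]|ns] := boolP (0 < size s <= 4)%N; first by exists C.
  by exists 0.
have [C HC] := choice bd.
have H1 := HC [:: i] isT; have H2 j := HC [:: j; i] isT.
have H3 j k := HC [:: j; k; i] isT; have H4 j k l := HC [:: j; k; l; i] isT.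
pose K := `|C [:: i]| + (\sum_j `|C [:: j; i]| + (\sum_(p : 'I_n * 'I_n) `|C [:: p.1; p.2; i]|
  + \sum_(p : 'I_n * 'I_n * 'I_n) `|C [:: p.1.1; p.1.2; p.2; i]|)).
have s0 (I : finType) (f : I -> R) : 0 <= \sum_i `|f i| by exact: sumr_ge0.
have le_s (I : finType) (f : I -> R) j : f j <= \sum_i `|f i|.
  by rewrite (bigD1 j)//= (le_trans (ler_norm _))// lerDl sumr_ge0.
exists K; split.
- by move=> j u; exact: (dH [:: i]).
- by move=> j k u; exact: (dH [:: k; i]).
- by move=> j k l u; exact: (dH [:: k; l; i]).
- move=> u; rewrite (le_trans (H1 u))// (le_trans (ler_norm _))// lerDl.
  by rewrite !addr_ge0.
- move=> j u; rewrite (le_trans (H2 j u))// (le_trans (le_s _ (fun j => C [:: j; i]) j))//.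
  by rewrite /K addrCA lerDl !addr_ge0.
- move=> j k u; rewrite (le_trans (H3 j k u))//.
  rewrite (le_trans (le_s _ (fun p : 'I_n * 'I_n => C [:: p.1; p.2; i]) (j, k)))//.
  by rewrite /K addrA addrCA lerDl !addr_ge0.
- move=> j k l u; rewrite (le_trans (H4 j k l u))//.
  rewrite (le_trans (le_s _ (fun p : 'I_n * 'I_n * 'I_n => C [:: p.1.1; p.1.2; p.2; i]) (j, k, l)))//.
  by rewrite /K !addrA lerDr !addr_ge0.
Qed.

Definition C3b_field (b : 'cV[R]_n -> 'cV[R]_n) (K : R) := forall l, C3b (fun x => b x l 0) K.

End Taylor.

Lemma hamiltonian_C3b (R : realType) (d : nat) (H : 'cV[R]_(d + d) -> R) :
  bounded_derivs_upto 4 H -> exists K, 0 <= K /\ C3b_field (hamiltonian_field H) K.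
Proof.
move=> hH; have [K HK] := choice (fun i => C3b_pderiv i hH).
pose K' l := \sum_j `|symplJ (R := R) d l j| * K j.
have Hl l : C3b (fun x => hamiltonian_field H x l 0) (K' l).
  have := C3b_sum (index_enum _) (fun j => symplJ (R := R) d l j) HK.
  rewrite (_ : (fun x => _) = (fun x => hamiltonian_field H x l 0))//.
  by apply/funext => x; rewrite [RHS]mxE; apply: eq_bigr => j _; congr (_ * _); rewrite [RHS]mxE.
exists (\sum_l `|K' l|); split; first exact: sumr_ge0.
move=> l; apply: C3b_weak (Hl l).
by rewrite (bigD1 l)//= (le_trans (ler_norm _))// lerDl sumr_ge0.
Qed.

(** * Integrals of continuous functions *)

Section IntegralOfContinuous.
Context {R : realType}.
Implicit Types (f g : R -> R) (a b c t : R).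

(** Integrands are kept continuous on the whole line, so every segment is admissible; paths on
    [[0, T]] are extended by clamping to fit. *)
Definition itg a b g : R := \int[lebesgue_measure]_(s in `[a, b]) g s.

Lemma itg_integrable a b g : continuous g ->
  (@lebesgue_measure R).-integrable `[a, b] (EFin \o g).
Proof.
move=> cg; apply: continuous_compact_integrable; first exact: segment_compact.
exact: continuous_subspaceT.
Qed.

Lemma itg_eq a b f g : (forall s, a <= s <= b -> f s = g s) -> itg a b f = itg a b g.
Proof. by move=> fg; apply: eq_Rintegral => s; rewrite inE/= in_itv/=; exact: fg. Qed.

Lemma itgD a b f g : continuous f -> continuous g ->
  itg a b (fun s => f s + g s) = itg a b f + itg a b g.
Proof. by move=> cf cg; rewrite /itg RintegralD//; exact: itg_integrable. Qed.

Lemma itgB a b f g : continuous f -> continuous g ->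
  itg a b (fun s => f s - g s) = itg a b f - itg a b g.
Proof. by move=> cf cg; rewrite /itg RintegralB//; exact: itg_integrable. Qed.

Lemma itgZ a b k g : continuous g -> itg a b (fun s => k * g s) = k * itg a b g.
Proof. by move=> cg; rewrite /itg RintegralZl//; exact: itg_integrable. Qed.

Lemma itg_cst a b k : a <= b -> itg a b (fun=> k) = k * (b - a).
Proof.
move=> ab; rewrite /itg Rintegral_cst//= lebesgue_measure_itv/=.
by case: ifPn => //; rewrite lte_fin -leNgt => ba; rewrite (@le_anti _ _ a b) ?ab// subrr.
Qed.

Lemma itg_le a b f g : continuous f -> continuous g ->
  (forall s, a <= s <= b -> f s <= g s) -> itg a b f <= itg a b g.
Proof.
move=> cf cg fg; apply: le_Rintegral; [by []|exact: itg_integrable|exact: itg_integrable|].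
by move=> s /=; rewrite in_itv/=; exact: fg.
Qed.

Lemma itg_ge0 a b f : (forall s, a <= s <= b -> 0 <= f s) -> 0 <= itg a b f.
Proof. by move=> f0; apply: Rintegral_ge0 => s /=; rewrite in_itv/=; exact: f0. Qed.

Lemma itg_abs a b f : continuous f -> `|itg a b f| <= itg a b (fun s => `|f s|).
Proof. by move=> cf; apply: le_normr_Rintegral => //; exact: itg_integrable. Qed.

Lemma continuous_abs f : continuous f -> continuous (fun s => `|f s|).
Proof. by move=> cf s; apply: continuous_comp; [exact: cf|exact: norm_continuous]. Qed.

Lemma itg_bound a b f k : a <= b -> continuous f ->
  (forall s, a <= s <= b -> `|f s| <= k) -> `|itg a b f| <= k * (b - a).
Proof.
move=> ab cf fk; apply: le_trans (itg_abs _ _ cf) _; rewrite -itg_cst//.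
by apply: itg_le => //; [exact: continuous_abs|exact: cst_continuous].
Qed.

Lemma itg_split a b c f : a <= b -> b <= c -> continuous f ->
  itg a c f = itg a b f + itg b c f.
Proof.
move=> ab bc cf; have := @Rintegral_itvB R f (BLeft a) (BRight c) b (itg_integrable a c cf).
rewrite !bnd_simp => /(_ ab bc) H.
rewrite /itg -(Rintegral_itv_obnd_cbnd (r := b)).
  by rewrite -H addrC subrK.
by apply: integrableS (itg_integrable b c cf) => //; apply: subset_itvr; rewrite bnd_simp.
Qed.

Lemma itg_point a f : itg a a f = 0.
Proof. by rewrite /itg set_itv1 Rintegral_set1. Qed.

(** Heine's theorem by compactness, with [s] in the segment but [t] anywhere near it. *)
Lemma unif_cont a b g (e : R) : continuous g -> 0 < e -> exists2 d : R, 0 < d &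
  forall s t, a <= s <= b -> `|s - t| < d -> `|g s - g t| <= e.
Proof.
move=> cg e0.
have nc : near_covering `[a, b]%classic.
  by apply/compact_near_coveringP; exact: segment_compact.
have H : \forall d \near (0 : R)^'+, `[a, b]%classic `<=`
    (fun s => forall t, `|s - t| < d -> `|g s - g t| <= e).
  apply: nc => x _.
  have e2 : 0 < e / 2 by rewrite divr_gt0.
  have /cvgrPdist_le/(_ _ e2)/nbhs_ballP[r /= r0 Hr] := cg x.
  near=> s d => t /= sd.
  have sx : `|x - s| < r / 2.
    by near: s; apply/nbhs_ballP; exists (r / 2); [rewrite /= divr_gt0|].
  have dr : d < r / 2 by near: d; apply: nbhs_right_lt; rewrite divr_gt0.
  have tx : `|x - t| < r.
    rewrite (_ : x - t = (x - s) + (s - t)); last by ring.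
    by rewrite (le_lt_trans (ler_normD _ _))//; lra.
  have Hs := Hr s; have Ht := Hr t.
  rewrite (_ : g s - g t = - (g x - g s) + (g x - g t)); last by ring.
  rewrite (le_trans (ler_normD _ _))// normrN.
  have : `|g x - g s| <= e / 2 by apply: Hs; rewrite /ball/=; lra.
  have : `|g x - g t| <= e / 2 by apply: Ht.
  by lra.
near (0 : R)^'+ => d; exists d; first by near: d; exact: nbhs_right_gt.
have Hd : `[a, b]%classic `<=` (fun s => forall t, `|s - t| < d -> `|g s - g t| <= e) by near: d.
by move=> s t sab; apply: Hd; rewrite /= in_itv.
Unshelve. all: by end_near. Qed.

Lemma itg_bounded a b g : a <= b -> continuous g ->
  exists2 k, 0 <= k & forall s, a <= s <= b -> `|g s| <= k.
Proof.
move=> ab cg.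
have [c cab H] := EVT_max ab (continuous_subspaceT (continuous_abs cg)).
exists `|g c| => // s sab; apply: H; by rewrite in_itv.
Qed.

(** Right-endpoint sums, over [M + 1] cells so that no division by zero occurs. *)
Definition rsum a b (M : nat) g : R :=
  (b - a) / M.+1%:R * \sum_(j < M.+1) g (a + j.+1%:R * ((b - a) / M.+1%:R)).

Lemma itg_cells a (d : R) (M : nat) g : 0 <= d -> continuous g ->
  itg a (a + M%:R * d) g = \sum_(j < M) itg (a + j%:R * d) (a + j.+1%:R * d) g.
Proof.
move=> d0 cg; elim: M => [|M IH]; first by rewrite big_ord0 mul0r addr0 itg_point.
rewrite big_ord_recr/= -IH; apply: itg_split => //.
  by rewrite lerDl mulr_ge0.
by rewrite lerD2l ler_wpM2r// ler_nat.
Qed.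

Lemma rsum_pt a b (M : nat) (j : 'I_M.+1) : a <= b ->
  a <= a + j.+1%:R * ((b - a) / M.+1%:R) <= b.
Proof.
move=> ab; have M0 : 0 < M.+1%:R :> R by rewrite ltr0n.
have h0 : 0 <= (b - a) / M.+1%:R by rewrite divr_ge0 ?subr_ge0// ltW.
rewrite lerDl mulr_ge0//=.
rewrite (_ : a + _ <= b = (j.+1%:R * ((b - a) / M.+1%:R) <= b - a)); last by rewrite lerBrDl.
rewrite mulrA ler_pdivrMr// mulrC ler_wpM2l ?subr_ge0//.
by rewrite ler_nat.
Qed.

Lemma rsum_cvg a b g : a <= b -> continuous g -> rsum a b ^~ g @ \oo --> itg a b g.
Proof.
move=> ab cg; apply/cvgrPdist_le => e e0.
(* The added 1 keeps the divisor positive when [a = b]. *)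
have c0 : 0 < b - a + 1 by rewrite ltr_wpDl// subr_ge0.
have [d d0 Hd] := unif_cont a b cg (divr_gt0 e0 c0).
near=> M.
have M0 : 0 < M.+1%:R :> R by rewrite ltr0n.
set h := (b - a) / M.+1%:R.
have h0 : 0 <= h by rewrite divr_ge0 ?subr_ge0// ltW.
have hd : h < d.
  rewrite /h ltr_pdivrMr// mulrC -ltr_pdivrMr//.
  have : ((b - a) / d) < M%:R by near: M; exact: nbhs_infty_gtr.
  by move/lt_le_trans; apply; rewrite ler_nat.
have bE : b = a + M.+1%:R * h by rewrite /h mulrCA divff ?mulr1 ?gt_eqF// addrC subrK.
rewrite {1}bE itg_cells// /rsum -/h mulr_sumr -sumrB (le_trans (ler_norm_sum _ _ _))//.
apply: (@le_trans _ _ (\sum_(j < M.+1) (e / (b - a + 1)) * h)); last first.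
  have hE : M.+1%:R * h = b - a by rewrite [in RHS]bE addrC addKr.
  rewrite sumr_const card_ord -[(_ * h) *+ _]mulr_natl mulrCA hE.
  by rewrite -mulrA ger_pMr// mulrC ler_pdivrMr// mul1r lerDl.
apply: ler_sum => j _.
set l := a + j%:R * h; set r := a + j.+1%:R * h.
have lr : r - l = h by rewrite /l /r -natr1; ring.
have lr' : l <= r by rewrite -subr_ge0 lr.
have -> : itg l r g - h * g r = itg l r (fun s => g s - g r).
  rewrite itgB//; last exact: cst_continuous.
  by rewrite itg_cst// lr mulrC.
rewrite -[in leRHS]lr; apply: itg_bound => //.
  by move=> s; apply: cvgB; [exact: cg|exact: cvg_cst].
move=> s /andP[ls sr]; rewrite distrC; apply: Hd; first exact: rsum_pt.
rewrite ger0_norm ?subr_ge0// (le_lt_trans _ hd)// -lr.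
by rewrite lerD2l lerN2.
Unshelve. all: by end_near. Qed.

Lemma itg_lip T g k s t : (forall u, 0 <= u <= T -> `|g u| <= k) -> continuous g ->
  0 <= s -> s <= t -> t <= T -> `|itg 0 t g - itg 0 s g| <= k * (t - s).
Proof.
move=> gk cg s0 st tT; rewrite (itg_split s0 st cg) addrAC subrr add0r.
apply: itg_bound => // u /andP[su ut]; apply: gk.
by rewrite (le_trans s0 su) (le_trans ut tT).
Qed.

(** The exponential weight under which the Picard map contracts. *)
Lemma itg_expR (l t : R) : 0 < l -> 0 <= t -> itg 0 t (fun s => expR (l * s)) <= expR (l * t) / l.
Proof.
move=> l0 t0; rewrite le_eqVlt in t0; case/predU1P: t0 => [<-|t0].
  by rewrite itg_point divr_ge0 ?expR_ge0// ltW.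
have ce : continuous (fun s => expR (l * s)).
  move=> s; apply: continuous_comp; last exact: continuous_expR.
  by apply: cvgM; [exact: cvg_cst|exact: cvg_id].
have dF (s : R) : is_derive s (1 : R) (fun s => l^-1 * expR (l * s)) (expR (l * s)).
  have D1 : is_derive s (1 : R) (fun s => l * s) l.
    have := is_deriveZ l (is_derive_id s (1 : R)).
    by rewrite [_ *: _]mulr1.
  have D2 := @is_derive1_comp _ _ _ _ _ _ (is_derive_expR (l * s)) D1.
  have := is_deriveZ l^-1 D2.
  by rewrite -[_ *: (_ * _)]/(_ * _) [expR _ * _]mulrC mulrA mulVf ?gt_eqF// mul1r.
have cF : continuous (fun s => l^-1 * expR (l * s)).
  by move=> s; apply: cvgM; [exact: cvg_cst|exact: ce].
rewrite /itg /Rintegral (@continuous_FTC2 _ _ (fun s => l^-1 * expR (l * s)))//.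
- rewrite /= mulr0 expR0 mulr1 mulrC lerBlDl lerDr invr_ge0; exact: ltW.
- exact: continuous_subspaceT.
- split.
  + by move=> s _; have [] := dF s.
  + apply: cvg_at_right_filter; exact: cF.
  + apply: cvg_at_left_filter; exact: cF.
- by move=> s _; rewrite derive1E; have [_ ->] := dF s.
Qed.

End IntegralOfContinuous.

Section ParamIntegral.
Context {R : realType} {disp : measure_display} {O : measurableType disp}.
Variables (a b : R) (g : R -> O -> R).
Hypotheses (ab : a <= b) (cg : forall w, continuous (g ^~ w))
 (mg : forall s, a <= s <= b -> mfT (g s)).

Lemma itg_meas : mfT (fun w => itg a b (g ^~ w)).
Proof.
apply: (measurable_fun_cvg (h := fun M w => rsum a b M (g ^~ w))).
  move=> M; apply: measurable_funM => //; apply: measurable_sum => j.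
  by apply: mg; exact: rsum_pt.
by move=> w _; exact: rsum_cvg.
Qed.

(** Fatou's lemma on Riemann sums takes the place of Fubini, which would ask for joint measurability
    in time and sample. *)
Lemma Eb_itg (P : probability O R) v : (forall s, a <= s <= b -> Eb P (g s) v) ->
  Eb P (fun w => itg a b (g ^~ w)) ((b - a) * v).
Proof.
move=> gv; apply: (@Eb_fatou _ _ _ P (fun M w => rsum a b M (g ^~ w))).
  move=> M; have M0 : 0 < M.+1%:R :> R by rewrite ltr0n.
  rewrite (_ : (b - a) * v = (b - a) / M.+1%:R * \sum_(j < M.+1) v).
    apply: Eb_scale; first by rewrite divr_ge0 ?subr_ge0// ltW.
    by apply: Eb_sum => j _; apply: gv; exact: rsum_pt.
  by rewrite sumr_const card_ord -[v *+ _]mulr_natl mulrA divfK// gt_eqF.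
by move=> w; exact: rsum_cvg.
Qed.

End ParamIntegral.

(** * Normal laws *)

Import HBNNSimple.

Section Density.
Context {d : measure_display} {T : measurableType d} {R : realType}.
Variables (mu nu : {measure set T -> \bar R}) (p : T -> R).
Hypotheses (mp : mfT p) (p0 : forall x, 0 <= p x)
 (nuE : forall A, measurable A -> (nu A = \int[mu]_(x in A) (p x)%:E)%E).

Local Open Scope ereal_scope.

Let mpE : mfT (fun x => (p x)%:E).
Proof. exact/measurable_EFinP. Qed.

Let indic_density (E : set T) : measurable E ->
  \int[nu]_x (\1_E x)%:E = \int[mu]_x ((\1_E x)%:E * (p x)%:E).
Proof.
move=> mE; rewrite integral_indic//= setIT nuE// integral_mkcond/=.
apply: eq_integral => x _; rewrite patchE indicE; case: (_ \in _); by rewrite ?mul1e// mul0e.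
Qed.

Let nnsfun_density (f : {nnsfun T >-> R}) :
  \int[nu]_x (f x)%:E = \int[mu]_x ((f x)%:E * (p x)%:E).
Proof.
under [LHS]eq_integral do rewrite fimfunE -fsumEFin//.
rewrite [LHS]ge0_integral_fsum//; last 2 first.
  - by move=> r; exact/measurable_EFinP/measurableT_comp.
  - by move=> n x _; rewrite EFinM nnfun_muleindic_ge0.
under [RHS]eq_integral.
  move=> x xD; rewrite fimfunE -fsumEFin// muleC ge0_mule_fsumr; last first.
    by move=> r; rewrite EFinM nnfun_muleindic_ge0.
  over.
rewrite [RHS]ge0_integral_fsum//; last 2 first.
  - move=> r; apply: emeasurable_funM => //; apply/measurable_EFinP; exact/measurableT_comp.
  - move=> n x _; apply: mule_ge0; first by rewrite lee_fin.
    by rewrite EFinM nnfun_muleindic_ge0.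
apply: eq_fsbigr => r _.
have [r0|r0] := leP 0%R r; last first.
  have E0 : f @^-1` [set r] = set0.
    by apply/seteqP; split => // x /= fxr; move: r0; rewrite -fxr ltNge fun_ge0.
  rewrite E0 integral0_eq; last by move=> x _; rewrite indic0 mulr0.
  by rewrite integral0_eq// => x _; rewrite indic0 mulr0 mule0.
under eq_integral do rewrite EFinM.
rewrite ge0_integralZl_EFin//; last exact/measurable_EFinP/measurable_indic.
rewrite indic_density// -ge0_integralZl_EFin//; last 2 first.
  - by move=> x _; rewrite mule_ge0// lee_fin.
  - by apply: emeasurable_funM => //; exact/measurable_EFinP/measurable_indic.
by apply: eq_integral => x _; rewrite EFinM muleA [RHS]muleC.
Qed.

(** The usual ladder: indicators by [nuE], simple functions by linearity, then monotone convergence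
    on both sides. *)
Lemma ge0_integral_density (f : T -> \bar R) : mfT f ->
  (forall x, 0 <= f x) -> \int[nu]_x f x = \int[mu]_x (f x * (p x)%:E).
Proof.
move=> mf f0; pose g := nnsfun_approx measurableT mf.
have mg n : mfT (fun x => (g n x)%:E) by exact/measurable_EFinP.
have g0 n x : setT x -> 0 <= (g n x)%:E by rewrite lee_fin.
have gnd x : setT x -> {homo (fun n => (g n x)%:E) : n m / (n <= m)%N >-> n <= m}.
  by move=> _ n m nm; rewrite lee_fin; have /lefP := nd_nnsfun_approx measurableT mf nm.
have gf x : (g n x)%:E @[n --> \oo] --> f x.
  by apply: cvg_nnsfun_approx.
have c1 := cvg_monotone_convergence (mu := nu) measurableT mg g0 gnd.
have mg2 n : mfT (fun x => (g n x)%:E * (p x)%:E) by apply: emeasurable_funM.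
have g20 n x : setT x -> 0 <= (g n x)%:E * (p x)%:E by move=> _; rewrite mule_ge0// lee_fin.
have g2nd x : setT x -> {homo (fun n => (g n x)%:E * (p x)%:E) : n m / (n <= m)%N >-> n <= m}.
  by move=> Tx n m nm; apply: lee_wpmul2r; [rewrite lee_fin|exact: gnd].
have c2 := cvg_monotone_convergence (mu := mu) measurableT mg2 g20 g2nd.
have -> : \int[nu]_x f x = \int[nu]_x limn (fun n => (g n x)%:E).
  by apply: eq_integral => x _; apply/esym/cvg_lim.
have -> : \int[mu]_x (f x * (p x)%:E) = \int[mu]_x limn (fun n => (g n x)%:E * (p x)%:E).
  apply: eq_integral => x _; apply/esym/cvg_lim => //.
  exact: cvgeZr.
have E : (fun n => \int[nu]_x (g n x)%:E) = (fun n => \int[mu]_x ((g n x)%:E * (p x)%:E)).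
  by apply/funext => n; exact: nnsfun_density.
rewrite E in c1; rewrite -(cvg_lim _ c1)//; exact: (cvg_lim _ c2).
Qed.

End Density.

Lemma meas_sec1 d1 d2 d3 (T1 : measurableType d1) (T2 : measurableType d2) (T3 : measurableType d3)
  (F : T1 * T2 -> T3) x : mfT F -> mfT (fun y => F (x, y)).
Proof.
by move=> mF; exact: (measurableT_comp mF (measurable_fun_pair (measurable_cst x) (@measurable_id _ _ _))).
Qed.

Lemma meas_sec2 d1 d2 d3 (T1 : measurableType d1) (T2 : measurableType d2) (T3 : measurableType d3)
  (F : T1 * T2 -> T3) y : mfT F -> mfT (fun x => F (x, y)).
Proof.
by move=> mF; exact: (measurableT_comp mF (measurable_fun_pair (@measurable_id _ _ _) (measurable_cst y))).
Qed.

Section LebesguePlane.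
Context {R : realType}.
Local Notation mu := (@lebesgue_measure R).
Local Open Scope ereal_scope.

(** The image measure takes the same values as Lebesgue measure on half-open intervals, hence equals
    it. *)
Lemma integral_translation (F : R -> \bar R) (c : R) : mfT F ->
  (forall x, 0 <= F x) -> \int[mu]_x F (x + c)%R = \int[mu]_x F x.
Proof.
move=> mF F0.
have ms : measurable_fun (setT : set R) (fun x : R => (x + c)%R : measurableTypeR R) by exact: measurable_funD.
transitivity (\int[pushforward mu (fun x : R => (x + c)%R : measurableTypeR R)]_x F x).
  by rewrite ge0_integral_pushforward//.
apply: eq_measure_integral => A mA _; apply/esym/lebesgue_measure_unique => //= _ [[a b]] _ <-.
rewrite /pushforward.
have -> : (fun x : R => (x + c)%R) @^-1` [set` `]a, b]] = [set` `](a - c)%R, (b - c)%R]].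
  by apply/seteqP; split => x /=; rewrite !in_itv/= ltrBlDr lerBrDr.
rewrite !lebesgue_measure_itv/= !lte_fin ltrD2r.
by case: ifPn => //; rewrite -!EFinB => _; congr (_%:E); ring.
Qed.

Lemma integral_reflection (F : R -> \bar R) : mfT F ->
  (forall x, 0 <= F x) -> \int[mu]_x F (- x)%R = \int[mu]_x F x.
Proof.
move=> mF F0.
transitivity (\int[pushforward mu (-%R : _ -> measurableTypeR R)]_x F x).
  by rewrite ge0_integral_pushforward//.
by apply: eq_measure_integral => A mA _; exact: lebesgue_measureN.
Qed.

Definition plane_integral (F : R * R -> \bar R) := \int[mu]_x \int[mu]_y F (x, y).

Lemma measurable_affine2 (a b c d : R) :
  mfT (fun z : R * R => (a * z.1 + b * z.2, c * z.1 + d * z.2)%R).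
Proof.
apply: measurable_fun_pair; apply: measurable_funD; apply: measurable_funM => //;
  by [exact: measurable_fst|exact: measurable_snd].
Qed.

(** When the first coordinate is integrated first, with the second one fixed, the shear is a
    translation. *)
Lemma shear1 (F : R * R -> \bar R) (t : R) : mfT F -> (forall z, 0 <= F z) ->
  plane_integral (fun z => F (1 * z.1 + t * z.2, 0 * z.1 + 1 * z.2)%R) = plane_integral F.
Proof.
move=> mF F0; pose G z := F (1 * z.1 + t * z.2, 0 * z.1 + 1 * z.2)%R.
have mG : mfT G by exact: measurableT_comp mF (measurable_affine2 _ _ _ _).
apply: (etrans (@fubini_tonelli _ _ _ _ _ mu mu G mG (fun z => F0 _))).
apply: (etrans _ (esym (@fubini_tonelli _ _ _ _ _ mu mu F mF F0))).
apply: eq_integral => y _.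
under eq_integral do rewrite /G/= !mul1r mul0r add0r.
apply: (@integral_translation (fun x => F (x, y))) => //.
exact: meas_sec2.
Qed.

Lemma shear2 (F : R * R -> \bar R) (t : R) : mfT F -> (forall z, 0 <= F z) ->
  plane_integral (fun z => F (1 * z.1 + 0 * z.2, t * z.1 + 1 * z.2)%R) = plane_integral F.
Proof.
move=> mF F0; apply: eq_integral => x _.
under eq_integral do rewrite /= !mul1r mul0r addr0 addrC.
apply: (@integral_translation (fun y => F (x, y))) => //.
exact: meas_sec1.
Qed.

Lemma plane_rotation (F : R * R -> \bar R) (c d : R) : mfT F -> (forall z, 0 <= F z) ->
  (c ^+ 2 + d ^+ 2 = 1)%R -> d != 0%R ->
  plane_integral (fun z => F (c * z.1 + d * z.2, - d * z.1 + c * z.2)%R) = plane_integral F.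
Proof.
(* The rotation factors into a shear by [t], a transversal shear by [- d] and again a shear by [t],
   where [t] is the tangent of the half angle. *)
move=> mF F0 cd d0; pose t := ((1 - c) / d)%R.
pose F1 (z : R * R) := F (1 * z.1 + t * z.2, 0 * z.1 + 1 * z.2)%R.
pose F2 (z : R * R) := F1 (1 * z.1 + 0 * z.2, - d * z.1 + 1 * z.2)%R.
have mF1 : mfT F1 by exact: measurableT_comp mF (measurable_affine2 _ _ _ _).
have mF2 : mfT F2 by exact: measurableT_comp mF1 (measurable_affine2 _ _ _ _).
have F20 z : 0 <= F2 z by exact: F0.
transitivity (plane_integral F1); last exact: shear1.
transitivity (plane_integral F2); last by apply: shear2 => // z; exact: F0.
transitivity (plane_integral (fun z : R * R => F2 (1 * z.1 + t * z.2, 0 * z.1 + 1 * z.2)%R)); last exact: shear1.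
congr plane_integral; apply/funext => z; rewrite /F2 /F1 /=; congr (F (_, _)).
  have -> : c = (1 - t * d)%R by rewrite /t divfK// subKr.
  have : (t * (2 - t * d) = d)%R.
    have -> : (2 - t * d = 1 + c)%R by rewrite /t divfK//; ring.
    rewrite /t mulrAC (_ : (1 - c) * (1 + c) = d ^+ 2)%R; last by rewrite -subr_sqr expr1n -cd; ring.
    by rewrite expr2 mulfK.
  move=> td; have -> : (d * z.2 = t * (2 - t * d) * z.2)%R by rewrite td.
  ring.
have -> : c = (1 - t * d)%R by rewrite /t divfK// subKr.
ring.
Qed.

End LebesguePlane.

Section NormalLaw.
Context {R : realType}.
Variable s : R.
Hypothesis s0 : 0 < s.
Local Notation mu := (@lebesgue_measure R).
Local Notation gam := (normal_prob 0 s).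

Let sn0 : s != 0. Proof. by rewrite gt_eqF. Qed.

Lemma ge0_integral_normal (f : R -> \bar R) : mfT f -> (forall x, 0 <= f x)%E ->
  (\int[gam]_x f x = \int[mu]_x (f x * (normal_pdf 0 s x)%:E))%E.
Proof.
move=> mf f0; apply: ge0_integral_density => //.
- exact: measurable_normal_pdf.
- by move=> x; exact: normal_pdf_ge0.
Qed.

(* A rotation is a product of three shears, each of which preserves Lebesgue
   measure by translation invariance. *)
Lemma normal_rotation (F : R * R -> \bar R) (c d : R) : mfT F ->
  (forall z, 0 <= F z)%E -> c ^+ 2 + d ^+ 2 = 1 -> d != 0 ->
  (\int[gam]_x \int[gam]_y F (c * x + d * y, - d * x + c * y)%R =
   \int[gam]_x \int[gam]_y F (x, y))%E.
Proof.
move=> mF F0 cd d0.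
(* The product of the two densities depends only on [z.1 ^+ 2 + z.2 ^+ 2], which rotations
   preserve. *)
have expand (G : R * R -> \bar R) : mfT G -> (forall z, 0 <= G z)%E ->
    (\int[gam]_x \int[gam]_y G (x, y) =
     plane_integral (fun z => G z * (normal_peak s ^+ 2 * expR (- (z.1 ^+ 2 + z.2 ^+ 2) / (s ^+ 2 *+ 2)))%:E))%E.
  move=> mG G0.
  rewrite ge0_integral_normal; last 2 first.
  - exact: (measurable_fun_fubini_tonelli_F (m2 := gam) G).
  - by move=> x; apply: integral_ge0.
  apply: eq_integral => x _.
  rewrite ge0_integral_normal//; last exact: meas_sec1.
  rewrite muleC -ge0_integralZl//; last 3 first.
  - apply: emeasurable_funM; first exact: meas_sec1.
    by apply/measurable_EFinP; exact: measurable_normal_pdf.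
  - by move=> y _; rewrite mule_ge0// lee_fin normal_pdf_ge0.
  - by rewrite lee_fin normal_pdf_ge0.
  apply: eq_integral => y _; rewrite muleCA -EFinM !normal_pdfE//; congr (_ * _%:E)%E.
  rewrite /normal_fun !subr0 mulrACA -expr2 -expRD; congr (_ * expR _).
  by rewrite -mulrDl opprD.
rewrite expand//.
rewrite -(@plane_rotation _ _ c d)//.
- have mG : mfT (fun z : R * R => F (c * z.1 + d * z.2, - d * z.1 + c * z.2)%R).
    exact: measurableT_comp mF (measurable_affine2 _ _ _ _).
  apply: (etrans (expand _ mG (fun z => F0 _))).
  congr plane_integral; apply/funext => z.
  have -> // : z.1 ^+ 2 + z.2 ^+ 2 = (c * z.1 + d * z.2) ^+ 2 + (- d * z.1 + c * z.2) ^+ 2.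
  transitivity ((c ^+ 2 + d ^+ 2) * (z.1 ^+ 2 + z.2 ^+ 2)); last by ring.
  by rewrite cd mul1r.
- apply: emeasurable_funM => //; apply/measurable_EFinP; apply: measurable_funM => //.
  apply: measurableT_comp => //; apply: measurable_funM => //; apply: measurableT_comp => //.
  by apply: measurable_funD; apply: measurable_funX; [exact: measurable_fst|exact: measurable_snd].
- by move=> z; rewrite mule_ge0// lee_fin mulr_ge0 ?expR_ge0// sqr_ge0.
Qed.


End NormalLaw.

Section NormalMoments.
Context {R : realType} {disp : measure_display} {O : measurableType disp}.
Variables (P : probability O R) (s : R) (xi : O -> R).
Hypotheses (s0 : 0 < s) (mxi : mfT xi)
 (lxi : forall B : set R, measurable B -> P (xi @^-1` B) = normal_prob 0 s B).
Local Notation mu := (@lebesgue_measure R).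

Let sn0 : s != 0. Proof. by rewrite gt_eqF. Qed.

Lemma ge0_integral_normal_rv (f : R -> \bar R) : mfT f -> (forall x, 0 <= f x)%E ->
  (\int[P]_w f (xi w) = \int[mu]_x (f x * (normal_pdf 0 s x)%:E))%E.
Proof.
move=> mf f0; rewrite -ge0_integral_normal//.
have mxi' : @measurable_fun _ _ O (measurableTypeR R) setT xi by exact: mxi.
pose X : {RV P >-> measurableTypeR R} := @mfun_Sub _ _ O (measurableTypeR R) xi (mem_set mxi').
have mf' : @measurable_fun _ _ (measurableTypeR R) _ setT f by exact: mf.
rewrite -[LHS](ge0_integral_distribution X mf' f0).
by apply: eq_measure_integral => A mA _; exact: (lxi mA).
Qed.

(** The weight turns the density with deviation [s] into [l] times the density with deviation
    [l * s]. The second and fourth moments are drawn from this family of identities. *)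
Lemma normal_exp_moment (l : R) : 0 < l ->
  (\int[P]_w (expR ((1 - l ^- 2) / (s ^+ 2 *+ 2) * xi w ^+ 2))%:E = l%:E)%E.
Proof.
move=> l0; have ln0 : l != 0 by rewrite gt_eqF.
rewrite (ge0_integral_normal_rv (f := fun x => (expR ((1 - l ^- 2) / (s ^+ 2 *+ 2) * x ^+ 2))%:E)); last 2 first.
- apply/measurable_EFinP; apply: measurableT_comp => //; apply: measurable_funM => //.
- by move=> x; rewrite lee_fin expR_ge0.
have peak : normal_peak s = l * normal_peak (l * s).
  rewrite /normal_peak (_ : (l * s) ^+ 2 * pi *+ 2 = l ^+ 2 * (s ^+ 2 * pi *+ 2)); last by ring.
  by rewrite sqrtrM ?sqr_ge0// sqrtr_sqr gtr0_norm// invfM mulrA divff// mul1r.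
transitivity (\int[mu]_x (l%:E * (normal_pdf 0 (l * s) x)%:E))%E.
  apply: eq_integral => x _; rewrite -!EFinM !normal_pdfE ?mulf_neq0//; congr (_%:E).
  have -> : normal_fun 0 (l * s) x = expR ((1 - l ^- 2) / (s ^+ 2 *+ 2) * x ^+ 2) * normal_fun 0 s x.
    rewrite /normal_fun !subr0 -expRD; congr expR.
    by field; rewrite sn0 ln0.
  by rewrite peak; ring.
rewrite ge0_integralZl_EFin//.
- by rewrite integral_normal_pdf mule1.
- by move=> x _; rewrite lee_fin normal_pdf_ge0.
- by apply/measurable_EFinP; exact: measurable_normal_pdf.
- exact: ltW.
Qed.

Let Eb_exp (k l : R) : 0 < l -> k = (1 - l ^- 2) / (s ^+ 2 *+ 2) ->
  Eb P (fun w => expR (k * xi w ^+ 2)) l.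
Proof.
move=> l0 ->; split.
+ by apply: measurableT_comp => //; apply: measurable_funM => //; exact: measurable_funX.
+ by move=> x; exact: expR_ge0.
+ by rewrite normal_exp_moment.
Qed.

Lemma normal_pow4 : Eb P (fun w => xi w ^+ 4) (29 * s ^+ 4).
Proof.
(* The choice [l = 2] in [normal_exp_moment], with [1 + x^2 / 2 <= exp x], gives [256 / 9] times
   [s^4], rounded up to 29. *)
pose k := (1 - 2 ^- 2) / (s ^+ 2 *+ 2) : R.
have k0 : 0 < k by rewrite divr_gt0 ?mulrn_wgt0 ?exprn_gt0//; lra.
have kn0 : k != 0 by rewrite gt_eqF.
apply: (@Eb_weak _ _ _ _ (2 * k ^- 2 * 2)).
  have -> : 2 * k ^- 2 * 2 = (256 / 9) * s ^+ 4 by rewrite /k; field.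
  by rewrite ler_wpM2r ?exprn_ge0 ?ltW//; lra.
apply: (@Eb_le _ _ _ _ (fun w => 2 * k ^- 2 * expR (k * xi w ^+ 2))).
- exact: measurable_funX.
- by move=> w; rewrite (exprM _ 2 2) sqr_ge0.
- move=> w; have kx0 : 0 <= k * xi w ^+ 2 by rewrite mulr_ge0 ?sqr_ge0// ltW.
  have := expR_ge1Dxn 1 kx0; rewrite (_ : 2`! = 2)%N// => H.
  have -> : xi w ^+ 4 = 2 * k ^- 2 * ((k * xi w ^+ 2) ^+ 2 / 2) by field.
  rewrite ler_wpM2l//; first by rewrite mulr_ge0// invr_ge0 exprn_ge0// ltW.
  by lra.
- apply: Eb_scale; first by rewrite mulr_ge0// invr_ge0 exprn_ge0// ltW.
  exact: Eb_exp.
Qed.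

Lemma normal_sqr_summable : summable P (fun w => xi w ^+ 2).
Proof.
apply: (@summable_le _ _ _ _ _ (fun w => 1 + xi w ^+ 4)).
- exact: measurable_funX.
- move=> w; rewrite ger0_norm ?sqr_ge0//.
  by have := sqr_ge0 (xi w ^+ 2 - 1); rewrite (exprM _ 2 2) sqrrB; have := sqr_ge0 (xi w); lra.
- by apply: Eb_summable (Eb_add (Eb_cst P ler01) normal_pow4).
Qed.

(** From [1 + x <= exp x] at [x = k xi^2]: as [k] has the sign of [l - 1], the second moment is
    bounded above for [l > 1] and below for [l < 1]. *)
Lemma normal_sqr_bounds (l : R) : 0 < l -> l != 1 ->
  if 1 < l then Ex P (fun w => xi w ^+ 2) <= s ^+ 2 * (2 * l ^+ 2 / (l + 1))
  else s ^+ 2 * (2 * l ^+ 2 / (l + 1)) <= Ex P (fun w => xi w ^+ 2).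
Proof.
move=> l0 l1; have ln0 : l != 0 by rewrite gt_eqF.
pose k := (1 - l ^- 2) / (s ^+ 2 *+ 2) : R.
have sE := Eb_summable (@Eb_exp k l l0 erefl).
have EE : Ex P (fun w => expR (k * xi w ^+ 2)) = l.
  by rewrite /Ex /Rintegral normal_exp_moment.
have s1 : summable P (fun=> 1) by exact: Eb_summable (Eb_cst P ler01).
have s2 := normal_sqr_summable.
have H : 1 + k * Ex P (fun w => xi w ^+ 2) <= l.
  rewrite -EE -(Ex_cst P 1) -ExZ// -ExD//; last exact: summableZ.
  apply: Ex_le => //; last by move=> x; exact: expR_ge1Dx.
  by apply: summableD => //; exact: summableZ.
have l1' : l + 1 != 0 by rewrite gt_eqF// addr_gt0.
have lm1 : l - 1 != 0 by rewrite subr_eq0.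
have kE : (l - 1) / k = s ^+ 2 * (2 * l ^+ 2 / (l + 1)).
  rewrite /k; field; rewrite sn0 ln0 l1' /=.
  by rewrite -[X in _ - X](expr1n _ 2) subr_sqr mulf_neq0.
case: ifPn => l1lt.
  have k0 : 0 < k.
    rewrite divr_gt0 ?mulrn_wgt0 ?exprn_gt0// subr_gt0 -exprVn exprn_ilt1 ?invr_ge0 ?ltW//.
    by rewrite invf_lt1.
  by rewrite -kE ler_pdivlMr// mulrC; lra.
have k0 : k < 0.
  have ll : l < 1 by rewrite lt_neqAle l1 leNgt.
  rewrite /k pmulr_llt0 ?invr_gt0 ?mulrn_wgt0 ?exprn_gt0// subr_lt0 -exprVn exprn_egt1//.
  by rewrite invf_gt1.
by rewrite -kE ler_ndivrMr// mulrC; lra.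
Qed.

(** The upper and the lower bound both tend to [s^2] as [l] tends to 1. *)
Lemma normal_sqr : Ex P (fun w => xi w ^+ 2) = s ^+ 2.
Proof.
pose g (l : R) := s ^+ 2 * (2 * l ^+ 2 / (l + 1)).
have g1 : g 1 = s ^+ 2 by rewrite /g expr1n; field.
have cg : g @ (1 : R) --> g 1.
  apply: cvgM; first exact: cvg_cst.
  apply: cvgM.
    by apply: cvgM; [exact: cvg_cst|exact: exprn_continuous].
  apply: cvgV; first by rewrite (_ : 1 + 1 = 2 :> R) ?pnatr_eq0//; lra.
  by apply: cvgD; [exact: cvg_id|exact: cvg_cst].
(* The shift [n.+2] keeps [1 - 1 / (n + 2)] positive. *)
have h0 : (fun n => n.+2%:R^-1 : R) @ \oo --> (0 : R).
  have := @cvg_harmonic R; rewrite -(cvg_shiftS (fun n => n.+1%:R^-1 : R)).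
  exact.
have cp : (fun n => 1 + n.+2%:R^-1 : R) @ \oo --> (1 : R).
  by rewrite -[X in _ --> X]addr0; apply: cvgD; [exact: cvg_cst|exact: h0].
have cm : (fun n => 1 - n.+2%:R^-1 : R) @ \oo --> (1 : R).
  by rewrite -[X in _ --> X]subr0; apply: cvgB; [exact: cvg_cst|exact: h0].
have n2 n : 0 < n.+2%:R^-1 :> R by rewrite invr_gt0.
have n21 n : n.+2%:R^-1 < 1 :> R by rewrite invf_lt1// ltr1n.
apply/eqP; rewrite eq_le; apply/andP; split.
  rewrite -g1; apply: (@cvg_cst_le _ (fun n => g (1 + n.+2%:R^-1))).
    apply: (@cvg_comp _ _ _ (fun n => 1 + n.+2%:R^-1 : R) g _ (nbhs (1 : R))) => //.
  move=> n; have := @normal_sqr_bounds (1 + n.+2%:R^-1).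
  by rewrite ltrDl n2; apply; [rewrite addr_gt0|rewrite gt_eqF// ltrDl].
rewrite -g1; apply: (@cvg_le_cst _ (fun n => g (1 - n.+2%:R^-1))).
  apply: (@cvg_comp _ _ _ (fun n => 1 - n.+2%:R^-1 : R) g _ (nbhs (1 : R))) => //.
move=> n; have := @normal_sqr_bounds (1 - n.+2%:R^-1).
rewrite (_ : (1 < 1 - n.+2%:R^-1) = false); last by apply/negbTE; rewrite -leNgt gerBl ltW.
apply; first by rewrite subr_gt0.
by rewrite lt_eqF// gtrBl.
Qed.

Lemma normal_sqrE : Eb P (fun w => xi w ^+ 2) (s ^+ 2).
Proof.
apply: EbI; [exact: normal_sqr_summable|by move=> w; exact: sqr_ge0|].
by rewrite normal_sqr.
Qed.

Lemma normal_summable : summable P xi.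
Proof. exact: summable_sqr_abs normal_sqrE. Qed.

(** The density is even, so reflection exchanges the integrals of the positive and negative
    parts. *)
Lemma normal_mean : Ex P xi = 0.
Proof.
have pdfN x : normal_pdf 0 s (- x) = normal_pdf 0 s x.
  by rewrite !normal_pdfE// /normal_fun !subr0 sqrrN.
pose p (x : R) := (`|x| + x) / 2; pose q (x : R) := (`|x| - x) / 2.
have p0 x : 0 <= p x by rewrite /p; have := ler_norm (- x); rewrite normrN; lra.
have q0 x : 0 <= q x by rewrite /q; have := ler_norm x; lra.
have mp : mfT p.
  by apply: measurable_funM => //; apply: measurable_funD => //; exact: measurableT_comp.
have mq : mfT q.
  by apply: measurable_funM => //; apply: measurable_funB => //; exact: measurableT_comp.
have E : (\int[P]_w (p (xi w))%:E = \int[P]_w (q (xi w))%:E)%E.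
  rewrite (ge0_integral_normal_rv (f := fun x => (p x)%:E)) ?(ge0_integral_normal_rv (f := fun x => (q x)%:E))//;
    try exact/measurable_EFinP.
  rewrite -(integral_reflection (F := fun x => ((q x)%:E * (normal_pdf 0 s x)%:E)%E)).
  - by apply: eq_integral => x _; rewrite /p /q pdfN normrN opprK.
  - apply: emeasurable_funM; first exact/measurable_EFinP.
    by apply/measurable_EFinP; exact: measurable_normal_pdf.
  - by move=> x; rewrite mule_ge0// lee_fin// normal_pdf_ge0.
have ps : summable P (p \o xi).
  apply: summable_le (integrable_norm normal_summable) => [|w]; first exact: measurableT_comp.
  by rewrite ger0_norm//= /p; have := ler_norm (xi w); lra.
have qs : summable P (q \o xi).
  apply: summable_le (integrable_norm normal_summable) => [|w]; first exact: measurableT_comp.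
  by rewrite ger0_norm//= /q; have := ler_norm (- xi w); rewrite normrN; lra.
rewrite (_ : xi = (fun w => (p \o xi) w - (q \o xi) w)); last by apply/funext => w; rewrite /= /p /q; lra.
by rewrite Ex_sub// /Ex /Rintegral/= E subrr.
Qed.

End NormalMoments.

(** * Brownian increments *)

Section IndepOf.
Context {R : realType} {disp : measure_display} {O : measurableType disp}.
Variable P : probability O R.

Lemma indep_of_cst G (c : R) : G `<=` measurable -> indep_of P G (fun=> c).
Proof.
move=> Gm B E mB GE; have [cB|cB] := pselect (B c).
  rewrite (_ : _ @^-1` B = setT) ?setTI ?probability_setT ?mul1e//.
  by apply/seteqP; split.
rewrite (_ : _ @^-1` B = set0) ?set0I ?measure0 ?mul0e//.
by apply/seteqP; split.
Qed.

Lemma indep_of_families (S G : set (set O)) Y : sigma_algebra setT S ->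
  smeas S Y -> indep_families P S G -> indep_of P G Y.
Proof. by move=> sS mY SG B E mB GE; apply: SG => //; exact: smeas_set. Qed.

End IndepOf.

Section BrownianIncrements.
Context {R : realType} {disp : measure_display} {O : measurableType disp}.
Variables (P : probability O R) (T : R) (F : R -> set (set O)) (m : nat).
Variable W : R -> O -> 'cV[R]_m.
Hypotheses (hF : filtration T F) (hW : brownian_motion P T F W).

Definition incr (s t : R) (i : 'I_m) (w : O) : R := W t w i 0 - W s w i 0.
(** The compensator [t - s] on the diagonal makes these centred: they are the second-order
    martingale increments of the expansion. *)
Definition qincr (s t : R) (i j : 'I_m) (w : O) : R :=
  incr s t i w * incr s t j w - (i == j)%:R * (t - s).

Lemma filt_sigma t : 0 <= t -> t <= T -> sigma_algebra setT (F t).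
Proof. by move=> t0 tT; case: hF => H _; apply: H; rewrite in_itv/= t0. Qed.

Lemma filt_meas t : 0 <= t -> t <= T -> F t `<=` measurable.
Proof. by move=> t0 tT; case: hF => _ [H _]; apply: H; rewrite in_itv/= t0. Qed.

Lemma filt_mono s t : 0 <= s -> s <= t -> t <= T -> F s `<=` F t.
Proof. by case: hF => _ [_]; apply. Qed.

Lemma smeas_W s t i : 0 <= s -> s <= t -> t <= T -> smeas (F t) (fun w => W s w i 0).
Proof.
move=> s0 st tT; have sT := le_trans st tT.
apply: (smeasS (filt_mono s0 st tT)).
apply/(smeasP _ (filt_sigma s0 sT)); case: hW => H _; apply: H; by rewrite in_itv/= s0.
Qed.

Lemma smeas_incr s t i : 0 <= s -> s <= t -> t <= T -> smeas (F t) (incr s t i).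
Proof.
move=> s0 st tT; apply: smeasB; last exact: smeas_W.
by apply: smeas_W => //; exact: le_trans st.
Qed.

Lemma smeas_qincr s t i j : 0 <= s -> s <= t -> t <= T -> smeas (F t) (qincr s t i j).
Proof.
by move=> *; apply: smeasB; [apply: smeasM; exact: smeas_incr|exact: smeas_cst].
Qed.

Lemma meas_incr s t i : 0 <= s -> s <= t -> t <= T -> mfT (incr s t i).
Proof.
move=> s0 st tT; exact: smeas_meas (filt_meas (le_trans s0 st) tT) (smeas_incr i s0 st tT).
Qed.

Lemma incr_box s t (B : 'I_m -> set R) : 0 <= s -> s < t -> t <= T ->
  (forall i, measurable (B i)) ->
  P [set w | forall i, B i (incr s t i w)] = (\prod_(i < m) normal_prob 0%R (Num.sqrt (t - s)%R) (B i))%E.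
Proof.
move=> s0 st tT mB; have [_ [_ [_ [H _]]]] := hW.
rewrite -(H s t s0 st tT B mB); congr (P _).
by apply/seteqP; split => w /= H' i; have := H' i; rewrite /incr !mxE.
Qed.

Lemma incr_law s t i (B : set R) : 0 <= s -> s < t -> t <= T -> measurable B ->
  P (incr s t i @^-1` B) = normal_prob 0 (Num.sqrt (t - s)) B.
Proof.
move=> s0 st tT mB; pose B' j := if j == i then B else setT.
have := @incr_box s t B' s0 st tT; rewrite (bigD1 i)//= big1 ?mule1; last first.
  by move=> j ji; rewrite /B' (negbTE ji) probability_setT.
rewrite /B' eqxx => <-; last by move=> j; case: ifP.
congr (P _); apply/seteqP; split => w /=.
  by move=> Bw j; case: eqP => // ->.
by move=> /(_ i); rewrite eqxx.
Qed.

Lemma incr_law2 s t i j (B C : set R) : i != j -> 0 <= s -> s < t -> t <= T ->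
  measurable B -> measurable C ->
  P (incr s t i @^-1` B `&` incr s t j @^-1` C) =
  (normal_prob 0 (Num.sqrt (t - s)) B * normal_prob 0 (Num.sqrt (t - s)) C)%E.
Proof.
move=> ij s0 st tT mB mC; pose B' k := if k == i then B else if k == j then C else setT.
have := @incr_box s t B' s0 st tT; rewrite (bigD1 i)//= (bigD1 j)/=; last by rewrite eq_sym.
rewrite big1 ?mule1; last first.
  by move=> k /andP[ki kj]; rewrite /B' (negbTE ki) (negbTE kj) probability_setT.
rewrite /B' eqxx eq_sym (negbTE ij) eqxx => <-; last by move=> k; case: ifP => // _; case: ifP.
congr (P _); apply/seteqP; split => w /=.
  by move=> [Bw Cw] k; case: eqP => [->//|_]; case: eqP => [->|].
move=> H; split; first by have := H i; rewrite eqxx.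
by have := H j; rewrite eq_sym (negbTE ij) eqxx.
Qed.

Lemma incr_indep_comp s t i j : i != j -> 0 <= s -> s < t -> t <= T ->
  indep_rv P (incr s t i) (incr s t j).
Proof.
move=> ij s0 st tT B C mB mC; have -> := incr_law2 ij s0 st tT mB mC.
by have -> := incr_law i s0 st tT mB; have -> := incr_law j s0 st tT mC.
Qed.

Lemma incr_self s i w : incr s s i w = 0.
Proof. by rewrite /incr subrr. Qed.

Let sq (s t : R) : s < t -> 0 < Num.sqrt (t - s). Proof. by rewrite sqrtr_gt0 subr_gt0. Qed.

(** [brownian_motion] speaks of [s < t] only, where the deviation is positive; the case [s = t] is
    treated apart, here and in the lemmas below. *)
Lemma incr_mean s t i : 0 <= s -> s <= t -> t <= T -> Ex P (incr s t i) = 0.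
Proof.
move=> s0; rewrite le_eqVlt => /predU1P[<- _|st tT].
  by rewrite (_ : incr s s i = fun=> 0) ?Ex_cst//; apply/funext => w; exact: incr_self.
apply: (@normal_mean _ _ _ P (Num.sqrt (t - s))) => //.
- exact: sq.
- exact: meas_incr (ltW st) tT.
- by move=> B mB; exact: incr_law.
Qed.

Lemma incr_sqr s t i : 0 <= s -> s <= t -> t <= T -> Eb P (fun w => incr s t i w ^+ 2) (t - s).
Proof.
move=> s0; rewrite le_eqVlt => /predU1P[<- _|st tT].
  apply: (@Eb_ext _ _ _ _ (fun=> 0)); first by move=> w; rewrite incr_self expr0n.
  by rewrite subrr; exact: Eb_cst.
rewrite -[X in Eb _ _ X](@sqr_sqrtr _ (t - s)) ?subr_ge0 ?(ltW st)//.
apply: normal_sqrE => //; [exact: sq|exact: meas_incr (ltW st) tT|].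
by move=> B mB; exact: incr_law.
Qed.

Lemma Ex_incr_sqr s t i : 0 <= s -> s <= t -> t <= T -> Ex P (fun w => incr s t i w ^+ 2) = t - s.
Proof.
move=> s0; rewrite le_eqVlt => /predU1P[<- _|st tT].
  rewrite (_ : (fun w => _) = fun=> 0) ?Ex_cst ?subrr//.
  by apply/funext => w; rewrite incr_self expr0n.
rewrite -[RHS](@sqr_sqrtr _ (t - s)) ?subr_ge0 ?(ltW st)//.
apply: normal_sqr => //; [exact: sq|exact: meas_incr (ltW st) tT|].
by move=> B mB; exact: incr_law.
Qed.

Lemma incr_pow4 s t i : 0 <= s -> s <= t -> t <= T ->
  Eb P (fun w => incr s t i w ^+ 4) (29 * (t - s) ^+ 2).
Proof.
move=> s0; rewrite le_eqVlt => /predU1P[<- _|st tT].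
  apply: (@Eb_ext _ _ _ _ (fun=> 0)); first by move=> w; rewrite incr_self expr0n.
  by rewrite subrr expr0n mulr0; exact: Eb_cst.
rewrite -[X in X ^+ 2](@sqr_sqrtr _ (t - s)) ?subr_ge0 ?(ltW st)// -exprM.
apply: normal_pow4 => //; [exact: sq|exact: meas_incr (ltW st) tT|].
by move=> B mB; exact: incr_law.
Qed.

Lemma incr_summable s t i : 0 <= s -> s <= t -> t <= T -> summable P (incr s t i).
Proof. by move=> s0 st tT; exact: summable_sqr_abs (meas_incr i s0 st tT) (incr_sqr i s0 st tT). Qed.

Lemma qincr_mean s t i j : 0 <= s -> s <= t -> t <= T -> Ex P (qincr s t i j) = 0.
Proof.
move=> s0 st tT.
have sp : summable P (fun w => incr s t i w * incr s t j w).
  exact: summable_mul_sqr (meas_incr i s0 st tT) (meas_incr j s0 st tT) (incr_sqr i s0 st tT) (incr_sqr j s0 st tT).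
rewrite /qincr Ex_sub//; last by apply: summable_bounded => // w; exact: lexx.
rewrite Ex_cst; case: eqVneq => [->|ij].
  rewrite mul1r (_ : (fun w => _) = (fun w => incr s t j w ^+ 2)).
    by rewrite Ex_incr_sqr// subrr.
  by apply/funext => w; rewrite expr2.
rewrite mul0r subr0; have := st; rewrite le_eqVlt => /predU1P[sE|slt].
  rewrite sE (_ : (fun w => _) = fun=> 0) ?Ex_cst//.
  by apply/funext => w; rewrite incr_self mul0r.
have [_ ->//] := indep_Ex_mul0 (incr_summable i s0 st tT) (incr_summable j s0 st tT)
   (incr_indep_comp ij s0 slt tT) (incr_mean j s0 st tT).
Qed.

(** [60 = 29 + 29 + 2], from [(a b - c)^2 <= a^4 + b^4 + 2 c^2] and the fourth moments of the two
    increments. *)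
Lemma qincr_sqr s t i j : 0 <= s -> s <= t -> t <= T ->
  Eb P (fun w => qincr s t i j w ^+ 2) (60 * (t - s) ^+ 2).
Proof.
move=> s0 st tT.
apply: (@Eb_le _ _ _ _ (fun w => incr s t i w ^+ 4 + incr s t j w ^+ 4 + 2 * (t - s) ^+ 2)).
- apply: measurable_funX; apply: measurable_funB => //.
  by apply: measurable_funM; exact: meas_incr.
- by move=> w; exact: sqr_ge0.
- move=> w; rewrite /qincr; set a := incr s t i w; set b := incr s t j w.
  set c := (i == j)%:R * (t - s).
  have H1 := sqr_ge0 (a ^+ 2 - b ^+ 2).
  have H2 := sqr_ge0 (a * b + c).
  have H3 : c ^+ 2 <= (t - s) ^+ 2.
    by rewrite exprMn; case: (i == j); rewrite ?expr1n ?mul1r// expr0n mul0r sqr_ge0.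
  rewrite -subr_ge0 (_ : _ - _ = (a ^+ 2 - b ^+ 2) ^+ 2 + (a * b + c) ^+ 2 + 2 * ((t - s) ^+ 2 - c ^+ 2)); last by ring.
  by rewrite addr_ge0 ?addr_ge0// mulr_ge0// subr_ge0.
- have -> : 60 * (t - s) ^+ 2 = 29 * (t - s) ^+ 2 + 29 * (t - s) ^+ 2 + 2 * (t - s) ^+ 2 by ring.
  apply: Eb_add; last by apply: Eb_cst; rewrite mulr_ge0// sqr_ge0.
  by apply: Eb_add; exact: incr_pow4.
Qed.

Let S s t := sigma_of setT (fun (i : 'I_m) w => (W t w - W s w) i 0).

Let sS s t : sigma_algebra setT (S s t).
Proof. exact: smallest_sigma_algebra. Qed.

Let smS s t i : smeas (S s t) (incr s t i).
Proof.
apply/(smeasP _ (sS s t)) => B mB; apply: sub_sigma_algebra; exists i; split => //.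
by exists B => //; apply/seteqP; split => w; rewrite /preimage/= /incr !mxE.
Qed.

Lemma incr_indep s t i : 0 <= s -> s <= t -> t <= T -> indep_of P (F s) (incr s t i).
Proof.
move=> s0 st tT; have sT := le_trans st tT.
move: st; rewrite le_eqVlt => /predU1P[<-|st].
  by rewrite (_ : incr s s i = fun=> 0); [exact/indep_of_cst/filt_meas|apply/funext => w; exact: incr_self].
apply: (indep_of_families (sS s t) (smS s t i)).
by have [_ [_ [_ [_ H]]]] := hW; exact: H.
Qed.

Lemma qincr_indep s t i j : 0 <= s -> s <= t -> t <= T -> indep_of P (F s) (qincr s t i j).
Proof.
move=> s0 st tT; have sT := le_trans st tT.
move: st; rewrite le_eqVlt => /predU1P[<-|st].
  rewrite (_ : qincr s s i j = fun=> 0); first exact/indep_of_cst/filt_meas.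
  by apply/funext => w; rewrite /qincr !incr_self subrr !mulr0 subrr.
apply: (indep_of_families (sS s t)).
  apply: smeasB; last exact: smeas_cst.
  by apply: smeasM; exact: smS.
by have [_ [_ [_ [_ H]]]] := hW; exact: H.
Qed.

End BrownianIncrements.

(** * Bounds in mean *)

Section UpperBounds.
Context {R : realType} {disp : measure_display} {O : measurableType disp}.
Variable P : probability O R.
Implicit Types (f g : O -> R) (v : R).

(* The mean of [|f|] is at most [v], without requiring [f] to be measurable. *)
Definition Ub f v : Prop := exists2 g, (forall w, `|f w| <= g w) & Eb P g v.

Lemma Ub_Eb f v : Eb P f v -> Ub f v.
Proof. by move=> fv; exists f => // w; case: fv => _ f0 _; rewrite ger0_norm. Qed.

Lemma Ub_le g f v : (forall w, `|f w| <= g w) -> Ub g v -> Ub f v.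
Proof.
move=> fg [k gk kv]; exists k => // w; apply: le_trans (fg w) _.
exact: le_trans (ler_norm _) (gk w).
Qed.

Lemma Ub_weak v v' f : v <= v' -> Ub f v -> Ub f v'.
Proof. by move=> vv' [g fg gv]; exists g => //; exact: Eb_weak gv. Qed.

Lemma Ub_ge0 f v : Ub f v -> 0 <= v.
Proof. by move=> [g _ /Eb_ge0]. Qed.

Lemma Ub_add f g v v' : Ub f v -> Ub g v' -> Ub (fun w => f w + g w) (v + v').
Proof.
move=> [k fk kv] [k' gk kv']; exists (fun w => k w + k' w); last exact: Eb_add.
by move=> w; rewrite (le_trans (ler_normD _ _))// lerD.
Qed.

Lemma Ub_scale (c : R) f v : Ub f v -> Ub (fun w => c * f w) (`|c| * v).
Proof.
move=> [k fk kv]; exists (fun w => `|c| * k w); last exact: Eb_scale.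
by move=> w; rewrite normrM ler_wpM2l.
Qed.

Lemma Ub_pscale (c : R) f v : 0 <= c -> Ub f v -> Ub (fun w => c * f w) (c * v).
Proof. by move=> c0 /(Ub_scale c); rewrite ger0_norm. Qed.

Lemma Ub_cst (c : R) : 0 <= c -> Ub (fun=> c) c.
Proof. by move=> c0; apply: Ub_Eb; exact: Eb_cst. Qed.

Lemma Ub_sum (I : Type) (s : seq I) (Q : pred I) (f : I -> O -> R) (v : I -> R) :
  (forall i, Q i -> Ub (f i) (v i)) ->
  Ub (fun w => \sum_(i <- s | Q i) f i w) (\sum_(i <- s | Q i) v i).
Proof.
move=> fv; elim: s => [|i s IH].
  by rewrite big_nil (_ : (fun _ => _) = fun=> 0); [exact: Ub_cst|apply/funext => w; rewrite big_nil].
rewrite big_cons (_ : (fun _ => _) = (fun w => (if Q i then f i w + \sum_(i <- s | Q i) f i w else \sum_(i <- s | Q i) f i w))).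
  by case: ifPn => // Qi; apply: Ub_add => //; exact: fv.
by apply/funext => w; rewrite big_cons.
Qed.

Lemma Ub_sum_const (N : nat) (f : nat -> O -> R) v k : (k <= N)%N -> 0 <= v ->
  (forall i, (i < k)%N -> Ub (f i) v) -> Ub (fun w => \sum_(i < k) f i w) (N%:R * v).
Proof.
move=> kN v0 fv; apply: (@Ub_weak (\sum_(i < k) v)).
  by rewrite sumr_const card_ord -[leLHS]mulr_natl ler_wpM2r// ler_nat.
by apply: Ub_sum => i _; exact: fv.
Qed.

Lemma Ub_abs f v : Ub f v -> Ub (fun w => `|f w|) v.
Proof. by move=> [g fg gv]; exists g => // w; rewrite normr_id. Qed.

Lemma Ub_ext f g v : f =1 g -> Ub f v -> Ub g v.
Proof. by move=> /funext ->. Qed.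

(** Young's inequality with parameter [s] turns a mean-square bound into a bound in mean of the size
    of its root. *)
Lemma Ub_sqr f v (s : R) : 0 < s -> v <= s ^+ 2 -> Ub (fun w => f w ^+ 2) v -> Ub f s.
Proof.
move=> s0 vs H; have v0 := Ub_ge0 H; case: H => g fg gv; exists (fun w => 2^-1 * (s + s^-1 * g w)).
  move=> w; have := fg w; rewrite ger0_norm ?sqr_ge0// -(real_normK (num_real (f w))).
  set a := `|_| => ag; apply: (@le_trans _ _ (2^-1 * (s + s^-1 * a ^+ 2))); last first.
    by rewrite ler_pM2l// lerD2l ler_pM2l// invr_gt0.
  have : 0 <= s^-1 * (s - a) ^+ 2 by rewrite mulr_ge0 ?sqr_ge0// invr_ge0 ltW.
  rewrite (_ : s^-1 * (s - a) ^+ 2 = s + s^-1 * a ^+ 2 - 2 * a); last by field; rewrite gt_eqF.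
  lra.
apply: (@Eb_weak _ _ _ _ (2^-1 * (s + s^-1 * v))).
  have : s^-1 * v <= s by rewrite mulrC ler_pdivrMr// -expr2.
  lra.
apply: Eb_scale; first by rewrite invr_ge0.
by apply: Eb_add; [apply: Eb_cst; exact: ltW|apply: Eb_scale => //; rewrite invr_ge0 ltW].
Qed.

(** The weight [s] is left free, to balance two factors of different orders. *)
Lemma Ub_mul f g v v' (s : R) : 0 < s -> Ub (fun w => f w ^+ 2) v -> Ub (fun w => g w ^+ 2) v' ->
  Ub (fun w => f w * g w) (s * v + s^-1 * v').
Proof.
move=> s0 fv gv; apply: Ub_le (Ub_add (Ub_pscale (ltW s0) fv) (Ub_pscale _ gv)); last first.
  by rewrite invr_ge0 ltW.
move=> w; rewrite normrM -(real_normK (num_real (f w))) -(real_normK (num_real (g w))).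
have f0 := normr_ge0 (f w); have g0 := normr_ge0 (g w).
set a := `|f w| in f0 *; set b := `|g w| in g0 *.
have : 0 <= s^-1 * (s * a - b) ^+ 2 by rewrite mulr_ge0 ?sqr_ge0// invr_ge0 ltW.
rewrite (_ : s^-1 * (s * a - b) ^+ 2 = s * a ^+ 2 + s^-1 * b ^+ 2 - 2 * (a * b)); last by field; rewrite gt_eqF.
have := mulr_ge0 f0 g0; lra.
Qed.

(** A discrete Gronwall inequality in mean for a recursion that holds path by path; the induction
    bounds the accumulated sum, since bounds in mean add. *)
Lemma Ub_gronwall (N : nat) (a c : nat -> O -> R) (r lam : R) : 0 <= lam ->
  (forall k w, (k <= N)%N -> `|a k w| <= c k w + lam * \sum_(i < k) `|a i w|) ->
  (forall k, (k <= N)%N -> Ub (c k) r) ->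
  forall k, (k <= N)%N -> Ub (a k) (r * (1 + lam) ^+ k).
Proof.
move=> l0 ac cr.
have S k : (k <= N)%N -> Ub (fun w => lam * \sum_(i < k) `|a i w|) (r * ((1 + lam) ^+ k - 1)).
  elim: k => [_|k IH kN].
    rewrite expr0 subrr mulr0; apply: (@Ub_ext (fun=> 0)); last exact: Ub_cst.
    by move=> w; rewrite big_ord0 mulr0.
  have {}IH := IH (ltnW kN); have ck := cr _ (ltnW kN).
  have -> : r * ((1 + lam) ^+ k.+1 - 1) = (1 + lam) * (r * ((1 + lam) ^+ k - 1)) + lam * r.
    by rewrite exprS; ring.
  apply: Ub_le (Ub_add (Ub_pscale _ IH) (Ub_pscale l0 ck)); last by rewrite addr_ge0.
  move=> w; rewrite ger0_norm; last by rewrite mulr_ge0// sumr_ge0.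
  rewrite big_ord_recr/= mulrDr.
  have := ler_wpM2l l0 (ac _ w (ltnW kN)).
  set s := \sum_(i < k) _; set q := `|a k w|; lra.
move=> k kN; have -> : r * (1 + lam) ^+ k = r + r * ((1 + lam) ^+ k - 1) by ring.
by apply: Ub_le (Ub_add (cr _ kN) (S _ kN)) => w; exact: ac.
Qed.

Lemma gronwall_exp (N k : nat) (L r : R) : 0 <= L -> 0 <= r -> (k <= N)%N -> (0 < N)%N ->
  r * (1 + L / N%:R) ^+ k <= r * expR L.
Proof.
move=> L0 r0 kN N0; have N0' : 0 < N%:R :> R by rewrite ltr0n.
rewrite ler_wpM2l//; apply: (@le_trans _ _ (expR (L / N%:R) ^+ k)).
  by rewrite lerXn2r ?nnegrE ?expR_ge0 ?addr_ge0 ?divr_ge0// expR_ge1Dx.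
rewrite -expRM_natl ler_expR mulrCA ler_piMr// ler_pdivrMr// mul1r ler_nat//.
Qed.

End UpperBounds.

Lemma cvg_sqr (R : realType) (u : nat -> R) (l : R) :
  u @ \oo --> l -> (fun n => u n ^+ 2) @ \oo --> l ^+ 2.
Proof.
move=> ul; rewrite expr2 (_ : (fun n => _) = (fun n => u n * u n)); first exact: cvgM.
by apply/funext => n; rewrite expr2.
Qed.

Lemma cvg_bigsum (R : realType) (I : Type) (r : seq I) (u : I -> nat -> R) (l : I -> R) :
  (forall i, u i @ \oo --> l i) -> (fun n => \sum_(i <- r) u i n) @ \oo --> \sum_(i <- r) l i.
Proof.
move=> ul; elim: r => [|i r IH].
  by rewrite big_nil (_ : (fun n => _) = fun=> 0); [exact: cvg_cst|apply/funext => n; rewrite big_nil].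
rewrite big_cons (_ : (fun n => _) = (fun n => u i n + \sum_(i <- r) u i n)); first exact: cvgD.
by apply/funext => n; rewrite big_cons.
Qed.

(** * Martingale transforms of time integrals *)

Section IntegralTransform.
Context {R : realType} {disp : measure_display} {O : measurableType disp}.
Variable P : probability O R.
Variable G : nat -> set (set O).
Hypotheses (sG : forall k, sigma_algebra setT (G k)) (Gm : forall k, G k `<=` measurable)
 (Gmono : forall k, G k `<=` G k.+1).
Variables (t : nat -> R) (h : R) (A : nat -> O -> R) (phi : nat -> R -> O -> R).
Variables (al : nat -> R) (v : R).
Hypotheses (h0 : 0 <= h) (th : forall k, t k <= t k.+1 <= t k + h) (mA : forall k, smeas (G k) (A k))
 (mphi : forall k s, t k <= s <= t k.+1 -> smeas (G k.+1) (phi k s))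
 (cphi : forall k w, continuous (phi k ^~ w))
 (iphi : forall k s, t k <= s <= t k.+1 -> indep_of P (G k) (phi k s))
 (phi0 : forall k s, t k <= s <= t k.+1 -> Ex P (phi k s) = 0)
 (Aal : forall k, Eb P (fun w => A k w ^+ 2) (al k))
 (phiv : forall k s, t k <= s <= t k.+1 -> Eb P (fun w => phi k s w ^+ 2) v).

(** On Riemann sums with [M + 1] points per cell, picking the [j]-th point of every cell gives one
    martingale transform for each [j]; averaging over [j], then Fatou, reaches the integrals. *)
Lemma mtrans_itg_sqr K :
  Eb P (fun w => (\sum_(k < K) A k w * itg (t k) (t k.+1) (phi k ^~ w)) ^+ 2)
    (h ^+ 2 * \sum_(k < K) al k * v).
Proof.
have tS k : t k <= t k.+1 by case/andP: (th k).
have v0 : 0 <= v by apply: (Eb_ge0 (phiv (k := 0) (s := t 0) _)); rewrite lexx tS.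
have al0 k : 0 <= al k by exact: Eb_ge0 (Aal k).
apply: (@Eb_fatou _ _ _ P (fun M w => (\sum_(k < K) A k w * rsum (t k) (t k.+1) M (phi k ^~ w)) ^+ 2)); last first.
  move=> w; apply: cvg_sqr.
  apply: cvg_bigsum => k; apply: cvgM; [exact: cvg_cst|apply: rsum_cvg => //; exact: cphi].
move=> M.
pose u k (j : 'I_M.+1) := t k + j.+1%:R * ((t k.+1 - t k) / M.+1%:R).
have uP k j : t k <= u k j <= t k.+1 by exact: rsum_pt.
pose S (j : 'I_M.+1) w := \sum_(k < K) ((t k.+1 - t k) * A k w) * phi k (u k j) w.
have SE w : \sum_(k < K) A k w * rsum (t k) (t k.+1) M (phi k ^~ w) =
    \sum_j (M.+1%:R^-1 * S j w).
  under eq_bigr do rewrite /rsum mulr_sumr mulr_sumr.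
  rewrite exchange_big/=; apply: eq_bigr => j _; rewrite /S mulr_sumr; apply: eq_bigr => k _.
  rewrite -/(u k j); ring.
apply: (@Eb_ext _ _ _ _ (fun w => (\sum_j (M.+1%:R^-1 * S j w)) ^+ 2)).
  by move=> w; rewrite SE.
have SEb j : Eb P (fun w => S j w ^+ 2) (h ^+ 2 * \sum_(k < K) al k * v).
  have H k : Eb P (fun w => ((t k.+1 - t k) * A k w) ^+ 2) (h ^+ 2 * al k).
    apply: (@Eb_weak _ _ _ _ ((t k.+1 - t k) ^+ 2 * al k)).
      rewrite ler_wpM2r// lerXn2r ?nnegrE ?subr_ge0//.
      by case/andP: (th k) => _; rewrite -lerBlDl.
    apply: Eb_ext (Eb_scale (sqr_ge0 _) (Aal k)) => w; by rewrite exprMn.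
  have := @mtrans_sqr _ _ _ P G sG Gm Gmono (fun k w => (t k.+1 - t k) * A k w)
    (fun k => phi k (u k j)) (fun k => h ^+ 2 * al k) (fun=> v) _ _ _ _ H _ K.
  rewrite mulr_sumr.
  rewrite (_ : \sum_(k < K) h ^+ 2 * al k * v = \sum_(k < K) h ^+ 2 * (al k * v)); last first.
    by apply: eq_bigr => k _; rewrite mulrA.
  apply.
  - by move=> k; apply: smeasM => //; exact: smeas_cst.
  - by move=> k; exact: mphi.
  - by move=> k; exact: iphi.
  - by move=> k; exact: phi0.
  - by move=> k; exact: phiv.
have mS j : mfT (S j).
  apply: measurable_sum => k; apply: measurable_funM.
    by apply: measurable_funM => //; exact: smeas_meas (@Gm k) (mA k).
  exact: smeas_meas (@Gm k.+1) (mphi (uP k j)).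
have M0 : M.+1%:R != 0 :> R by rewrite pnatr_eq0.
have := @Eb_sqr_sum _ _ _ P 'I_M.+1 (fun j w => M.+1%:R^-1 * S j w) (M.+1%:R^-1 ^+ 2 * (h ^+ 2 * \sum_(k < K) al k * v)) _ _.
rewrite card_ord (_ : M.+1%:R ^+ 2 * (M.+1%:R^-1 ^+ 2 * _) = h ^+ 2 * \sum_(k < K) al k * v); last by field.
apply.
  by move=> j; exact: measurable_funM.
by move=> j; apply: Eb_ext (Eb_scale (sqr_ge0 _) (SEb j)) => w; rewrite exprMn.
Qed.

End IntegralTransform.

(** * Joint law of increments and areas *)

Section Peeling.
Context {R : realType} {disp : measure_display} {O : measurableType disp}.
Variables (P : probability O R) (s : R).
Hypothesis s0 : 0 < s.
Local Notation gam := (normal_prob 0 s).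
Implicit Types (E : set O) (X Y Z : O -> R) (B C : set R).
Local Open Scope ereal_scope.

(** Under the event [E], a pair of independent centred normal variables, independent of [E] as well.
    Carrying [E] along is what lets other variables be frozen during an induction. *)
Definition iid2 E X Y : Prop := forall B C, measurable B -> measurable C ->
  P (E `&` (X @^-1` B `&` Y @^-1` C)) = P E * (gam B * gam C).

Lemma iid2_law E X Y (D : set (R * R)) : measurable E ->
  mfT X -> mfT Y -> iid2 E X Y -> measurable D ->
  P (E `&` [set w | D (X w, Y w)]) =
  P E * \int[gam]_x \int[gam]_y (\1_D (x, y))%:E.
Proof.
move=> mE mX mY H mD.
have mX' : @measurable_fun _ _ O (measurableTypeR R) setT X by exact: mX.
have mY' : @measurable_fun _ _ O (measurableTypeR R) setT Y by exact: mY.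
have mZ : @measurable_fun _ _ O (measurableTypeR R * measurableTypeR R)%type setT (fun w => (X w, Y w)).
  exact: measurable_fun_pair.
have mD' : @measurable _ (measurableTypeR R * measurableTypeR R)%type D by exact: mD.
have mDZ : measurable [set w | D (X w, Y w)].
  by have := mZ measurableT _ mD'; rewrite setTI.
have PEfin : P E \is a fin_num by exact: fin_num_measure.
have [PE0|PE0] := eqVneq (P E) 0.
  rewrite PE0 mul0e; apply/eqP; rewrite eq_le measure_ge0 andbT -PE0.
  by apply: le_measure; rewrite ?inE//; exact: measurableI.
have r0 : (0 <= (fine (P E))^-1)%R by rewrite invr_ge0 fine_ge0.
pose Z (w : O) : (measurableTypeR R * measurableTypeR R)%type := (X w, Y w).
(* The law of the pair under the probability conditioned on [E]; it is identified with the product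
   measure by its values on rectangles. *)
pose m1 : {measure set O -> \bar R} := mscale (NngNum r0) (mrestr P mE).
pose m2 := (pushforward m1 Z : {measure set (measurableTypeR R * measurableTypeR R)%type -> \bar R}).
have [m' m'E] : exists m' : {measure set (measurableTypeR R * measurableTypeR R)%type -> \bar R}, forall A, m' A = (fine (P E))^-1%:E * P (E `&` Z @^-1` A).
  by exists (m2 mZ) => A; rewrite /m2 /= /pushforward/= /mscale/= /mrestr/= setIC.
have PE1 : P E * (fine (P E))^-1%:E = 1.
  rewrite -{1}(fineK PEfin) -EFinM mulfV//.
  by apply: contra PE0 => /eqP h; rewrite -(fineK PEfin) h.
have key : (gam \x gam) D = m' D.
  apply: (@product_measure_unique _ _ (measurableTypeR R) (measurableTypeR R)) => //= B C mB mC.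
  rewrite m'E (_ : _ `&` _ = E `&` (X @^-1` B `&` Y @^-1` C))//.
  by rewrite H// muleA [_ * P E]muleC PE1 mul1e.
have -> : \int[gam]_x \int[gam]_y (\1_D (x, y))%:E = (gam \x gam) D.
  rewrite /product_measure1; apply: eq_integral => x _ /=.
  rewrite (_ : (fun y => _) = (fun y => (\1_(xsection D x) y)%:E)).
    by rewrite integral_indic// ?setIT//; exact: measurable_xsection.
  by apply/funext => y; rewrite !indicE mem_xsection.
by rewrite key m'E muleA PE1 mul1e.
Qed.

Lemma iid2_rotation E X Y (c d : R) : measurable E ->
  mfT X -> mfT Y -> (c ^+ 2 + d ^+ 2 = 1)%R -> d != 0%R ->
  iid2 E X Y ->
  iid2 E (fun w => c * X w + d * Y w)%R (fun w => - d * X w + c * Y w)%R.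
Proof.
move=> mE mX mY cd d0 H B C mB mC.
pose D := [set z : R * R | B (c * z.1 + d * z.2)%R /\ C (- d * z.1 + c * z.2)%R].
have mBC : measurable (B `*` C) by exact: measurableX.
have mD : measurable D.
  have lin (a b : R) A : measurable A -> measurable [set z : R * R | A (a * z.1 + b * z.2)%R].
    move=> mA; have : mfT (fun z : R * R => (a * z.1 + b * z.2)%R).
      by apply: measurable_funD; apply: measurable_funM.
    by move=> /(_ measurableT _ mA); rewrite setTI.
  exact: measurableI (lin _ _ _ mB) (lin _ _ _ mC).
have -> : E `&` ((fun w => (c * X w + d * Y w)%R) @^-1` B `&` (fun w => (- d * X w + c * Y w)%R) @^-1` C)
  = E `&` [set w | D (X w, Y w)] by [].
rewrite (iid2_law mE mX mY H mD); congr (_ * _).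
rewrite (_ : \int[gam]_x \int[gam]_y _ = \int[gam]_x \int[gam]_y (\1_(B `*` C) (c * x + d * y, - d * x + c * y)%R)%:E); last first.
  apply: eq_integral => x _; by apply: eq_integral => y _; rewrite !indicE.
rewrite (@normal_rotation _ _ s0 (fun z => (\1_(B `*` C) z)%:E))//; last first.
  by apply/measurable_EFinP; exact: measurable_indic.
have E1 x : \int[gam]_y (\1_(B `*` C) (x, y))%:E = gam C * (\1_B x)%:E.
  rewrite (_ : (fun y => _) = (fun y => (\1_B x)%:E * (\1_C y)%:E)); last first.
    by apply/funext => y; rewrite -EFinM !indicE in_setX; case: (x \in B); case: (y \in C); rewrite ?mulr1 ?mulr0.
  rewrite ge0_integralZl//; last first.
    by apply/measurable_EFinP; exact: measurable_indic.
  by rewrite integral_indic// setIT muleC.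
transitivity (\int[gam]_x (gam C * (\1_B x)%:E)); first by apply: eq_integral => x _; exact: E1.
rewrite ge0_integralZl//; last first.
  by apply/measurable_EFinP; exact: measurable_indic.
by rewrite integral_indic// setIT muleC.
Qed.

Definition iid3 E X Y Z : Prop := forall A B C, measurable A -> measurable B -> measurable C ->
  P (E `&` (X @^-1` A `&` (Y @^-1` B `&` Z @^-1` C))) = P E * (gam A * (gam B * gam C)).

Lemma iid3_swap E X Y Z : iid3 E X Y Z -> iid3 E Y X Z.
Proof.
move=> H A B C mA mB mC.
have -> : Y @^-1` A `&` (X @^-1` B `&` Z @^-1` C) = X @^-1` B `&` (Y @^-1` A `&` Z @^-1` C).
  exact: setICA.
have -> := H B A C mB mA mC.
by congr (_ * _); rewrite muleCA.

Qed.

Lemma iid3_iid2 E X Y Z : iid3 E X Y Z -> iid2 E X Y.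
Proof.
move=> H A B mA mB; have := H A B setT mA mB measurableT.
by rewrite preimage_setT setIT probability_setT mule1.
Qed.

Let mpre X A : mfT X -> measurable A -> measurable (X @^-1` A).
Proof. by move=> mX mA; have := mX measurableT _ mA; rewrite setTI. Qed.

(** [Y] is absorbed into the event, which leaves a pair to rotate. *)
Lemma iid3_rotation E X Y Z (c d : R) : measurable E ->
  mfT X -> mfT Y -> mfT Z ->
  (c ^+ 2 + d ^+ 2 = 1)%R -> d != 0%R -> iid3 E X Y Z ->
  iid3 E (fun w => c * X w + d * Z w)%R Y (fun w => - d * X w + c * Z w)%R.
Proof.
move=> mE mX mY mZ cd d0 H A B C mA mB mC.
have PB : P (E `&` Y @^-1` B) = P E * gam B.
  have := H setT B setT measurableT mB measurableT.
  by rewrite !preimage_setT setTI setIT !probability_setT mul1e mule1.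
have H2 : iid2 (E `&` Y @^-1` B) X Z.
  move=> A' C' mA' mC'; rewrite PB -muleA (muleCA (gam B)) -H//; congr (P _).
  by rewrite -setIA; congr (_ `&` _); rewrite setICA.
have mEB : measurable (E `&` Y @^-1` B) by apply: measurableI => //; exact: mpre.
have := iid2_rotation mEB mX mZ cd d0 H2 mA mC.
have -> : P E * (gam A * (gam B * gam C)) = P E * gam B * (gam A * gam C).
  by rewrite -muleA; congr (_ * _); rewrite muleCA.
rewrite PB => <-; congr (P _).
by rewrite -setIA; congr (_ `&` _); rewrite setICA.
Qed.

(** Quantified over [E] in [peel], so that the induction can move the last variable into the
    event. *)
Definition good (xi : nat -> O -> R) (M : nat) E : Prop := measurable E /\
  forall D : nat -> set R, (forall i, measurable (D i)) ->
    P (E `&` [set w | forall i, (i < M)%N -> D i (xi i w)]) = P E * \prod_(i < M) gam (D i).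

Variables (xi : nat -> O -> R) (a : nat -> R).
Hypotheses (mxi : forall i, mfT (xi i)) (a10 : (a 1 <= a 0)%R).

(* The sums [S = sum xi_i] and [A = sum a_i xi_i] are combinations of two
   independent normal variables: [S = sqrt M X] and [A = q X + r Y]. *)
Lemma peel n : exists X Y : O -> R, exists q r : R,
  [/\ mfT X /\ mfT Y,
     (0 <= r)%R /\ forall w, (\sum_(i < n.+2) xi i w = Num.sqrt n.+2%:R * X w)%R,
     forall w, (\sum_(i < n.+2) a i * xi i w = q * X w + r * Y w)%R,
     (q ^+ 2 + r ^+ 2 = \sum_(i < n.+2) a i ^+ 2)%R & (q * Num.sqrt n.+2%:R = \sum_(i < n.+2) a i)%R] /\
  forall E, good xi n.+2 E -> iid2 E X Y.
Proof.
have sqr n' : (Num.sqrt n'%:R ^+ 2 = n'%:R :> R)%R by rewrite sqr_sqrtr.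
have sq0 n' : (0 < Num.sqrt n'.+1%:R :> R)%R by rewrite sqrtr_gt0 ltr0n.
elim: n => [|n [X [Y [q [r [[[mX mY] [r0 SX] AXY qrS qS] HE]]]]]].
  (* Base case: a rotation by an eighth of a turn, with [X] along the sum and [Y] along the
     difference; [a 1 <= a 0] makes [r] nonnegative. *)
  set p := Num.sqrt 2%:R : R.
  have p0 : (p != 0)%R by rewrite gt_eqF// sq0.
  have p2 : (p ^+ 2 = 2)%R by exact: sqr.
  exists (fun w => p^-1 * xi 1%N w + p^-1 * xi 0%N w)%R, (fun w => - p^-1 * xi 1%N w + p^-1 * xi 0%N w)%R.
  exists ((a 0 + a 1) / p)%R, ((a 0 - a 1) / p)%R; split; first split.
  - by split; apply: measurable_funD; apply: measurable_funM.
  - split; first by rewrite divr_ge0 ?subr_ge0// sqrtr_ge0.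
    by move=> w; rewrite !big_ord_recr big_ord0/= add0r; field.
  - move=> w; rewrite !big_ord_recr big_ord0/= add0r; field : p2.
    exact: p0.
  - rewrite !big_ord_recr big_ord0/= add0r; field: p2; exact: p0.
  - by rewrite !big_ord_recr big_ord0/= add0r; field.
  move=> E [mE gE]; apply: iid2_rotation => //.
  - by rewrite -mulr2n exprVn p2 -[LHS]mulr_natl divff.
  - by rewrite invr_eq0.
  move=> B C mB mC.
  pose D i := if i is 0%N then C else B.
  have := gE D; rewrite !big_ord_recr big_ord0/= mul1e [gam C * _]muleC => <-; last by case.
  congr (P (_ `&` _)); apply/seteqP; split => w /=.
    by move=> [Bw Cw] [|[|]].
  by move=> Hw; split; [exact: (Hw 1%N)|exact: (Hw 0%N)].
set p := Num.sqrt n.+2%:R in SX qS; set p' := Num.sqrt n.+3%:R.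
have p'0 : (p' != 0)%R by rewrite gt_eqF// sq0.
have p2 : (p ^+ 2 = n.+2%:R)%R by exact: sqr.
have p'2 : (p' ^+ 2 = p ^+ 2 + 1)%R by rewrite p2 sqr -natr1.
pose Z := xi n.+2; pose al := a n.+2.
(* The rotation of [(X, Z)] whose first coordinate is the normalised sum of [n + 3] variables, [X]
   being that of the first [n + 2]; the other coordinate [Z'] is orthogonal to it. *)
pose c := (p / p')%R; pose d := (p'^-1)%R.
have cd : (c ^+ 2 + d ^+ 2 = 1)%R.
  by rewrite /c /d expr_div_n exprVn p'2 -{2}[(_^-1)%R]mul1r -mulrDl divff// -p'2 expf_neq0.
have d0 : d != 0%R by rewrite invr_eq0.
pose X' w := (c * X w + d * Z w)%R; pose Z' w := (- d * X w + c * Z w)%R.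
have mZ : mfT Z by exact: mxi.
have mX' : mfT X' by apply: measurable_funD; apply: measurable_funM.
have mZ' : mfT Z' by apply: measurable_funD; apply: measurable_funM.
pose q' := (q * c + al * d)%R; pose u := (al * c - q * d)%R.
have XZ w : (X w = c * X' w - d * Z' w /\ Z w = d * X' w + c * Z' w)%R.
  by split; rewrite -[LHS]mul1r -cd /X' /Z'; ring.
have SX' w : (\sum_(i < n.+3) xi i w = p' * X' w)%R.
  by rewrite big_ord_recr/= SX /X' /c /d /Z; field.
have AXYZ w : (\sum_(i < n.+3) a i * xi i w = q' * X' w + (r * Y w + u * Z' w))%R.
  rewrite big_ord_recr/= AXY -/al -/(Z w) /q' /u; have [-> ->] := XZ w; ring.
have qS' : (q' * p' = \sum_(i < n.+3) a i)%R.
  by rewrite big_ord_recr/= -qS /q' /c /d /al; field.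
have qu : (q' ^+ 2 + u ^+ 2 = q ^+ 2 + al ^+ 2)%R.
  by rewrite -[RHS]mulr1 -cd /q' /u; ring.
(* The condition on the new variable [Z] is put into the event, where the induction hypothesis
   supplies [X] and [Y]. *)
have H3 E : good xi n.+3 E -> iid3 E X' Y Z'.
  move=> [mE gE]; apply: iid3_rotation => // A B C mA mB mC.
  have PC : P (E `&` Z @^-1` C) = P E * gam C.
    pose D'' i := if (i < n.+2)%N then setT else C.
    have mD'' i : measurable (D'' i) by rewrite /D''; case: ifP.
    have := gE D'' mD''; rewrite big_ord_recr/= big1; last first.
      by move=> i _; rewrite /D'' ltn_ord probability_setT.
    have -> : D'' n.+2 = C by rewrite /D'' ltnn.
    rewrite mul1e => <-.
    congr (P (_ `&` _)); apply/seteqP; split => w /=.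
      move=> Cw i; rewrite /D'' ltnS leq_eqVlt => /predU1P[->|->//].
      by rewrite ltnn.
    by move=> /(_ n.+2 (ltnSn _)); rewrite /D'' ltnn.
  have gC : good xi n.+2 (E `&` Z @^-1` C).
    split; first by apply: measurableI => //; exact: mpre.
    move=> D mD; pose D' i := if (i < n.+2)%N then D i else C.
    have mD' i : measurable (D' i) by rewrite /D'; case: ifP.
    have := gE D' mD'; rewrite big_ord_recr/=.
    have -> : D' n.+2 = C by rewrite /D' ltnn.
    rewrite (eq_bigr (fun i : 'I_n.+2 => gam (D i))); last first.
      by move=> i _; rewrite /D' ltn_ord.
    rewrite PC -muleA [gam C * _]muleC => <-.
    rewrite -setIA; congr (P (_ `&` _)); apply/seteqP; split => w /=.
      move=> [Cw Dw] i; rewrite /D' ltnS leq_eqVlt => /predU1P[->|ni].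
        by rewrite ltnn.
      by rewrite ni; exact: Dw.
    move=> Hw; split; first by have := Hw n.+2 (ltnSn _); rewrite /D' ltnn.
    by move=> i ni; have := Hw i (ltnW ni); rewrite /D' ni.
  have := HE _ gC A B mA mB; rewrite PC => H.
  rewrite (_ : _ `&` _ = E `&` Z @^-1` C `&` (X @^-1` A `&` Y @^-1` B)); last first.
    by apply/seteqP; split => w /=; tauto.
  by rewrite H -muleA; congr (_ * _); rewrite muleC muleA.
have [u0|u0] := eqVneq u 0%R.
  exists X', Y, q', r; split; first split => //.
  - by move=> w; rewrite AXYZ u0 mul0r addr0.
  - rewrite big_ord_recr/= -qrS -/al; move: qu; rewrite u0 expr0n addr0 => ->; ring.
  by move=> E /H3; exact: iid3_iid2.
(* A second rotation, in the plane of [Y] and [Z'], merges [r Y + u Z'] into a single variable; for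
   [u = 0] nothing is left to merge. *)
pose r' := Num.sqrt (r ^+ 2 + u ^+ 2).
have r'p : (0 < r')%R by rewrite sqrtr_gt0 ltr_wpDl ?sqr_ge0// exprn_even_gt0.
have r'2 : (r' ^+ 2 = r ^+ 2 + u ^+ 2)%R by rewrite sqr_sqrtr// addr_ge0 ?sqr_ge0.
have cd' : ((r / r') ^+ 2 + (u / r') ^+ 2 = 1)%R.
  by rewrite !expr_div_n -mulrDl -r'2 divff// expf_neq0// gt_eqF.
have d'0 : (u / r' != 0)%R by rewrite mulf_neq0// invr_eq0 gt_eqF.
exists X', (fun w => r / r' * Y w + u / r' * Z' w)%R, q', r'; split; first split => //.
- by split => //; apply: measurable_funD; apply: measurable_funM.
- by split => //; exact: ltW.
- by move=> w; rewrite AXYZ; field; rewrite gt_eqF.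
- rewrite big_ord_recr/= -qrS -/al r'2; move: qu; lra.
move=> E gE; have [mE _] := gE.
have := iid3_rotation mE mY mX' mZ' cd' d'0 (iid3_swap (H3 _ gE)).
by move=> /iid3_swap/iid3_iid2.
Qed.

End Peeling.

Section BlockLaw.
Context {R : realType} {disp : measure_display} {O : measurableType disp}.
Variables (P : probability O R) (s : R).
Hypothesis s0 : 0 < s.
Local Notation gam := (normal_prob 0 s).
Variables (B : finType) (n : nat).
Variables (xi : B -> nat -> O -> R) (a : nat -> R).
Hypotheses (mxi : forall b i, mfT (xi b i)) (a10 : (a 1 <= a 0)%R)
 (box : forall D : B -> nat -> set R, (forall b i, measurable (D b i)) ->
  P [set w | forall b i, (i < n.+2)%N -> D b i (xi b i w)] =
  (\prod_b \prod_(i < n.+2) gam (D b i))%E).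

Lemma block_law : exists X Y : B -> O -> R, exists q r : R,
  [/\ forall b, mfT (X b) /\ mfT (Y b),
     0 <= r /\ forall b w, \sum_(i < n.+2) xi b i w = Num.sqrt n.+2%:R * X b w,
     forall b w, \sum_(i < n.+2) a i * xi b i w = q * X b w + r * Y b w,
     q ^+ 2 + r ^+ 2 = \sum_(i < n.+2) a i ^+ 2 & q * Num.sqrt n.+2%:R = \sum_(i < n.+2) a i] /\
  forall C D : B -> set R, (forall b, measurable (C b)) -> (forall b, measurable (D b)) ->
    P [set w | forall b, C b (X b w) /\ D b (Y b w)] = (\prod_b (gam (C b) * gam (D b)))%E.
Proof.
(* Without any block, [q] and [r] must still be produced; they are taken from null variables. *)
have [[b0 _]|nB] := pselect (exists b : B, True); last first.
  have [X [Y [q [r [[_ [r0 _] _ qr qs] _]]]]] := @peel _ _ _ P s s0 (fun=> fun=> 0) a (fun=> measurable_cst _) a10 n.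
  exists (fun=> fun=> 0), (fun=> fun=> 0), q, r; split.
    by split => //; [split => // b|move=> b]; exfalso; apply: nB; exists b.
  move=> C D _ _; rewrite big1; last by move=> b; exfalso; apply: nB; exists b.
  rewrite (_ : [set _ | _] = setT) ?probability_setT//.
  by apply/seteqP; split => w // _ b; exfalso; apply: nB; exists b.
have pl b := @peel _ _ _ P s s0 (xi b) a (mxi b) a10 n.
have [X {}pl] := choice pl; have [Y {}pl] := choice pl.
have [q {}pl] := choice pl; have [r {}pl] := choice pl.
have sn : Num.sqrt n.+2%:R != 0 :> R by rewrite gt_eqF// sqrtr_gt0 ltr0n.
have qE b : q b = q b0.
  apply: (mulIf sn); have [[_ _ _ _ ->] _] := pl b; by have [[_ _ _ _ ->] _] := pl b0.
have rE b : r b = r b0.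
  have [[_ [r0 _] _ qr _] _] := pl b; have [[_ [r0' _] _ qr' _] _] := pl b0.
  apply/eqP; rewrite -(eqrXn2 (n := 2))//; apply/eqP.
  by apply: (addrI (q b ^+ 2)); rewrite qr qE qr'.
exists X, Y, (q b0), (r b0); split.
  split.
  - by move=> b; have [[mXY _ _ _ _] _] := pl b.
  - by have [[_ [r0 _] _ qr _] _] := pl b0; split => // b w; have [[_ [_ ->] _ _ _] _] := pl b.
  - by move=> b w; have [[_ _ -> _ _] _] := pl b; rewrite qE rE.
  - by have [[_ _ _ -> _] _] := pl b0.
  - by have [[_ _ _ _ ->] _] := pl b0.
move=> C D mC mD.
(* Blocks in [l] are already described by [X] and [Y], the others still by their original
   variables. *)
pose rep (l : seq B) (A : B -> nat -> set R) : set O := [set w | forall b,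
  if b \in l then C b (X b w) /\ D b (Y b w) else forall i, (i < n.+2)%N -> A b i (xi b i w)].
have mpre Z A : mfT Z -> measurable A -> measurable (Z @^-1` A : set O).
  by move=> mZ mA; have := mZ measurableT _ mA; rewrite setTI.
have mrep l A : (forall b i, measurable (A b i)) -> measurable (rep l A).
  move=> mA; rewrite (_ : rep l A = \bigcap_(b in [set: B]) [set w | if b \in l then C b (X b w) /\ D b (Y b w) else forall i, (i < n.+2)%N -> A b i (xi b i w)]); last first.
    by apply/seteqP; split => w /= H b; [move=> _; exact: H|exact: (H b I)].
  apply: fin_bigcap_measurable; first exact: finite_finset.
  move=> b _; case: (b \in l).
    have [[[mX mY] _ _ _ _] _] := pl b.
    by apply: (@measurableI _ _ (X b @^-1` C b) (Y b @^-1` D b)); exact: mpre.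
  rewrite (_ : [set _ | _] = \bigcap_(i in [set i | (i < n.+2)%N]) (xi b i @^-1` A b i)); last by apply/seteqP; split.
  by apply: bigcap_measurableType => i _; exact: mpre.
have key l A : uniq l -> (forall b i, measurable (A b i)) ->
    P (rep l A) = (\prod_b (if b \in l then gam (C b) * gam (D b) else \prod_(i < n.+2) gam (A b i)))%E.
  elim: l A => [|b l IH] A /=.
    by move=> _ mA; rewrite -box//; congr (P _).
  move=> /andP[bl ul] mA.
  pose A' (F : nat -> set R) b' := if b' == b then F else A b'.
  have mA' F : (forall i, measurable (F i)) -> forall b' i, measurable (A' F b' i).
    by move=> mF b' i; rewrite /A'; case: ifP.
  pose rest := (\prod_(b' | b' != b) (if b' \in l then gam (C b') * gam (D b') else \prod_(i < n.+2) gam (A b' i)))%E.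
  have PA' F : (forall i, measurable (F i)) -> P (rep l (A' F)) = (\prod_(i < n.+2) gam (F i) * rest)%E.
    move=> mF; rewrite IH//; last exact: mA'.
    rewrite (bigD1 b)//= (negbTE bl) /A' eqxx; congr (_ * _)%E.
    by apply: eq_bigr => b' /negbTE ->.
  have repT F : rep l (A' F) = rep l (A' (fun=> setT)) `&` [set w | forall i, (i < n.+2)%N -> F i (xi b i w)].
    apply/seteqP; split => w /=.
      move=> H; split; last by have := H b; rewrite (negbTE bl) /A' eqxx.
      by move=> b'; have := H b'; case: ifP => // _; rewrite /A'; case: ifP.
    move=> [H HF] b'; have := H b'; case: ifP => // _; rewrite /A'; case: eqP => [->//|//].
  have PT : P (rep l (A' (fun=> setT))) = rest.
    by rewrite PA'// big1 ?mul1e// => i _; exact: probability_setT.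
  have g : good P s (xi b) n.+2 (rep l (A' (fun=> setT))).
    split; first by apply: mrep; exact: mA'.
    by move=> F mF; rewrite -repT PA'// PT muleC.
  have [_ /(_ _ g)/(_ _ _ (mC b) (mD b))] := pl b.
  rewrite PT (_ : _ `&` _ = rep (b :: l) A); last first.
    apply/seteqP; split => w /=.
      move=> [H [Cw Dw]] b'; have := H b'; rewrite inE /A'; case: (eqVneq b' b) => [->//|_] /=.
      by [].
    move=> H; split; last by have := H b; rewrite inE eqxx.
    move=> b'; have := H b'; rewrite inE /A'; case: (eqVneq b' b) => [->|_] //=.
    by rewrite (negbTE bl).
  move=> ->; rewrite [RHS](bigD1 b)//= inE eqxx/= muleC; congr (_ * _)%E.
  by apply: eq_bigr => b' /negbTE; rewrite inE => ->.
have := key (enum B) (fun=> fun=> setT) (enum_uniq _) (fun _ _ => measurableT).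
rewrite (eq_bigr (fun b => (gam (C b) * gam (D b))%E)); last by move=> b _; rewrite mem_enum.
move=> <-; congr (P _); apply/seteqP; split => w /= H b; have := H b; rewrite ?mem_enum//.
Qed.

End BlockLaw.

Section BoundedConvergence.
Context {R : realType} {disp : measure_display} {O : measurableType disp}.
Variable P : probability O R.

Lemma Ex_bounded_cvg (f_ : nat -> O -> R) f (C : R) :
  (forall n, mfT (f_ n)) -> (forall n w, `|f_ n w| <= C) ->
  (forall w, f_ ^~ w @ \oo --> f w) -> (fun n => Ex P (f_ n)) @ \oo --> Ex P f.
Proof.
move=> mf fC cf.
have mlim : mfT f by exact: measurable_fun_cvg mf (fun w _ => cf w).
have bf w : `|f w| <= C.
  apply: (@cvg_le_cst _ (fun n => `|f_ n w|)) => //.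
  exact: cvg_norm (cf w).
have [] := @dominated_convergence _ _ R P setT measurableT (fun n w => (f_ n w)%:E) (fun w => (f w)%:E) (fun=> C%:E).
- by move=> n; exact/measurable_EFinP.
- exact/measurable_EFinP.
- by apply: aeW => w _; apply: cvg_EFin; [exact: nearW|exact: cf].
- exact: (Eb_summable (Eb_cst P (le_trans (normr_ge0 _) (bf point)))).
- by apply: aeW => w n _; rewrite lee_fin; exact: fC.
move=> _ _ H.
rewrite [X in _ --> X](_ : _ = fine (Ex P f)%:E)// .
have -> : (fun n => Ex P (f_ n)) = fine \o (fun n => \int[P]_w (f_ n w)%:E)%E by [].
apply: fine_cvg; rewrite -ExE; last exact: summable_bounded mlim bf.
exact: H.
Qed.

End BoundedConvergence.

(** * Means of continuous functionals from probabilities of boxes *)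

Section Lattice.
Context {R : realType}.
Variable I : finType.
Variable g : (I -> R) -> R.

(** Sequential continuity coordinate by coordinate: it is easily checked for a recursive scheme, and
    it is what the limit of [lattice] uses. *)
Definition seq_continuous : Prop := forall (u : nat -> I -> R) y,
  (forall i, u ^~ i @ \oo --> y i) -> (fun n => g (u n)) @ \oo --> g y.

Hypothesis gc : seq_continuous.

(** Half-open cells of width [1 / (p + 1)] that tile the interval from [- (p + 1)] to [p + 1]. *)
Let ncell p := (2 * (p.+1 * p.+1))%N.
Let node p (j : nat) : R := - p.+1%:R + j%:R / p.+1%:R.
Let cell p (j : nat) : set R := `[node p j, node p j.+1[%classic.

(* [g] on a grid of mesh [1 / p.+1]: the law of a vector on boxes determines the
   mean of [lattice p], which converges to that of [g]. *)
Definition lattice (p : nat) (y : I -> R) : R :=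
  \sum_(f : {ffun I -> 'I_(ncell p)}) g (fun i => node p (f i)) * \prod_i \1_(cell p (f i)) (y i).

Let idx p (x : R) : nat := Num.truncn ((x + p.+1%:R) * p.+1%:R).

Let idxP p x : `|x| < p.+1%:R -> (idx p x < ncell p)%N /\
  (forall j : nat, \1_(cell p j) x = (j == idx p x)%:R :> R) /\
  `|x - node p (idx p x)| <= p.+1%:R^-1.
Proof.
move=> xp; have p0 : 0 < p.+1%:R :> R by rewrite ltr0n.
have := xp; rewrite ltr_norml => /andP[x1 x2].
have u0 : 0 <= (x + p.+1%:R) * p.+1%:R by rewrite mulr_ge0// ltW//; lra.
have /andP[t1 t2] := truncn_itv u0.
split.
  rewrite /idx -(ltr_nat R); apply: le_lt_trans t1 _.
  rewrite /ncell !natrM mulrA ltr_pM2r//; lra.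
have nodeE j : (node p j <= x) = (j%:R <= (x + p.+1%:R) * p.+1%:R).
  by rewrite -(ler_pdivrMr _ _ p0) /node addrC lerBlDr.
split.
  move=> j; rewrite indicE; congr ((nat_of_bool _)%:R); rewrite [LHS](_ : _ = (node p j <= x < node p j.+1)); last first.
    by rewrite /cell; apply/idP/idP; rewrite inE/= in_itv.
  rewrite ltNge !nodeE -ltNge; apply/idP/idP.
    move=> /andP[a b]; rewrite eqn_leq; apply/andP; split.
      by rewrite -ltnS -(ltr_nat R); exact: le_lt_trans a t2.
    by rewrite -ltnS -(ltr_nat R); exact: le_lt_trans t1 b.
  by move=> /eqP ->; rewrite t1 t2.
have n1 : node p (idx p x) <= x by rewrite nodeE.
have n2 : x < node p (idx p x).+1 by rewrite ltNge nodeE -ltNge.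
rewrite ger0_norm ?subr_ge0//; have nS j : node p j.+1 = node p j + p.+1%:R^-1.
  by rewrite /node -[j.+1%:R]natr1 mulrDl mul1r addrA.
by rewrite lerBlDl ltW// -nS.
Qed.

(** Once [p] exceeds all coordinates, a single term of the sum is nonzero: the value of [g] at the
    lower corner of the cell containing [y]. *)
Lemma lattice_cvg y : lattice ^~ y @ \oo --> g y.
Proof.
pose z p i := node p (idx p (y i)).
have zc i : z ^~ i @ \oo --> y i.
  apply/cvgrPdist_le => e e0; near=> p.
  have [|_ [_ H]] := @idxP p (y i).
    rewrite (@le_lt_trans _ _ p%:R)// ?ltr_nat//; near: p; exact: nbhs_infty_ger.
  apply/ltW; apply: le_lt_trans H _; near: p; exact: (near_infty_natSinv_lt (PosNum e0)).
have gz := gc zc.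
rewrite -[X in _ --> X]addr0 -[X in X @ _ --> _](_ : (fun p => g (z p) + (lattice p y - g (z p))) = _); last first.
  by apply/funext => p; rewrite addrC subrK.
apply: cvgD => //; apply: cvg_near_cst; near=> p.
have yp i : `|y i| < p.+1%:R.
  rewrite (@le_lt_trans _ _ (\sum_j `|y j|))//.
    by rewrite (bigD1 i)//= lerDl sumr_ge0.
  rewrite (@le_lt_trans _ _ p%:R)// ?ltr_nat//; near: p; exact: nbhs_infty_ger.
have H i := idxP (yp i).
pose f0 : {ffun I -> 'I_(ncell p)} := [ffun i => Ordinal (H i).1].
rewrite /lattice (bigD1 f0)//= [X in _ + X - _]big1 ?addr0.
  rewrite big1 ?mulr1 => [|i _].
    rewrite (_ : (fun i => _) = z p) ?subrr//.
    by apply/funext => i; rewrite ffunE.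
  by rewrite (H i).2.1 ffunE eqxx.
move=> f ff0; have [i fi] : exists i, f i != f0 i.
  by apply/existsP; apply: contraNT ff0; rewrite negb_exists => /forallP ff; apply/eqP/ffunP => i; apply/eqP; have := ff i; rewrite negbK.
rewrite (bigD1 i)//= (H i).2.1 (_ : (_ == _) = false) ?mul0r ?mulr0//.
by apply/negbTE; apply: contra fi => /eqP e; apply/eqP/val_inj; rewrite ffunE.
Unshelve. all: by end_near. Qed.

Let prod_indic (A : I -> set R) y :
  \prod_i \1_(A i) (y i) = \1_[set u : I -> R | forall i, A i (u i)] y :> R.
Proof.
have [H|/existsNP[i Hi]] := pselect (forall i, A i (y i)).
  by rewrite [RHS]indicE mem_set// big1// => i _; rewrite indicE mem_set.
by rewrite [RHS]indicE memNset; [rewrite (bigD1 i)//= indicE memNset// mul0r|move=> /(_ i)].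
Qed.

(** The cells are disjoint, so the products of indicators sum to at most 1; in one coordinate this
    is a telescoping sum of indicators of half-lines. *)
Lemma lattice_bound (C : R) p y : (forall u, `|g u| <= C) -> `|lattice p y| <= C.
Proof.
move=> gC; have C0 : 0 <= C by exact: le_trans (normr_ge0 _) (gC y).
have p0 : 0 < p.+1%:R :> R by rewrite ltr0n.
apply: (@le_trans _ _ (\sum_(f : {ffun I -> 'I_(ncell p)}) C * \prod_i \1_(cell p (f i)) (y i))).
  apply: le_trans (ler_norm_sum _ _ _) _; apply: ler_sum => f _.
  by rewrite normrM prod_indic ler_pM// indicE; case: (_ \in _); rewrite ?normr1 ?normr0.
rewrite -mulr_sumr ler_piMr// -(bigA_distr_bigA (fun i (j : 'I_(ncell p)) => \1_(cell p j) (y i) : R)).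
apply: prodr_ile1 => i _; rewrite sumr_ge0//=.
have cE (j : nat) : \1_(cell p j) (y i) = ((node p j <= y i)%R)%:R - ((node p j.+1 <= y i)%R)%:R :> R.
  rewrite indicE (_ : (_ \in _) = (node p j <= y i < node p j.+1)); last first.
    by rewrite /cell; apply/idP/idP; rewrite inE/= in_itv.
  rewrite ltNge; case: (lerP (node p j.+1) (y i)) => /= H; last by rewrite andbT subr0.
  rewrite andbF (_ : node p j <= y i) ?subrr//; apply: le_trans H.
  by rewrite /node lerD2l ler_pM2r ?invr_gt0// ler_nat.
rewrite (eq_bigr _ (fun (j : 'I_(ncell p)) _ => cE j)).
rewrite -(big_mkord xpredT (fun j => ((node p j <= y i)%R)%:R - ((node p j.+1 <= y i)%R)%:R : R)).
rewrite (@telescope_sumr_eq _ 0 (ncell p) (fun j => - ((node p j <= y i)%R)%:R))//; last first.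
  by move=> k _; rewrite opprK addrC.
by rewrite opprK; case: (node p (ncell p) <= y i)%R; case: (node p 0 <= y i)%R; rewrite /=; lra.
Qed.

Lemma smeas_seq_continuous (disp : measure_display) (O : measurableType disp)
    (G : set (set O)) (Y : I -> O -> R) :
  (forall i, smeas G (Y i)) -> smeas G (fun w => g (Y ^~ w)).
Proof.
move=> mY; apply: (@smeas_cvg _ _ _ _ (fun p w => lattice p (Y ^~ w))); last first.
  by move=> w; exact: lattice_cvg.
move=> p; apply: smeas_sum => f; apply: smeasM; first exact: smeas_cst.
elim: (index_enum I) => [|i l IH].
  by rewrite (_ : (fun w => _) = fun=> 1); [exact: smeas_cst|apply/funext => w; rewrite big_nil].
rewrite (_ : (fun w => _) = (fun w => \1_(cell p (f i)) (Y i w) * \prod_(i <- l) \1_(cell p (f i)) (Y i w))).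
  apply: smeasM => //; apply: (smeas_comp (f := \1_(cell p (f i)))) => //.
  by apply: measurable_indic; exact: measurable_itv.
by apply/funext => w; rewrite big_cons.
Qed.

(** The mean of [lattice p] is a finite combination of probabilities of boxes, the same on both
    sides; bounded convergence in [p] concludes. *)
Lemma seq_continuous_law (d1 d2 : measure_display) (O1 : measurableType d1) (O2 : measurableType d2)
    (P1 : probability O1 R) (P2 : probability O2 R) (Y1 : I -> O1 -> R) (Y2 : I -> O2 -> R) (C : R) :
  (forall u, `|g u| <= C) ->
  (forall i, mfT (Y1 i)) -> (forall i, mfT (Y2 i)) ->
  (forall A : I -> set R, (forall i, measurable (A i)) ->
     P1 [set w | forall i, A i (Y1 i w)] = P2 [set w | forall i, A i (Y2 i w)]) ->
  Ex P1 (fun w => g (Y1 ^~ w)) = Ex P2 (fun w => g (Y2 ^~ w)).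
Proof.
move=> gC mY1 mY2 law.
have lim (d : measure_display) (O : measurableType d) (P : probability O R) (Y : I -> O -> R) :
  (forall i, mfT (Y i)) ->
  (fun p => \sum_(f : {ffun I -> 'I_(ncell p)}) g (fun i => node p (f i)) * fine (P [set w | forall i, cell p (f i) (Y i w)]))
     @ \oo --> Ex P (fun w => g (Y ^~ w)).
  move=> mY.
  have mcell p (f : {ffun I -> 'I_(ncell p)}) : measurable [set w | forall i, cell p (f i) (Y i w)].
    rewrite (_ : [set w | _] = \bigcap_(i in [set: I]) (Y i @^-1` cell p (f i))).
      apply: fin_bigcap_measurable; first exact: finite_finset.
      by move=> i _; rewrite -[X in measurable X]setTI; apply: mY => //; exact: measurable_itv.
    by apply/seteqP; split => w /= H i; [move=> _; exact: H|exact: (H i Logic.I)].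
  have prodE p (f : {ffun I -> 'I_(ncell p)}) w :
    \prod_i \1_(cell p (f i)) (Y i w) = \1_[set w | forall i, cell p (f i) (Y i w)] w :> R.
    rewrite (prod_indic (fun i => cell p (f i)) (Y ^~ w)) !indicE; congr (_%:R).
  have mlat p : mfT (fun w => lattice p (Y ^~ w)).
    apply: measurable_sum => f; apply: measurable_funM => //.
    rewrite (_ : (fun w => _) = \1_[set w | forall i, cell p (f i) (Y i w)]); first exact: measurable_indic.
    by apply/funext => w; exact: prodE.
  have H := @Ex_bounded_cvg _ _ _ P (fun p w => lattice p (Y ^~ w)) (fun w => g (Y ^~ w)) C mlat
    (fun p w => lattice_bound p (Y ^~ w) gC) (fun w => @lattice_cvg (Y ^~ w)).
  apply: cvg_trans H; apply: near_eq_cvg; apply: nearW => p; rewrite /lattice.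
  elim: (index_enum _) => [|f l IH].
    by rewrite big_nil (_ : (fun w => _) = fun=> 0) ?Ex_cst//; apply/funext => w; rewrite big_nil.
  rewrite [RHS]big_cons -IH.
  have si (h : {ffun I -> 'I_(ncell p)}) : summable P (fun w => g (fun i => node p (h i)) * \prod_i \1_(cell p (h i)) (Y i w)).
    apply: (@summable_bounded _ _ _ _ _ C).
      apply: measurable_funM => //.
      rewrite (_ : (fun w => _) = \1_[set w | forall i, cell p (h i) (Y i w)]); first exact: measurable_indic.
      by apply/funext => w; exact: prodE.
    move=> w; rewrite prodE normrM indicE -[leRHS]mulr1 ler_pM// ?normr_ge0//.
    by case: (_ \in _); rewrite ?normr1 ?normr0.
  rewrite (_ : (fun w => _) = (fun w => g (fun i => node p (f i)) * \prod_i \1_(cell p (f i)) (Y i w) +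
     \sum_(f <- l) g (fun i => node p (f i)) * \prod_i \1_(cell p (f i)) (Y i w))); last first.
    by apply/funext => w; rewrite big_cons.
  rewrite ExD//; last first.
    elim: l {IH} => [|h l IH].
      rewrite (_ : (fun w => _) = fun=> 0); last by apply/funext => w; rewrite big_nil.
      exact: Eb_summable (Eb_cst P (lexx 0)).
    rewrite (_ : (fun w => _) = (fun w => g (fun i => node p (h i)) * \prod_i \1_(cell p (h i)) (Y i w) +
     \sum_(f <- l) g (fun i => node p (f i)) * \prod_i \1_(cell p (f i)) (Y i w))); last first.
      by apply/funext => w; rewrite big_cons.
    exact: summableD.
  congr (_ + _); rewrite (_ : (fun w => _) = (fun w => g (fun i => node p (f i)) * \1_[set w | forall i, cell p (f i) (Y i w)] w)); last first.
    by apply/funext => w; rewrite prodE.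
  rewrite ExZ; last first.
    apply: (@summable_bounded _ _ _ _ _ 1); first exact: measurable_indic.
    by move=> w; rewrite indicE; case: (_ \in _); rewrite ?normr1 ?normr0.
  by rewrite /Ex /Rintegral integral_indic// setIT.
apply: (cvg_unique _ (lim _ _ P1 Y1 mY1)) => //.
rewrite (_ : (fun p => _) = (fun p => \sum_(f : {ffun I -> 'I_(ncell p)}) g (fun i => node p (f i)) * fine (P2 [set w | forall i, cell p (f i) (Y2 i w)]))).
  exact: lim.
apply/funext => p; apply: eq_bigr => f _.
by have -> := law (fun i => cell p (f i)) (fun i => measurable_itv _).
Qed.

End Lattice.

(** * Law of the Brownian increments over a grid *)

Section GridLaw.
Context {R : realType} {disp : measure_display} {O : measurableType disp}.

Lemma sigma_forall (G : set (set O)) (I : finType) (A : I -> set O) :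
  sigma_algebra setT G -> (forall i, G (A i)) -> G [set w | forall i, A i w].
Proof.
move=> sG GA; have GE : <<s G >> = G by exact: sigma_algebra_id.
rewrite -GE (_ : [set w | _] = \bigcap_(i in [set: I]) A i); last first.
  by apply/seteqP; split => w /= H i; [move=> _; exact: H|exact: (H i Logic.I)].
apply: (@fin_bigcap_measurable _ (g_sigma_algebraType G)); first exact: finite_finset.
move=> i _; by rewrite /measurable/= GE; exact: GA.
Qed.

Lemma sigma_setI (G : set (set O)) (A B : set O) :
  sigma_algebra setT G -> G A -> G B -> G (A `&` B).
Proof.
move=> sG GA GB; have GE : <<s G >> = G by exact: sigma_algebra_id.
rewrite -GE; apply: (@measurableI _ (g_sigma_algebraType G)); by rewrite /measurable/= GE.
Qed.

Lemma sigma_setT (G : set (set O)) : sigma_algebra setT G -> G setT.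
Proof.
move=> sG; have GE : <<s G >> = G by exact: sigma_algebra_id.
by rewrite -GE; exact: (@measurableT _ (g_sigma_algebraType G)).
Qed.

Variables (P : probability O R) (T : R) (F : R -> set (set O)) (m : nat).
Variable W : R -> O -> 'cV[R]_m.
Hypotheses (hF : filtration T F) (hW : brownian_motion P T F W).
Local Notation incr := (incr W).

Lemma incr_box_indep s t E (D : 'I_m -> set R) : 0 <= s -> s < t -> t <= T -> F s E ->
  (forall i, measurable (D i)) ->
  P (E `&` [set w | forall i, D i (incr s t i w)]) =
  (P E * \prod_(i < m) normal_prob 0 (Num.sqrt (t - s)) (D i))%E.
Proof.
move=> s0 st tT FE mD; rewrite -(incr_box hW s0 st tT mD) muleC setIC.
have [_ [_ [_ [_ H]]]] := hW; apply: (H s t s0 st tT) => //.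
have sS : sigma_algebra setT (sigma_of setT (fun (i : 'I_m) w => (W t w - W s w) i 0)).
  exact: smallest_sigma_algebra.
apply: (sigma_forall (A := fun i => incr s t i @^-1` D i)) => // i.
apply: sub_sigma_algebra; exists i; split => //; exists (D i) => //.
by apply/seteqP; split => w; rewrite /preimage/= /incr !mxE.
Qed.

(** Induction on the number of subcells: the event so far belongs to the filtration at the left end
    of the next subcell, of which the next increment is independent. *)
Lemma incr_chain (a d : R) E M (D : nat -> 'I_m -> set R) : 0 <= a -> 0 < d ->
  a + M%:R * d <= T -> F a E -> (forall j i, measurable (D j i)) ->
  F (a + M%:R * d) (E `&` [set w | forall j i, (j < M)%N -> D j i (incr (a + j%:R * d) (a + j.+1%:R * d) i w)]) /\
  P (E `&` [set w | forall j i, (j < M)%N -> D j i (incr (a + j%:R * d) (a + j.+1%:R * d) i w)]) =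
  (P E * \prod_(j < M) \prod_(i < m) normal_prob 0 (Num.sqrt d) (D j i))%E.
Proof.
move=> a0 d0 + FE mD; elim: M => [|M IH] MT.
  rewrite mul0r addr0 big_ord0 mule1 (_ : [set w | _] = setT) ?setIT//.
  by apply/seteqP; split.
have stepE : a + M.+1%:R * d - (a + M%:R * d) = d.
  by rewrite -natr1; ring.
have lt : a + M%:R * d < a + M.+1%:R * d by rewrite -subr_gt0 stepE.
have M0 : 0 <= a + M%:R * d by rewrite addr_ge0// mulr_ge0// ltW.
have [FM PM] := IH (le_trans (ltW lt) MT).
set E' := _ `&` _ in FM PM.
have -> : E `&` [set w | forall j i, (j < M.+1)%N -> D j i (incr (a + j%:R * d) (a + j.+1%:R * d) i w)] =
  E' `&` [set w | forall i, D M i (incr (a + M%:R * d) (a + M.+1%:R * d) i w)].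
  apply/seteqP; split => w.
    move=> [Ew H]; split; first by split => // j i jM; apply: H; exact: ltnW.
    by move=> i; exact: H.
  move=> [[Ew H] H']; split => // j i; rewrite ltnS leq_eqVlt => /predU1P[->|]; first exact: H'.
  exact: H.
have FT := filt_sigma hF (le_trans M0 (ltW lt)) MT.
split.
  apply: sigma_setI => //.
    exact: (filt_mono hF M0 (ltW lt) MT).
  apply: (sigma_forall (A := fun i => incr (a + M%:R * d) (a + M.+1%:R * d) i @^-1` D M i)) => // i.
  apply: smeas_set => //; exact: (smeas_incr hF hW _ M0 (ltW lt) MT).
by rewrite incr_box_indep// PM stepE -muleA big_ord_recr.
Qed.

Variables (h d : R) (M K : nat).
Hypotheses (d0 : 0 < d) (hd : h = M%:R * d) (M0 : (0 < M)%N).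

(** [incr_chain] inside a cell, then induction over the cells with the event so far as [E]. *)
Lemma incr_cells (D : nat -> nat -> 'I_m -> set R) : K%:R * h <= T ->
  (forall k j i, measurable (D k j i)) ->
  P [set w | forall k j i, (k < K)%N -> (j < M)%N ->
     D k j i (incr (k%:R * h + j%:R * d) (k%:R * h + j.+1%:R * d) i w)] =
  (\prod_(k < K) \prod_(j < M) \prod_(i < m) normal_prob 0 (Num.sqrt d) (D k j i))%E.
Proof.
move=> KT mD.
have h0 : 0 < h by rewrite hd mulr_gt0// ltr0n.
suff H : F (K%:R * h) [set w | forall k j i, (k < K)%N -> (j < M)%N ->
     D k j i (incr (k%:R * h + j%:R * d) (k%:R * h + j.+1%:R * d) i w)] /\
  P [set w | forall k j i, (k < K)%N -> (j < M)%N ->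
     D k j i (incr (k%:R * h + j%:R * d) (k%:R * h + j.+1%:R * d) i w)] =
  (\prod_(k < K) \prod_(j < M) \prod_(i < m) normal_prob 0 (Num.sqrt d) (D k j i))%E by case: H.
elim: K KT => [|L IH] LT.
  rewrite mul0r big_ord0 (_ : [set w | _] = setT); last by apply/seteqP; split.
  split; last exact: probability_setT.
  by apply: sigma_setT; apply: (filt_sigma hF) => //; move: LT; rewrite mul0r.
have L1 : L.+1%:R * h = L%:R * h + M%:R * d by rewrite -natr1 mulrDl mul1r hd.
have LT' : L%:R * h + M%:R * d <= T by rewrite -L1.
have Lh : 0 <= L%:R * h by rewrite mulr_ge0// ltW.
have LT0 : L%:R * h <= T by apply: le_trans LT; rewrite ler_wpM2r ?(ltW h0)// ler_nat.
have [FL PL] := IH LT0.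
have [FE PE] := incr_chain (D := D L) Lh d0 LT' FL (mD L).
set E1 := _ `&` _ in FE PE.
have -> : [set w | forall k j i, (k < L.+1)%N -> (j < M)%N ->
     D k j i (incr (k%:R * h + j%:R * d) (k%:R * h + j.+1%:R * d) i w)] = E1.
  apply/seteqP; split => w.
    move=> H; split; first by move=> k j i kL; apply: H; exact: ltnW.
    by move=> j i; exact: H.
  move=> [H H'] k j i; rewrite ltnS leq_eqVlt => /predU1P[->|]; first exact: H'.
  exact: H.
by rewrite L1 PE PL big_ord_recr.
Qed.

End GridLaw.

Lemma meas_smeas {R : realType} {disp : measure_display} {O : measurableType disp} (X : O -> R) :
  mfT X -> smeas measurable X.
Proof.
move=> mX; apply/smeasP; first exact: sigma_algebra_measurable.
by move=> B mB; have := mX measurableT _ mB; rewrite setTI.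
Qed.

(** * Discretised areas *)

Section RiemannWeights.
Context {R : realType}.
Implicit Types (c T : R) (M : nat).

Lemma sum_natr M : \sum_(j < M) j%:R = M%:R * (M%:R - 1) / 2 :> R.
Proof.
elim: M => [|M IH]; first by rewrite big_ord0 !mul0r.
by rewrite big_ord_recr/= IH -natr1; field.
Qed.

Lemma sum_natr_sqr M : \sum_(j < M) j%:R ^+ 2 = M%:R * (M%:R - 1) * (2 * M%:R - 1) / 6 :> R.
Proof.
elim: M => [|M IH]; first by rewrite big_ord0 !mul0r.
by rewrite big_ord_recr/= IH -natr1; field.
Qed.

(* Summation by parts: with [D_j] the increments over [M] equal subcells,
   [\sum_j weight T M j * D_j] approximates the area [cell_area] below. *)
Definition weight T M (j : nat) : R := T / M%:R * ((M%:R - 1) / 2 - j%:R).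

(** This makes the discretised area orthogonal to the increment over the whole cell: [q = 0] in
    [block_law]. *)
Lemma weight_sum T M : \sum_(j < M) weight T M j = 0.
Proof. by rewrite -mulr_sumr sumrB sumr_const card_ord -[_ *+ M]mulr_natl sum_natr; ring. Qed.

(** The factor [1 / 12], up to [1 - 1 / M^2], is the variance of equally spaced points in a unit
    interval; it is the source of [sqrt 3 / 6]. *)
Lemma weight_sum_sqr T M : (0 < M)%N ->
  \sum_(j < M) weight T M j ^+ 2 = M%:R * (T ^+ 2 / 12 * (1 - (M%:R ^+ 2)^-1)).
Proof.
move=> M0; have M0' : M%:R != 0 :> R by rewrite pnatr_eq0 -lt0n.
pose c : R := (M%:R - 1) / 2.
rewrite (eq_bigr (fun j : 'I_M => (T / M%:R) ^+ 2 * (c ^+ 2 - 2 * c * j%:R + j%:R ^+ 2))); last first.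
  by move=> j _; rewrite /weight -/c exprMn; congr (_ * _); ring.
rewrite -mulr_sumr big_split/= sumrB sumr_const card_ord -[_ *+ M]mulr_natl.
by rewrite -mulr_sumr sum_natr sum_natr_sqr /c; field.
Qed.

(** Abel summation. The right-hand side is a right-endpoint Riemann sum for the area;
    [T / (2 * M%:R)] is the correction due to the endpoint rule. *)
Lemma weight_incr T M (w : nat -> R) : (0 < M)%N -> w 0%N = 0 ->
  \sum_(j < M) weight T M j * (w j.+1 - w j) =
  T / M%:R * \sum_(j < M) w j.+1 - (T / 2 + T / (2 * M%:R)) * w M.
Proof.
move=> M0 w0; have M0' : M%:R != 0 :> R by rewrite pnatr_eq0 -lt0n.
have key (c : R) L : \sum_(j < L) (c - j%:R) * (w j.+1 - w j) = (c - L%:R) * w L + \sum_(j < L) w j.+1.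
  elim: L => [|L IH]; first by rewrite !big_ord0 w0 mulr0 addr0.
  by rewrite !big_ord_recr/= IH -[L.+1%:R]natr1; ring.
rewrite (eq_bigr (fun j : 'I_M => T / M%:R * (((M%:R - 1) / 2 - j%:R) * (w j.+1 - w j)))); last first.
  by move=> j _; rewrite /weight mulrA.
by rewrite -mulr_sumr key; field.
Qed.

End RiemannWeights.

Section IncrementLaw.
Context {R : realType} {d1 d2 : measure_display}.
Context {O1 : measurableType d1} {O2 : measurableType d2}.
Variables (P1 : probability O1 R) (P2 : probability O2 R) (T : R) (m : nat).
Variables (F1 : R -> set (set O1)) (F2 : R -> set (set O2)).
Variables (W1 : R -> O1 -> 'cV[R]_m) (W2 W3 : R -> O2 -> 'cV[R]_m).
Hypotheses (hF1 : filtration T F1) (hW1 : brownian_motion P1 T F1 W1) (hF2 : filtration T F2)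
 (hW2 : brownian_motion P2 T F2 W2) (hW3 : brownian_motion P2 T F2 W3)
 (hind : independent_processes P2 T W2 W3).
Variables (N : nat) (h : R).
Hypotheses (h0 : 0 < h) (NT : N%:R * h = T).

Local Notation gam n := (normal_prob 0 (Num.sqrt (h / n.+2%:R))).
Let fine_time n (k j : nat) : R := k%:R * h + j%:R * (h / n.+2%:R).

Let dn0 n : 0 < h / n.+2%:R. Proof. by rewrite divr_gt0// ltr0n. Qed.
Let hdn n : h = n.+2%:R * (h / n.+2%:R). Proof. by rewrite mulrC divfK// pnatr_eq0. Qed.
Let fine_end n k : fine_time n k n.+2 = k.+1%:R * h.
Proof. by rewrite /fine_time -hdn -natr1 mulrDl mul1r. Qed.
Let fine_start n k : fine_time n k 0 = k%:R * h.
Proof. by rewrite /fine_time mul0r addr0. Qed.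
Let fine_lt n k j : fine_time n k j < fine_time n k j.+1.
Proof. by rewrite /fine_time ltrD2l ltr_pM2r// ltr_nat. Qed.
Let fine_ge0 n k j : 0 <= fine_time n k j.
Proof. by rewrite addr_ge0// mulr_ge0// ltW. Qed.
Let fine_le n (k j : nat) : (k < N)%N -> (j <= n.+2)%N -> fine_time n k j <= T.
Proof.
move=> kN jn; apply: (@le_trans _ _ (fine_time n k n.+2)).
  by rewrite /fine_time lerD2l ler_wpM2r ?(ltW (dn0 _))// ler_nat.
by rewrite fine_end -NT ler_wpM2r ?(ltW h0)// ler_nat.
Qed.

(** Set to 0 beyond the last subcell, so that the family is indexed by all of [nat], as in
    [block_law]. *)
Let fincr (d : measure_display) (O : measurableType d) (W : R -> O -> 'cV[R]_m) n (b : 'I_N * 'I_m) (j : nat) (w : O) : R :=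
  if (j < n.+2)%N then incr W (fine_time n b.1 j) (fine_time n b.1 j.+1) b.2 w else 0.

Let fincr_sum (d : measure_display) (O : measurableType d) (W : R -> O -> 'cV[R]_m) n b w :
  \sum_(j < n.+2) fincr W n b j w = incr W (b.1%:R * h) (b.1.+1%:R * h) b.2 w.
Proof.
rewrite (eq_bigr (fun j : 'I_n.+2 => incr W (fine_time n b.1 j) (fine_time n b.1 j.+1) b.2 w)); last first.
  by move=> j _; rewrite /fincr ltn_ord.
rewrite -(big_mkord xpredT (fun j => incr W (fine_time n b.1 j) (fine_time n b.1 j.+1) b.2 w)).
by rewrite /incr (telescope_sumr (fun j => W (fine_time n b.1 j) w b.2 0))// fine_end fine_start.
Qed.

Let fincr_smeas (d : measure_display) (O : measurableType d) (P : probability O R)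
   (F : R -> set (set O)) (W : R -> O -> 'cV[R]_m) (hF : filtration T F) (hW : brownian_motion P T F W) n b j :
  mfT (fincr W n b j).
Proof.
have [jn|jn] := boolP (j < n.+2)%N; last first.
  by rewrite (_ : fincr W n b j = fun=> 0)//; apply/funext => w; rewrite /fincr (negbTE jn).
rewrite (_ : fincr W n b j = incr W (fine_time n b.1 j) (fine_time n b.1 j.+1) b.2); last first.
  by apply/funext => w; rewrite /fincr jn.
by apply: (meas_incr hF hW) => //; [exact: ltW|exact: fine_le].
Qed.

Let fincr_box (d : measure_display) (O : measurableType d) (P : probability O R)
   (F : R -> set (set O)) (W : R -> O -> 'cV[R]_m) (hF : filtration T F) (hW : brownian_motion P T F W) n
   (D : 'I_N * 'I_m -> nat -> set R) : (forall b i, measurable (D b i)) ->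
  P [set w | forall b i, (i < n.+2)%N -> D b i (fincr W n b i w)] =
  (\prod_b \prod_(i < n.+2) gam n (D b i))%E.
Proof.
move=> mD.
(* [insub] turns a family indexed by ordinals into one indexed by [nat]; the default [setT] imposes
   no condition. *)
pose D' (k j : nat) (i : 'I_m) : set R := if insub k is Some k' then D (k', i) j else setT.
have mD' k j i : measurable (D' k j i) by rewrite /D'; case: insubP.
have D'E (k : 'I_N) j i : D' k j i = D (k, i) j by rewrite /D' valK.
have := incr_cells hF hW (dn0 n) (hdn n) (ltn0Sn _) _ mD' (K := N); rewrite NT => /(_ (lexx _)) H.
transitivity (P [set w | forall k j i, (k < N)%N -> (j < n.+2)%N ->
     D' k j i (incr W (k%:R * h + j%:R * (h / n.+2%:R)) (k%:R * h + j.+1%:R * (h / n.+2%:R)) i w)]).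
  congr (P _); apply/seteqP; split => w /= H'.
    move=> k j i kN jn; have := H' (Ordinal kN, i) j jn.
    by rewrite /fincr jn (D'E (Ordinal kN)).
  move=> [k i] j jn; have := H' k j i (ltn_ord k) jn.
  by rewrite /fincr jn D'E.
rewrite H (eq_bigr (fun k : 'I_N => \prod_(i < m) \prod_(j < n.+2) gam n (D (k, i) j))%E).
  by rewrite pair_bigA/=; apply: eq_bigr => -[k i].
move=> k _; rewrite exchange_big/=; apply: eq_bigr => i _; apply: eq_bigr => j _.
by rewrite D'E.
Qed.

Let fincr_sigma (d : measure_display) (O : measurableType d) (W : R -> O -> 'cV[R]_m) n
   (D : 'I_N * 'I_m -> nat -> set R) : (forall b i, measurable (D b i)) ->
  sigma_process T W [set w | forall b i, (i < n.+2)%N -> D b i (fincr W n b i w)].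
Proof.
move=> mD.
have sS : sigma_algebra setT (sigma_process T W) by exact: smallest_sigma_algebra.
rewrite (_ : [set w | _] = [set w | forall p : ('I_N * 'I_m) * 'I_n.+2, D p.1 p.2 (fincr W n p.1 p.2 w)]); last first.
  apply/seteqP; split => w /= H; first by move=> [b i]; exact: H.
  by move=> b i ni; exact: (H (b, Ordinal ni)).
apply: (sigma_forall (A := fun p : ('I_N * 'I_m) * 'I_n.+2 => fincr W n p.1 p.2 @^-1` D p.1 p.2)) => // -[b j].
apply: smeas_set => //=.
rewrite (_ : fincr W n b j = fun w => W (fine_time n b.1 j.+1) w b.2 0 - W (fine_time n b.1 j) w b.2 0); last first.
  by apply/funext => w; rewrite /fincr ltn_ord.
have sW s : 0 <= s -> s <= T -> smeas (sigma_process T W) (fun w => W s w b.2 0).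
  move=> s0 sT; apply/smeasP => // B mB; apply: sub_sigma_algebra; exists (s, b.2) => /=.
  by split; [rewrite in_itv/= s0|exists B].
by apply: smeasB; apply: sW => //; apply: fine_le => //; exact: ltnW.
Qed.

(** The two Brownian motions of the limit as one family of blocks, the boolean selecting the
    motion. *)
Let fincr2 n (b : ('I_N * 'I_m) * bool) (j : nat) : O2 -> R :=
  if b.2 then fincr W3 n b.1 j else fincr W2 n b.1 j.

Let fincr2_box n (D : ('I_N * 'I_m) * bool -> nat -> set R) : (forall b i, measurable (D b i)) ->
  P2 [set w | forall b i, (i < n.+2)%N -> D b i (fincr2 n b i w)] =
  (\prod_b \prod_(i < n.+2) gam n (D b i))%E.
Proof.
move=> mD.
have -> : [set w | forall b i, (i < n.+2)%N -> D b i (fincr2 n b i w)] =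
  [set w | forall b i, (i < n.+2)%N -> D (b, false) i (fincr W2 n b i w)] `&`
  [set w | forall b i, (i < n.+2)%N -> D (b, true) i (fincr W3 n b i w)].
  apply/seteqP; split => w /=.
    by move=> H; split => b i ni; [exact: (H (b, false))|exact: (H (b, true))].
  by move=> [H1 H2] [b []] i ni; [exact: H2|exact: H1].
rewrite (hind (fincr_sigma _ (fun b i => mD (b, false) i)) (fincr_sigma _ (fun b i => mD (b, true) i))).
rewrite (fincr_box hF2 hW2 n (fun b i => mD (b, false) i)) (fincr_box hF2 hW3 n (fun b i => mD (b, true) i)).
rewrite -big_split/=.
rewrite (eq_bigr (fun b => \prod_(c : bool) \prod_(i < n.+2) gam n (D (b, c) i))%E); last first.
  by move=> b _; rewrite big_bool/= muleC.
by rewrite pair_bigA/=; apply: eq_bigr => -[b c].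
Qed.

Definition cell_incr (d : measure_display) (O : measurableType d) (W : R -> O -> 'cV[R]_m)
    (b : 'I_N * 'I_m) (w : O) : R := incr W (b.1%:R * h) (b.1.+1%:R * h) b.2 w.

Definition pairing (O : Type) (U V : 'I_N * 'I_m -> O -> R) (b : ('I_N * 'I_m) * bool) (w : O) : R :=
  if b.2 then V b.1 w else U b.1 w.

Let Z n (b : 'I_N * 'I_m) (w : O1) : R := \sum_(j < n.+2) weight T n.+2 j * fincr W1 n b j w.
(** The ratio between the deviation of a discretised area and that of the increment over its
    cell. *)
Let rad n : R := Num.sqrt (T ^+ 2 / 12 * (1 - (n.+2%:R ^+ 2)^-1)).

Let T0 : 0 <= T. Proof. by rewrite -NT mulr_ge0// ltW. Qed.

Let rad_sqr n : rad n ^+ 2 = T ^+ 2 / 12 * (1 - (n.+2%:R ^+ 2)^-1).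
Proof.
rewrite sqr_sqrtr// mulr_ge0 ?divr_ge0 ?sqr_ge0// subr_ge0 invf_le1 ?exprn_gt0 ?ltr0n//.
by rewrite exprn_ege1// ler1n.
Qed.

(** Both sides are expressed through the independent normal variables of [block_law]: increment and
    area of each cell on the first space, increments of [W2] and [W3] on the second. *)
Let weight_rect n (A : ('I_N * 'I_m) * bool -> set R) : (forall b, measurable (A b)) ->
  P1 [set w | forall b, A b (pairing (cell_incr W1) (Z n) b w)] =
  P2 [set w | forall b, A b (pairing (cell_incr W2) (fun b w => rad n * cell_incr W3 b w) b w)].
Proof.
move=> mA; have M0 : 0 < n.+2%:R :> R by rewrite ltr0n.
set p := Num.sqrt n.+2%:R : R.
have p0 : 0 < p by rewrite sqrtr_gt0.
have p2 : p ^+ 2 = n.+2%:R by rewrite sqr_sqrtr// ltW.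
have gs : 0 < Num.sqrt (h / n.+2%:R) by rewrite sqrtr_gt0.
have a10 : weight T n.+2 1 <= weight T n.+2 0.
  by rewrite /weight ler_wpM2l ?divr_ge0//; lra.
have [X [Y [q [r [[mXY [r0 SX] AXY qr qs] XYlaw]]]]] :=
  block_law gs (fun b j => fincr_smeas hF1 hW1 n b j) a10 (fincr_box hF1 hW1 n).
have q0 : q = 0.
  by apply/eqP; move: qs; rewrite weight_sum => /eqP; rewrite mulf_eq0 (gt_eqF p0) orbF.
have rE : r = rad n * p.
  apply/eqP; rewrite -(eqrXn2 (n := 2))// ?mulr_ge0 ?sqrtr_ge0//; apply/eqP.
  by rewrite exprMn rad_sqr p2; move: qr; rewrite q0 expr0n add0r weight_sum_sqr// mulrC.
have mf2 b j : mfT (fincr2 n b j).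
  by case: b => b [] /=; [exact: (fincr_smeas hF2 hW3)|exact: (fincr_smeas hF2 hW2)].
(* Null weights: on the second space only the sums over the cells are wanted. *)
have [X' [Y' [q' [r' [[mXY' [_ SX'] _ _ _] XYlaw']]]]] :=
  block_law gs mf2 (lexx _ : (fun=> 0 : R) 1%N <= (fun=> 0 : R) 0%N) (@fincr2_box n).
have mscal (c : R) B : measurable B -> measurable [set x : R | B (c * x)].
  move=> mB; have : mfT (fun x : R => c * x) by exact: measurable_funM.
  by move=> /(_ measurableT _ mB); rewrite setTI.
pose AX b := [set x | A (b, false) (p * x)]; pose AY b := [set x | A (b, true) (rad n * p * x)].
transitivity (P1 [set w | forall b, AX b (X b w) /\ AY b (Y b w)]).
  congr (P1 _); apply/seteqP; split => w /= H.
    move=> b; have := H (b, false); have := H (b, true); rewrite /pairing/= /Z AXY q0 mul0r add0r rE.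
    by rewrite /cell_incr -(fincr_sum _ n) SX.
  move=> [b []]; have [H1 H2] := H b; rewrite /pairing/=.
    by rewrite /Z AXY q0 mul0r add0r rE.
  by rewrite /cell_incr -(fincr_sum _ n) SX.
rewrite XYlaw; [|by move=> b; exact: mscal|by move=> b; exact: mscal].
transitivity (P2 [set w | forall b : ('I_N * 'I_m) * bool, (if b.2 then AY b.1 else AX b.1) (X' b w) /\ setT (Y' b w)]); last first.
  congr (P2 _); apply/seteqP; split => w /= H.
    move=> [b c]; have [+ _] := H (b, c); have := SX' (b, c) w; rewrite /pairing/=.
    case: c => /= E; rewrite /cell_incr -(fincr_sum _ n) /=; rewrite /fincr2/= in E; rewrite E//.
    by rewrite /AY/= mulrA.
  move=> [b c]; split => //; have := H (b, c); have := SX' (b, c) w; rewrite /pairing/=.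
  case: c => /= E; rewrite /cell_incr -(fincr_sum _ n) /=; rewrite /fincr2/= in E; rewrite E//.
  by rewrite /AY/= mulrA.
rewrite (XYlaw' (fun b => if b.2 then AY b.1 else AX b.1) (fun=> setT)) => [|b|//]; last first.
  by case: ifP => _; exact: mscal.
rewrite (eq_bigr (fun b => \prod_(c : bool) normal_prob 0 (Num.sqrt (h / n.+2%:R)) (if c then AY b else AX b))%E); last first.
  by move=> b _; rewrite big_bool/= muleC.
rewrite pair_bigA/=; apply: eq_bigr => -[b c] _ /=.
by rewrite probability_setT mule1.
Qed.

Hypothesis cW1 : forall w i, continuous (fun s => W1 s w i 0).

Definition cell_area (b : 'I_N * 'I_m) (w : O1) : R :=
  N%:R * itg (b.1%:R * h) (b.1.+1%:R * h) (fun s => incr W1 (b.1%:R * h) s b.2 w) - T / 2 * cell_incr W1 b w.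

(* The variance of an area is [T ^+ 2 / 12] per unit of time, the square of
   [Num.sqrt 3 / 6 * T]. *)
Lemma increment_law (g : (('I_N * 'I_m) * bool -> R) -> R) (C : R) :
  seq_continuous g -> (forall u, `|g u| <= C) ->
  Ex P1 (fun w => g (fun b => pairing (cell_incr W1) cell_area b w)) =
  Ex P2 (fun w => g (fun b => pairing (cell_incr W2) (fun b w => Num.sqrt 3 / 6 * T * cell_incr W3 b w) b w)).
Proof.
move=> cg gC.
have mcell (d : measure_display) (O : measurableType d) (P : probability O R)
   (F : R -> set (set O)) (W : R -> O -> 'cV[R]_m) : filtration T F -> brownian_motion P T F W ->
   forall b, mfT (cell_incr W b).
  move=> hF hW b; apply: (meas_incr hF hW).
  - by rewrite mulr_ge0// ltW.
  - by rewrite ler_wpM2r ?ltW// ltr_nat.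
  - by rewrite -NT ler_wpM2r ?(ltW h0)// ler_nat.
have mZ n b : mfT (Z n b).
  by apply: measurable_sum => j; apply: measurable_funM => //; exact: (fincr_smeas hF1 hW1).
have eqn n : Ex P1 (fun w => g (fun b => pairing (cell_incr W1) (Z n) b w)) =
    Ex P2 (fun w => g (fun b => pairing (cell_incr W2) (fun b w => rad n * cell_incr W3 b w) b w)).
  apply: (seq_continuous_law cg gC) => //; last exact: weight_rect.
    by move=> [b []]; rewrite /pairing/=; [exact: mZ|exact: mcell hF1 hW1 _].
  move=> [b []]; rewrite /pairing/=; last exact: mcell hF2 hW2 _.
  by apply: measurable_funM => //; exact: mcell hF2 hW3 _.
have mg (d : measure_display) (O : measurableType d) (Y : ('I_N * 'I_m) * bool -> O -> R) :
    (forall b, mfT (Y b)) -> mfT (fun w => g (Y ^~ w)).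
  move=> mY; apply: (@smeas_meas _ _ _ measurable) => //.
  by apply: (smeas_seq_continuous cg) => b; exact: meas_smeas.
have M0 n : n.+2%:R != 0 :> R by rewrite pnatr_eq0.
have inv0 : (fun n => n.+2%:R^-1) @ \oo --> (0 : R).
  have := @cvg_harmonic R; rewrite -(cvg_shiftS _ _).
  by apply: cvg_trans; apply: near_eq_cvg; apply: nearW => n.
(* The discretised areas are Riemann sums, so they converge path by path. *)
have cZ b w : (fun n => Z n b w) @ \oo --> cell_area b w.
  pose f s := incr W1 (b.1%:R * h) s b.2 w.
  have cf : continuous f by move=> s; apply: cvgB; [exact: cW1|exact: cvg_cst].
  have t01 : b.1%:R * h <= b.1.+1%:R * h by rewrite ler_wpM2r ?ltW// ltr_nat.
  have ZE n : Z n b w = N%:R * rsum (b.1%:R * h) (b.1.+1%:R * h) n.+1 f - (T / 2 + T / 2 * n.+2%:R^-1) * cell_incr W1 b w.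
    rewrite /Z (eq_bigr (fun j : 'I_n.+2 => weight T n.+2 j * (f (fine_time n b.1 j.+1) - f (fine_time n b.1 j)))); last first.
      by move=> j _; rewrite /fincr ltn_ord /f /incr; congr (_ * _); ring.
    rewrite (@weight_incr _ T n.+2 (fun j => f (fine_time n b.1 j)))//; last first.
      by rewrite /f fine_start incr_self.
    rewrite fine_end /rsum (_ : b.1.+1%:R * h - b.1%:R * h = h); last by rewrite -natr1; ring.
    rewrite mulrA (_ : N%:R * (h / n.+2%:R) = T / n.+2%:R); last by rewrite mulrA NT.
    rewrite (_ : T / (2 * n.+2%:R) = T / 2 * n.+2%:R^-1)//; by field.
  rewrite (_ : (fun n => Z n b w) = (fun n => N%:R * rsum (b.1%:R * h) (b.1.+1%:R * h) n.+1 f - (T / 2 + T / 2 * n.+2%:R^-1) * cell_incr W1 b w)); last by apply/funext.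
  apply: cvgB.
    apply: cvgM; first exact: cvg_cst.
    have := rsum_cvg t01 cf; rewrite -(cvg_shiftS _ _); exact.
  apply: cvgM; last exact: cvg_cst.
  rewrite -[X in _ --> X]addr0; apply: cvgD; first exact: cvg_cst.
  by rewrite -[X in _ --> X](mulr0 (T / 2)); apply: cvgM => //; exact: cvg_cst.
have crad : rad @ \oo --> Num.sqrt 3 / 6 * T.
  rewrite (_ : Num.sqrt 3 / 6 * T = Num.sqrt (T ^+ 2 / 12 * (1 - 0 ^+ 2))); last first.
    have c0 : 0 <= Num.sqrt 3 / 6 * T by rewrite mulr_ge0// divr_ge0// sqrtr_ge0.
    rewrite -[LHS](ger0_norm c0) -sqrtr_sqr; congr (Num.sqrt _).
    by rewrite !exprMn sqr_sqrtr//; field.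
  apply: (cvg_comp (fun n => T ^+ 2 / 12 * (1 - (n.+2%:R ^+ 2)^-1)) Num.sqrt); last exact: sqrt_continuous.
  apply: cvgM; first exact: cvg_cst.
  apply: cvgB; first exact: cvg_cst.
  rewrite (_ : (fun n => _) = (fun n => (n.+2%:R^-1 : R) ^+ 2)); first exact: cvg_sqr.
  by apply/funext => n; rewrite exprVn.
have lim1 : (fun n => Ex P1 (fun w => g (fun b => pairing (cell_incr W1) (Z n) b w))) @ \oo -->
   Ex P1 (fun w => g (fun b => pairing (cell_incr W1) cell_area b w)).
  apply: (Ex_bounded_cvg (C := C)) => // [n|w].
    by apply: mg => -[b []]; rewrite /pairing/=; [exact: mZ|exact: mcell hF1 hW1 _].
  by apply: cg => -[b []]; rewrite /pairing/=; [exact: cZ|exact: cvg_cst].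
have lim2 : (fun n => Ex P2 (fun w => g (fun b => pairing (cell_incr W2) (fun b w => rad n * cell_incr W3 b w) b w))) @ \oo -->
   Ex P2 (fun w => g (fun b => pairing (cell_incr W2) (fun b w => Num.sqrt 3 / 6 * T * cell_incr W3 b w) b w)).
  apply: (Ex_bounded_cvg (C := C)) => // [n|w].
    apply: mg => -[b []]; rewrite /pairing/=; last exact: mcell hF2 hW2 _.
    by apply: measurable_funM => //; exact: mcell hF2 hW3 _.
  apply: cg => -[b []]; rewrite /pairing/=; last exact: cvg_cst.
  by apply: cvgM => //; exact: cvg_cst.
apply: (cvg_unique _ lim1) => //; apply: cvg_trans lim2; apply: near_eq_cvg; apply: nearW => n.
exact/esym/eqn.
Qed.

End IncrementLaw.

(** * Ito integrals *)

Section UniformLimit.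
Context {R : realType}.
Local Notation half k := ((2^-1 : R) ^+ k).

Lemma half_gt0 k : 0 < half k. Proof. by rewrite exprn_gt0// invr_gt0. Qed.

Lemma half_cvg0 : (fun k => half k) @ \oo --> (0 : R).
Proof. by apply: cvg_expr; rewrite ger0_norm ?invr_ge0// invf_lt1// ltr1n. Qed.

Lemma half_sum K : \sum_(k < K) half k = 2 - 2 * half K.
Proof.
elim: K => [|K IH]; first by rewrite big_ord0 expr0; ring.
by rewrite big_ord_recr/= IH exprS; field.
Qed.

Variables (f : nat -> R -> R) (k0 : nat) (C : R).
Hypotheses (C0 : 0 <= C) (cf : forall k, continuous (f k))
 (fC : forall k t, (k0 <= k)%N -> `|f k.+1 t - f k t| <= C * half k).

Let step k j t : (k0 <= k)%N -> `|f (k + j) t - f k t| <= C * (2 * half k - 2 * half (k + j)).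
Proof.
move=> k0k; elim: j => [|j IH]; first by rewrite addn0 !subrr normr0 mulr0.
rewrite addnS (_ : f (k + j).+1 t - f k t = (f (k + j).+1 t - f (k + j)%N t) + (f (k + j)%N t - f k t)); last by ring.
apply: le_trans (ler_normD _ _) _; apply: le_trans (lerD (fC t _) IH) _.
  by rewrite (leq_trans k0k)// leq_addr.
by rewrite -mulrDr ler_wpM2l// exprS; set u := half (k + j); set v := half k; lra.
Qed.

Let step2 k j t : (k0 <= k)%N -> (k <= j)%N -> `|f j t - f k t| <= C * (2 * half k).
Proof.
move=> k0k kj; rewrite -(subnKC kj); apply: le_trans (step _ _ k0k) _.
by rewrite ler_wpM2l// lerBlDr lerDl mulr_ge0// ltW// half_gt0.
Qed.

Let cvg_half (c : R) : (fun k => c * half k) @ \oo --> (0 : R).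
Proof. by rewrite -(mulr0 c); apply: cvgM; [exact: cvg_cst|exact: half_cvg0]. Qed.

Lemma unif_limit_cvg t : f ^~ t @ \oo --> limn (f ^~ t).
Proof.
apply: cauchy_cvg; apply/cauchy_exP => e e0.
near \oo => k.
have k0k : (k0 <= k)%N by near: k; exact: nbhs_infty_ge.
have ke : C * 2 * half k < e.
  near: k; have /cvgrPdist_lt/(_ e e0) := cvg_half (C * 2).
  by apply: filterS => k; rewrite sub0r normrN; apply: le_lt_trans; exact: ler_norm.
exists (f k t); exists k => // j /= kj.
by rewrite -ball_normE /ball_/= distrC (le_lt_trans (step2 t k0k kj))// mulrA.
Unshelve. all: by end_near. Qed.

Lemma unif_limit_dist k t : (k0 <= k)%N -> `|limn (f ^~ t) - f k t| <= C * (2 * half k).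
Proof.
move=> k0k; apply: (@cvg_le_cst _ (fun j => `|f (k + j)%N t - f k t|)); last first.
  by move=> j; apply: step2 => //; exact: leq_addr.
apply: cvg_norm; apply: cvgB; last exact: cvg_cst.
have := @unif_limit_cvg t; rewrite -(cvg_shiftn k).
by apply: cvg_trans; apply: near_eq_cvg; apply: nearW => j; rewrite addnC.
Qed.

Lemma unif_limit_continuous : continuous (fun t => limn (f ^~ t)).
Proof.
move=> t; apply/cvgrPdist_le => e e0.
near \oo => k.
have k0k : (k0 <= k)%N by near: k; exact: nbhs_infty_ge.
have ke : C * 2 * half k < e / 3.
  near: k; have /cvgrPdist_lt/(_ (e / 3)) := cvg_half (C * 2).
  by rewrite divr_gt0// => /(_ isT); apply: filterS => k; rewrite sub0r normrN; apply: le_lt_trans; exact: ler_norm.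
have /cvgrPdist_le/(_ (e / 3)) := @cf k t; rewrite divr_gt0// => /(_ isT); apply: filterS => s fs.
have D1 := unif_limit_dist t k0k; have D2 := unif_limit_dist s k0k.
rewrite (_ : _ - _ = (limn (f ^~ t) - f k t) + (f k t - f k s) - (limn (f ^~ s) - f k s)); last by ring.
apply: le_trans (ler_normB _ _) _; apply: le_trans (lerD (ler_normD _ _) (lexx _)) _.
move: fs D1 D2 ke; rewrite mulrA; lra.
Unshelve. all: by end_near. Qed.

End UniformLimit.

Lemma continuous_bigsum (R : realType) (I : Type) (r : seq I) (f : I -> R -> R) :
  (forall i, continuous (f i)) -> continuous (fun t => \sum_(i <- r) f i t).
Proof.
move=> cf; elim: r => [|i r IH] t.
  by rewrite (_ : (fun t => _) = fun=> 0); [exact: cvg_cst|apply/funext => s; rewrite big_nil].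
rewrite (_ : (fun t => _) = (fun t => f i t + \sum_(i <- r) f i t)); last by apply/funext => s; rewrite big_cons.
by apply: cvgD; [exact: cf|exact: IH].
Qed.

Section ItoSums.
Context {R : realType} {disp : measure_display} {O : measurableType disp}.
Variables (P : probability O R) (T : R) (F : R -> set (set O)) (m : nat).
Variables (W : R -> O -> 'cV[R]_m) (i : 'I_m).
Hypotheses (T0 : 0 < T) (hF : filtration T F) (hW : brownian_motion P T F W)
 (cW : forall w i, continuous (fun s => W s w i 0)).
Variables (Phi : R -> O -> R) (K : R).
Hypotheses (aPhi : forall t, 0 <= t -> t <= T -> smeas (F t) (Phi t)) (K0 : 0 <= K)
 (KPhi : forall s t, 0 <= s -> s <= t -> t <= T ->
  Eb P (fun w => (Phi t w - Phi s w) ^+ 2) (K * (t - s))).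

Definition ito_sum (N : nat) (t : R) (w : O) : R :=
  \sum_(k < N) Phi (k%:R * (T / N%:R)) w *
    (W (Num.min (k.+1%:R * (T / N%:R)) t) w i 0 - W (Num.min (k%:R * (T / N%:R)) t) w i 0).

Lemma ito_sum_continuous N w : continuous (fun t => ito_sum N t w).
Proof.
have c a : continuous (fun t => W (Num.min a t) w i 0).
  move=> t; apply: (@continuous_comp _ _ _ (fun t => Num.min a t) (fun s => W s w i 0)); last exact: cW.
  by apply: (@continuous_min _ _ (fun=> a) id); [exact: cst_continuous|exact: cvg_id].
move=> t; rewrite /ito_sum.
apply: continuous_bigsum => k {}t; apply: cvgM; first exact: cvg_cst.
by apply: cvgB; exact: c.
Qed.

Let grid (N : nat) (k : nat) : R := k%:R * (T / N%:R).

Let grid_le N k : (0 < N)%N -> (k <= N)%N -> grid N k <= T.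
Proof.
move=> N0 kN; rewrite /grid mulrCA ler_piMr ?(ltW T0)//.
by rewrite ler_pdivrMr ?ltr0n// mul1r ler_nat.
Qed.

Let grid_ge0 N k : 0 <= grid N k.
Proof. by rewrite mulr_ge0// divr_ge0// ltW. Qed.

Let grid_mono N j k : (j <= k)%N -> grid N j <= grid N k.
Proof. by move=> jk; rewrite ler_wpM2r ?divr_ge0 ?(ltW T0)// ler_nat. Qed.

Let grid_refine N M k : (0 < M)%N -> grid (N * M) (k * M) = grid N k.
Proof.
move=> M0; rewrite /grid !natrM; have [->|N0] := posnP N; first by rewrite mul0r !invr0 !mulr0.
have M' : M%:R != 0 :> R by rewrite pnatr_eq0 -lt0n.
have N' : N%:R != 0 :> R by rewrite pnatr_eq0 -lt0n.
by field; rewrite M' N'.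
Qed.

(** The coarse sum read on a grid [M] times finer: the fine cell [q] lies in the coarse cell
    [q %/ M], and increments telescope. *)
Lemma ito_sum_refine N M t w : (0 < M)%N ->
  ito_sum N t w = \sum_(q < N * M) Phi (grid N (q %/ M)) w *
    (W (Num.min (grid (N * M) q.+1) t) w i 0 - W (Num.min (grid (N * M) q) t) w i 0).
Proof.
move=> M0; rewrite -(big_mkord xpredT (fun q => Phi (grid N (q %/ M)) w *
    (W (Num.min (grid (N * M) q.+1) t) w i 0 - W (Num.min (grid (N * M) q) t) w i 0))).
rewrite big_nat_mul /ito_sum big_mkord; apply: eq_bigr => k _.
rewrite (@eq_big_nat _ _ _ _ _ _ (fun q => Phi (grid N k) w *
    (W (Num.min (grid (N * M) q.+1) t) w i 0 - W (Num.min (grid (N * M) q) t) w i 0))); last first.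
  move=> q /andP[q1 q2]; congr (Phi (grid N _) w * _).
  apply/eqP; rewrite eqn_leq -ltnS ltn_divLR// q2 /= leq_divRL//.
rewrite -mulr_sumr (telescope_sumr (fun q => W (Num.min (grid (N * M) q) t) w i 0)); last first.
  by rewrite leq_mul2r leqnSn orbT.
by rewrite !grid_refine.
Qed.

Section Compare.
Variables (N M1 M2 : nat).
Hypotheses (N0 : (0 < N)%N) (M10 : (0 < M1)%N) (M20 : (0 < M2)%N).
(** The grids with [N] and [N * M1] cells are compared on a common one; the factor [M2] refines it
    at will without changing the two sums, so that a supremum over times can be approached. *)
Let Q := (N * M1 * M2)%N.
Let Q0 : (0 < Q)%N. Proof. by rewrite !muln_gt0 N0 M10. Qed.
(** Grid times capped at [T], so that every index gives a time of the filtration. *)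
Let u q := Num.min (grid Q q) T.

Let A q w := if (q < Q)%N then Phi (grid N (q %/ (M1 * M2))) w - Phi (grid (N * M1) (q %/ M2)) w else 0.

Let uE q : (q <= Q)%N -> u q = grid Q q.
Proof. by move=> qQ; rewrite /u minEle grid_le. Qed.

Let u_ge0 q : 0 <= u q. Proof. by rewrite le_min grid_ge0 ltW. Qed.
Let u_le q : u q <= T. Proof. by rewrite ge_min lexx orbT. Qed.
Let uS q : u q <= u q.+1. Proof. by rewrite le_min u_le andbT ge_min grid_mono. Qed.
Let u_mono a b : (a <= b)%N -> u a <= u b.
Proof. by move=> ab; rewrite le_min u_le andbT ge_min grid_mono. Qed.
Let uS_sub q : u q.+1 - u q <= T / Q%:R.
Proof.
have := @grid_mono Q q q.+1 (leqnSn q); have : grid Q q.+1 = grid Q q + T / Q%:R.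
  by rewrite /grid -natr1 mulrDl mul1r.
rewrite /u; set a := grid Q q; set b := grid Q q.+1 => -> ab.
by move: (T / Q%:R) ab => c ab; rewrite !minEle; case: (leP (a + c) T) => ?; case: (leP a T) => ?; lra.
Qed.

Let coarse q : (q < Q)%N -> 0 <= grid N (q %/ (M1 * M2)) /\
  grid N (q %/ (M1 * M2)) <= grid (N * M1) (q %/ M2) /\ grid (N * M1) (q %/ M2) <= u q /\
  grid (N * M1) (q %/ M2) - grid N (q %/ (M1 * M2)) <= T / N%:R.
Proof.
move=> qQ; rewrite uE ?(ltnW qQ)//; split; first exact: grid_ge0.
have E : (q %/ (M1 * M2) = q %/ M2 %/ M1)%N by rewrite -divnMA mulnC.
rewrite -(grid_refine N _ M10) E; split; first by apply: grid_mono; exact: leq_divM.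
split; first by rewrite -(grid_refine (N * M1) _ M20); apply: grid_mono; exact: leq_divM.
set r := (q %/ M2)%N.
apply: (@le_trans _ _ (grid (N * M1) ((r %/ M1).+1 * M1) - grid (N * M1) (r %/ M1 * M1))).
  by rewrite lerB// grid_mono// ltnW// ltn_ceil.
by rewrite !grid_refine// /grid -natr1; lra.
Qed.

Let GF q := F (u q).
Let GFs q : sigma_algebra setT (GF q). Proof. exact: (filt_sigma hF). Qed.
Let GFm q : GF q `<=` measurable. Proof. exact: (filt_meas hF). Qed.
Let GFmono q : GF q `<=` GF q.+1. Proof. exact: (filt_mono hF). Qed.

Let mA q : smeas (GF q) (A q).
Proof.
rewrite /A; have [qQ|_] := ltnP q Q; last exact: smeas_cst.
have [a0 [ab [bu _]]] := coarse qQ.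
apply: smeasB; [apply: smeasS (aPhi a0 _)|apply: smeasS (aPhi (le_trans a0 ab) _)].
- exact: (filt_mono hF a0 (le_trans ab bu)).
- exact: le_trans (le_trans ab bu) (u_le _).
- exact: (filt_mono hF (le_trans a0 ab) bu).
- exact: le_trans bu (u_le _).
Qed.

Let AE q : Eb P (fun w => A q w ^+ 2) (K * (T / N%:R)).
Proof.
have TN : 0 <= K * (T / N%:R) by rewrite mulr_ge0// divr_ge0// ltW.
rewrite /A; have [qQ|_] := ltnP q Q; last first.
  by apply: Eb_weak TN _; apply: Eb_ext (Eb_cst P (lexx 0)) => w; rewrite expr0n.
have [a0 [ab [bu ba]]] := coarse qQ.
apply: (@Eb_weak _ _ _ _ (K * (grid (N * M1) (q %/ M2) - grid N (q %/ (M1 * M2))))).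
  by rewrite ler_wpM2l.
apply: Eb_ext (KPhi a0 ab (le_trans bu (u_le _))) => w.
by rewrite -sqrrN opprB.
Qed.

Let phi t q w := incr W (Num.min (u q) t) (Num.min (u q.+1) t) i w.

Let phiP t q : 0 <= t -> t <= T -> (t <= u q /\ phi t q = fun=> 0) \/
  (phi t q = incr W (u q) (Num.min (u q.+1) t) i /\ u q <= Num.min (u q.+1) t /\ Num.min (u q.+1) t <= u q.+1).
Proof.
move=> t0 tT; have [tu|ut] := leP t (u q); [left|right].
  split => //; apply/funext => w; rewrite /phi !minEge tu (le_trans tu (uS q)).
  exact: incr_self.
have -> : phi t q = incr W (u q) (Num.min (u q.+1) t) i.
  by apply/funext => w; rewrite /phi [Num.min (u q) t]minEle (ltW ut).
by rewrite le_min uS (ltW ut) ge_min lexx.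
Qed.

Let phi_meas t q : 0 <= t -> t <= T -> smeas (GF q.+1) (phi t q).
Proof.
move=> t0 tT; have [[_ ->]|[-> [le1 le2]]] := phiP q t0 tT; first exact: smeas_cst.
apply: smeasS (smeas_incr hF hW i (u_ge0 q) le1 (le_trans le2 (u_le _))).
exact: (filt_mono hF (le_trans (u_ge0 q) le1) le2).
Qed.

Let phi_indep t q : 0 <= t -> t <= T -> indep_of P (GF q) (phi t q).
Proof.
move=> t0 tT; have [[_ ->]|[-> [le1 le2]]] := phiP q t0 tT; first exact: indep_of_cst.
exact: (incr_indep hF hW i (u_ge0 q) le1 (le_trans le2 (u_le _))).
Qed.

Let phi_mean t q : 0 <= t -> t <= T -> Ex P (phi t q) = 0.
Proof.
move=> t0 tT; have [[_ ->]|[-> [le1 le2]]] := phiP q t0 tT; first exact: Ex_cst.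
exact: (incr_mean hF hW i (u_ge0 q) le1 (le_trans le2 (u_le _))).
Qed.

Let phi_sqr t q : 0 <= t -> t <= T -> Eb P (fun w => phi t q w ^+ 2) (T / Q%:R).
Proof.
have TQ : 0 <= T / Q%:R by rewrite divr_ge0// ltW.
move=> t0 tT; have [[_ ->]|[-> [le1 le2]]] := phiP q t0 tT.
  by apply: Eb_weak TQ _; apply: Eb_ext (Eb_cst P (lexx 0)) => w; rewrite expr0n.
apply: Eb_weak (incr_sqr hF hW i (u_ge0 q) le1 (le_trans le2 (u_le _))).
by apply: le_trans (uS_sub q); rewrite lerB.
Qed.

Let diffE t w : 0 <= t -> t <= T ->
  ito_sum N t w - ito_sum (N * M1) t w = mtrans A (phi t) Q w.
Proof.
move=> t0 tT; rewrite (@ito_sum_refine N (M1 * M2))// ?muln_gt0 ?M10// (@ito_sum_refine (N * M1) M2)//.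
rewrite mulnA -/Q -sumrB /mtrans; apply: eq_bigr => q _.
rewrite -mulrBl; congr (_ * _); first by rewrite /A ltn_ord.
have minT x : Num.min (Num.min x T) t = Num.min x t by rewrite -minA [Num.min T t]minEge tT.
by rewrite /phi /incr /u !minT.
Qed.

(** The difference is a martingale transform on the common grid: the integrands differ by at most
    [K T / N] in mean square and the increments have total variance at most [T]. *)
Lemma ito_sum_sqr t : 0 <= t -> t <= T ->
  Eb P (fun w => (ito_sum N t w - ito_sum (N * M1) t w) ^+ 2) (K * T ^+ 2 / N%:R).
Proof.
move=> t0 tT.
have H := @mtrans_sqr _ _ _ P GF GFs GFm GFmono A (phi t) (fun=> K * (T / N%:R)) (fun=> T / Q%:R) mA
  (fun q => phi_meas q t0 tT) (fun q => @phi_indep t q t0 tT) (fun q => phi_mean q t0 tT) AE (fun q => phi_sqr q t0 tT) Q.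
apply: (Eb_weak _ (Eb_ext _ H)); last by move=> w /=; rewrite diffE.
rewrite sumr_const card_ord -[_ *+ Q]mulr_natl le_eqVlt; apply/orP; left; apply/eqP.
by field; rewrite !pnatr_eq0 -!lt0n N0 Q0.
Qed.

Lemma ito_sum_max (lam : R) : 0 < lam ->
  Eb P (\1_[set w | exists2 j, (j <= Q)%N & lam <= `|ito_sum N (grid Q j) w - ito_sum (N * M1) (grid Q j) w|])
    (K * T ^+ 2 / N%:R / lam ^+ 2).
Proof.
move=> lam0; have TT := lexx T; have T0' := ltW T0.
have H := @kolmogorov_max _ _ _ P GF GFs GFm GFmono A (phi T) (fun=> K * (T / N%:R)) (fun=> T / Q%:R) mA
  (fun q => phi_meas q T0' TT) (fun q => @phi_indep T q T0' TT) (fun q => phi_mean q T0' TT) AE (fun q => phi_sqr q T0' TT) lam Q lam0.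
(* The sum stopped at a grid time is a partial sum of the transform, because later increments
   vanish. *)
have E j w : (j <= Q)%N -> ito_sum N (grid Q j) w - ito_sum (N * M1) (grid Q j) w = mtrans A (phi T) j w.
  move=> jQ; rewrite diffE ?grid_ge0 ?grid_le//.
  rewrite /mtrans -(big_mkord xpredT (fun q => A q w * phi (grid Q j) q w)) (@big_cat_nat _ _ _ j)//=.
  rewrite [X in _ + X]big_nat [X in _ + X]big1 ?addr0; last first.
    move=> q /andP[jq _]; rewrite (_ : phi _ _ _ = 0) ?mulr0//.
    have ju : grid Q j <= u q by rewrite -(uE jQ) u_mono.
    by rewrite /phi !minEge ju (le_trans ju (uS q)) incr_self.
  rewrite big_mkord; apply: eq_bigr => q _; congr (_ * _).
  have jq := ltn_ord q.
  rewrite /phi ![Num.min _ T]minEle !u_le ![Num.min _ (grid Q j)]minEle -(uE jQ).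
  by rewrite (u_mono jq) (u_mono (ltnW jq)).
apply: (Eb_weak _ (Eb_ext _ H)).
  rewrite ler_wpM2r ?invr_ge0 ?sqr_ge0// sumr_const card_ord -[_ *+ Q]mulr_natl le_eqVlt; apply/orP; left; apply/eqP.
  by field; rewrite !pnatr_eq0 -!lt0n N0 Q0.
move=> w; rewrite !indicE; congr (_ %:R); congr (nat_of_bool _); apply/idP/idP; rewrite !inE/=.
  by move=> [j jQ le]; exists j => //; rewrite E.
by move=> [j jQ le]; exists j => //; rewrite -E.
Qed.

End Compare.

Lemma ito_sum_meas N t : 0 <= t -> t <= T -> mfT (ito_sum N t).
Proof.
move=> t0 tT; have [->|N0] := posnP N.
  by rewrite (_ : ito_sum 0 t = fun=> 0)//; apply/funext => w; rewrite /ito_sum big_ord0.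
apply: measurable_sum => k; apply: measurable_funM.
  have kT := grid_le N0 (ltnW (ltn_ord k)).
  exact: smeas_meas (filt_meas hF (grid_ge0 _ _) kT) (aPhi (grid_ge0 _ _) kT).
have mW a : 0 <= a -> mfT (fun w => W (Num.min a t) w i 0).
  move=> a0; have b0 : 0 <= Num.min a t by rewrite le_min a0.
  have bT : Num.min a t <= T by rewrite ge_min tT orbT.
  exact: smeas_meas (filt_meas hF b0 bT) (smeas_W hF hW i b0 (lexx _) bT).
by apply: measurable_funB; apply: mW; exact: grid_ge0.
Qed.

(** With [8^k] cells and the threshold [2^-k], the maximal inequality gives a probability of order
    [8^-k / 4^-k = 2^-k], which is summable. *)
Let Np k := (8 ^ k)%N.
Let lam k : R := (2^-1) ^+ k.
Let Np0 k : (0 < Np k)%N. Proof. by rewrite expn_gt0. Qed.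

Let clampP t : exists2 t', 0 <= t' <= T & forall N w, (0 < N)%N -> ito_sum N t w = ito_sum N t' w.
Proof.
have [t0|t0] := leP 0 t; last first.
  exists 0; first by rewrite lexx ltW.
  move=> N w N0; rewrite /ito_sum !big1// => k _.
    by rewrite ![Num.min _ 0]minEge !grid_ge0 subrr mulr0.
  by rewrite ![Num.min _ t]minEge !(le_trans (ltW t0) (grid_ge0 _ _)) subrr mulr0.
have [tT|tT] := leP t T; first by exists t; rewrite ?t0.
exists T; first by rewrite lexx ltW.
move=> N w N0; apply: eq_bigr => k _.
rewrite ![Num.min _ t]minEle ![Num.min _ T]minEle.
by rewrite !(le_trans (grid_le N0 _) (ltW tT))// ?grid_le// ltnW.
Qed.

Let D k t w := ito_sum (Np k) t w - ito_sum (Np k.+1) t w.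
(** The deviation is tested on a grid of [8 ^ (k + 1 + p)] cells; these events increase with [p]. *)
Let bad k p : set O := [set w | exists2 j, (j <= Np (k.+1 + p))%N & lam k <= `|D k (grid (Np (k.+1 + p)) j) w|].
Let Bad k : set O := \bigcup_p bad k p.

Let NpE k p : (Np k * 8 * Np p = Np (k.+1 + p))%N.
Proof. by rewrite /Np expnD expnSr. Qed.

Let bad_meas k p : measurable (bad k p).
Proof.
rewrite (_ : bad k p = \bigcup_(j in [set j | (j <= Np (k.+1 + p))%N]) ((fun w => `|D k (grid (Np (k.+1 + p)) j) w|) @^-1` `[lam k, +oo[%classic)); last first.
  apply/seteqP; split => w /= [j a b]; exists j => //=; first by rewrite in_itv/= andbT.
  by move: b; rewrite /preimage/= in_itv/= andbT.
apply: bigcup_measurable => j jN; rewrite -[X in measurable X]setTI.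
have mD : mfT (fun w => `|D k (grid (Np (k.+1 + p)) j) w|).
  apply: measurableT_comp => //; apply: measurable_funB; apply: ito_sum_meas; rewrite ?grid_ge0//;
    apply: grid_le => //; exact: Np0.
by apply: mD => //; exact: measurable_itv.
Qed.

Let bad_prob k p : (P (bad k p) <= (K * T ^+ 2 * (2^-1) ^+ k)%:E)%E.
Proof.
have l0 : 0 < lam k by exact: half_gt0.
have [_ _] := ito_sum_max (Np0 k) (isT : (0 < 8)%N) (Np0 p) l0.
rewrite integral_indic//; last first.
  by have := bad_meas k p; rewrite /bad /D -NpE /Np expnSr.
rewrite setIT NpE /D /bad /Np -expnSr => H; apply: (le_trans H).
rewrite lee_fin le_eqVlt; apply/orP; left; apply/eqP.
have h0 : (2^-1 : R) ^+ k != 0 by rewrite gt_eqF// half_gt0.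
have -> : ((8 ^ k)%:R : R)^-1 = lam k ^+ 3.
  by rewrite natrX -exprVn /lam -exprM mulnC exprM; congr (_ ^+ _); field.
rewrite /lam; move: ((2^-1 : R) ^+ k) h0 => y y0; by field.
Qed.

Let Bad_prob k : (P (Bad k) <= (K * T ^+ 2 * (2^-1) ^+ k)%:E)%E.
Proof.
have mono : {homo bad k : p q / (p <= q)%N >-> (p <= q)%O}.
  move=> p q pq; apply/subsetPset => w [j jp le]; exists (j * Np (q - p))%N.
    by rewrite (_ : Np (k.+1 + q) = Np (k.+1 + p) * Np (q - p))%N ?leq_mul2r ?jp ?orbT// /Np -expnD -addnA subnKC.
  by rewrite (_ : Np (k.+1 + q) = Np (k.+1 + p) * Np (q - p))%N ?grid_refine// /Np -expnD -addnA subnKC.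
have mB : measurable (Bad k) by apply: bigcupT_measurable => p; exact: bad_meas.
have := nondecreasing_cvg_mu (mu := P) (bad_meas k) mB mono.
move=> /cvg_lim <-//; apply: lime_le.
  apply: ereal_nondecreasing_is_cvgn => p q pq /=; apply: le_measure; rewrite ?inE; try exact: bad_meas.
  by apply/subsetPset; exact: mono.
by apply: nearW => p; exact: bad_prob.
Qed.

(** A deviation above the threshold at some time persists, by uniform continuity, at a nearby point
    of a fine enough grid. *)
Let notBad k w t : ~ Bad k w -> `|D k t w| <= lam k.
Proof.
move=> nB; have [t' /andP[t0 tT] tE] := clampP t.
rewrite /D !tE ?Np0// -/(D k t' w) leNgt; apply/negP => lt.
have cD : continuous (fun t => `|D k t w|).
  by apply: continuous_abs => s; apply: cvgB; exact: ito_sum_continuous.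
have e0 : 0 < (`|D k t' w| - lam k) / 2 by rewrite divr_gt0// subr_gt0.
have [d d0 Hd] := unif_cont 0 T cD e0.
have Td0 : 0 <= T / d by rewrite divr_ge0// ltW.
pose p := (Num.truncn (T / d)).+1.
have pd : T / (Np (k.+1 + p))%:R < d.
  rewrite ltr_pdivrMr ?ltr0n// mulrC -ltr_pdivrMr//.
  have /andP[_ H] := truncn_itv Td0; apply: lt_trans H _; rewrite ltr_nat -/p.
  by rewrite /Np; apply: (@leq_ltn_trans (k.+1 + p)); [exact: leq_addl|exact: ltn_expl].
set N := Np (k.+1 + p) in pd.
have N0 : 0 < N%:R :> R by rewrite ltr0n /N Np0.
have TN0 : 0 < T / N%:R by rewrite divr_gt0.
have q0 : 0 <= t' / (T / N%:R) by rewrite divr_ge0// ltW.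
pose j := Num.truncn (t' / (T / N%:R)).
have /andP[j1 j2] := truncn_itv q0; rewrite -/j in j1 j2.
have jt : grid N j <= t' by rewrite /grid -ler_pdivlMr.
have jt2 : t' < grid N j + T / N%:R.
  by move: j2; rewrite ltr_pdivrMr// -natr1 mulrDl mul1r.
apply: nB; exists p => //; exists j.
  rewrite -(ler_nat R) -/N; apply: le_trans j1 _; rewrite ler_pdivrMr// mulrCA mulfV ?gt_eqF// mulr1//.
have close : `|t' - grid N j| < d.
  by rewrite ger0_norm ?subr_ge0//; lra.
have := Hd t' (grid N j); rewrite t0 tT => /(_ isT close).
rewrite -/N ler_norml => /andP[_]; move: e0 => /ltW; lra.
Qed.

Let badlim := lim_sup_set Bad.

(** Borel-Cantelli, as the bounds [2^-k] sum to at most 2. *)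
Let badlim0 : P badlim = 0%E.
Proof.
apply: lim_sup_set_cvg0.
  by move=> k; apply: bigcupT_measurable => p; exact: bad_meas.
have KT0 : 0 <= K * T ^+ 2 by rewrite mulr_ge0// sqr_ge0.
apply: (@le_lt_trans _ _ (K * T ^+ 2 * 2)%:E); last exact: ltry.
apply: lime_le; first by apply: is_cvg_nneseries => n _ _; exact: measure_ge0.
apply: nearW => n; apply: (@le_trans _ _ (\sum_(0 <= k < n) (K * T ^+ 2 * (2^-1) ^+ k)%:E)%E).
  by apply: lee_sum => k _; exact: Bad_prob.
rewrite big_mkord sumEFin lee_fin -mulr_sumr ler_wpM2l// half_sum.
by rewrite lerBlDr lerDl mulr_ge0// ltW// half_gt0.
Qed.

Let mbad : measurable badlim.
Proof.
apply: bigcapT_measurable => n; apply: bigcup_measurable => k _.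
by apply: bigcupT_measurable => p; exact: bad_meas.
Qed.

Let good_unif w : ~ badlim w -> exists k0, forall k t, (k0 <= k)%N ->
  `|ito_sum (Np k.+1) t w - ito_sum (Np k) t w| <= 1 * (2^-1) ^+ k.
Proof.
move=> nb; have [k0 Hk0] : exists k0, forall k, (k0 <= k)%N -> ~ Bad k w.
  apply/not_existsP => H; apply: nb => k _ /=.
  have /existsNP[j /not_implyP[kj /contrapT Bj]] := H k.
  by exists j.
by exists k0 => k t kk; rewrite distrC mul1r; apply: notBad; exact: Hk0.
Qed.

(** Along [8^k] cells the sums converge uniformly in time off a null set, on which they are replaced
    by 0; this gives continuous paths at every sample point. The rate comes from comparing any two
    grids with a common refinement. *)
Lemma ito_exists : exists I : R -> O -> R,
  [/\ forall t, 0 <= t -> t <= T -> mfT (I t),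
      forall w, continuous (I ^~ w) &
      forall N t, (0 < N)%N -> 0 <= t -> t <= T ->
        Eb P (fun w => (I t w - ito_sum N t w) ^+ 2) (4 * (K * T ^+ 2) / N%:R)].
Proof.
pose one w : R := \1_(~` badlim) w.
pose I t w := limn (fun k => ito_sum (Np k) t w * one w).
have one0 w : badlim w -> one w = 0 by move=> bw; rewrite /one indicE memNset//; apply.
have one1 w : ~ badlim w -> one w = 1 by move=> bw; rewrite /one indicE mem_set.
have mone : mfT one by apply: measurable_indic; exact: measurableC.
have gu w : exists k0, forall k t, (k0 <= k)%N ->
    `|ito_sum (Np k.+1) t w * one w - ito_sum (Np k) t w * one w| <= 1 * (2^-1) ^+ k.
  have [bw|/[dup] nbw /good_unif[k0 Hk]] := pselect (badlim w).
    by exists 0%N => k t _; rewrite one0// !mulr0 subrr normr0 mul1r ltW// half_gt0.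
  by exists k0 => k t kk; rewrite one1// !mulr1; exact: Hk.
have cs w k : continuous (fun t => ito_sum (Np k) t w * one w).
  by move=> t; apply: cvgM; [exact: ito_sum_continuous|exact: cvg_cst].
have Ic t w : (fun k => ito_sum (Np k) t w * one w) @ \oo --> I t w.
  have [k0 Hk] := gu w.
  exact: (unif_limit_cvg (f := fun k t => ito_sum (Np k) t w * one w) ler01 Hk).
have mI t : 0 <= t -> t <= T -> mfT (I t).
  move=> t0 tT; apply: (measurable_fun_cvg (h := fun k w => ito_sum (Np k) t w * one w)).
    by move=> k; apply: measurable_funM => //; exact: ito_sum_meas.
  by move=> w _; exact: Ic.
exists I; split => //.
  move=> w; have [k0 Hk] := gu w.
  exact: (unif_limit_continuous (f := fun k t => ito_sum (Np k) t w * one w) ler01 (cs w) Hk).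
move=> N t N0 t0 tT; have C0 : 0 <= K * T ^+ 2 by rewrite mulr_ge0// sqr_ge0.
have mS M : mfT (ito_sum M t) by exact: ito_sum_meas.
have NpN k : (N <= Np (N + k))%N.
  apply: (@leq_trans (N + k)); first exact: leq_addr.
  by rewrite /Np ltnW// ltn_expl.
have H1 : Eb P (fun w => ((I t w - ito_sum N t w) * one w) ^+ 2) (4 * (K * T ^+ 2) / N%:R).
  apply: (@Eb_fatou _ _ _ P (fun k w => ((ito_sum (Np (N + k)) t w * one w - ito_sum N t w) * one w) ^+ 2)); last first.
    move=> w; apply: cvg_sqr; apply: cvgM; last exact: cvg_cst.
    apply: cvgB; last exact: cvg_cst.
    have := Ic t w; rewrite -(cvg_shiftn N).
    by apply: cvg_trans; apply: near_eq_cvg; apply: nearW => k; rewrite addnC.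
  move=> k; set M := Np (N + k).
  (* Both sums are compared with the sum on [N * M] cells. The constant 4 is [2 + 2], as
     [N <= M]. *)
  have H := Eb_add (Eb_scale (ler0n R 2) (ito_sum_sqr N0 (Np0 (N + k)) (isT : (0 < 1)%N) t0 tT))
                   (Eb_scale (ler0n R 2) (ito_sum_sqr (Np0 (N + k)) N0 (isT : (0 < 1)%N) t0 tT)).
  apply: (Eb_le (g := fun w => 2 * (ito_sum N t w - ito_sum (N * M) t w) ^+ 2 + 2 * (ito_sum M t w - ito_sum (M * N) t w) ^+ 2)).
  - apply: measurable_funX; apply: measurable_funM => //; apply: measurable_funB => //.
    exact: measurable_funM.
  - by move=> w; exact: sqr_ge0.
  - move=> w; rewrite [(M * N)%N]mulnC.
    have [bw|bw] := pselect (badlim w).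
      by rewrite one0// mulr0 expr0n addr_ge0// mulr_ge0// sqr_ge0.
    rewrite one1// !mulr1; set a := ito_sum N t w; set b := ito_sum M t w; set c := ito_sum (N * M) t w.
    rewrite -subr_ge0 (_ : 2 * (a - c) ^+ 2 + 2 * (b - c) ^+ 2 - (b - a) ^+ 2 = ((a - c) + (b - c)) ^+ 2).
      exact: sqr_ge0.
    by ring.
  - apply: Eb_weak H.
    have : K * T ^+ 2 / M%:R <= K * T ^+ 2 / N%:R.
      have M0 : 0 < M%:R :> R by rewrite ltr0n /M Np0.
      have N0' : 0 < N%:R :> R by rewrite ltr0n.
      by rewrite ler_wpM2l// lef_pV2// ler_nat; exact: NpN.
    by rewrite -(mulrA 4); set x := _ / M%:R; set y := _ / N%:R; lra.
have [m1 p1 le1] := H1.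
split.
- by apply: measurable_funX; apply: measurable_funB => //; exact: mI.
- by move=> w; exact: sqr_ge0.
apply: le_trans le1; rewrite le_eqVlt; apply/orP; left; apply/eqP.
apply: ae_eq_integral => //.
- by apply/measurable_EFinP; apply: measurable_funX; apply: measurable_funB => //; exact: mI.
- exact/measurable_EFinP.
- exists badlim; split => //.
  move=> w /= H; apply: contrapT => nb; apply: H => _.
  by rewrite one1// mulr1.
Qed.

End ItoSums.

(** * Rates of convergence *)

Section Preliminaries.
Context {R : realType}.

Lemma itg_linear (a b : R) : a <= b -> itg a b (fun s => s - a) = (b - a) ^+ 2 / 2.
Proof.
move=> ab.
have cf : continuous (fun s : R => s - a) by move=> s; apply: cvgB; [exact: cvg_id|exact: cvg_cst].
apply: (cvg_unique _ (rsum_cvg ab cf)) => //.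
have E M : rsum a b M (fun s => s - a) = (b - a) ^+ 2 / 2 + (b - a) ^+ 2 / 2 * M.+1%:R^-1.
  rewrite /rsum (eq_bigr (fun j : 'I_M.+1 => (b - a) / M.+1%:R * j%:R + (b - a) / M.+1%:R)); last first.
    by move=> j _; rewrite -natr1; ring.
  rewrite big_split/= -mulr_sumr sum_natr sumr_const card_ord -[(_ / _) *+ _]mulr_natl.
  have M0 : M.+1%:R != 0 :> R by rewrite pnatr_eq0.
  by move: (M.+1%:R) M0 => x x0; field.
rewrite (_ : (fun M => _) = (fun M => (b - a) ^+ 2 / 2 + (b - a) ^+ 2 / 2 * M.+1%:R^-1)); last exact/funext.
rewrite /= -[X in _ --> X]addr0; apply: cvgD; first exact: cvg_cst.
rewrite -[X in _ --> X](mulr0 ((b - a) ^+ 2 / 2)); apply: cvgM; first exact: cvg_cst.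
exact: cvg_harmonic.
Qed.

(** The integral of the square of [f] minus its mean is nonnegative. *)
Lemma itg_sqr_le (a b : R) f : a <= b -> continuous f ->
  itg a b f ^+ 2 <= (b - a) * itg a b (fun s => f s ^+ 2).
Proof.
move=> ab cf; have [<-|/eqP nab] := eqVneq a b.
  by rewrite !itg_point expr0n mulr0.
have h0 : 0 < b - a by rewrite subr_gt0 lt_neqAle ab andbT; apply/eqP.
set h := b - a; set I := itg a b f.
have c2 : continuous (fun s => f s ^+ 2) by move=> s; rewrite /continuous_at expr2; under eq_fun do rewrite expr2; apply: cvgM; exact: cf.
have c1 : continuous (fun s => (2 * (I / h)) * f s) by move=> s; apply: cvgM; [exact: cvg_cst|exact: cf].
have : 0 <= itg a b (fun s => f s ^+ 2 - (2 * (I / h)) * f s + (I / h) ^+ 2).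
  apply: itg_ge0 => s _; have := sqr_ge0 (f s - I / h).
  by rewrite (_ : (f s - I / h) ^+ 2 = f s ^+ 2 - (2 * (I / h)) * f s + (I / h) ^+ 2)//; ring.
rewrite itgD; last 2 first.
- by move=> s; apply: cvgB; [exact: c2|exact: c1].
- by move=> s; exact: cvg_cst.
rewrite itgB// itgZ// itg_cst// -/I -/h => H.
have hn : h != 0 by rewrite gt_eqF.
rewrite -ler_pdivrMl//; move: H; rewrite (_ : _ - _ + _ = itg a b (fun s => f s ^+ 2) - h^-1 * I ^+ 2); last by field.
by rewrite subr_ge0.
Qed.

Lemma lipschitz_path (n : nat) (g : 'cV[R]_n -> R) (K : R) (x : R -> 'cV[R]_n) :
  (forall u v, `|g u - g v| <= K * nrm (u - v)) -> (forall l, continuous (fun s => x s l 0)) ->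
  continuous (fun s => g (x s)).
Proof.
(* The Lipschitz bound itself forces [0 <= K], except in dimension 0. *)
move=> gK cx s; have K0 : 0 <= K \/ n = 0%N.
  case: n g x gK cx => [|n] g x gK cx; first by right.
  left; have := le_trans (normr_ge0 _) (gK (delta_mx 0 0) 0).
  rewrite pmulr_lge0// subr0; apply: lt_le_trans (coord_le_nrm _ 0).
  by rewrite mxE !eqxx normr1.
case: K0 => [K0|n0]; last first.
  by subst n; rewrite (_ : (fun s => g (x s)) = fun=> g 0); [exact: cvg_cst|apply/funext => u; rewrite (flatmx0 (x u))].
have H : (fun r => K * nrm (x s - x r)) @ s --> (0 : R).
  rewrite -(mulr0 K); apply: cvgM; first exact: cvg_cst.
  rewrite (_ : (fun r => _) = (fun r => \sum_i `|x s i 0 - x r i 0|)); last first.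
    by apply/funext => r; rewrite /nrm; apply: eq_bigr => i _; rewrite !mxE.
  have c : continuous (fun r => \sum_i `|x s i 0 - x r i 0|).
    apply: continuous_bigsum => i; apply: continuous_abs => r.
    by apply: cvgB; [exact: cvg_cst|exact: cx].
  have := c s; rewrite /continuous_at (_ : \sum_i `|x s i 0 - x s i 0| = 0)//.
  by rewrite big1// => i _; rewrite subrr normr0.
apply/cvgrPdist_le => e e0.
move/cvgrPdist_le: H => /(_ e e0); apply: filterS => r.
rewrite sub0r normrN ger0_norm; last by rewrite mulr_ge0// nrm_ge0.
exact: le_trans (gK _ _).
Qed.

Lemma nrm_continuous (n : nat) (x : R -> 'cV[R]_n) :
  (forall l, continuous (fun s => x s l 0)) -> continuous (fun s => nrm (x s)).
Proof. by move=> cx; apply: continuous_bigsum => i; apply: continuous_abs. Qed.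

Lemma smeas_lipschitz (disp : measure_display) (O : measurableType disp) (G : set (set O))
    (n : nat) (g : 'cV[R]_n -> R) (K : R) (X : O -> 'cV[R]_n) :
  (forall u v, `|g u - g v| <= K * nrm (u - v)) ->
  (forall l, smeas G (fun w => X w l 0)) -> smeas G (fun w => g (X w)).
Proof.
move=> gK mX.
have sc : @seq_continuous R 'I_n (fun y => g (\col_l y l)).
  move=> u y uy; apply/cvgrPdist_le => e e0.
  have H : (fun p => K * nrm (\col_l y l - \col_l u p l)) @ \oo --> (0 : R).
    rewrite -(mulr0 K); apply: cvgM; first exact: cvg_cst.
    rewrite (_ : (fun p => _) = (fun p => \sum_l `|y l - u p l|)); last first.
      by apply/funext => p; rewrite /nrm; apply: eq_bigr => l _; rewrite !mxE.
    rewrite -[X in _ --> X](_ : \sum_(l < n) 0 = 0); last by rewrite big1.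
    apply: cvg_bigsum => l; rewrite -[X in _ --> X](@normr0 _ R) -(subrr (y l)).
    by apply: cvg_norm; apply: cvgB; [exact: cvg_cst|exact: uy].
  move/cvgrPdist_le: H => /(_ e e0); apply: filterS => p.
  rewrite sub0r normrN => H; apply: le_trans (gK _ _) _; apply: le_trans H; exact: ler_norm.
have := smeas_seq_continuous sc mX.
by rewrite (_ : (fun w => g (\col_l X w l 0)) = (fun w => g (X w)))//; apply/funext => w; congr g; apply/colP => l; rewrite mxE.
Qed.

End Preliminaries.

Section Rates.
Context {R : realType} {disp : measure_display} {O : measurableType disp}.
Variables (P : probability O R) (T : R) (N0 : nat).
Hypotheses (T0 : 0 < T) (N00 : (0 < N0)%N).

Definition step (N : nat) : R := T / N%:R.
(** The size of a Brownian increment over one step; all rates are counted in its powers. *)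
Definition rt (N : nat) : R := Num.sqrt (step N).

Lemma step_gt0 N : (N0 <= N)%N -> 0 < step N.
Proof. by move=> N0N; rewrite divr_gt0// ltr0n (leq_trans N00). Qed.

Lemma step_rt N : (N0 <= N)%N -> step N = rt N ^+ 2.
Proof. by move=> /step_gt0 s0; rewrite sqr_sqrtr// ltW. Qed.

Lemma rt_gt0 N : (N0 <= N)%N -> 0 < rt N.
Proof. by move=> /step_gt0 s0; rewrite sqrtr_gt0. Qed.

Lemma N_step N : (N0 <= N)%N -> N%:R * step N = T.
Proof. by move=> N0N; rewrite /step mulrCA divff ?mulr1// pnatr_eq0 -lt0n (leq_trans N00). Qed.

Lemma tk_le N k : (N0 <= N)%N -> (k <= N)%N -> k%:R * step N <= T.
Proof. by move=> N0N kN; rewrite -[leRHS](N_step N0N) ler_wpM2r ?ler_nat// ltW// step_gt0. Qed.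

Lemma tk_ge0 N (k : nat) : (N0 <= N)%N -> 0 <= k%:R * step N.
Proof. by move=> N0N; rewrite mulr_ge0// ltW// step_gt0. Qed.

Lemma tkS N (k : nat) : k.+1%:R * step N = k%:R * step N + step N.
Proof. by rewrite -natr1 mulrDl mul1r. Qed.

(* The mean of [|f N k|], for all [k] with [e k N], is O(h^(p/2)), h = T/N. *)
Definition BU (e : rel nat) (p : nat) (f : nat -> nat -> O -> R) : Prop :=
  exists2 C, 0 <= C & forall N k, (N0 <= N)%N -> e k N -> Ub P (f N k) (C * rt N ^+ p).

Lemma BU_ltn p f : BU leq p f -> BU ltn p f.
Proof. by move=> [C C0 fC]; exists C => // N k N0N kN; apply: fC => //; exact: ltnW. Qed.

Lemma BU_le (e : rel nat) p (f g : nat -> nat -> O -> R) (c : R) : (forall N k w, (N0 <= N)%N -> e k N -> `|f N k w| <= c * g N k w) ->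
  BU e p g -> BU e p f.
Proof.
move=> fg [C C0 gC]; exists (`|c| * C); first by rewrite mulr_ge0.
move=> N k N0N kN; rewrite -mulrA.
by apply: Ub_le (Ub_scale c (gC N k N0N kN)) => w; exact: fg.
Qed.

Lemma BU_le1 (e : rel nat) p (f g : nat -> nat -> O -> R) : (forall N k w, (N0 <= N)%N -> e k N -> `|f N k w| <= g N k w) ->
  BU e p g -> BU e p f.
Proof. by move=> fg; apply: (BU_le (c := 1)) => N k w N0N kN; rewrite mul1r; exact: fg. Qed.

Lemma BU_add e p f g : BU e p f -> BU e p g -> BU e p (fun N k w => f N k w + g N k w).
Proof.
move=> [C C0 fC] [D D0 gD]; exists (C + D); first exact: addr_ge0.
by move=> N k N0N kN; rewrite mulrDl; apply: Ub_add; [exact: fC|exact: gD].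
Qed.

Lemma BU_scale e p f (c : R) : BU e p f -> BU e p (fun N k w => c * f N k w).
Proof.
move=> [C C0 fC]; exists (`|c| * C); first by rewrite mulr_ge0.
by move=> N k N0N kN; rewrite -mulrA; apply: Ub_scale; exact: fC.
Qed.

Lemma BU_abs e p f : BU e p f -> BU e p (fun N k w => `|f N k w|).
Proof. by move=> [C C0 fC]; exists C => // N k N0N kN; apply: Ub_abs; exact: fC. Qed.

Lemma BU_bigsum e p (I : Type) (s : seq I) (f : I -> nat -> nat -> O -> R) :
  (forall i, BU e p (f i)) -> BU e p (fun N k w => \sum_(i <- s) f i N k w).
Proof.
move=> fp; elim: s => [|i s IH].
  exists 0 => // N k _ _; rewrite mul0r; apply: (@Ub_ext _ _ _ _ (fun=> 0)); last exact: Ub_cst.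
  by move=> w; rewrite big_nil.
have [C C0 H] := BU_add (fp i) IH; exists C => // N k N0N kN.
by apply: Ub_ext (H N k N0N kN) => w; rewrite big_cons.
Qed.

Lemma BU_cst e (c : R) : BU e 0 (fun _ _ _ => c).
Proof.
exists `|c| => // N k _ _; rewrite expr0 mulr1.
by apply: Ub_le (Ub_cst P (normr_ge0 c)) => w.
Qed.

Lemma BU_step e p f : BU e p f -> BU e p.+2 (fun N k w => step N * f N k w).
Proof.
move=> [C C0 fC]; exists C => // N k N0N kN; rewrite -addn2 exprD mulrCA -step_rt//.
rewrite [C * _]mulrC mulrA [_ * step N]mulrC -[X in Ub _ _ X]mulrA.
by rewrite [_ * C]mulrC; apply: Ub_pscale; [exact/ltW/step_gt0|exact: fC].
Qed.

(** There are at most [N = T / h] terms: summation costs one power of [h], that is two powers of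
    [rt]. *)
Lemma BU_sumk p f : BU ltn p.+2 f -> BU leq p (fun N k w => \sum_(i < k) f N i w).
Proof.
move=> [C C0 fC]; exists (C * T); first by rewrite mulr_ge0// ltW.
move=> N k N0N kN; have rt0 := rt_gt0 N0N.
have -> : C * T * rt N ^+ p = N%:R * (C * rt N ^+ p.+2).
  rewrite (_ : C * T = C * (N%:R * step N)); last by rewrite N_step.
  have E : rt N ^+ p.+2 = rt N ^+ p * rt N ^+ 2 by rewrite -exprD addn2.
  by rewrite [step N in LHS]step_rt// E; ring.
apply: Ub_sum_const => //; first by rewrite mulr_ge0// exprn_ge0// ltW.
by move=> i ik; apply: fC => //; exact: leq_trans ik kN.
Qed.

Lemma BU_sqr e p f : BU e (p + p) (fun N k w => f N k w ^+ 2) -> BU e p f.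
Proof.
(* The added 1 keeps the factor positive when [C = 0]. *)
move=> [C C0 fC]; exists (Num.sqrt C + 1); first by rewrite addr_ge0// sqrtr_ge0.
move=> N k N0N kN; have r0 : 0 < rt N ^+ p by rewrite exprn_gt0// rt_gt0.
have c1 : 0 < Num.sqrt C + 1 by rewrite ltr_wpDl// sqrtr_ge0.
apply: Ub_sqr (fC N k N0N kN); first by rewrite mulr_gt0.
rewrite exprMn -exprM muln2 -addnn ler_wpM2r ?exprD ?mulr_ge0 ?(ltW r0)//.
by rewrite -{1}(sqr_sqrtr C0) lerXn2r ?nnegrE ?sqrtr_ge0 ?(ltW c1)// lerDl.
Qed.

(** Young's inequality with the weight [rt^q / rt^p], which gives both squares the order [p + q]. *)
Lemma BU_mul e p q f g : BU e (p + p) (fun N k w => f N k w ^+ 2) -> BU e (q + q) (fun N k w => g N k w ^+ 2) ->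
  BU e (p + q) (fun N k w => f N k w * g N k w).
Proof.
move=> [C C0 fC] [D D0 gD]; exists (C + D); first exact: addr_ge0.
move=> N k N0N kN; have r0 := rt_gt0 N0N.
have p0 : rt N ^+ p != 0 by rewrite expf_neq0// gt_eqF.
have q0 : rt N ^+ q != 0 by rewrite expf_neq0// gt_eqF.
have s0 : 0 < rt N ^+ q / rt N ^+ p by rewrite divr_gt0// exprn_gt0.
have := Ub_mul s0 (fC N k N0N kN) (gD N k N0N kN); congr (Ub _ _ _).
rewrite !exprD; move: (rt N ^+ p) (rt N ^+ q) p0 q0 => x y x0 y0.
by field; rewrite x0 y0.
Qed.

Lemma BU_sqr_add e p f g : BU e p (fun N k w => f N k w ^+ 2) -> BU e p (fun N k w => g N k w ^+ 2) ->
  BU e p (fun N k w => (f N k w + g N k w) ^+ 2).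
Proof.
move=> fp gp; apply: (BU_le (c := 2)) (BU_add fp gp) => N k w _ _.
rewrite ger0_norm ?sqr_ge0// -subr_ge0 (_ : _ - _ = (f N k w - g N k w) ^+ 2) ?sqr_ge0//; ring.
Qed.

Lemma BU_sqr_bigsum e p (I : Type) (s : seq I) (f : I -> nat -> nat -> O -> R) :
  (forall i, BU e p (fun N k w => f i N k w ^+ 2)) -> BU e p (fun N k w => (\sum_(i <- s) f i N k w) ^+ 2).
Proof.
move=> fp; elim: s => [|i s IH].
  exists 0 => // N k _ _; rewrite mul0r; apply: (@Ub_ext _ _ _ _ (fun=> 0)); last exact: Ub_cst.
  by move=> w; rewrite big_nil expr0n.
have [C C0 H] := BU_sqr_add (fp i) IH; exists C => // N k N0N kN.
by apply: Ub_ext (H N k N0N kN) => w; rewrite big_cons.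
Qed.

Lemma BU_sqr_sumk p f : BU ltn (p.+2) (fun N k w => f N k w ^+ 2) ->
  BU leq p (fun N k w => step N * (\sum_(i < k) f N i w) ^+ 2).
Proof.
move=> H; apply: (BU_le (c := T)) (BU_sumk H) => N k w N0N kN.
rewrite ger0_norm; last by rewrite mulr_ge0 ?sqr_ge0// ltW// step_gt0.
rewrite -[T in leRHS](N_step N0N) [N%:R * _]mulrC -[leRHS]mulrA ler_wpM2l ?(ltW (step_gt0 N0N))//.
have := sqr_sum_le (fun i : 'I_k => f N i w); rewrite card_ord => /le_trans; apply.
by rewrite ler_wpM2r ?ler_nat// sumr_ge0// => i _; exact: sqr_ge0.
Qed.

Lemma BU_gronwall p (a c : nat -> nat -> O -> R) (lam : R) : 0 <= lam ->
  (forall N k w, (N0 <= N)%N -> (k <= N)%N ->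
     `|a N k w| <= c N k w + lam * step N * \sum_(i < k) `|a N i w|) ->
  BU leq p c -> BU leq p a.
Proof.
move=> l0 ac [C C0 cC]; exists (C * expR (lam * T)); first by rewrite mulr_ge0// expR_ge0.
move=> N k N0N kN; have r0 := rt_gt0 N0N; have s0 := step_gt0 N0N.
have r1 : 0 <= C * rt N ^+ p by rewrite mulr_ge0// exprn_ge0// ltW.
have := Ub_gronwall (mulr_ge0 l0 (ltW s0)) (fun k w => @ac N k w N0N) (fun k => cC N k N0N) kN.
apply: Ub_weak; rewrite [leRHS]mulrAC (_ : lam * step N = lam * T / N%:R); last by rewrite /step mulrA.
by apply: gronwall_exp => //; [rewrite mulr_ge0// ltW|exact: leq_trans N0N].
Qed.

End Rates.

(** * Martingale increments over the cells *)

Section Martingales.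
Context {R : realType} {disp : measure_display} {O : measurableType disp}.
Variables (P : probability O R) (T : R) (N0 : nat) (F : R -> set (set O)) (m : nat).
Hypotheses (T0 : 0 < T) (N00 : (0 < N0)%N) (hF : filtration T F).
Local Notation step := (@step R T).
Local Notation rt := (@rt R T).

(* [z N k] behaves like a normalised martingale increment over the [k]-th cell:
   transforms of square norm at most [al] have mean square O(al h^p). *)
Definition mart (p : nat) (z : nat -> nat -> O -> R) : Prop :=
  exists2 C, 0 <= C & forall N (A : nat -> O -> R) al, (N0 <= N)%N ->
    (forall k, (k < N)%N -> smeas (F (k%:R * step N)) (A k)) ->
    (forall k, (k < N)%N -> Eb P (fun w => A k w ^+ 2) al) ->
    forall K, (K <= N)%N -> Ub P (fun w => (\sum_(k < K) A k w * z N k w) ^+ 2) (C * al * step N ^+ p).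

Lemma mart_scale p z (c : R) : mart p z -> mart p (fun N k w => c * z N k w).
Proof.
move=> [C C0 H]; exists (c ^+ 2 * C); first by rewrite mulr_ge0// sqr_ge0.
move=> N A al N0N mA Aal K KN.
rewrite (_ : c ^+ 2 * C * al * step N ^+ p = c ^+ 2 * (C * al * step N ^+ p)); last by ring.
apply: Ub_ext (Ub_pscale (sqr_ge0 c) (H N A al N0N mA Aal K KN)) => w.
by rewrite -exprMn mulr_sumr; congr (_ ^+ 2); apply: eq_bigr => k _; rewrite mulrCA.
Qed.

Lemma mart_add p z z' : mart p z -> mart p z' -> mart p (fun N k w => z N k w + z' N k w).
Proof.
move=> [C C0 H] [C' C'0 H']; exists (2 * (C + C')); first by rewrite mulr_ge0// addr_ge0.
move=> N A al N0N mA Aal K KN.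
have -> : 2 * (C + C') * al * step N ^+ p = 2 * (C * al * step N ^+ p) + 2 * (C' * al * step N ^+ p) by ring.
apply: Ub_le (Ub_add (Ub_pscale (ler0n R 2) (H N A al N0N mA Aal K KN)) (Ub_pscale (ler0n R 2) (H' N A al N0N mA Aal K KN))) => w.
under eq_bigr do rewrite mulrDr.
rewrite big_split/= ger0_norm ?sqr_ge0//; set a := \sum_(k < K) _; set b := \sum_(k < K) _.
by rewrite -subr_ge0 (_ : _ - _ = (a - b) ^+ 2) ?sqr_ge0//; ring.
Qed.

(* The integrals of [phi N k], for [phi N k s] centred and independent of the past. *)
Lemma mart_integral p (c V : nat -> R) (v : R) (phi : nat -> nat -> R -> O -> R) : 0 <= v ->
  (forall N, (N0 <= N)%N -> 0 <= V N /\ c N ^+ 2 * step N * V N <= v * step N ^+ p) ->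
  (forall N k s, (N0 <= N)%N -> (k < N)%N -> k%:R * step N <= s <= k.+1%:R * step N ->
     [/\ smeas (F (k.+1%:R * step N)) (phi N k s), indep_of P (F (k%:R * step N)) (phi N k s),
         Ex P (phi N k s) = 0 & Eb P (fun w => phi N k s w ^+ 2) (V N)]) ->
  (forall N k w, continuous (phi N k ^~ w)) ->
  mart p (fun N k w => c N * itg (k%:R * step N) (k.+1%:R * step N) (phi N k ^~ w)).
Proof.
move=> v0 cv phiP cphi; exists (T * v); first by rewrite mulr_ge0// ltW.
move=> N A al N0N mA Aal K KN.
have s0 := step_gt0 T0 N00 N0N.
have [V0 cN] := cv N N0N.
have al0 : 0 <= al by apply: (Eb_ge0 (Aal 0%N _)); exact: leq_trans N0N.
(* Times capped at [T], and data set to 0 beyond [N], turn the first [N] cells into the infinite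
   sequence that [mtrans_itg_sqr] expects. *)
pose t k := Num.min (k%:R * step N) T.
have tE k : (k <= N)%N -> t k = k%:R * step N by move=> kN; rewrite /t minEle (tk_le T0 N00 N0N kN).
have t_ge0 k : 0 <= t k by rewrite le_min (tk_ge0 T0 N00 k N0N) ltW.
have t_le k : t k <= T by rewrite ge_min lexx orbT.
have tS k : t k <= t k.+1.
  by rewrite le_min t_le andbT ge_min tkS lerDl ltW.
have tS2 k : t k <= t k.+1 <= t k + step N.
  rewrite tS /=; rewrite /t tkS; move: (k%:R * step N) => a.
  by rewrite !minEle; case: (leP (a + step N) T) => ?; case: (leP a T) => ?; lra.
pose A' k w := if (k < N)%N then A k w else 0.
pose phi' k s w := if (k < N)%N then phi N k s w else 0.
have E2 : Eb P (fun w : O => 0 ^+ 2) 0 by apply: Eb_ext (Eb_cst P (lexx 0)) => w; rewrite expr0n.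
have := @mtrans_itg_sqr _ _ _ P (fun k => F (t k)) _ _ _ t (step N) A' phi' (fun=> al) (V N).
move=> /(_ (fun k => filt_sigma hF (t_ge0 k) (t_le k)) (fun k => filt_meas hF (t_ge0 k) (t_le k))
   (fun k => filt_mono hF (t_ge0 k) (tS k) (t_le k.+1)) (ltW s0) tS2).
have mA' k : smeas (F (t k)) (A' k).
  rewrite /A'; case: ltnP => kN; last exact: smeas_cst.
  by rewrite tE ?(ltnW kN)//; exact: mA.
move=> /(_ mA').
have side k s : t k <= s <= t k.+1 -> [/\ smeas (F (t k.+1)) (phi' k s), indep_of P (F (t k)) (phi' k s),
         Ex P (phi' k s) = 0 & Eb P (fun w => phi' k s w ^+ 2) (V N)].
  rewrite /phi'; case: ltnP => kN; last first.
    move=> _; split; [exact: smeas_cst|exact/indep_of_cst/(filt_meas hF)|exact: Ex_cst|exact: Eb_weak V0 E2].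
  by rewrite !tE ?(ltnW kN)//; exact: phiP.
move=> /(_ (fun k s ks => let: And4 a _ _ _ := side k s ks in a)).
have cphi' k w : continuous (phi' k ^~ w).
  rewrite /phi'; case: ltnP => kN; [exact: cphi|by move=> s; exact: cvg_cst].
move=> /(_ cphi' (fun k s ks => let: And4 _ a _ _ := side k s ks in a) (fun k s ks => let: And4 _ _ a _ := side k s ks in a)).
have Aal' k : Eb P (fun w => A' k w ^+ 2) al.
  rewrite /A'; case: ltnP => kN; [exact: Aal|exact: Eb_weak al0 E2].
move=> /(_ Aal' (fun k s ks => let: And4 _ _ _ a := side k s ks in a) K) H.
have H2 := Ub_Eb (Eb_scale (sqr_ge0 (c N)) H).
apply: (Ub_weak _ (Ub_ext _ H2)).
  rewrite sumr_const card_ord -[(al * _) *+ K]mulr_natl.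
  apply: (@le_trans _ _ (c N ^+ 2 * (step N ^+ 2 * (N%:R * (al * V N))))).
    by rewrite ler_wpM2l ?sqr_ge0// ler_wpM2l ?sqr_ge0// ler_wpM2r ?ler_nat// mulr_ge0.
  rewrite (_ : _ ^+ 2 * _ = (c N ^+ 2 * step N * V N) * ((N%:R * step N) * al)); last by ring.
  rewrite (N_step T N00 N0N) (_ : T * v * al * _ = v * step N ^+ p * (T * al)); last by ring.
  by rewrite ler_wpM2r// mulr_ge0// ltW.
move=> w; rewrite -exprMn mulr_sumr; congr (_ ^+ 2); apply: eq_bigr => k _.
have kN := leq_trans (ltn_ord k) KN.
by rewrite /A' kN !tE ?(ltnW kN)// mulrCA /phi' kN.
Qed.

Variable W : R -> O -> 'cV[R]_m.
Hypotheses (hW : brownian_motion P T F W) (cW : forall w i, continuous (fun s => W s w i 0)).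

Definition dW N k (i : 'I_m) : O -> R := incr W (k%:R * step N) (k.+1%:R * step N) i.

Let cell N k s : (N0 <= N)%N -> (k < N)%N -> k%:R * step N <= s <= k.+1%:R * step N ->
  [/\ 0 <= k%:R * step N, k%:R * step N <= s, s <= T, s - k%:R * step N <= step N & k.+1%:R * step N <= T].
Proof.
move=> N0N kN /andP[s1 s2]; have kT := tk_le T0 N00 N0N kN.
split => //; [exact: (tk_ge0 T0 N00 k N0N)|exact: le_trans kT|].
by move: s2; rewrite tkS; lra.
Qed.

Lemma incr_continuous s i w : continuous (fun r => incr W s r i w).
Proof. by move=> r; apply: cvgB; [exact: cW|exact: cvg_cst]. Qed.

Let N_sqr N : (N0 <= N)%N -> N%:R ^+ 2 * step N ^+ 2 = T ^+ 2.
Proof. by move=> N0N; rewrite -exprMn (N_step _ N00 N0N). Qed.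

(** The scaling is [N^2 h V = T^2] with [V = h]: areas multiplied by [N] have the order of
    increments. *)
Lemma mart_area (i : 'I_m) :
  mart 0 (fun N k w => N%:R * itg (k%:R * step N) (k.+1%:R * step N) (fun s => incr W (k%:R * step N) s i w)).
Proof.
apply: (mart_integral (V := step) (v := T ^+ 2)) => //; first exact: sqr_ge0.
- move=> N N0N; split; first exact/ltW/(step_gt0 T0 N00).
  by rewrite expr0 mulr1 -mulrA -expr2 N_sqr.
- move=> N k s N0N kN /(cell N0N kN)[a0 as_ sT sh bT].
  split; [| |exact: (incr_mean hF hW)|].
  + apply: smeasS (smeas_incr hF hW i a0 as_ sT).
    by apply: (filt_mono hF) => //; [exact: le_trans as_|rewrite tkS -lerBlDl].
  + exact: (incr_indep hF hW).
  + exact: Eb_weak sh (incr_sqr hF hW i a0 as_ sT).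
- by move=> N k w; exact: incr_continuous.
Qed.

(** One order better than for areas, since the second moment of [qincr] is of order [h^2]. *)
Lemma mart_qincr_integral (i j : 'I_m) :
  mart 1 (fun N k w => N%:R * itg (k%:R * step N) (k.+1%:R * step N) (fun s => qincr W (k%:R * step N) s i j w)).
Proof.
apply: (mart_integral (V := fun N => 60 * step N ^+ 2) (v := 60 * T ^+ 2)) => //; first by rewrite mulr_ge0// sqr_ge0.
- move=> N N0N; split; first by rewrite mulr_ge0// sqr_ge0.
  by rewrite expr1 -(N_sqr N0N) le_eqVlt; apply/orP; left; apply/eqP; ring.
- move=> N k s N0N kN /(cell N0N kN)[a0 as_ sT sh bT].
  split; [| |exact: (qincr_mean hF hW)|].
  + apply: smeasS (smeas_qincr hF hW i j a0 as_ sT).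
    by apply: (filt_mono hF) => //; [exact: le_trans as_|rewrite tkS -lerBlDl].
  + exact: (qincr_indep hF hW).
  + apply: Eb_weak (qincr_sqr hF hW i j a0 as_ sT).
    by rewrite ler_wpM2l// lerXn2r ?nnegrE ?subr_ge0// ltW// (step_gt0 T0 N00).
- move=> N k w s; apply: cvgB; first by apply: cvgM; exact: incr_continuous.
  by apply: cvgM; [exact: cvg_cst|apply: cvgB; [exact: cvg_id|exact: cvg_cst]].
Qed.

(** A variable attached to a cell is [1 / h] times its own integral over that cell, which brings it
    under [mart_integral]. *)
Let mart_cst p z (V : nat -> R) (v : R) : 0 <= v ->
  (forall N, (N0 <= N)%N -> 0 <= V N /\ V N <= v * step N ^+ p * step N) ->
  (forall N k, (N0 <= N)%N -> (k < N)%N ->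
     [/\ smeas (F (k.+1%:R * step N)) (z N k), indep_of P (F (k%:R * step N)) (z N k),
         Ex P (z N k) = 0 & Eb P (fun w => z N k w ^+ 2) (V N)]) -> mart p z.
Proof.
move=> v0 VP zP.
have [C C0 H] : mart p (fun N k w => (step N)^-1 * itg (k%:R * step N) (k.+1%:R * step N) (fun=> z N k w)).
  apply: (mart_integral (V := V) (phi := fun N k _ w => z N k w) v0) => //.
  - move=> N N0N; have s0 := step_gt0 T0 N00 N0N; have [V0 V1] := VP N N0N; split => //.
    rewrite (_ : _ ^+ 2 * _ * _ = (step N)^-1 * V N); last by field; rewrite gt_eqF.
    by rewrite ler_pdivrMl// mulrC.
  - by move=> N k s N0N kN _; exact: zP.
  - by move=> N k w s; exact: cvg_cst.
exists C => // N A al N0N mA Aal K KN.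
apply: Ub_ext (H N A al N0N mA Aal K KN) => w; congr (_ ^+ 2); apply: eq_bigr => k _; congr (_ * _).
have s0 := step_gt0 T0 N00 N0N.
by rewrite itg_cst ?tkS ?lerDl ?(ltW s0)//; field; rewrite gt_eqF.
Qed.

Let cellT N k : (N0 <= N)%N -> (k < N)%N ->
  [/\ 0 <= k%:R * step N, k%:R * step N <= k.+1%:R * step N, k.+1%:R * step N <= T &
   k.+1%:R * step N - k%:R * step N = step N].
Proof.
move=> N0N kN; have s0 := step_gt0 T0 N00 N0N; split.
- exact: (tk_ge0 T0 N00 k N0N).
- by rewrite tkS lerDl ltW.
- exact: (tk_le T0 N00 N0N kN).
- by rewrite tkS addrC addKr.
Qed.

Lemma mart_dW (i : 'I_m) : mart 0 (fun N k => dW N k i).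
Proof.
apply: (mart_cst (V := step) ler01) => [N N0N|N k N0N kN].
  by rewrite expr0 !mul1r lexx; split => //; exact/ltW/(step_gt0 T0 N00).
have [a0 ab bT hE] := cellT N0N kN; split.
- exact: (smeas_incr hF hW).
- exact: (incr_indep hF hW).
- exact: (incr_mean hF hW).
- by have := incr_sqr hF hW i a0 ab bT; rewrite hE.
Qed.

Lemma mart_qincr (i j : 'I_m) : mart 1 (fun N k => qincr W (k%:R * step N) (k.+1%:R * step N) i j).
Proof.
apply: (mart_cst (V := fun N => 60 * step N ^+ 2) (v := 60)) => // [N N0N|N k N0N kN].
  by rewrite expr1 -mulrA -expr2 lexx; split => //; rewrite mulr_ge0// sqr_ge0.
have [a0 ab bT hE] := cellT N0N kN; split.
- exact: (smeas_qincr hF hW).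
- exact: (qincr_indep hF hW).
- exact: (qincr_mean hF hW).
- by have := qincr_sqr hF hW i j a0 ab bT; rewrite hE.
Qed.

End Martingales.

Section MartingaleBounds.
Context {R : realType} {disp : measure_display} {O : measurableType disp}.
Variables (P : probability O R) (T : R) (N0 : nat) (F : R -> set (set O)).
Hypotheses (T0 : 0 < T) (N00 : (0 < N0)%N) (hF : filtration T F).
Local Notation step := (@step R T).

Lemma mart_BU p q z (A : nat -> nat -> O -> R) : mart P T N0 F p z ->
  (forall N k, (N0 <= N)%N -> (k < N)%N -> smeas (F (k%:R * step N)) (A N k)) ->
  BU P T N0 ltn q (fun N k w => A N k w ^+ 2) ->
  BU P T N0 leq (q + (p + p)) (fun N k w => (\sum_(i < k) A N i w * z N i w) ^+ 2).
Proof.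
move=> [C C0 H] mA [D D0 AD]; exists (C * D); first exact: mulr_ge0.
move=> N k N0N kN; have s0 := step_gt0 T0 N00 N0N.
have AE j : (j < N)%N -> Eb P (fun w => A N j w ^+ 2) (D * rt T N ^+ q).
  move=> jN; have [g fg gv] := AD N j N0N jN.
  apply: (Eb_le _ _ _ gv) => [|w|w]; [|exact: sqr_ge0|exact: le_trans (ler_norm _) (fg w)].
  apply: measurable_funX; apply: smeas_meas (mA N j N0N jN).
  by apply: (filt_meas hF); [exact: (tk_ge0 T0 N00 j N0N)|exact: (tk_le T0 N00 N0N (ltnW jN))].
apply: Ub_weak (H N (A N) _ N0N (mA N ^~ N0N) AE k kN).
rewrite (step_rt T0 N00 N0N) -exprM mul2n -addnn [in leRHS]exprD le_eqVlt; apply/orP; left; apply/eqP; ring.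
Qed.

End MartingaleBounds.

(** * One-step expansions *)

Section Schemes.
Context {R : realType} {n m : nat}.
Variables (b : 'cV[R]_n -> 'cV[R]_n) (sigma : 'M[R]_(n, m)) (x0 : 'cV[R]_n) (h c1 c2 : R).
Implicit Types (dl z : nat -> 'cV[R]_m).

Fixpoint euler dl k : 'cV[R]_n :=
  if k is k'.+1 then let x := euler dl k' in x + h *: b x + sigma *m dl k' else x0.

Definition diffusion_term (x : 'cV[R]_n) : 'cV[R]_n :=
  \sum_(p < m) second_deriv b x (col p sigma) (col p sigma).

(** The part of the one-step error that does not involve the error itself: [d] stands for an
    increment, [z] for an area or for its substitute in law. *)
Definition error_noise (x : 'cV[R]_n) (d z : 'cV[R]_m) : 'cV[R]_n :=
  c1 *: (h *: (Db b x *m b x) + Db b x *m (sigma *m d))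
  + Db b x *m (sigma *m z) + c2 *: (h *: diffusion_term x).

(** All coefficients are taken along [euler], so the result is a function of the sequences [dl] and
    [z] alone; this is what makes a transfer of law possible. *)
Fixpoint error_scheme dl z k : 'cV[R]_n :=
  if k is k'.+1 then
    let x := euler dl k' in let v := error_scheme dl z k' in
    v + h *: (Db b x *m v) + error_noise x (dl k') (z k')
  else 0.

End Schemes.

Section Coefficients.
Context {R : realType} {n m : nat}.
Variables (b : 'cV[R]_n -> 'cV[R]_n) (sigma : 'M[R]_(n, m)) (K : R).
Hypothesis bK : C3b_field b K.

Definition lipb (g : 'cV[R]_n -> R) (C : R) : Prop :=
  0 <= C /\ (forall x, `|g x| <= C) /\ forall x y, `|g x - g y| <= C * nrm (x - y).

Lemma lipb_mul f g C D : lipb f C -> lipb g D -> lipb (fun x => f x * g x) (C * D + C * D).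
Proof.
move=> [C0 [fC fL]] [D0 [gD gL]]; split; first by rewrite addr_ge0// mulr_ge0.
split=> [x|x y].
  by rewrite normrM (@le_trans _ _ (C * D))// ?ler_pM// lerDl mulr_ge0.
rewrite (_ : f x * g x - f y * g y = f x * (g x - g y) + (f x - f y) * g y); last by ring.
apply: le_trans (ler_normD _ _) _; rewrite !normrM mulrDl lerD//.
  by rewrite -mulrA ler_pM.
by rewrite mulrAC ler_pM.
Qed.

Lemma lipb_add f g C D : lipb f C -> lipb g D -> lipb (fun x => f x + g x) (C + D).
Proof.
move=> [C0 [fC fL]] [D0 [gD gL]]; split; first by rewrite addr_ge0.
split=> [x|x y]; first by apply: le_trans (ler_normD _ _) _; rewrite lerD.
rewrite (_ : f x + g x - (f y + g y) = (f x - f y) + (g x - g y)); last by ring.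
by apply: le_trans (ler_normD _ _) _; rewrite mulrDl lerD.
Qed.

Lemma lipb_cst c : lipb (fun=> c) `|c|.
Proof. by split=> //; split=> // x y; rewrite subrr normr0 mulr_ge0// nrm_ge0. Qed.

Lemma lipb_sum (I : Type) (s : seq I) (g : I -> 'cV[R]_n -> R) (C : I -> R) :
  (forall i, lipb (g i) (C i)) -> lipb (fun x => \sum_(i <- s) g i x) (\sum_(i <- s) C i).
Proof.
move=> gC; elim: s => [|i s IH].
  rewrite big_nil (_ : (fun x => _) = fun=> 0); last by apply/funext => x; rewrite big_nil.
  by have := lipb_cst 0; rewrite normr0.
rewrite big_cons (_ : (fun x => _) = (fun x => g i x + \sum_(i <- s) g i x)); last by apply/funext => x; rewrite big_cons.
exact: lipb_add.
Qed.

Let field_ge0 (l : 'I_n) : 0 <= K.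
Proof. exact: le_trans (normr_ge0 _) (C3b_0 (bK l) 0). Qed.

Lemma lipb_field l : lipb (fun x => b x l 0) K.
Proof.
split; first exact: field_ge0.
split=> [x|x y]; first exact: (C3b_0 (bK l)).
exact: (lipschitz_of_pderiv (C3b_d1 (bK l)) (C3b_1 (bK l))).
Qed.

Lemma lipb_jacobian l j : lipb (fun x => Db b x l j) K.
Proof.
split; first exact: field_ge0.
have E x : Db b x l j = pderiv j (fun y => b y l 0) x by rewrite mxE.
split=> [x|x y]; rewrite !E; first exact: (C3b_1 (bK l)).
apply: lipschitz_of_pderiv => [i u|i u]; [exact: (C3b_d2 (bK l))|exact: (C3b_2 (bK l))].
Qed.

Definition hess l i j x := pderiv i (pderiv j (fun y => b y l 0)) x.

Lemma lipb_hess l i j : lipb (hess l i j) K.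
Proof.
split; first exact: field_ge0.
split=> [x|x y]; first exact: (C3b_2 (bK l)).
apply: lipschitz_of_pderiv => [k u|k u]; [exact: (C3b_d3 (bK l))|exact: (C3b_3 (bK l))].
Qed.

Lemma jacobian_sigmaE x (v : 'cV[R]_m) l :
  (Db b x *m (sigma *m v)) l 0 = \sum_p (Db b x *m sigma) l p * v p 0.
Proof. by rewrite mulmxA mxE. Qed.

Lemma lipb_jacobian_sigma l p : exists C, lipb (fun x => (Db b x *m sigma) l p) C.
Proof.
exists (\sum_j (K * `|sigma j p| + K * `|sigma j p|)).
rewrite (_ : (fun x => _) = (fun x => \sum_j Db b x l j * sigma j p)); last by apply/funext => x; rewrite mxE.
by apply: lipb_sum => j; apply: lipb_mul; [exact: lipb_jacobian|exact: lipb_cst].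
Qed.

Lemma lipb_jacobian_field l : exists C, lipb (fun x => (Db b x *m b x) l 0) C.
Proof.
exists (\sum_(j < n) (K * K + K * K)).
rewrite (_ : (fun x => _) = (fun x => \sum_j Db b x l j * b x j 0)); last by apply/funext => x; rewrite mxE.
by apply: lipb_sum => j; apply: lipb_mul; [exact: lipb_jacobian|exact: lipb_field].
Qed.

Lemma diffusion_termE x l :
  diffusion_term b sigma x l 0 = \sum_(p < m) \sum_i \sum_j hess l i j x * (sigma i p * sigma j p).
Proof.
rewrite summxE; apply: eq_bigr => p _; rewrite mxE; apply: eq_bigr => i _; apply: eq_bigr => j _.
by rewrite !mxE mulrA.
Qed.

Lemma lipb_diffusion l : exists C, lipb (fun x => diffusion_term b sigma x l 0) C.
Proof.
exists (\sum_(p < m) \sum_(i < n) \sum_(j < n) (K * `|sigma i p * sigma j p| + K * `|sigma i p * sigma j p|)).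
rewrite (_ : (fun x => _) = (fun x => \sum_(p < m) \sum_i \sum_j hess l i j x * (sigma i p * sigma j p))); last first.
  by apply/funext => x; rewrite diffusion_termE.
apply: lipb_sum => p; apply: lipb_sum => i; apply: lipb_sum => j.
by apply: lipb_mul; [exact: lipb_hess|exact: lipb_cst].
Qed.

Lemma nrm_jacobian x (v : 'cV[R]_n) : nrm (Db b x *m v) <= n%:R * (K * nrm v).
Proof. by apply: nrm_mulmx => l j; have [_ [H _]] := lipb_jacobian l j. Qed.

Lemma nrm_field x : nrm (b x) <= n%:R * K.
Proof. by apply: nrm_le => l; have [_ [H _]] := lipb_field l. Qed.

Lemma nrm_field_sub x y : nrm (b x - b y) <= n%:R * (K * nrm (x - y)).
Proof. by apply: nrm_le => l; rewrite !mxE; have [_ [_ H]] := lipb_field l. Qed.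

(** A crude bound for the operator norm of [sigma] in [nrm]. *)
Definition sgn : R := n%:R * \sum_i \sum_j `|sigma i j|.

Lemma sgn_ge0 : 0 <= sgn.
Proof. by rewrite mulr_ge0// sumr_ge0// => i _; rewrite sumr_ge0. Qed.

Lemma nrm_sigma (v : 'cV[R]_m) : nrm (sigma *m v) <= sgn * nrm v.
Proof.
rewrite /sgn -mulrA; apply: nrm_mulmx => i j.
rewrite (bigD1 i)//= (bigD1 j)//= -addrA lerDl addr_ge0 ?sumr_ge0// => k _.
by rewrite sumr_ge0.
Qed.

End Coefficients.

Lemma pow4_le (R : realType) (x y : R) : (x + y) ^+ 4 <= 8 * x ^+ 4 + 8 * y ^+ 4.
Proof.
have e : 0 <= (x - y) ^+ 2 * (5 * (x + y) ^+ 2 + 2 * x ^+ 2 + 2 * y ^+ 2).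
  by rewrite mulr_ge0 ?sqr_ge0// !addr_ge0// mulr_ge0// sqr_ge0.
rewrite -subr_ge0; apply: le_trans e _; rewrite le_eqVlt; apply/orP; left; apply/eqP; ring.
Qed.

Section CellMoments.
Context {R : realType} {disp : measure_display} {O : measurableType disp}.
Variables (P : probability O R) (T : R) (N0 : nat) (F : R -> set (set O)) (m : nat).
Variable W : R -> O -> 'cV[R]_m.
Hypotheses (T0 : 0 < T) (N00 : (0 < N0)%N) (hF : filtration T F) (hW : brownian_motion P T F W)
 (cW : forall w i, continuous (fun s => W s w i 0)).
Local Notation step := (@step R T).
Local Notation rt := (@rt R T).
Local Notation BU := (BU P T N0).
Local Notation tk N k := (k%:R * step N).

(** Up to a constant, the size of any displacement within a cell, drift and noise together; it is of
    order [rt N]. *)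
Definition cellg N k s w : R := step N + nrm (W s w - W (tk N k) w).

Lemma cellg_continuous N k w : continuous (cellg N k ^~ w).
Proof.
move=> s; apply: cvgD; first exact: cvg_cst.
apply: nrm_continuous => l {}s; rewrite /continuous_at mxE; under eq_fun do rewrite mxE.
by apply: cvgD; [exact: cW|exact: cvg_cst].
Qed.

Lemma cellg_ge0 N k s w : (N0 <= N)%N -> 0 <= cellg N k s w.
Proof. by move=> N0N; rewrite addr_ge0 ?nrm_ge0// ltW// (step_gt0 T0 N00). Qed.

Lemma cell_bounds N k s : (N0 <= N)%N -> (k < N)%N -> tk N k <= s <= tk N k.+1 ->
  [/\ 0 <= tk N k, tk N k <= s, s <= T, s - tk N k <= step N & 0 <= s].
Proof.
move=> N0N kN /andP[s1 s2]; have kT := tk_le T0 N00 N0N kN.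
have t0 := tk_ge0 T0 N00 k N0N.
split => //; [exact: le_trans kT| |exact: le_trans s1].
by move: s2; rewrite tkS; lra.
Qed.

Lemma cellg_meas N k s : (N0 <= N)%N -> (k < N)%N -> tk N k <= s <= tk N k.+1 ->
  mfT (cellg N k s).
Proof.
move=> N0N kN /(cell_bounds N0N kN)[a0 as_ sT sh s0].
apply: measurable_funD => //; apply: measurable_sum => i; apply: measurableT_comp => //.
rewrite (_ : (fun w => _) = incr W (tk N k) s i); last by apply/funext => w; rewrite !mxE.
exact: (meas_incr hF hW).
Qed.

Lemma nrmW_pow4 N k s : (N0 <= N)%N -> (k < N)%N -> tk N k <= s <= tk N k.+1 ->
  Eb P (fun w => nrm (W s w - W (tk N k) w) ^+ 4) (m%:R ^+ 4 * (29 * step N ^+ 2)).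
Proof.
move=> N0N kN sc; have [a0 as_ sT sh s0] := cell_bounds N0N kN sc.
have := @Eb_sqr_sum _ _ _ P 'I_m (fun i w => m%:R * incr W (tk N k) s i w ^+ 2) (m%:R ^+ 2 * (29 * step N ^+ 2)) _ _.
rewrite card_ord (_ : m%:R ^+ 2 * (m%:R ^+ 2 * (29 * step N ^+ 2)) = m%:R ^+ 4 * (29 * step N ^+ 2)); last by ring.
move=> H; apply: (Eb_le _ _ _ (H _ _)).
- have := cellg_meas N0N kN sc; rewrite /cellg => mg; apply: measurable_funX.
  rewrite (_ : (fun w => _) = (fun w => cellg N k s w - step N)); first exact: measurable_funB.
  by apply/funext => w; rewrite /cellg addrAC subrr add0r.
- by move=> w; rewrite exprn_ge0// nrm_ge0.
- move=> w; rewrite (_ : nrm (W s w - W (tk N k) w) ^+ 4 = (nrm (W s w - W (tk N k) w) ^+ 2) ^+ 2); last by rewrite -exprM.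
  rewrite lerXn2r ?nnegrE ?sqr_ge0//.
    by apply: sumr_ge0 => i _; rewrite mulr_ge0// sqr_ge0.
  rewrite -mulr_sumr; have := sqr_sum_le (fun i => `|incr W (tk N k) s i w|).
  rewrite card_ord /nrm; congr (_ ^+ 2 <= _ * _).
    by apply: eq_bigr => i _; rewrite !mxE.
  by apply: eq_bigr => i _; rewrite real_normK// num_real.
- by move=> i; apply: measurable_funM => //; apply: measurable_funX; exact: (meas_incr hF hW).
- move=> i; apply: (@Eb_weak _ _ _ _ (m%:R ^+ 2 * (29 * (s - tk N k) ^+ 2))).
    by rewrite !ler_wpM2l ?sqr_ge0// lerXn2r ?nnegrE ?subr_ge0// ltW// (step_gt0 T0 N00).
  apply: Eb_ext (Eb_scale (sqr_ge0 _) (incr_pow4 hF hW i a0 as_ sT)) => w.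
  by rewrite exprMn -exprM.
Qed.

Lemma cellg_pow4 N k s : (N0 <= N)%N -> (k < N)%N -> tk N k <= s <= tk N k.+1 ->
  Eb P (fun w => cellg N k s w ^+ 4) ((8 * T ^+ 2 + 8 * (m%:R ^+ 4 * 29)) * rt N ^+ 4).
Proof.
move=> N0N kN sc; have s0 := step_gt0 T0 N00 N0N.
have sT : step N <= T.
  by rewrite -{2}(N_step T N00 N0N) ler_peMl ?(ltW s0)// ler1n (leq_trans N00).
have H := Eb_add (Eb_cst P (_ : 0 <= 8 * step N ^+ 4)) (Eb_scale (ler0n R 8) (nrmW_pow4 N0N kN sc)).
apply: (Eb_weak _ (Eb_le _ _ _ (H _))).
- rewrite (_ : rt N ^+ 4 = step N ^+ 2); last by rewrite (step_rt T0 N00)// -exprM.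
  rewrite (_ : 8 * step N ^+ 4 = 8 * step N ^+ 2 * step N ^+ 2); last by rewrite -mulrA -exprD.
  have : step N ^+ 2 <= T ^+ 2 by rewrite lerXn2r ?nnegrE ?(ltW s0) ?(ltW T0).
  move=> /(ler_wpM2r (sqr_ge0 (step N))); set x := step N ^+ 2; set y := m%:R ^+ 4; nra.
- apply: measurable_funX; exact: cellg_meas.
- by move=> w; rewrite exprn_ge0// cellg_ge0.
- move=> w; rewrite /cellg; set x := step N; set y := nrm _.
  have y0 : 0 <= y by exact: nrm_ge0.
  exact: pow4_le.
- by rewrite mulr_ge0// exprn_ge0// ltW.
Qed.

(** Deduced from the fourth moment: [2 g^2 <= r^2 + g^4 / r^2] with [r = rt N]. *)
Lemma cellg_pow2 N k s : (N0 <= N)%N -> (k < N)%N -> tk N k <= s <= tk N k.+1 ->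
  Eb P (fun w => cellg N k s w ^+ 2) ((1 + (8 * T ^+ 2 + 8 * (m%:R ^+ 4 * 29))) * rt N ^+ 2).
Proof.
move=> N0N kN sc; have r0 := rt_gt0 T0 N00 N0N.
have H := Eb_scale (_ : 0 <= 2^-1) (Eb_add (Eb_cst P (ltW (exprn_gt0 2 r0))) (Eb_scale (_ : 0 <= rt N ^- 2) (cellg_pow4 N0N kN sc))).
apply: (Eb_weak _ (Eb_le _ _ _ (H _ _))).
- set c := 8 * _ + _.
  have c0 : 0 <= c by apply: addr_ge0; apply: mulr_ge0 => //; rewrite ?sqr_ge0 ?mulr_ge0 ?exprn_ge0.
  rewrite (_ : rt N ^- 2 * (c * rt N ^+ 4) = c * rt N ^+ 2); last by field; rewrite gt_eqF.
  have := mulr_ge0 c0 (ltW (exprn_gt0 2 r0)); have := exprn_gt0 2 r0.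
  by rewrite (_ : (1 + c) * _ = rt N ^+ 2 + c * rt N ^+ 2); [lra|ring].
- apply: measurable_funX; exact: cellg_meas.
- by move=> w; exact: sqr_ge0.
- move=> w; set g := cellg N k s w; set r := rt N.
  have : 0 <= r ^- 2 * (r ^+ 2 - g ^+ 2) ^+ 2 by rewrite mulr_ge0 ?sqr_ge0// invr_ge0 sqr_ge0.
  rewrite (_ : _ * _ ^+ 2 = r ^+ 2 + r ^- 2 * g ^+ 4 - 2 * g ^+ 2); last by field; rewrite gt_eqF.
  lra.
- by rewrite invr_ge0.
- by rewrite invr_ge0 sqr_ge0.
Qed.

(** Interpolates between the second and the fourth moment: [2 g^3 <= r g^2 + g^4 / r]. *)
Lemma cellg_pow3 N k s : (N0 <= N)%N -> (k < N)%N -> tk N k <= s <= tk N k.+1 ->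
  Eb P (fun w => cellg N k s w ^+ 3) ((1 + 2 * (8 * T ^+ 2 + 8 * (m%:R ^+ 4 * 29))) * rt N ^+ 3).
Proof.
move=> N0N kN sc; have r0 := rt_gt0 T0 N00 N0N.
have H := Eb_scale (_ : 0 <= 2^-1) (Eb_add (Eb_scale (ltW r0) (cellg_pow2 N0N kN sc)) (Eb_scale (_ : 0 <= (rt N)^-1) (cellg_pow4 N0N kN sc))).
apply: (Eb_weak _ (Eb_le _ _ _ (H _ _))).
- set c := 8 * _ + _.
  have c0 : 0 <= c by apply: addr_ge0; apply: mulr_ge0 => //; rewrite ?sqr_ge0 ?mulr_ge0 ?exprn_ge0.
  rewrite (_ : (rt N)^-1 * (c * rt N ^+ 4) = c * rt N ^+ 3); last by field; rewrite gt_eqF.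
  rewrite (_ : rt N * ((1 + c) * rt N ^+ 2) = rt N ^+ 3 + c * rt N ^+ 3); last by ring.
  have := mulr_ge0 c0 (ltW (exprn_gt0 3 r0)); have := exprn_gt0 3 r0.
  by rewrite (_ : (1 + 2 * c) * _ = rt N ^+ 3 + 2 * (c * rt N ^+ 3)); [lra|ring].
- apply: measurable_funX; exact: cellg_meas.
- by move=> w; rewrite exprn_ge0// cellg_ge0.
- move=> w; set g := cellg N k s w; set r := rt N.
  have : 0 <= r^-1 * (g * (r - g)) ^+ 2 by rewrite mulr_ge0 ?sqr_ge0// invr_ge0 ltW.
  rewrite (_ : _ * _ ^+ 2 = r * g ^+ 2 + r^-1 * g ^+ 4 - 2 * g ^+ 3); last by field; rewrite gt_eqF.
  lra.
- by rewrite invr_ge0.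
- by rewrite invr_ge0 ltW.
Qed.

Lemma BU_itg p (C : R) (f : nat -> nat -> R -> O -> R) : 0 <= C ->
  (forall N k w, continuous (f N k ^~ w)) ->
  (forall N k s, (N0 <= N)%N -> (k < N)%N -> tk N k <= s <= tk N k.+1 ->
     Eb P (f N k s) (C * rt N ^+ p)) ->
  BU ltn p.+2 (fun N k w => itg (tk N k) (tk N k.+1) (f N k ^~ w)).
Proof.
move=> C0 cf fC; exists C => // N k N0N kN; have s0 := step_gt0 T0 N00 N0N.
have le : tk N k <= tk N k.+1 by rewrite tkS lerDl ltW.
have /Ub_Eb := Eb_itg le (cf N k) (fun s sc => fC N k s N0N kN sc); apply: Ub_weak.
rewrite tkS [X in X * _](_ : _ = step N); last by rewrite addrC addKr.
by rewrite {1}(step_rt T0 N00 N0N) mulrCA -exprD.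
Qed.

Lemma BU_step_inv e p f : BU e p.+2 (fun N k w => step N * f N k w) -> BU e p f.
Proof.
move=> [C C0 H]; exists C => // N k N0N kN; have s0 := step_gt0 T0 N00 N0N.
have := Ub_pscale (ltW (_ : 0 < (step N)^-1)) (H N k N0N kN); rewrite invr_gt0 => /(_ s0) H'.
apply: Ub_weak (Ub_ext _ H'); last by move=> w; rewrite mulKf// gt_eqF.
have E : rt N ^+ p.+2 = rt N ^+ p * step N by rewrite (step_rt T0 N00 N0N) -exprD addn2.
by rewrite E le_eqVlt; apply/orP; left; apply/eqP; field; rewrite gt_eqF.
Qed.

Let cstC : R := 1 + 2 * (8 * T ^+ 2 + 8 * (m%:R ^+ 4 * 29)).

Let cell_end N k : (N0 <= N)%N -> tk N k <= tk N k.+1 <= tk N k.+1.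
Proof. by move=> N0N; rewrite lexx andbT tkS lerDl ltW// (step_gt0 T0 N00). Qed.

Let cst_ge0 : 0 <= 8 * T ^+ 2 + 8 * (m%:R ^+ 4 * 29) :> R.
Proof. by apply: addr_ge0; apply: mulr_ge0 => //; rewrite ?sqr_ge0 ?mulr_ge0 ?exprn_ge0. Qed.

Lemma BU_cellg_end2 : BU ltn 2 (fun N k w => cellg N k (tk N k.+1) w ^+ 2).
Proof.
by eexists; last (move=> N k N0N kN; apply: Ub_Eb; exact: (cellg_pow2 N0N kN (cell_end k N0N))); rewrite addr_ge0.
Qed.

Lemma BU_cellg_end3 : BU ltn 3 (fun N k w => cellg N k (tk N k.+1) w ^+ 3).
Proof.
by eexists; last (move=> N k N0N kN; apply: Ub_Eb; exact: (cellg_pow3 N0N kN (cell_end k N0N))); rewrite addr_ge0 ?mulr_ge0.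
Qed.

Lemma BU_cellg_end : BU ltn 1 (fun N k => cellg N k (tk N k.+1)).
Proof. exact/(BU_sqr T0 N00)/BU_cellg_end2. Qed.

Let cpow N k w q : continuous (fun s => cellg N k s w ^+ q).
Proof.
elim: q => [|q IH] s; first by rewrite /continuous_at expr0; under eq_fun do rewrite expr0; exact: cvg_cst.
rewrite /continuous_at exprS; under eq_fun do rewrite exprS.
by apply: cvgM; [exact: cellg_continuous|exact: IH].
Qed.

Lemma BU_cellg_itg2 : BU ltn 4 (fun N k w => itg (tk N k) (tk N k.+1) (fun s => cellg N k s w ^+ 2)).
Proof.
apply: (BU_itg (p := 2) (C := 1 + (8 * T ^+ 2 + 8 * (m%:R ^+ 4 * 29)))); first by rewrite addr_ge0.
  by move=> N k w; exact: cpow.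
by move=> N k s N0N kN sc; exact: cellg_pow2.
Qed.

Lemma BU_cellg_itg3 : BU ltn 5 (fun N k w => itg (tk N k) (tk N k.+1) (fun s => cellg N k s w ^+ 3)).
Proof.
apply: (BU_itg (p := 3) (C := 1 + 2 * (8 * T ^+ 2 + 8 * (m%:R ^+ 4 * 29)))); first by rewrite addr_ge0 ?mulr_ge0.
  by move=> N k w; exact: cpow.
by move=> N k s N0N kN sc; exact: cellg_pow3.
Qed.

(** Cauchy-Schwarz in time reduces this to the second moment. *)
Lemma BU_cellg_itg_sqr : BU ltn 6 (fun N k w => itg (tk N k) (tk N k.+1) (cellg N k ^~ w) ^+ 2).
Proof.
have H := BU_step T0 N00 BU_cellg_itg2.
apply: (BU_le1 _ H) => N k w N0N kN; rewrite ger0_norm ?sqr_ge0//.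
have le : tk N k <= tk N k.+1 by rewrite tkS lerDl ltW// (step_gt0 T0 N00).
have := itg_sqr_le le (@cellg_continuous N k w).
have E : tk N k.+1 - tk N k = step N by rewrite tkS addrC addKr.
by rewrite E.
Qed.

Lemma BU_cellg_itg : BU ltn 3 (fun N k w => itg (tk N k) (tk N k.+1) (cellg N k ^~ w)).
Proof. exact/(BU_sqr T0 N00)/BU_cellg_itg_sqr. Qed.

End CellMoments.

Lemma itg_sum (R : realType) (a b : R) (I : Type) (r : seq I) (f : I -> R -> R) :
  (forall i, continuous (f i)) -> itg a b (fun s => \sum_(i <- r) f i s) = \sum_(i <- r) itg a b (f i).
Proof.
move=> cf; elim: r => [|i r IH].
  rewrite big_nil (_ : (fun s => _) = fun=> 0); last by apply/funext => s; rewrite big_nil.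
  by rewrite /itg Rintegral_cst//= mul0r.
rewrite big_cons -IH -itgD//; last exact: continuous_bigsum.
by congr itg; apply/funext => s; rewrite big_cons.
Qed.

Lemma continuous_scale (R : realType) (c : R) (f : R -> R) : continuous f -> continuous (fun s => c * f s).
Proof. by move=> cf s; apply: cvgM; [exact: cvg_cst|exact: cf]. Qed.

Lemma continuous_add (R : realType) (f g : R -> R) : continuous f -> continuous g -> continuous (fun s => f s + g s).
Proof. by move=> cf cg s; apply: cvgD; [exact: cf|exact: cg]. Qed.

Lemma continuous_sub (R : realType) (f g : R -> R) : continuous f -> continuous g -> continuous (fun s => f s - g s).
Proof. by move=> cf cg s; apply: cvgB; [exact: cf|exact: cg]. Qed.

(** * Expansion of the drift on one cell *)

Section Expansion.
Context {R : realType} {n m : nat}.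
Variables (b : 'cV[R]_n -> 'cV[R]_n) (sigma : 'M[R]_(n, m)) (K : R).
Hypotheses (K0 : 0 <= K) (bK : C3b_field b K).

Definition hessq l (x s : 'cV[R]_n) : R := 2^-1 * \sum_i \sum_j hess b l i j x * (s i 0 * s j 0).

Definition hess_sigma l p q (x : 'cV[R]_n) : R :=
  2^-1 * \sum_i \sum_j hess b l i j x * (sigma i p * sigma j q).

(** The displacement [v] is split into a drift close to [a] and a noise [s]. The linear term keeps
    both; the quadratic term keeps only the noise, because a mixed term is of order [h^(3/2)] and
    vanishes after summation over the cells. *)
Lemma taylor_drift_noise l (x v a s : 'cV[R]_n) :
  `|b (x + v) l 0 - b x l 0 - ((Db b x *m a) l 0 + (Db b x *m s) l 0 + hessq l x s)| <=
  K * nrm (v - a - s) + K * (nrm (v - s) * (nrm v + nrm s)) + K * nrm v ^+ 3.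
Proof.
have E (v' : 'cV[R]_n) : \sum_j pderiv j (fun y => b y l 0) x * v' j 0 = (Db b x *m v') l 0.
  by rewrite mxE; apply: eq_bigr => j _; rewrite mxE.
have := taylor2 (bK l) x v; rewrite E => H.
have E2 : 2^-1 * \sum_i \sum_j pderiv i (pderiv j (fun y => b y l 0)) x * v i 0 * v j 0 = hessq l x v.
  by congr (_ * _); apply: eq_bigr => i _; apply: eq_bigr => j _; rewrite mulrA.
rewrite E2 in H.
have H1 : `|(Db b x *m (v - a - s)) l 0| <= K * nrm (v - a - s).
  rewrite mxE (le_trans (ler_norm_sum _ _ _))// /nrm mulr_sumr; apply: ler_sum => j _.
  by rewrite normrM ler_wpM2r//; have [_ [+ _]] := lipb_jacobian bK l j; exact.
have H2 : `|hessq l x v - hessq l x s| <= K * (nrm (v - s) * (nrm v + nrm s)).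
  rewrite /hessq -mulrBr normrM ger0_norm ?invr_ge0// -sumrB.
  apply: (@le_trans _ _ (`|\sum_i (\sum_j hess b l i j x * (v i 0 * v j 0) - \sum_j hess b l i j x * (s i 0 * s j 0))|)).
    by rewrite ler_piMl//; lra.
  have -> : K * (nrm (v - s) * (nrm v + nrm s)) =
      \sum_i \sum_j K * (`|(v - s) i 0| * `|v j 0| + `|s i 0| * `|(v - s) j 0|).
    under [RHS]eq_bigr do rewrite -mulr_sumr big_split/= -!mulr_sumr -/(nrm _) -/(nrm _).
    by rewrite -mulr_sumr big_split/= -!mulr_suml -/(nrm _) -/(nrm _); ring.
  apply: le_trans (ler_norm_sum _ _ _) _; apply: ler_sum => i _.
  rewrite -sumrB; apply: le_trans (ler_norm_sum _ _ _) _; apply: ler_sum => j _.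
  rewrite -mulrBr normrM ler_pM//; first by have [_ [+ _]] := lipb_hess bK l i j; exact.
  rewrite !mxE (_ : _ - _ = (v i 0 - s i 0) * v j 0 + s i 0 * (v j 0 - s j 0)); last by ring.
  by rewrite (le_trans (ler_normD _ _))// !normrM.
have -> : b (x + v) l 0 - b x l 0 - ((Db b x *m a) l 0 + (Db b x *m s) l 0 + hessq l x s) =
  (Db b x *m (v - a - s)) l 0 + (hessq l x v - hessq l x s) +
  (b (x + v) l 0 - b x l 0 - (Db b x *m v) l 0 - hessq l x v).
  have -> : (Db b x *m (v - a - s)) l 0 = (Db b x *m v) l 0 - (Db b x *m a) l 0 - (Db b x *m s) l 0.
    by rewrite !mulmxBr !mxE.
  ring.
apply: le_trans (ler_normD _ _) _; rewrite lerD//.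
by apply: le_trans (ler_normD _ _) _; rewrite lerD.
Qed.

Lemma hessq_sigma l x (u : 'cV[R]_m) :
  hessq l x (sigma *m u) = \sum_p \sum_q hess_sigma l p q x * (u p 0 * u q 0).
Proof.
rewrite /hessq.
transitivity (2^-1 * \sum_i \sum_j \sum_p \sum_q hess b l i j x * (sigma i p * sigma j q) * (u p 0 * u q 0)).
  congr (_ * _); apply: eq_bigr => i _; apply: eq_bigr => j _.
  rewrite !mxE mulr_suml mulr_sumr; apply: eq_bigr => p _.
  rewrite mulr_sumr mulr_sumr; apply: eq_bigr => q _; ring.
rewrite mulr_sumr.
transitivity (\sum_p \sum_q \sum_i \sum_j 2^-1 * (hess b l i j x * (sigma i p * sigma j q) * (u p 0 * u q 0))).
  rewrite [RHS](eq_bigr (fun p => \sum_i \sum_q \sum_j 2^-1 * (hess b l i j x * (sigma i p * sigma j q) * (u p 0 * u q 0)))); last first.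
    by move=> p _; rewrite exchange_big.
  rewrite exchange_big; apply: eq_bigr => i _.
  rewrite [RHS](eq_bigr (fun p => \sum_j \sum_q 2^-1 * (hess b l i j x * (sigma i p * sigma j q) * (u p 0 * u q 0)))); last first.
    by move=> p _; rewrite exchange_big.
  rewrite exchange_big mulr_sumr; apply: eq_bigr => j _; rewrite mulr_sumr; apply: eq_bigr => p _.
  by rewrite mulr_sumr.
apply: eq_bigr => p _; apply: eq_bigr => q _; rewrite /hess_sigma mulr_sumr mulr_suml; apply: eq_bigr => i _.
by rewrite -mulrA -mulr_sumr mulr_suml.
Qed.

Lemma hessqZ l x (c : R) s : hessq l x (c *: s) = c ^+ 2 * hessq l x s.
Proof.
rewrite /hessq mulrCA; congr (_ * _); rewrite mulr_sumr; apply: eq_bigr => i _.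
by rewrite mulr_sumr; apply: eq_bigr => j _; rewrite !mxE; ring.
Qed.

Lemma hess_sigma_diag l x : \sum_p hess_sigma l p p x = 2^-1 * diffusion_term b sigma x l 0.
Proof. by rewrite diffusion_termE -mulr_sumr. Qed.

Lemma lipb_hess_sigma l p q : exists C, lipb (hess_sigma l p q) C.
Proof.
exists (`|2^-1| * (\sum_(i < n) \sum_(j < n) (K * `|sigma i p * sigma j q| + K * `|sigma i p * sigma j q|))
 + `|2^-1| * (\sum_(i < n) \sum_(j < n) (K * `|sigma i p * sigma j q| + K * `|sigma i p * sigma j q|))).
apply: lipb_mul; first exact: lipb_cst.
apply: lipb_sum => i; apply: lipb_sum => j.
by apply: lipb_mul; [exact: lipb_hess|exact: lipb_cst].
Qed.

Definition C1 : R := n%:R * K + sgn sigma.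

Lemma C1_ge0 : 0 <= C1.
Proof. by rewrite addr_ge0 ?sgn_ge0// mulr_ge0. Qed.

Lemma nrm_drift_noise (c d h : R) z (u : 'cV[R]_m) : 0 <= h -> `|c| <= 1 -> `|d| <= h ->
  nrm (d *: b z + c *: (sigma *m u)) <= C1 * (h + nrm u).
Proof.
move=> h0 c1 dh; apply: le_trans (nrmD _ _) _; rewrite !nrmZ mulrDl !mulrDr lerD//.
  apply: (@le_trans _ _ (n%:R * K * h)); last by rewrite lerDl ?mulr_ge0 ?nrm_ge0// ?K0.
  by rewrite mulrC ler_pM ?nrm_ge0// nrm_field.
apply: (@le_trans _ _ (sgn sigma * nrm u)).
  by rewrite (le_trans _ (nrm_sigma sigma u))// ler_piMl ?nrm_ge0.
by rewrite lerDr mulr_ge0 ?sgn_ge0// ltW.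
Qed.

(** [E1], [E2] and [E3] are the constants of the three errors in [taylor_drift_noise]: drift, mixed
    and cubic. *)
Definition E1 : R := K * (n%:R * (K * (C1 + 1))).
Definition E2 : R := K * (n%:R * K * (C1 + C1)).
Definition E3 : R := K * C1 ^+ 3.

Lemma E1_ge0 : 0 <= E1. Proof. by rewrite !mulr_ge0// addr_ge0// C1_ge0. Qed.
Lemma E2_ge0 : 0 <= E2. Proof. by rewrite !mulr_ge0// addr_ge0// C1_ge0. Qed.
Section Cell.
Variables (T h a NN : R) (x : R -> 'cV[R]_n) (u : R -> 'cV[R]_m).
Hypotheses (h0 : 0 < h) (NN0 : 0 <= NN) (NT : NN * h = T) (cx : forall l, continuous (fun s => x s l 0))
 (cu : forall p, continuous (fun s => u s p 0)) (xE : forall s l, a <= s <= a + h ->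
  x s l 0 = x a l 0 + itg a s (fun r => b (x r) l 0) + (sigma *m u s) l 0).

Let g s : R := h + nrm (u s).
Let In := itg a (a + h) g.

Let g0 s : 0 <= g s. Proof. by rewrite addr_ge0 ?nrm_ge0// ltW. Qed.

Let cg : continuous g.
Proof. by move=> s; apply: cvgD; [exact: cvg_cst|exact: nrm_continuous]. Qed.

Let cbx l : continuous (fun s => b (x s) l 0).
Proof.
by apply: (@lipschitz_path _ _ (fun y => b y l 0) K) => // y z; have [_ [_ H]] := lipb_field bK l.
Qed.

Let drift s : 'cV[R]_n := \col_l itg a s (fun r => b (x r) l 0).

Let xd s : a <= s <= a + h -> x s - x a = drift s + sigma *m u s.
Proof. by move=> sc; apply/colP => l; rewrite !mxE xE// [(sigma *m _) l 0]mxE; ring. Qed.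

Let nrm_drift s : a <= s <= a + h -> nrm (drift s) <= n%:R * (K * (s - a)).
Proof.
move=> /andP[as_ sb]; apply: nrm_le => l; rewrite mxE; apply: itg_bound; [by []|exact: cbx|move=> r _].
by have [_ [H _]] := lipb_field bK l.
Qed.

Lemma path_bound s : a <= s <= a + h -> nrm (x s - x a) <= C1 * (h + nrm (u s)).
Proof.
move=> sc; rewrite xd//; have /andP[s1 s2] := sc.
apply: le_trans (nrmD _ _) _; rewrite mulrDl !mulrDr lerD//.
  apply: le_trans (nrm_drift sc) _; rewrite -mulrA.
  apply: (@le_trans _ _ (n%:R * (K * h))); last by rewrite lerDl !mulr_ge0 ?nrm_ge0.
  by rewrite !ler_wpM2l//; lra.
by apply: le_trans (nrm_sigma _ _) _; rewrite lerDr mulr_ge0 ?sgn_ge0// ltW.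
Qed.

Let itg_g s : a <= s <= a + h -> itg a s g <= In.
Proof.
move=> /andP[s1 s2]; rewrite /In (itg_split s1 s2 cg) lerDl.
by apply: itg_ge0 => r _.
Qed.

(** Freezing the drift at the left end costs a time integral of displacements, through the Lipschitz
    bound on [b]. *)
Let nrm_drift_sub s : a <= s <= a + h -> nrm (drift s - (s - a) *: b (x a)) <= n%:R * (K * (C1 * In)).
Proof.
move=> sc; have /andP[s1 s2] := sc; apply: nrm_le => l; rewrite !mxE.
have cc : continuous (fun _ : R => b (x a) l 0) by move=> r; exact: cvg_cst.
have cbl := @cbx l; rewrite mulrC -(itg_cst _ s1) -itgB//.
apply: le_trans (itg_abs _ _ _) _; first by move=> r; apply: cvgB; [exact: cbx|exact: cvg_cst].
apply: (@le_trans _ _ (itg a s (fun r => (K * C1) * g r))).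
  apply: itg_le => [||r /andP[r1 r2]].
  - by apply: continuous_abs => r; apply: cvgB; [exact: cbx|exact: cvg_cst].
  - by move=> r; apply: cvgM; [exact: cvg_cst|exact: cg].
  - have [_ [_ H]] := lipb_field bK l; apply: le_trans (H _ _) _.
    by rewrite -mulrA ler_wpM2l// path_bound// r1 (le_trans r2 s2).
by rewrite itgZ// -mulrA ler_wpM2l// ler_wpM2l ?C1_ge0// itg_g.
Qed.

Let hE2 : itg a (a + h) (fun s => s - a) = h ^+ 2 / 2.
Proof. by rewrite itg_linear ?lerDl ?(ltW h0)// [a + h]addrC addrK. Qed.

Let J3 := itg a (a + h) (fun s => g s ^+ 3).

(** The expansion of [b] along the path, with all coefficients frozen at the left end [a]. *)
Let approx l s := (s - a) * (Db b (x a) *m b (x a)) l 0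
  + \sum_p (Db b (x a) *m sigma) l p * u s p 0
  + \sum_p \sum_q hess_sigma l p q (x a) * (u s p 0 * u s q 0).

Let approx_err l s : a <= s <= a + h ->
  `|b (x s) l 0 - b (x a) l 0 - approx l s| <= E1 * In + E2 * h * g s + E3 * g s ^+ 3.
Proof.
move=> sc; have := taylor_drift_noise l (x a) (x s - x a) ((s - a) *: b (x a)) (sigma *m u s).
rewrite [x a + _]addrC subrK hessq_sigma jacobian_sigmaE.
rewrite (_ : (Db b (x a) *m _) l 0 = (s - a) * (Db b (x a) *m b (x a)) l 0); last by rewrite -scalemxAr mxE.
move=> H; apply: le_trans H _; have /andP[s1 s2] := sc.
have us : nrm (sigma *m u s) <= C1 * g s.
  have := @nrm_drift_noise 1 0 h 0 (u s) (ltW h0); rewrite scale0r add0r scale1r; apply.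
    by rewrite normr1.
  by rewrite normr0 ltW.
rewrite !lerD//.
- rewrite /E1 -!mulrA ler_wpM2l// xd// addrAC addrK; apply: le_trans (nrm_drift_sub sc) _.
  rewrite ler_wpM2l// ler_wpM2l// ler_wpM2r ?lerDl//.
  by apply: itg_ge0 => r _.
- rewrite /E2 -!mulrA ler_wpM2l// (_ : x s - x a - sigma *m u s = drift s); last by rewrite xd// addrK.
  rewrite (_ : n%:R * _ = n%:R * (K * h) * (C1 * g s + C1 * g s)); last by ring.
  rewrite ler_pM ?nrm_ge0 ?addr_ge0 ?nrm_ge0//.
    by apply: le_trans (nrm_drift sc) _; rewrite !ler_wpM2l//; lra.
  by rewrite lerD// path_bound.
- rewrite /E3 -mulrA ler_wpM2l// -exprMn lerXn2r ?nnegrE ?nrm_ge0 ?mulr_ge0 ?C1_ge0//.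
  exact: path_bound.
Qed.

Let ccu p q : continuous (fun s => u s p 0 * u s q 0).
Proof. by move=> s; apply: cvgM; exact: cu. Qed.

Let clin : continuous (fun s : R => s - a).
Proof. by move=> s; apply: cvgB; [exact: cvg_id|exact: cvg_cst]. Qed.

(* Its integral is a martingale increment; the compensator [s - a] is what
   produces the second derivatives in the limit. *)
Definition quad p q s : R := u s p 0 * u s q 0 - (p == q)%:R * (s - a).

Let quad_itg p q : itg a (a + h) (fun s => u s p 0 * u s q 0) =
  itg a (a + h) (quad p q) + (p == q)%:R * (h ^+ 2 / 2).
Proof.
rewrite -hE2 -(itgZ _ _ _ clin) -itgD.
- by congr itg; apply/funext => s; rewrite /quad subrK.
- by apply: continuous_sub; [exact: ccu|exact: continuous_scale clin].
- exact: continuous_scale clin.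
Qed.

Let approx_itg l : NN * itg a (a + h) (approx l) =
  T * h / 2 * (Db b (x a) *m b (x a)) l 0
  + \sum_p (Db b (x a) *m sigma) l p * (NN * itg a (a + h) (fun s => u s p 0))
  + \sum_p \sum_q hess_sigma l p q (x a) * (NN * itg a (a + h) (quad p q))
  + T * h / 4 * diffusion_term b sigma (x a) l 0.
Proof.
rewrite itgD; last 2 first.
- move=> s; apply: cvgD; first by apply: cvgM; [exact: clin|exact: cvg_cst].
  by apply: continuous_bigsum => p; apply: continuous_scale.
- by apply: continuous_bigsum => p; apply: continuous_bigsum => q; apply: continuous_scale.
rewrite itgD; last 2 first.
- by move=> s; apply: cvgM; [exact: clin|exact: cvg_cst].
- by apply: continuous_bigsum => p; apply: continuous_scale.
rewrite (_ : (fun s => (s - a) * _) = (fun s => (Db b (x a) *m b (x a)) l 0 * (s - a))); last by apply/funext => s; rewrite mulrC.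
rewrite itgZ// hE2 itg_sum; last by move=> p; apply: continuous_scale.
rewrite [itg a _ (fun s => \sum_p \sum_q _)]itg_sum; last by move=> p; apply: continuous_bigsum => q; apply: continuous_scale.
rewrite (eq_bigr (fun p => (Db b (x a) *m sigma) l p * itg a (a + h) (fun s => u s p 0))); last by move=> p _; rewrite itgZ.
rewrite [X in _ * (_ + X) = _](eq_bigr (fun p => \sum_q hess_sigma l p q (x a) * itg a (a + h) (quad p q) + hess_sigma l p p (x a) * (h ^+ 2 / 2))); last first.
  move=> p _; rewrite itg_sum; last by move=> q; apply: continuous_scale.
  under eq_bigr do rewrite itgZ// quad_itg mulrDr.
  rewrite big_split/=; congr (_ + _); rewrite (bigD1 p)//= eqxx mul1r big1 ?addr0// => q qp.
  by rewrite eq_sym (negbTE qp) mul0r mulr0.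
rewrite big_split/= -mulr_suml hess_sigma_diag !mulrDr !addrA; congr (_ + _ + _ + _).
- by rewrite -NT; field.
- by rewrite mulr_sumr; apply: eq_bigr => p _; ring.
- rewrite mulr_sumr; apply: eq_bigr => p _; rewrite mulr_sumr; apply: eq_bigr => q _; ring.
- by rewrite -NT; field.
Qed.

(** [T h / 2] is [N] times the integral of [s - a] over the cell. [T h / 4] is half of it: the
    compensators of the quadratic terms are [s - a] on the diagonal, and the Taylor coefficient is
    one half. *)
Lemma cell_expansion l :
  `|NN * itg a (a + h) (fun s => b (x s) l 0 - b (x a) l 0) -
   (T * h / 2 * (Db b (x a) *m b (x a)) l 0
  + \sum_p (Db b (x a) *m sigma) l p * (NN * itg a (a + h) (fun s => u s p 0))
  + \sum_p \sum_q hess_sigma l p q (x a) * (NN * itg a (a + h) (quad p q))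
  + T * h / 4 * diffusion_term b sigma (x a) l 0)| <= (E1 + E2) * T * In + E3 * (NN * J3).
Proof.
have ca : continuous (approx l).
  move=> s; apply: cvgD; last by apply: continuous_bigsum => p; apply: continuous_bigsum => q; apply: continuous_scale.
  apply: cvgD; first by apply: cvgM; [exact: clin|exact: cvg_cst].
  by apply: continuous_bigsum => p; apply: continuous_scale.
have cb : continuous (fun s => b (x s) l 0 - b (x a) l 0) by move=> s; apply: cvgB; [exact: cbx|exact: cvg_cst].
have cg3 : continuous (fun s => g s ^+ 3).
  by move=> s; apply: (@cvg_comp _ _ _ g (fun y => y ^+ 3)); [exact: cg|exact: exprn_continuous].
rewrite -approx_itg -mulrBr -itgB// normrM (ger0_norm NN0).
apply: (@le_trans _ _ (NN * itg a (a + h) (fun s => E1 * In + E2 * h * g s + E3 * g s ^+ 3))).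
  rewrite ler_wpM2l//; apply: le_trans (itg_abs _ _ _) _.
    by move=> s; apply: cvgB; [exact: cb|exact: ca].
  apply: itg_le => [||s sc]; last exact: approx_err.
    by apply: continuous_abs => s; apply: cvgB; [exact: cb|exact: ca].
  apply: continuous_add; last exact: continuous_scale.
  by apply: continuous_add; [move=> s; exact: cvg_cst|exact: continuous_scale].
have ah : a <= a + h by rewrite lerDl ltW.
have c0 : continuous (fun _ : R => E1 * In) by move=> s; exact: cvg_cst.
rewrite itgD; [|by apply: continuous_add; [move=> s; exact: cvg_cst|exact: continuous_scale]|exact: continuous_scale].
rewrite itgD//; last by apply: continuous_scale.
rewrite itg_cst// !itgZ// -/In -/J3 [a + h]addrC addrK -NT le_eqVlt; apply/orP; left; apply/eqP; ring.
Qed.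

(** The point where the scheme evaluates [b], moved from the position of the scheme to that of the
    solution. The noise enters with the factor [theta], whence [theta^2] before the quadratic terms;
    the implicit point [z] enters through [b z], which is compared with [b (x a)]. *)
Lemma theta_expansion (th : R) (z : 'cV[R]_n) l (s := a + h) : 0 <= th <= 1 ->
  `|b (x a + th *: (h *: b z + sigma *m u s)) l 0 - b (x a) l 0 -
   (th * h * (Db b (x a) *m b (x a)) l 0
   + \sum_p (Db b (x a) *m sigma) l p * (th * u s p 0)
   + \sum_p \sum_q hess_sigma l p q (x a) * (th ^+ 2 * quad p q s)
   + th ^+ 2 * h / 2 * diffusion_term b sigma (x a) l 0)| <=
  (E1 + E2) * h * (nrm (z - x a) + g s) + E3 * g s ^+ 3.
Proof.
move=> /andP[th0 th1]; set v := th *: (h *: b z + sigma *m u s).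
have := taylor_drift_noise l (x a) v (th *: (h *: b (x a))) (th *: (sigma *m u s)).
rewrite hessqZ hessq_sigma (_ : (Db b (x a) *m (th *: (h *: _))) l 0 = th * h * (Db b (x a) *m b (x a)) l 0); last first.
  by rewrite -!scalemxAr !mxE mulrA.
rewrite (_ : (Db b (x a) *m (th *: _)) l 0 = \sum_p (Db b (x a) *m sigma) l p * (th * u s p 0)); last first.
  by rewrite -scalemxAr [LHS]mxE jacobian_sigmaE mulr_sumr; apply: eq_bigr => p _; ring.
rewrite (_ : th ^+ 2 * _ = \sum_p \sum_q hess_sigma l p q (x a) * (th ^+ 2 * quad p q s)
   + th ^+ 2 * h / 2 * diffusion_term b sigma (x a) l 0); last first.
  rewrite mulr_sumr -[th ^+ 2 * h / 2 * _]mulrA -hess_sigma_diag mulr_sumr -big_split/=.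
  apply: eq_bigr => p _; rewrite mulr_sumr (bigD1 p)//= [X in _ = X + _](bigD1 p)//= addrAC; congr (_ + _).
    by rewrite /quad /s eqxx mul1r [a + h]addrC addrK; ring.
  by apply: eq_bigr => q qp; rewrite /quad eq_sym (negbTE qp) mul0r subr0; ring.
rewrite addrA => H; apply: le_trans H _.
have v1 : nrm v <= C1 * g s.
  rewrite /v scalerDr scalerA; apply: nrm_drift_noise; [exact: ltW|by rewrite ger0_norm|].
  by rewrite ger0_norm ?ler_piMl ?mulr_ge0// ltW.
have v2 : nrm (th *: (sigma *m u s)) <= C1 * g s.
  have := @nrm_drift_noise th 0 h 0 (u s) (ltW h0); rewrite scale0r add0r; apply.
    by rewrite ger0_norm.
  by rewrite normr0 ltW.
rewrite !mulrDl lerD//; first rewrite lerD//.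
- rewrite /E1 -!mulrA ler_wpM2l//.
  rewrite (_ : v - _ - _ = (th * h) *: (b z - b (x a))); last first.
    by rewrite /v scalerDr addrAC addrK -!scalerBr scalerA.
  rewrite nrmZ ger0_norm ?mulr_ge0 ?(ltW h0)//.
  apply: (@le_trans _ _ (h * (n%:R * (K * nrm (z - x a))))).
    rewrite ler_pM ?nrm_ge0 ?mulr_ge0 ?(ltW h0)//; last exact: nrm_field_sub.
    by rewrite ler_piMl// ltW.
  rewrite [leRHS](_ : _ = h * (n%:R * (K * ((C1 + 1) * (nrm (z - x a) + g s))))); last by ring.
  rewrite ler_wpM2l ?(ltW h0)// !ler_wpM2l// mulrDl mul1r addrA.
  rewrite addrAC lerDr addr_ge0// mulr_ge0 ?C1_ge0//.
  by rewrite addr_ge0 ?nrm_ge0.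
- rewrite /E2 -!mulrA ler_wpM2l//.
  rewrite (_ : v - _ = (th * h) *: b z); last by rewrite /v scalerDr addrK scalerA.
  rewrite [leRHS](_ : _ = (h * (n%:R * K)) * (C1 * (nrm (z - x a) + g s) + C1 * (nrm (z - x a) + g s))); last by ring.
  rewrite ler_pM ?nrm_ge0 ?addr_ge0 ?nrm_ge0//.
    rewrite nrmZ ger0_norm ?mulr_ge0 ?(ltW h0)// ler_pM ?nrm_ge0 ?mulr_ge0 ?(ltW h0)//; last exact: nrm_field.
    by rewrite ler_piMl// ltW.
  have gg : C1 * g s <= C1 * (nrm (z - x a) + g s) by rewrite ler_wpM2l ?C1_ge0// lerDr nrm_ge0.
  by rewrite lerD// (le_trans _ gg).
- rewrite /E3 -mulrA ler_wpM2l// -exprMn lerXn2r ?nnegrE ?nrm_ge0 ?mulr_ge0 ?C1_ge0//.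
Qed.

End Cell.

End Expansion.

(** * The error recursion *)

Section Schemes.
Context {R : realType} {disp : measure_display} {O : measurableType disp}.
Variables (P : probability O R) (T : R) (N0 : nat) (F : R -> set (set O)) (n m : nat).
Variables (b : 'cV[R]_n -> 'cV[R]_n) (sigma : 'M[R]_(n, m)) (K : R) (x0 : 'cV[R]_n).
Variable W : R -> O -> 'cV[R]_m.
Hypotheses (K0 : 0 <= K) (bK : C3b_field b K) (T0 : 0 < T) (N00 : (0 < N0)%N) (hF : filtration T F)
 (hW : brownian_motion P T F W).
Local Notation step := (@step R T).
Local Notation rt := (@rt R T).
Local Notation BU := (BU P T N0).
Local Notation mart := (mart P T N0 F).
Local Notation tk N k := (k%:R * step N).

Definition incs N (w : O) (k : nat) : 'cV[R]_m := W (tk N k.+1) w - W (tk N k) w.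
Definition eul N k w := euler b sigma x0 (step N) (incs N w) k.

Lemma incsE N w k p : incs N w k p 0 = dW T W N k p w.
Proof. by rewrite /incs !mxE. Qed.

Lemma smeas_lipb G (g : 'cV[R]_n -> R) C (X : O -> 'cV[R]_n) : lipb g C ->
  (forall l, smeas G (fun w => X w l 0)) -> smeas G (fun w => g (X w)).
Proof. by move=> [_ [_ H]]; exact: smeas_lipschitz. Qed.

Lemma eul_smeas N k l : (N0 <= N)%N -> (k <= N)%N -> smeas (F (tk N k)) (fun w => eul N k w l 0).
Proof.
move=> N0N; elim: k l => [|k IH] l kN; first exact: smeas_cst.
have t0 := tk_ge0 T0 N00 k N0N; have tT := tk_le T0 N00 N0N kN.
have tt : tk N k <= tk N k.+1 by rewrite tkS lerDl ltW// (step_gt0 T0 N00).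
have mono := smeasS (filt_mono hF t0 tt tT).
rewrite (_ : (fun w => _) = (fun w => (eul N k w l 0 + step N * b (eul N k w) l 0) + \sum_p sigma l p * dW T W N k p w)); last first.
  by apply/funext => w; rewrite /eul/= !mxE; congr (_ + _); apply: eq_bigr => p _; rewrite -incsE.
apply: smeasD; last by apply: smeas_sum => p; apply: smeasM; [exact: smeas_cst|exact: (smeas_incr hF hW)].
apply: smeasD; first exact/mono/IH/ltnW.
apply: smeasM; first exact: smeas_cst.
by apply: mono; apply: smeas_lipb (lipb_field bK l) _ => i; exact/IH/ltnW.
Qed.

Lemma error_noiseE (h c1 c2 : R) x d z l : error_noise b sigma h c1 c2 x d z l 0 =
  c1 * (h * (Db b x *m b x) l 0) + \sum_p (Db b x *m sigma) l p * (c1 * d p 0 + z p 0)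
  + c2 * (h * diffusion_term b sigma x l 0).
Proof.
rewrite /error_noise.
have -> : (c1 *: (h *: (Db b x *m b x) + Db b x *m (sigma *m d)) + Db b x *m (sigma *m z)
  + c2 *: (h *: diffusion_term b sigma x)) l 0 =
  c1 * (h * (Db b x *m b x) l 0 + (Db b x *m (sigma *m d)) l 0) + (Db b x *m (sigma *m z)) l 0
  + c2 * (h * diffusion_term b sigma x l 0).
  move: (Db b x *m b x) (Db b x *m (sigma *m d)) (Db b x *m (sigma *m z)) (diffusion_term b sigma x) => u1 u2 u3 u4.
  by rewrite !mxE.
rewrite mulrDr -[X in X + _ = _]addrA; congr (_ + _ + _).
rewrite !jacobian_sigmaE mulr_sumr -big_split/=; apply: eq_bigr => p _; ring.
Qed.

(** Squaring the recursion and applying Cauchy-Schwarz with [k h <= T] gives a linear recursion for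
    the squares. *)
Lemma BU_gronwall_sqr p a M (lam : R) : 0 <= lam ->
  (forall N k w, (N0 <= N)%N -> (k <= N)%N -> 0 <= a N k w <= M N k w + lam * step N * \sum_(i < k) a N i w) ->
  BU leq p (fun N k w => M N k w ^+ 2) -> BU leq p (fun N k w => a N k w ^+ 2).
Proof.
move=> l0 aM Mp; apply: (BU_gronwall T0 N00 (lam := 2 * lam ^+ 2 * T)) (BU_scale 2 Mp).
  by rewrite !mulr_ge0 ?sqr_ge0// ltW.
move=> N k w N0N kN; have /andP[a0 aS] := aM N k w N0N kN; have s0 := step_gt0 T0 N00 N0N.
rewrite ger0_norm ?sqr_ge0//.
rewrite [X in _ <= _ + _ * X](eq_bigr (fun i : 'I_k => a N i w ^+ 2)); last by move=> i _; rewrite ger0_norm ?sqr_ge0.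
have S0 : 0 <= \sum_(i < k) a N i w.
  apply: sumr_ge0 => i _; have /andP[] // := aM N i w N0N (leq_trans (ltnW (ltn_ord i)) kN).
have sq := sqr_sum_le (fun i : 'I_k => a N i w); rewrite card_ord in sq.
set S := \sum_(i < k) a N i w in S0 sq aS *; set Q := \sum_(i < k) a N i w ^+ 2 in sq *.
have Q0 : 0 <= Q by apply: sumr_ge0 => i _; exact: sqr_ge0.
apply: (@le_trans _ _ ((M N k w + lam * step N * S) ^+ 2)).
  by rewrite lerXn2r ?nnegrE// (le_trans a0 aS).
apply: (@le_trans _ _ (2 * M N k w ^+ 2 + 2 * (lam * step N * S) ^+ 2)).
  rewrite -subr_ge0 (_ : _ - _ = (M N k w - lam * step N * S) ^+ 2) ?sqr_ge0//; ring.
rewrite lerD2l (_ : 2 * (lam * step N * S) ^+ 2 = 2 * (lam ^+ 2 * (step N * (step N * S ^+ 2)))); last by ring.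
have kT : k%:R * step N <= T by exact: (tk_le T0 N00 N0N kN).
rewrite (_ : 2 * lam ^+ 2 * T * step N * Q = 2 * (lam ^+ 2 * (step N * (T * Q)))); last by ring.
rewrite ler_wpM2l// ler_wpM2l ?sqr_ge0// ler_wpM2l ?(ltW s0)//.
apply: (@le_trans _ _ (step N * (k%:R * Q))); first by rewrite ler_wpM2l ?(ltW s0).
by rewrite mulrA [step N * _]mulrC ler_wpM2r.
Qed.

Lemma BU_sqr_nrm e p (v : nat -> nat -> O -> 'cV[R]_n) :
  (forall l, BU e p (fun N k w => v N k w l 0 ^+ 2)) -> BU e p (fun N k w => nrm (v N k w) ^+ 2).
Proof.
move=> H; apply: BU_sqr_bigsum => l; apply: (BU_le1 _ (H l)) => N k w _ _.
by rewrite ger0_norm ?sqr_ge0// real_normK// num_real.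
Qed.

Lemma BU_nrm e p (v : nat -> nat -> O -> 'cV[R]_n) :
  (forall l, BU e p (fun N k w => v N k w l 0)) -> BU e p (fun N k w => nrm (v N k w)).
Proof. by move=> H; apply: BU_bigsum => l; exact: BU_abs. Qed.

Lemma BU_const_sum (f : nat -> nat -> O -> R) C : 0 <= C -> (forall N k w, `|f N k w| <= C) ->
  BU leq 0 (fun N k w => (\sum_(i < k) step N * f N i w) ^+ 2).
Proof.
move=> C0 fC; apply: (BU_le1 _ (BU_cst P T N0 leq ((C * T) ^+ 2))) => N k w N0N kN.
rewrite ger0_norm ?sqr_ge0// -real_normK ?num_real// lerXn2r ?nnegrE ?mulr_ge0 ?(ltW T0)//.
have s0 := step_gt0 T0 N00 N0N.
apply: le_trans (ler_norm_sum _ _ _) _; apply: (@le_trans _ _ (\sum_(i < k) step N * C)).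
  by apply: ler_sum => i _; rewrite normrM ger0_norm ?(ltW s0)// ler_wpM2l// ltW.
by rewrite sumr_const card_ord -[_ *+ k]mulr_natl [step N * C]mulrC mulrCA ler_wpM2l// (tk_le T0 N00 N0N kN).
Qed.

Variables (c1 c2 : R) (z : nat -> O -> nat -> 'cV[R]_m).
Hypothesis zm : forall p, mart 0 (fun N k w => z N w k p 0).

Definition err N k w := error_scheme b sigma x0 (step N) c1 c2 (incs N w) (z N w) k.

Let noise N k w := error_noise b sigma (step N) c1 c2 (eul N k w) (incs N w k) (z N w k).

Lemma err_sum N k w : err N k w = \sum_(i < k) (step N *: (Db b (eul N i w) *m err N i w) + noise N i w).
Proof. by elim: k => [|k IH]; [rewrite big_ord0|rewrite big_ord_recr/= -IH addrA]. Qed.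

Lemma smeas_jacobian_sigma l p N k : (N0 <= N)%N -> (k < N)%N ->
  smeas (F (tk N k)) (fun w => (Db b (eul N k w) *m sigma) l p).
Proof.
move=> N0N kN; have [C H] := lipb_jacobian_sigma sigma bK l p.
by apply: (smeas_lipb H) => i; exact/eul_smeas/ltnW.
Qed.

Lemma BU_bounded (g : 'cV[R]_n -> R) C (x : nat -> nat -> O -> 'cV[R]_n) e :
  lipb g C -> BU e 0 (fun N k w => g (x N k w) ^+ 2).
Proof.
move=> [C0 [gC _]]; apply: (BU_le1 _ (BU_cst P T N0 e (C ^+ 2))) => N k w _ _.
by rewrite ger0_norm ?sqr_ge0// -real_normK ?num_real// lerXn2r ?nnegrE.
Qed.

(** The accumulated noise is bounded in mean square: drift and diffusion terms are [O(h)] per cell,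
    while increments and areas form martingale transforms with bounded coefficients. *)
Lemma BU_err : BU leq 0 (fun N k w => nrm (err N k w) ^+ 2).
Proof.
apply: (@BU_gronwall_sqr 0 _ (fun N k w => nrm (\sum_(i < k) noise N i w)) (n%:R * K)).
- by rewrite mulr_ge0.
- move=> N k w N0N kN; have s0 := step_gt0 T0 N00 N0N; rewrite nrm_ge0/= {1}err_sum big_split/= addrC.
  apply: le_trans (nrmD _ _) _; rewrite lerD2l mulr_sumr; apply: le_trans (nrm_sum _ _ _) _.
  apply: ler_sum => i _; rewrite nrmZ (ger0_norm (ltW s0)).
  by rewrite [leRHS](_ : _ = step N * (n%:R * (K * nrm (err N i w)))); [rewrite ler_wpM2l ?(ltW s0)// nrm_jacobian|ring].
apply: BU_sqr_nrm => l.
have [Cb Hb] := lipb_jacobian_field bK l; have [Cd Hd] := lipb_diffusion sigma bK l.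
have [Cb0 [Hb1 _]] := Hb; have [Cd0 [Hd1 _]] := Hd.
have H1 := @BU_const_sum (fun N k w => c1 * (Db b (eul N k w) *m b (eul N k w)) l 0) (`|c1| * Cb).
have H3 := @BU_const_sum (fun N k w => c2 * diffusion_term b sigma (eul N k w) l 0) (`|c2| * Cd).
have H2 : BU leq 0 (fun N k w => (\sum_p \sum_(i < k) (Db b (eul N i w) *m sigma) l p * (c1 * dW T W N i p w + z N w i p 0)) ^+ 2).
  apply: BU_sqr_bigsum => p; have [C Hp] := lipb_jacobian_sigma sigma bK l p.
  apply: (@mart_BU _ _ _ P T N0 F T0 N00 hF 0 0 (fun N k w => c1 * dW T W N k p w + z N w k p 0) (fun N k w => (Db b (eul N k w) *m sigma) l p)).
  - by apply: mart_add (zm p); apply: mart_scale; exact: (mart_dW T0 N00 hF hW).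
  - by move=> N k N0N kN; exact: smeas_jacobian_sigma.
  - exact: BU_bounded Hp.
have H := BU_sqr_add (BU_sqr_add (H1 _ _) H2) (H3 _ _).
apply: (BU_le1 _ (H _ _ _ _)) => [N k w _ _||N k w||N k w]; [|exact: mulr_ge0|by rewrite normrM ler_wpM2l|exact: mulr_ge0|by rewrite normrM ler_wpM2l].
rewrite ger0_norm ?sqr_ge0// le_eqVlt; apply/orP; left; apply/eqP; congr (_ ^+ 2).
rewrite exchange_big -!big_split/= summxE; apply: eq_bigr => i _.
rewrite /noise error_noiseE; congr (_ + _ + _); [ring| |ring].
by apply: eq_bigr => p _; rewrite incsE.
Qed.

End Schemes.

(** * The normalised error and its linearisation *)

Section Prelimit.
Context {R : realType} {disp : measure_display} {O : measurableType disp}.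
Variables (P : probability O R) (T : R) (N0 : nat) (F : R -> set (set O)) (n m : nat).
Variables (b : 'cV[R]_n -> 'cV[R]_n) (sigma : 'M[R]_(n, m)) (K : R) (x0 : 'cV[R]_n).
Variables (W : R -> O -> 'cV[R]_m) (X : R -> O -> 'cV[R]_n).
Hypotheses (K0 : 0 <= K) (bK : C3b_field b K) (T0 : 0 < T) (N00 : (0 < N0)%N) (hF : filtration T F)
 (hW : brownian_motion P T F W) (cW : forall w i, continuous (fun s => W s w i 0))
 (cX : forall w l, continuous (fun s => X s w l 0))
 (aX : forall s l, 0 <= s -> s <= T -> smeas (F s) (fun w => X s w l 0)) (X0 : forall w, X 0 w = x0)
 (XE : forall w r s l, 0 <= r -> r <= s -> s <= T ->
  X s w l 0 = X r w l 0 + itg r s (fun u => b (X u w) l 0) + (sigma *m (W s w - W r w)) l 0).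
Local Notation step := (@step R T).
Local Notation rt := (@rt R T).
Local Notation BU := (BU P T N0).
Local Notation tk N k := (k%:R * step N).
Local Notation incs := (incs T W).
Local Notation cellg := (cellg T W).
Local Notation C1 := (C1 sigma K).

Let C10 : 0 <= C1. Proof. exact: C1_ge0. Qed.

Let cellg0 N k s w : (N0 <= N)%N -> 0 <= cellg N k s w.
Proof. exact: (cellg_ge0 W T0 N00). Qed.

Definition cellI N k w : R := itg (tk N k) (tk N k.+1) (cellg N k ^~ w).

Let tk_lt N k : (N0 <= N)%N -> tk N k <= tk N k.+1.
Proof. by move=> N0N; rewrite tkS lerDl ltW// (step_gt0 T0 N00). Qed.

Let cellX N k w : (N0 <= N)%N -> (k < N)%N -> forall s l, tk N k <= s <= tk N k + step N ->
  X s w l 0 = X (tk N k) w l 0 + itg (tk N k) s (fun u => b (X u w) l 0) + (sigma *m (W s w - W (tk N k) w)) l 0.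
Proof.
move=> N0N kN s l; rewrite -tkS => sc.
by have [a0 as_ sT sh s0] := cell_bounds T0 N00 N0N kN sc; exact: XE.
Qed.

Let cbX w l : continuous (fun s => b (X s w) l 0).
Proof. by apply: (@lipschitz_path _ _ (fun y => b y l 0) K) => // y z; have [_ [_ H]] := lipb_field bK l. Qed.

Lemma X_cell N k w s : (N0 <= N)%N -> (k < N)%N -> tk N k <= s <= tk N k.+1 ->
  nrm (X s w - X (tk N k) w) <= C1 * cellg N k s w.
Proof.
move=> N0N kN; rewrite tkS => sc.
exact: (path_bound K0 bK (step_gt0 T0 N00 N0N) (fun l => @cX w l) (@cellX N k w N0N kN) sc).
Qed.

Lemma cellI_ge0 N k w : (N0 <= N)%N -> 0 <= cellI N k w.
Proof. by move=> N0N; apply: itg_ge0 => s _; exact: cellg0. Qed.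

Lemma cell_defect N k w (z : 'cV[R]_n) t l : (N0 <= N)%N -> (k < N)%N -> tk N k <= t <= tk N k.+1 ->
  `|itg (tk N k) t (fun s => b (X s w) l 0 - b z l 0)| <= K * (C1 * cellI N k w + step N * nrm (X (tk N k) w - z)).
Proof.
move=> N0N kN /andP[t1 t2].
have cz : continuous (fun s => b (X s w) l 0 - b z l 0) by apply: continuous_sub => // s; exact: cvg_cst.
apply: le_trans (itg_abs _ _ cz) _.
have cg := @cellg_continuous _ _ _ T m W cW N k w.
have cc : continuous (fun s => C1 * cellg N k s w + nrm (X (tk N k) w - z)).
  by apply: continuous_add; [exact: continuous_scale|move=> s; exact: cvg_cst].
apply: (@le_trans _ _ (itg (tk N k) t (fun s => K * (C1 * cellg N k s w + nrm (X (tk N k) w - z))))).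
  apply: itg_le => [||s /andP[s1 s2]]; [exact: continuous_abs|exact: continuous_scale|].
  have [_ [_ H]] := lipb_field bK l; apply: le_trans (H _ _) _; rewrite ler_wpM2l//.
  apply: le_trans (nrm_sub_trans _ (X (tk N k) w) _) _; rewrite lerD2r X_cell// s1/=.
  exact: le_trans t2.
rewrite itgZ// ler_wpM2l//; apply: (@le_trans _ _ (itg (tk N k) (tk N k.+1) (fun s => C1 * cellg N k s w + nrm (X (tk N k) w - z)))).
  rewrite (itg_split t1 t2 cc) lerDl; apply: itg_ge0 => s _.
  by rewrite addr_ge0 ?nrm_ge0// mulr_ge0// cellg0.
have cc0 : continuous (fun _ : R => nrm (X (tk N k) w - z)) by move=> s; exact: cvg_cst.
rewrite itgD//; last exact: continuous_scale.
have hE : tk N k.+1 - tk N k = step N by rewrite tkS addrC addKr.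
by rewrite itgZ// itg_cst ?tk_lt// hE [nrm _ * _]mulrC.
Qed.

(* [y] may be an implicit scheme and need not be measurable. *)
Definition scheme_like (y Z : nat -> nat -> O -> 'cV[R]_n) : Prop :=
  forall N w, (N0 <= N)%N -> y N 0 w = x0 /\ forall k, (k < N)%N ->
    y N k.+1 w = y N k w + step N *: b (Z N k w) + sigma *m incs N w k /\
    nrm (Z N k w - y N k w) <= C1 * cellg N k (tk N k.+1) w.

(** The noise is additive and shared, so it cancels and only drifts remain. *)
Lemma scheme_gap y Z N k w : scheme_like y Z -> (N0 <= N)%N -> (k <= N)%N ->
  X (tk N k) w - y N k w =
  \sum_(i < k) \col_l itg (tk N i) (tk N i.+1) (fun s => b (X s w) l 0 - b (Z N i w) l 0).
Proof.
move=> yZ N0N; have [y0 yS] := yZ N w N0N; elim: k => [|k IH] kN.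
  by rewrite big_ord0 mul0r X0 y0 subrr.
rewrite big_ord_recr/= -IH ?(ltnW kN)//; have [-> _] := yS k kN; apply/colP => l.
have cc0 : continuous (fun _ : R => b (Z N k w) l 0) by move=> s; exact: cvg_cst.
rewrite !mxE itgB// itg_cst ?tk_lt// tkS [_ + step N - _]addrC addKr -tkS.
rewrite (XE w l (tk_ge0 T0 N00 k N0N) (tk_lt k N0N) (tk_le T0 N00 N0N kN)) [(sigma *m _) l 0]mxE.
by rewrite (eq_bigr (fun j => sigma l j * incs N w k j 0))//; ring.
Qed.

(** A mean-square error of order [h] by Gronwall: enough to exchange coefficients along the solution
    and along the schemes. *)
Lemma scheme_strong y Z : scheme_like y Z -> BU leq 2 (fun N k w => nrm (X (tk N k) w - y N k w) ^+ 2).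
Proof.
move=> yZ.
pose S N k w := n%:R * K * C1 * (cellI N k w + step N * cellg N k (tk N k.+1) w).
apply: (@BU_gronwall_sqr _ _ _ P T N0 T0 N00 2 _ (fun N k w => \sum_(i < k) S N i w) (n%:R * K)).
- by rewrite mulr_ge0.
- move=> N k w N0N kN; rewrite nrm_ge0/= (scheme_gap w yZ N0N kN).
  apply: le_trans (nrm_sum _ _ _) _; rewrite mulr_sumr -big_split/=; apply: ler_sum => i _ /=.
  have iN := leq_trans (ltn_ord i) kN; have [_ yS] := yZ N w N0N; have [_ Zi] := yS i iN.
  apply: (@le_trans _ _ (n%:R * (K * (C1 * cellI N i w + step N * nrm (X (tk N i) w - Z N i w))))).
    by apply: nrm_le => l; rewrite mxE cell_defect// lexx andbT tk_lt.
  rewrite [leRHS](_ : _ = n%:R * (K * (C1 * cellI N i w + step N * (C1 * cellg N i (tk N i.+1) w + nrm (X (tk N i) w - y N i w))))); last by rewrite /S; ring.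
  rewrite !ler_wpM2l// lerD2l ler_wpM2l ?(ltW (step_gt0 T0 N00 N0N))// [leRHS]addrC.
  by apply: le_trans (nrm_sub_trans _ (y N i w) _) _; rewrite lerD2l nrmC.
apply: (BU_step_inv T0 N00); apply: (BU_sqr_sumk T0 N00).
have H1 := BU_cellg_itg_sqr T0 N00 hF hW cW.
have H2 := BU_step T0 N00 (BU_step T0 N00 (BU_cellg_end2 T0 N00 hF hW)).
have H3 : BU ltn 6 (fun N k w => (step N * cellg N k (tk N k.+1) w) ^+ 2).
  apply: (BU_le1 _ H2) => N k w _ _.
  by rewrite ger0_norm ?sqr_ge0// exprMn expr2 mulrA.
apply: (BU_le (c := (n%:R * K * C1) ^+ 2)) (BU_sqr_add H1 H3) => N k w _ _.
by rewrite ger0_norm ?sqr_ge0// /S exprMn.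
Qed.

Lemma euler_like : scheme_like (eul T b sigma x0 W) (eul T b sigma x0 W).
Proof.
move=> N w N0N; split => // k kN; split => //.
by rewrite subrr nrm0 mulr_ge0// cellg0.
Qed.

Lemma euler_strong : BU leq 2 (fun N k w => nrm (X (tk N k) w - eul T b sigma x0 W N k w) ^+ 2).
Proof. exact: scheme_strong euler_like. Qed.

Variable theta : R.
Hypothesis th01 : 0 <= theta <= 1.
Variable y : nat -> nat -> O -> 'cV[R]_n.
Let Z N k w := theta *: y N k.+1 w + (1 - theta) *: y N k w.
Hypotheses (y0 : forall N w, (N0 <= N)%N -> y N 0 w = x0) (yS : forall N w k, (N0 <= N)%N -> (k < N)%N ->
  y N k.+1 w = y N k w + step N *: b (Z N k w) + sigma *m incs N w k).

Let Zy N k w : (N0 <= N)%N -> (k < N)%N ->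
  Z N k w - y N k w = theta *: (step N *: b (Z N k w) + sigma *m incs N w k).
Proof.
move=> N0N kN; rewrite {1}/Z yS//; move: (y N k w) (step N *: _) (sigma *m _) => u1 u2 u3.
by apply/colP => l; rewrite !mxE; ring.
Qed.

Lemma theta_like : scheme_like y Z.
Proof.
move=> N w N0N; split; first exact: y0.
move=> k kN; split; first exact: yS.
have s0 := step_gt0 T0 N00 N0N; have /andP[th0 th1] := th01.
rewrite Zy// scalerDr scalerA.
apply: (@nrm_drift_noise _ _ _ b sigma K K0 bK theta (theta * step N) (step N) (Z N k w) (incs N w k)); first exact: ltW.
  by rewrite ger0_norm.
by rewrite normrM (ger0_norm th0) (ger0_norm (ltW s0)) ler_piMl// ltW.
Qed.

Lemma theta_strong : BU leq 2 (fun N k w => nrm (X (tk N k) w - y N k w) ^+ 2).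
Proof. exact: scheme_strong theta_like. Qed.

Let eul := eul T b sigma x0 W.
Let c1 : R := (1 - 2 * theta) * T / 2.
Let c2 : R := (1 - 2 * theta ^+ 2) * T / 4.

(* Uncorrelated with the increment over the cell. *)
Definition area N w k : 'cV[R]_m :=
  \col_p (N%:R * itg (tk N k) (tk N k.+1) (fun s => incr W (tk N k) s p w) - T / 2 * dW T W N k p w).

Definition area_err : nat -> nat -> O -> 'cV[R]_n := err T b sigma x0 W c1 c2 area.
Definition norm_err N k w : 'cV[R]_n := N%:R *: (X (tk N k) w - y N k w).

Let V := area_err.
Let U := norm_err.

Lemma mart_area_z p : mart P T N0 F 0 (fun N k w => area N w k p 0).
Proof.
have [C C0 H] := mart_add (mart_area T0 N00 hF hW cW p) (mart_scale (- (T / 2)) (mart_dW T0 N00 hF hW p)).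
exists C => // N A al N0N mA Aal k kN; apply: Ub_ext (H N A al N0N mA Aal k kN) => w.
by congr (_ ^+ 2); apply: eq_bigr => i _; rewrite mxE mulNr.
Qed.

(** The evaluation point of the scheme with its base [y N k] replaced by the solution; the
    difference to [Z] is then exactly the error at time [k]. *)
Let Z' N k w := X (tk N k) w + theta *: (step N *: b (Z N k w) + sigma *m incs N w k).

Let noise N k w := error_noise b sigma (step N) c1 c2 (eul N k w) (incs N w k) (area N w k).

(** The normalised error of one step based on the solution, after its limiting noise has been taken
    out. *)
Let rem N k w : 'cV[R]_n := \col_l (N%:R * itg (tk N k) (tk N k.+1) (fun s => b (X s w) l 0 - b (X (tk N k) w) l 0)
  - T * (b (Z' N k w) l 0 - b (X (tk N k) w) l 0)) - noise N k w.

(** The normalised effect of being off the solution, minus its linearisation at the Euler point. *)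
Let lin N k w : 'cV[R]_n := T *: (b (Z' N k w) - b (Z N k w)) - step N *: (Db b (eul N k w) *m U N k w).

Let gap N k w := U N k w - V N k w.

Let gap_sum N k w : (N0 <= N)%N -> (k <= N)%N ->
  gap N k w = \sum_(i < k) (rem N i w + lin N i w + step N *: (Db b (eul N i w) *m gap N i w)).
Proof.
move=> N0N kN; rewrite {1}/gap /U /norm_err (scheme_gap w theta_like N0N kN) scaler_sumr.
rewrite {1}/V /area_err err_sum -sumrB; apply: eq_bigr => i _.
have iN := leq_trans (ltn_ord i) kN.
rewrite /gap mulmxBr scalerBr /lin /rem -/(noise N i w) -/(V N i w).
move: (step N *: (Db b (eul N i w) *m U N i w)) (step N *: (Db b (eul N i w) *m V N i w)) (noise N i w) => u1 u2 u3.
have cc (v : 'cV[R]_n) l : continuous (fun s => b (X s w) l 0 - b v l 0).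
  by apply: continuous_sub => // s; exact: cvg_cst.
have cc0 (v : 'cV[R]_n) l : continuous (fun _ : R => b v l 0) by move=> s; exact: cvg_cst.
apply/colP => l; rewrite !mxE !itgB// !itg_cst ?tk_lt//.
have hE : tk N i.+1 - tk N i = step N by rewrite tkS addrC addKr.
have e1 c : N%:R * (c * step N) = T * c by rewrite -[T in RHS](N_step T N00 N0N); ring.
rewrite hE !mulrBr !e1; ring.
Qed.

Let dev N k w := 2 * nrm (X (tk N k) w - eul N k w) + (nrm (X (tk N k) w - y N k w) + 2 * (C1 * cellg N k (tk N k.+1) w)).

Let dev0 N k w : (N0 <= N)%N -> 0 <= dev N k w.
Proof. by move=> N0N; rewrite !addr_ge0 ?mulr_ge0 ?nrm_ge0// cellg0. Qed.

(** [nrm U] is bounded by the gap plus [nrm V]. Taylor's bound alone would produce [dev] times the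
    gap, for which no useful moment is known. The smaller of the Taylor and Lipschitz bounds leaves
    twice the gap, fit for Gronwall, and [dev] times [nrm V], fit for Cauchy-Schwarz. *)
Let lin_bound N k w : (N0 <= N)%N -> (k < N)%N ->
  nrm (lin N k w) <= n%:R * (step N * K * (2 * nrm (gap N k w) + dev N k w * nrm (V N k w))).
Proof.
move=> N0N kN; have s0 := step_gt0 T0 N00 N0N.
have [_ /(_ k kN)[_ Zb]] := theta_like w N0N.
set D := X (tk N k) w - y N k w.
have ZD : Z' N k w - Z N k w = D.
  by rewrite /Z' -Zy// /D; move: (Z N k w) (X _ _) (y N k w) => u1 u2 u3; apply/colP => l; rewrite !mxE; ring.
have Z'b : nrm (Z' N k w - X (tk N k) w) <= C1 * cellg N k (tk N k.+1) w.
  by rewrite (_ : _ - _ = Z N k w - y N k w)// Zy// /Z' addrC addKr.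
have TU : T *: D = step N *: U N k w by rewrite /U /norm_err scalerA mulrC (N_step T N00 N0N).
apply: nrm_le => l.
have -> : lin N k w l 0 = T * (b (Z' N k w) l 0 - b (Z N k w) l 0 - (Db b (eul N k w) *m D) l 0).
  have -> : lin N k w = T *: (b (Z' N k w) - b (Z N k w) - Db b (eul N k w) *m D).
    have E : step N *: (Db b (eul N k w) *m U N k w) = T *: (Db b (eul N k w) *m D) by rewrite !scalemxAr TU.
    by rewrite /lin E !scalerBr.
  by rewrite !mxE.
have J : (Db b (eul N k w) *m D) l 0 = \sum_j pderiv j (fun y => b y l 0) (eul N k w) * (Z' N k w - Z N k w) j 0.
  by rewrite ZD mxE; apply: eq_bigr => j _; rewrite mxE.
have B1 : `|b (Z' N k w) l 0 - b (Z N k w) l 0 - (Db b (eul N k w) *m D) l 0| <= K * dev N k w * nrm D.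
  rewrite J; apply: le_trans (taylor1 (bK l) _ _ _) _; rewrite ZD ler_wpM2r ?nrm_ge0// ler_wpM2l//.
  have t1 := nrm_sub_trans (Z' N k w) (X (tk N k) w) (eul N k w).
  have t2 := nrm_sub_trans (Z N k w) (y N k w) (eul N k w).
  have t3 := nrm_sub_trans (y N k w) (X (tk N k) w) (eul N k w).
  rewrite [nrm (y _ _ _ - X _ _)]nrmC in t3; rewrite /dev; lra.
have B2 : `|b (Z' N k w) l 0 - b (Z N k w) l 0 - (Db b (eul N k w) *m D) l 0| <= K * 2 * nrm D.
  apply: le_trans (ler_normB _ _) _; rewrite mulrAC mulr_natr mulr2n lerD//.
    by have [_ [_ H]] := lipb_field bK l; rewrite -ZD; exact: H.
  rewrite mxE (le_trans (ler_norm_sum _ _ _))// /nrm mulr_sumr; apply: ler_sum => j _.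
  by rewrite normrM ler_wpM2r//; have [_ [+ _]] := lipb_jacobian bK l j; exact.
rewrite normrM (ger0_norm (ltW T0)).
have TD : T * nrm D = step N * nrm (U N k w).
  by rewrite -{1}(ger0_norm (ltW T0)) -nrmZ TU nrmZ ger0_norm// ltW.
have UV : nrm (U N k w) <= nrm (gap N k w) + nrm (V N k w) by rewrite -{1}(subrK (V N k w) (U N k w)) nrmD.
set B := `|_| in B1 B2 *; have d0 := dev0 k w N0N.
(* The bounds [B1] and [B2] cross at [dev = 2]. *)
have [d2|d2] := leP (dev N k w) 2.
- apply: (@le_trans _ _ (step N * K * (dev N k w * (nrm (gap N k w) + nrm (V N k w))))).
    apply: (@le_trans _ _ (T * (K * dev N k w * nrm D))); first by rewrite ler_wpM2l// ltW.
    rewrite mulrCA TD [leLHS](_ : _ = step N * K * (dev N k w * nrm (U N k w))); last by ring.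
    by apply: ler_wpM2l; [rewrite mulr_ge0// ltW|exact: ler_wpM2l].
  apply: ler_wpM2l; first by rewrite mulr_ge0// ltW.
  by rewrite mulrDr lerD2r ler_wpM2r ?nrm_ge0.
- apply: (@le_trans _ _ (step N * K * (2 * (nrm (gap N k w) + nrm (V N k w))))).
    apply: (@le_trans _ _ (T * (K * 2 * nrm D))); first by rewrite ler_wpM2l// ltW.
    rewrite mulrCA TD [leLHS](_ : _ = step N * K * (2 * nrm (U N k w))); last by ring.
    by apply: ler_wpM2l; [rewrite mulr_ge0// ltW|exact: ler_wpM2l].
  apply: ler_wpM2l; first by rewrite mulr_ge0// ltW.
  by rewrite mulrDr lerD2l ler_wpM2r ?nrm_ge0// ltW.
Qed.

Let cell3 N k w := itg (tk N k) (tk N k.+1) (fun s => cellg N k s w ^+ 3).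

Let quadI N k p q w := N%:R * itg (tk N k) (tk N k.+1) (fun s => qincr W (tk N k) s p q w)
  - T * theta ^+ 2 * qincr W (tk N k) (tk N k.+1) p q w.

(** The leading part of [rem]: coefficient differences between solution and Euler scheme, and
    second-order martingale increments. The last two sums are [O(h)] on each cell, so only
    cancellation between cells makes their total small. *)
Let main N k w l :=
  step N * (c1 * ((Db b (X (tk N k) w) *m b (X (tk N k) w)) l 0 - (Db b (eul N k w) *m b (eul N k w)) l 0)
    + c2 * (diffusion_term b sigma (X (tk N k) w) l 0 - diffusion_term b sigma (eul N k w) l 0))
  + \sum_p ((Db b (X (tk N k) w) *m sigma) l p - (Db b (eul N k w) *m sigma) l p) * (c1 * dW T W N k p w + area N w k p 0)
  + \sum_p \sum_q hess_sigma b sigma l p q (X (tk N k) w) * quadI N k p q w.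

Let rem_err N k w :=
  (E1 sigma K + E2 sigma K) * (T * cellI N k w) + E3 sigma K * (N%:R * cell3 N k w)
  + T * ((E1 sigma K + E2 sigma K) * (step N * (nrm (X (tk N k) w - y N k w) + (C1 + 1) * cellg N k (tk N k.+1) w))
     + E3 sigma K * cellg N k (tk N k.+1) w ^+ 3).

(** [cell_expansion] minus [T] times [theta_expansion]; matching the result with [noise] is where
    the values of [c1] and [c2] are verified. *)
Let rem_bound N k w l : (N0 <= N)%N -> (k < N)%N -> `|rem N k w l 0 - main N k w l| <= rem_err N k w.
Proof.
move=> N0N kN; have s0 := step_gt0 T0 N00 N0N.
have NT := N_step T N00 N0N.
pose u s := W s w - W (tk N k) w.
have uE s p : u s p 0 = incr W (tk N k) s p w by rewrite !mxE.
have cu p : continuous (fun s => u s p 0).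
  by rewrite (_ : (fun s => _) = (fun s => incr W (tk N k) s p w)); [exact: incr_continuous|apply/funext].
have A1 := cell_expansion K0 bK s0 (ler0n R N) NT (fun l => @cX w l) cu (@cellX N k w N0N kN) l.
have A2 := @theta_expansion _ _ _ b sigma K K0 bK (step N) (tk N k) (X ^~ w) u s0 theta (Z N k w) l th01.
cbv zeta beta in A1, A2; rewrite -!tkS in A1 A2.
have qE p q s : quad (tk N k) u p q s = qincr W (tk N k) s p q w by rewrite /quad !uE.
set M1 := (X in `|_ - X| <= _) in A1; set M2 := (X in `|_ - X| <= _) in A2.
set NI := N%:R * _ in A1; set BZ := b _ l 0 - _ in A2.
have -> : rem N k w l 0 - main N k w l = (NI - M1) - T * (BZ - M2).
  have -> : rem N k w l 0 = NI - T * BZ - noise N k w l 0 by rewrite !mxE.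
  suff : M1 - T * M2 - noise N k w l 0 = main N k w l by move=> <-; ring.
  rewrite /noise error_noiseE /main.
  rewrite (eq_bigr (fun p => (Db b (eul N k w) *m sigma) l p * (c1 * dW T W N k p w + area N w k p 0))); last first.
    by move=> p _; rewrite incsE.
  rewrite [\sum_p (_ - _) * _](eq_bigr (fun p => (Db b (X (tk N k) w) *m sigma) l p * (c1 * dW T W N k p w + area N w k p 0)
     - (Db b (eul N k w) *m sigma) l p * (c1 * dW T W N k p w + area N w k p 0))); last by move=> p _; rewrite mulrBl.
  rewrite sumrB.
  have -> : M1 - T * M2 = step N * c1 * (Db b (X (tk N k) w) *m b (X (tk N k) w)) l 0
     + \sum_p (Db b (X (tk N k) w) *m sigma) l p * (c1 * dW T W N k p w + area N w k p 0)
     + \sum_p \sum_q hess_sigma b sigma l p q (X (tk N k) w) * quadI N k p q w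
     + step N * c2 * diffusion_term b sigma (X (tk N k) w) l 0.
    rewrite [in RHS](eq_bigr (fun p => (Db b (X (tk N k) w) *m sigma) l p * (N%:R * itg (tk N k) (tk N k.+1) (fun s => u s p 0))
       - T * ((Db b (X (tk N k) w) *m sigma) l p * (theta * u (tk N k.+1) p 0)))); last first.
      move=> p _; rewrite [area _ _ _ _ _]mxE uE (_ : (fun s => u s p 0) = (fun s => incr W (tk N k) s p w)); last exact/funext.
      by rewrite /dW /c1; field.
    rewrite [X in _ + X + _](eq_bigr (fun p => \sum_q hess_sigma b sigma l p q (X (tk N k) w) * (N%:R * itg (tk N k) (tk N k.+1) (quad (tk N k) u p q))
       - T * \sum_q hess_sigma b sigma l p q (X (tk N k) w) * (theta ^+ 2 * quad (tk N k) u p q (tk N k.+1)))); last first.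
      move=> p _; rewrite mulr_sumr -sumrB; apply: eq_bigr => q _; rewrite /quadI qE.
      rewrite (_ : quad (tk N k) u p q = (fun s => qincr W (tk N k) s p q w)); last exact/funext.
      ring.
    by rewrite !sumrB -!mulr_sumr /M1 /M2 /c1 /c2; field.
  have alg (h u1 u2 d1 d2 e1 e2 S1 S2 S3 : R) : h * u1 * d1 + S1 + S3 + h * u2 * e1 - (u1 * (h * d2) + S2 + u2 * (h * e2))
    = h * (u1 * (d1 - d2) + u2 * (e1 - e2)) + (S1 - S2) + S3 by ring.
  exact: alg.
apply: le_trans (ler_normB _ _) _; rewrite normrM (ger0_norm (ltW T0)) /rem_err; apply: lerD.
  by apply: le_trans A1 _; rewrite -mulrA.
rewrite ler_wpM2l ?(ltW T0)//; apply: le_trans A2 _.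
rewrite lerD2r -mulrA ler_wpM2l//; first by rewrite addr_ge0 ?E1_ge0 ?E2_ge0.
rewrite ler_wpM2l ?(ltW s0)// mulrDl mul1r [leRHS]addrA; apply: lerD => //.
have [_ /(_ k kN)[_ Zb]] := theta_like w N0N.
by apply: le_trans (nrm_sub_trans _ (y N k w) _) _; rewrite [nrm (y _ _ _ - _)]nrmC [leRHS]addrC lerD2r.
Qed.

Let BU_D : BU leq 1 (fun N k w => nrm (X (tk N k) w - y N k w)).
Proof. exact/(BU_sqr T0 N00)/theta_strong. Qed.

Let BU_E : BU leq 1 (fun N k w => nrm (X (tk N k) w - eul N k w)).
Proof. exact/(BU_sqr T0 N00)/euler_strong. Qed.

Let BU_g : BU ltn 1 (fun N k w => cellg N k (tk N k.+1) w).
Proof. exact: (BU_cellg_end T0 N00 hF hW). Qed.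

Let BU_NI : BU ltn 1 (fun N k w => N%:R * cellI N k w).
Proof.
apply: (BU_step_inv T0 N00); apply: (BU_le (c := T)) (BU_cellg_itg T0 N00 hF hW cW) => N k w N0N _.
rewrite mulrA [step N * _]mulrC (N_step T N00 N0N) -/(cellI N k w) ger0_norm//.
by rewrite mulr_ge0 ?(ltW T0)// cellI_ge0.
Qed.

Let BU_NJ : BU ltn 3 (fun N k w => N%:R * cell3 N k w).
Proof.
apply: (BU_step_inv T0 N00); apply: (BU_le (c := T)) (BU_cellg_itg3 T0 N00 hF hW cW) => N k w N0N _.
rewrite mulrA [step N * _]mulrC (N_step T N00 N0N) -/(cell3 N k w) ger0_norm//.
rewrite mulr_ge0 ?(ltW T0)//; apply: itg_ge0 => s _.
by rewrite exprn_ge0// cellg0.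
Qed.

Let BU_rem_err : BU leq 1 (fun N k w => \sum_(i < k) rem_err N i w).
Proof.
apply: (BU_sumk T0 N00); apply: BU_add.
  apply: BU_add; apply: BU_scale; last exact: BU_NJ.
  by apply: BU_scale; exact: (BU_cellg_itg T0 N00 hF hW cW).
apply: BU_scale; apply: BU_add; apply: BU_scale; last exact: (BU_cellg_end3 T0 N00 hF hW).
apply: (BU_step T0 N00); apply: BU_add; first exact: BU_ltn BU_D.
by apply: BU_scale; exact: BU_g.
Qed.

Let smeas_X N k : (N0 <= N)%N -> (k < N)%N -> forall l, smeas (F (tk N k)) (fun w => X (tk N k) w l 0).
Proof. by move=> N0N kN l; apply: aX; [exact: (tk_ge0 T0 N00 k N0N)|exact: (tk_le T0 N00 N0N (ltnW kN))]. Qed.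

Let smeas_E N k : (N0 <= N)%N -> (k < N)%N -> forall l, smeas (F (tk N k)) (fun w => eul N k w l 0).
Proof. by move=> N0N kN l; apply: (eul_smeas sigma x0 bK T0 N00 hF hW) => //; exact: ltnW. Qed.

Let lip_diff (g : 'cV[R]_n -> R) C : lipb g C -> forall N k w,
  `|g (X (tk N k) w) - g (eul N k w)| <= C * nrm (X (tk N k) w - eul N k w).
Proof. by move=> [_ [_ H]] N k w; exact: H. Qed.

(** Three contributions: Lipschitz differences of order [sqrt h] weighted by [h], a martingale
    transform whose coefficients are [O(sqrt h)] in mean square, and a second-order martingale
    transform with bounded coefficients. *)
Let BU_main l : BU leq 1 (fun N k w => \sum_(i < k) main N i w l).
Proof.
have [Cb Hb] := lipb_jacobian_field bK l; have [Cd Hd] := lipb_diffusion sigma bK l.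
pose f1 N i w := c1 * ((Db b (X (tk N i) w) *m b (X (tk N i) w)) l 0 - (Db b (eul N i w) *m b (eul N i w)) l 0)
    + c2 * (diffusion_term b sigma (X (tk N i) w) l 0 - diffusion_term b sigma (eul N i w) l 0).
have B1 : BU leq 1 (fun N k w => \sum_(i < k) step N * f1 N i w).
  apply: (@BU_sumk _ _ _ P T N0 T0 N00 1 (fun N i w => step N * f1 N i w)).
  apply: (BU_step T0 N00); apply: BU_add; apply: BU_scale.
    by apply: (BU_le (c := Cb)) (BU_ltn BU_E) => N k w _ _; exact: (lip_diff Hb).
  by apply: (BU_le (c := Cd)) (BU_ltn BU_E) => N k w _ _; exact: (lip_diff Hd).
have B2 : BU leq 1 (fun N k w => \sum_p \sum_(i < k) ((Db b (X (tk N i) w) *m sigma) l p - (Db b (eul N i w) *m sigma) l p) * (c1 * dW T W N i p w + area N w i p 0)).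
  apply: BU_bigsum => p; have [C Hp] := lipb_jacobian_sigma sigma bK l p.
  apply: (BU_sqr T0 N00).
  apply: (@mart_BU _ _ _ P T N0 F T0 N00 hF 0 2 (fun N k w => c1 * dW T W N k p w + area N w k p 0)
     (fun N k w => (Db b (X (tk N k) w) *m sigma) l p - (Db b (eul N k w) *m sigma) l p)).
  - by apply: mart_add; [apply: mart_scale; exact: (mart_dW T0 N00 hF hW)|exact: mart_area_z].
  - by move=> N k N0N kN; apply: smeasB; apply: (smeas_lipb Hp); [exact: smeas_X|exact: smeas_E].
  - apply: (BU_le (c := C ^+ 2)) (BU_ltn euler_strong) => N k w _ _.
    have [C0 _] := Hp.
    rewrite ger0_norm ?sqr_ge0// -exprMn -real_normK ?num_real// lerXn2r ?nnegrE ?mulr_ge0 ?nrm_ge0//.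
    exact: (lip_diff Hp).
have B3 : BU leq 1 (fun N k w => \sum_p \sum_q \sum_(i < k) hess_sigma b sigma l p q (X (tk N i) w) * quadI N i p q w).
  apply: BU_bigsum => p; apply: BU_bigsum => q; have [C Hp] := lipb_hess_sigma sigma bK l p q.
  apply: (BU_sqr T0 N00).
  apply: (@mart_BU _ _ _ P T N0 F T0 N00 hF 1 0 (fun N k w => quadI N k p q w) (fun N k w => hess_sigma b sigma l p q (X (tk N k) w))).
  - have [C0 C00 H] := mart_add (mart_qincr_integral T0 N00 hF hW cW p q) (mart_scale (- (T * theta ^+ 2)) (mart_qincr T0 N00 hF hW p q)).
    exists C0 => // N A al N0N mA Aal k kN; apply: Ub_ext (H N A al N0N mA Aal k kN) => w.
    by congr (_ ^+ 2); apply: eq_bigr => i _; rewrite /quadI mulNr.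
  - by move=> N k N0N kN; apply: (smeas_lipb Hp); exact: smeas_X.
  - exact: (BU_bounded P T N0 (fun N k w => X (tk N k) w) ltn Hp).
have [C C0 H] := BU_add (BU_add B1 B2) B3.
exists C => // N k N0N kN; apply: Ub_ext (H N k N0N kN) => w.
rewrite exchange_big -big_split/=.
rewrite [X in _ + X](eq_bigr (fun p => \sum_(i < k) \sum_q hess_sigma b sigma l p q (X (tk N i) w) * quadI N i p q w)); last by move=> p _; rewrite exchange_big.
by rewrite exchange_big -big_split.
Qed.

Let BU_rem l : BU leq 1 (fun N k w => \sum_(i < k) rem N i w l 0).
Proof.
apply: (BU_le1 _ (BU_add (BU_abs (BU_main l)) BU_rem_err)) => N k w N0N kN.
rewrite -[\sum_(i < k) rem N i w l 0](subrK (\sum_(i < k) main N i w l)) [X in `|X|]addrC.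
apply: le_trans (ler_normD _ _) _; rewrite lerD2l -sumrB.
apply: le_trans (ler_norm_sum _ _ _) _; apply: ler_sum => i _.
by apply: rem_bound => //; exact: leq_trans (ltn_ord i) kN.
Qed.

Lemma norm_err_area : BU leq 1 (fun N k w => nrm (norm_err N k w - area_err N k w)).
Proof.
have BV : BU ltn 0 (fun N k w => nrm (V N k w) ^+ 2).
  by apply: BU_ltn; exact: (BU_err sigma x0 K0 bK T0 N00 hF hW c1 c2 mart_area_z).
have Bdev : BU ltn 2 (fun N k w => dev N k w ^+ 2).
  apply: BU_sqr_add.
    apply: (BU_le (c := 4)) (BU_ltn euler_strong) => N k w _ _.
    by rewrite ger0_norm ?sqr_ge0// exprMn -natrX.
  apply: BU_sqr_add; first exact: BU_ltn theta_strong.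
  apply: (BU_le (c := (2 * C1) ^+ 2)) (BU_cellg_end2 T0 N00 hF hW) => N k w _ _.
  by rewrite ger0_norm ?sqr_ge0// mulrA exprMn.
have BdV := BU_sumk T0 N00 (BU_step T0 N00 (BU_mul T0 N00 (p := 1) (q := 0) Bdev BV)).
apply: (BU_gronwall T0 N00 (lam := n%:R * (K * 3)) (c := fun N k w => \sum_l `|\sum_(i < k) rem N i w l 0| +
   n%:R * K * (\sum_(i < k) step N * (dev N i w * nrm (V N i w))))).
- by rewrite !mulr_ge0.
- move=> N k w N0N kN; rewrite ger0_norm ?nrm_ge0//.
  rewrite -/(U N k w) -/(V N k w) -/(gap N k w) gap_sum// big_split/= big_split/= -addrA.
  apply: le_trans (nrmD _ _) _; rewrite -addrA lerD//.
    by rewrite /nrm; apply: ler_sum => l _; rewrite summxE.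
  apply: le_trans (nrmD _ _) _.
  rewrite !mulr_sumr; apply: (@le_trans _ _ (\sum_(i < k) nrm (lin N i w) + \sum_(i < k) nrm (step N *: (Db b (eul N i w) *m gap N i w)))).
    by rewrite lerD// nrm_sum.
  rewrite -!big_split/=; apply: ler_sum => i _; have iN := leq_trans (ltn_ord i) kN.
  have s0 := step_gt0 T0 N00 N0N.
  rewrite (ger0_norm (nrm_ge0 _)) -/(gap N i w).
  have L := lin_bound w N0N iN.
  have J : nrm (step N *: (Db b (eul N i w) *m gap N i w)) <= step N * (n%:R * (K * nrm (gap N i w))).
    by rewrite nrmZ (ger0_norm (ltW s0)) ler_wpM2l ?(ltW s0)// nrm_jacobian.
  apply: le_trans (lerD L J) _; rewrite le_eqVlt; apply/orP; left; apply/eqP; ring.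
- apply: BU_add; last exact: BU_scale BdV.
  by apply: BU_bigsum => l; apply: BU_abs; exact: BU_rem.
Qed.

(** Bounds the change of the normalised error between the left grid point and a time inside the
    cell. *)
Definition cell_err N k w : R :=
  n%:R * (K * (C1 * (N%:R * cellI N k w) + T * (nrm (X (tk N k) w - y N k w) + C1 * cellg N k (tk N k.+1) w))).

Lemma BU_cell_err : BU ltn 1 cell_err.
Proof.
do 2![apply: BU_scale]; apply: BU_add; apply: BU_scale; first exact: BU_NI.
by apply: BU_add; [exact: BU_ltn BU_D|apply: BU_scale; exact: BU_g].
Qed.

Lemma cell_errP N k w t : (N0 <= N)%N -> (k < N)%N -> tk N k <= t <= tk N k.+1 ->
  nrm (N%:R *: \col_l itg (tk N k) t (fun s => b (X s w) l 0 - b (Z N k w) l 0)) <= cell_err N k w.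
Proof.
move=> N0N kN tc; rewrite nrmZ normr_nat; have [_ /(_ k kN)[_ Zb]] := theta_like w N0N.
apply: (@le_trans _ _ (N%:R * (n%:R * (K * (C1 * cellI N k w + step N * nrm (X (tk N k) w - Z N k w)))))).
  by rewrite ler_wpM2l// nrm_le// => l; rewrite mxE cell_defect.
rewrite /cell_err [leLHS](_ : _ = n%:R * (K * (C1 * (N%:R * cellI N k w) + (N%:R * step N) * nrm (X (tk N k) w - Z N k w)))); last by ring.
rewrite !ler_wpM2l// lerD2l (N_step T N00 N0N) ler_wpM2l ?(ltW T0)//.
by apply: le_trans (nrm_sub_trans _ (y N k w) _) _; rewrite lerD2l nrmC.
Qed.

End Prelimit.

(** * The limit equation *)

Section Volterra.
Context {R : realType} {n : nat}.
Variables (T K : R) (A : R -> 'M[R]_n) (G : R -> 'cV[R]_n).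
Hypotheses (T0 : 0 < T) (K0 : 0 <= K) (cA : forall i j, continuous (fun s => A s i j))
 (AK : forall s i j, `|A s i j| <= K) (cG : forall l, continuous (fun s => G s l 0)).
Local Notation half k := ((2^-1 : R) ^+ k).

(* Paths stopped outside of [0, T] are continuous on the whole line. *)
Definition clamp (t : R) : R := Num.max 0 (Num.min t T).

Lemma clamp_ge0 t : 0 <= clamp t.
Proof. by rewrite le_max lexx. Qed.

Lemma clamp_le t : clamp t <= T.
Proof. by rewrite ge_max ge_min lexx orbT (ltW T0). Qed.

Lemma clamp_id t : 0 <= t <= T -> clamp t = t.
Proof. by move=> /andP[t0 tT]; rewrite /clamp (min_idPl tT) (max_idPr t0). Qed.

Lemma clamp_continuous : continuous clamp.
Proof.
move=> t; apply: (@continuous_max _ _ (fun=> 0) (fun t => Num.min t T)); first exact: cvg_cst.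
by apply: (@continuous_min _ _ id (fun=> T)); [exact: cvg_id|exact: cst_continuous].
Qed.

Lemma itg_clamp_continuous g : continuous g -> continuous (fun t => itg 0 (clamp t) g).
Proof.
move=> cg; have [k k0 gk] := itg_bounded (ltW T0) cg.
have L s t : 0 <= s <= T -> 0 <= t <= T -> `|itg 0 s g - itg 0 t g| <= k * `|s - t|.
  wlog st : s t / s <= t => [H|].
    have [st|/ltW st] := leP s t; first exact: H.
    by move=> *; rewrite distrC [`|s - t|]distrC; apply: H.
  move=> /andP[s0 _] /andP[_ tT]; rewrite distrC [`|s - t|]distrC [`|t - s|]ger0_norm ?subr_ge0//.
  exact: (itg_lip gk).
move=> t; apply/cvgrPdist_le => e e0.
have k1 : 0 < k + 1 by rewrite ltr_wpDl.
have /cvgrPdist_le/(_ (e / (k + 1))) := @clamp_continuous t.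
rewrite divr_gt0// => /(_ isT); apply: filterS => s H.
apply: le_trans (L _ _ _ _) _; rewrite ?clamp_ge0 ?clamp_le//.
apply: (@le_trans _ _ ((k + 1) * (e / (k + 1)))); last by rewrite mulrC divfK ?gt_eqF.
by rewrite ler_pM// lerDl.
Qed.

Lemma mulmx_coord_continuous (x : R -> 'cV[R]_n) l : (forall j, continuous (fun s => x s j 0)) ->
  continuous (fun s => (A s *m x s) l 0).
Proof.
move=> cx; rewrite (_ : (fun s => _) = (fun s => \sum_j A s l j * x s j 0)); last by apply/funext => s; rewrite mxE.
by apply: continuous_bigsum => j s; apply: cvgM; [exact: cA|exact: cx].
Qed.

Lemma mulmx_coord_le s (v : 'cV[R]_n) l : `|(A s *m v) l 0| <= K * nrm v.
Proof.
rewrite mxE (le_trans (ler_norm_sum _ _ _))// /nrm mulr_sumr; apply: ler_sum => j _.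
by rewrite normrM ler_wpM2r.
Qed.

Fixpoint picard k : R -> 'cV[R]_n :=
  if k is k'.+1 then fun t => G t + \col_l itg 0 (clamp t) (fun s => (A s *m picard k' s) l 0) else G.

Lemma picard_continuous k l : continuous (fun t => picard k t l 0).
Proof.
elim: k l => [|k IH] l; first exact: cG.
rewrite (_ : (fun t => _) = (fun t => G t l 0 + itg 0 (clamp t) (fun s => (A s *m picard k s) l 0))); last first.
  by apply/funext => t; rewrite !mxE.
apply: continuous_add; first exact: cG.
by apply: itg_clamp_continuous; apply: mulmx_coord_continuous.
Qed.

(** With the weight [exp (lam t)] the integral operator halves norms, because
    [n K / lam <= 1 / 2]. *)
Let lam : R := 2 * (n%:R * K) + 1.

Let lam0 : 0 < lam. Proof. by rewrite ltr_wpDl// !mulr_ge0. Qed.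

Let picard_step C k : 0 <= C ->
  (forall t, 0 <= t <= T -> nrm (picard k.+1 t - picard k t) <= C * expR (lam * t)) ->
  forall t, nrm (picard k.+2 t - picard k.+1 t) <= C * 2^-1 * expR (lam * clamp t).
Proof.
move=> C0 H t; have t0 := clamp_ge0 t; have tT := clamp_le t.
have E l : (picard k.+2 t - picard k.+1 t) l 0 = itg 0 (clamp t) (fun s => (A s *m (picard k.+1 s - picard k s)) l 0).
  rewrite (_ : (fun s => _) = (fun s => (A s *m picard k.+1 s) l 0 - (A s *m picard k s) l 0)); last first.
    by apply/funext => s; rewrite mulmxBr !mxE.
  rewrite itgB; [|by apply: mulmx_coord_continuous => j; exact: picard_continuous..].
  by rewrite [picard k.+2]/= [in X in _ - X]/= !mxE; ring.
have cE : continuous (fun s => expR (lam * s)).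
  by move=> s; apply: continuous_comp; [exact: mulrl_continuous|exact: continuous_expR].
have B l : `|(picard k.+2 t - picard k.+1 t) l 0| <= K * (C * (expR (lam * clamp t) / lam)).
  rewrite E; have cd : continuous (fun s => (A s *m (picard k.+1 s - picard k s)) l 0).
    apply: mulmx_coord_continuous => j; rewrite (_ : (fun s => _) = (fun s => picard k.+1 s j 0 - picard k s j 0)).
      by apply: continuous_sub; exact: picard_continuous.
    by apply/funext => s; rewrite !mxE.
  apply: le_trans (itg_abs _ _ cd) _.
  apply: (@le_trans _ _ (itg 0 (clamp t) (fun s => K * C * expR (lam * s)))).
    apply: itg_le => [||s /andP[s0 st]]; [exact: continuous_abs|exact: continuous_scale|].
    apply: le_trans (mulmx_coord_le _ _ _) _; rewrite -mulrA ler_wpM2l// H// s0.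
    exact: le_trans tT.
  by rewrite itgZ// -mulrA !ler_wpM2l// itg_expR.
apply: le_trans (nrm_le B) _.
rewrite [leLHS](_ : _ = C * expR (lam * clamp t) * (n%:R * K / lam)); last by ring.
rewrite [leRHS](_ : _ = C * expR (lam * clamp t) * 2^-1); last by ring.
rewrite ler_wpM2l ?mulr_ge0 ?expR_ge0// ler_pdivrMr// /lam.
have : 0 <= n%:R * K by rewrite mulr_ge0.
lra.
Qed.

(** Kept as a sigma type, so that the constant can be named afterwards. *)
Let bound : {C | 0 <= C & forall k t, (1 <= k)%N -> nrm (picard k.+1 t - picard k t) <= C * half k}.
Proof.
apply: cid2.
have cd : continuous (fun t => nrm (picard 1 t - picard 0 t)).
  apply: nrm_continuous => l; rewrite (_ : (fun s => _) = (fun s => picard 1 s l 0 - picard 0 s l 0)).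
    by apply: continuous_sub; exact: picard_continuous.
  by apply/funext => s; rewrite !mxE.
have [C C0 HC] := itg_bounded (ltW T0) cd.
have H k t : 0 <= t <= T -> nrm (picard k.+1 t - picard k t) <= C * half k * expR (lam * t).
  elim: k t => [|k IH] t tc.
    have /andP[t0 _] := tc; apply: le_trans (ler_norm _) _; apply: le_trans (HC t tc) _.
    rewrite expr0 mulr1 ler_peMr//; apply: (@le_trans _ _ (1 + lam * t)); last exact: expR_ge1Dx.
    by rewrite lerDl mulr_ge0// ltW.
  have := picard_step (mulr_ge0 C0 (ltW (half_gt0 k))) IH t.
  by rewrite clamp_id// exprS mulrA [_ * 2^-1]mulrC -!mulrA mulrCA.
exists (C * expR (lam * T)); first by rewrite mulr_ge0 ?expR_ge0.
(* The first difference is controlled on [[0, T]] only; from the second on, the clamped upper limit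
   gives the bound at all times. *)
case=> // k t _; apply: le_trans (picard_step (mulr_ge0 C0 (ltW (half_gt0 k))) (H k) t) _.
rewrite [leRHS](_ : _ = C * half k * 2^-1 * expR (lam * T)); last by rewrite exprS; ring.
rewrite ler_wpM2l ?mulr_ge0 ?(ltW (half_gt0 _))//.
by rewrite ler_expR ler_wpM2l ?(ltW lam0)// clamp_le.
Qed.

Definition volterra t : 'cV[R]_n := \col_l limn (fun k => picard k t l 0).

Let C := s2val bound.
Let C0 : 0 <= C := s2valP bound.
Let CP l k t : (1 <= k)%N -> `|picard k.+1 t l 0 - picard k t l 0| <= C * half k.
Proof.
move=> k1; apply: le_trans (s2valP' bound k t k1).
by apply: le_trans (coord_le_nrm _ l); rewrite !mxE.
Qed.

Let volterraE l : (fun t => volterra t l 0) = (fun t => limn (fun k => picard k t l 0)).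
Proof. by apply/funext => t; rewrite mxE. Qed.

Lemma volterra_continuous l : continuous (fun t => volterra t l 0).
Proof. by rewrite volterraE; exact: (unif_limit_continuous C0 (fun k => @picard_continuous k l) (CP l)). Qed.

Lemma volterra_eq t l : 0 <= t <= T ->
  volterra t l 0 = G t l 0 + itg 0 t (fun s => (A s *m volterra s) l 0).
Proof.
move=> tc; have /andP[t0 tT] := tc.
have L : (fun k => picard k t l 0) @ \oo --> volterra t l 0.
  by rewrite [volterra t l 0]mxE; exact: (unif_limit_cvg C0 (CP l)).
move: L; rewrite -(cvg_shiftS _ _) => L; apply: (cvg_unique _ L) => //.
rewrite /= (_ : (fun k => _) = (fun k => G t l 0 + itg 0 t (fun s => (A s *m picard k s) l 0))); last first.
  by apply/funext => k; rewrite !mxE clamp_id.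
apply: cvgD; first exact: cvg_cst.
apply/cvgrPdist_le => e e0.
have H : (fun k => K * (n%:R * (C * (2 * half k))) * T) @ \oo --> (0 : R).
  rewrite (_ : (fun k => _) = (fun k => (K * (n%:R * (C * 2)) * T) * half k)); last by apply/funext => k; ring.
  rewrite -[X in _ --> X](mulr0 (K * (n%:R * (C * 2)) * T)); apply: cvgM; first exact: cvg_cst.
  exact: half_cvg0.
move/cvgrPdist_le: H => /(_ e e0) H; near=> k.
have k1 : (1 <= k)%N by near: k; exact: nbhs_infty_ge.
have : `|0 - K * (n%:R * (C * (2 * half k))) * T| <= e by near: k; exact: H.
rewrite sub0r normrN; apply: le_trans; apply: le_trans (ler_norm _).
have cd : continuous (fun s => (A s *m (volterra s - picard k s)) l 0).
  apply: mulmx_coord_continuous => j; rewrite (_ : (fun s => _) = (fun s => volterra s j 0 - picard k s j 0)).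
    by apply: continuous_sub; [exact: volterra_continuous|exact: picard_continuous].
  by apply/funext => s; rewrite [LHS]mxE [X in _ + X]mxE.
rewrite -itgB; last 2 first.
- by apply: mulmx_coord_continuous; exact: volterra_continuous.
- by apply: mulmx_coord_continuous => j; exact: picard_continuous.
rewrite (_ : (fun s => _) = (fun s => (A s *m (volterra s - picard k s)) l 0)); last first.
  by apply/funext => s; rewrite mulmxBr [RHS]mxE [X in _ = _ + X]mxE.
apply: (@le_trans _ _ (K * (n%:R * (C * (2 * half k))) * (t - 0))); last first.
  by rewrite subr0 ler_wpM2l// !mulr_ge0// ltW// half_gt0.
apply: itg_bound => // s _; apply: le_trans (mulmx_coord_le _ _ _) _; rewrite ler_wpM2l//.
apply: nrm_le => j; rewrite [X in `|X|]mxE [X in _ + X]mxE [X in X - _]mxE.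
exact: (unif_limit_dist C0 (CP j)).
Unshelve. all: by end_near. Qed.

End Volterra.

Lemma gronwall_sum (R : realType) (N : nat) (a : nat -> R) (r lam : R) : 0 <= lam ->
  (forall k, (k <= N)%N -> a k <= r + lam * \sum_(i < k) a i) ->
  forall k, (k <= N)%N -> a k <= r * (1 + lam) ^+ k.
Proof.
move=> l0 H k kN; apply: le_trans (H k kN) _; elim: k kN => [|k IH] kN.
  by rewrite big_ord0 mulr0 addr0 expr0 mulr1.
rewrite big_ord_recr/= mulrDr exprS.
have H1 := IH (ltnW kN); have H2 := le_trans (H k (ltnW kN)) H1.
have := ler_wpM2l l0 H2; rewrite (_ : r * ((1 + lam) * _) = r * (1 + lam) ^+ k + lam * (r * (1 + lam) ^+ k)); [lra|ring].
Qed.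

Section CellIndex.
Context {R : realType}.
Variable T : R.
Hypothesis T0 : 0 < T.

(** Capped at [N - 1], so that [t = T] falls into the last closed cell. *)
Definition cell_index (t : R) (N : nat) : nat := minn (Num.truncn (t / step T N)) N.-1.

Lemma cell_indexP t N : 0 <= t <= T -> (0 < N)%N ->
  (cell_index t N < N)%N /\ (cell_index t N)%:R * step T N <= t <= (cell_index t N).+1%:R * step T N.
Proof.
move=> /andP[t0 tT] N0; have s0 : 0 < step T N by rewrite divr_gt0// ltr0n.
have q0 : 0 <= t / step T N by rewrite divr_ge0// ltW.
have /andP[h1 h2] := truncn_itv q0.
split; first by rewrite /cell_index gtn_min ltn_predL N0 orbT.
rewrite /cell_index; apply/andP; split.
  by rewrite -ler_pdivlMr//; apply: le_trans h1; rewrite ler_nat geq_minl.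
rewrite -ler_pdivrMr// /minn; case: ifP => _; first exact: ltW.
rewrite prednK// ler_pdivrMr// /step mulrCA divff ?mulr1// pnatr_eq0 -lt0n//.
Qed.

Lemma step_cvg0 : step T @ \oo --> (0 : R).
Proof.
have H : (fun N => T * N.+1%:R^-1) @ \oo --> (0 : R).
  by rewrite -[X in _ --> X](mulr0 T); apply: cvgM; [exact: cvg_cst|exact: cvg_harmonic].
by rewrite -(cvg_shiftS _ _); exact: H.
Qed.

Lemma cell_index_near (x : R -> R) t (e : R) : continuous x -> 0 <= t <= T -> 0 < e ->
  \forall N \near \oo, `|x t - x ((cell_index t N)%:R * step T N)| <= e.
Proof.
move=> cx tc e0; have [d d0 H] := unif_cont 0 T cx e0.
near=> N; apply: H; first exact: tc.
have N0 : (0 < N)%N by near: N; exact: nbhs_infty_gt.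
have [_ /andP[h1 h2]] := cell_indexP tc N0.
rewrite ger0_norm ?subr_ge0//; apply: (@le_lt_trans _ _ (step T N)).
  by move: h2; rewrite tkS; lra.
near: N; have /cvgrPdist_lt/(_ d d0) := step_cvg0.
by apply: filterS => N; rewrite sub0r normrN; apply: le_lt_trans; exact: ler_norm.
Unshelve. all: by end_near. Qed.

End CellIndex.

(** * Euler scheme for the limit equation *)

Section EulerVolterra.
Context {R : realType} {n : nat}.
Variables (T K : R) (A : R -> 'M[R]_n) (G U : R -> 'cV[R]_n).
Hypotheses (T0 : 0 < T) (K0 : 0 <= K) (cA : forall i j, continuous (fun s => A s i j))
 (AK : forall s i j, `|A s i j| <= K) (cU : forall l, continuous (fun s => U s l 0))
 (UE : forall t l, 0 <= t <= T -> U t l 0 = G t l 0 + itg 0 t (fun s => (A s *m U s) l 0)).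
Local Notation tk N k := (k%:R * step T N).

Fixpoint euler_volterra N k : 'cV[R]_n :=
  if k is k'.+1 then euler_volterra N k' + step T N *: (A (tk N k') *m euler_volterra N k') + (G (tk N k) - G (tk N k'))
  else G 0.

Lemma euler_volterra_sum N k : euler_volterra N k =
  G (tk N k) + \sum_(i < k) step T N *: (A (tk N i) *m euler_volterra N i).
Proof.
elim: k => [|k IH]; first by rewrite big_ord0 addr0 mul0r.
rewrite big_ord_recr [LHS]/= {1}IH.
move: (\sum_(i < k) _) (step T N *: _) (G (tk N k)) (G (tk N k.+1)) => u1 u2 u3 u4.
by apply/colP => l; rewrite !mxE; ring.
Qed.

Let AU l : continuous (fun s => (A s *m U s) l 0).
Proof. exact: mulmx_coord_continuous. Qed.

(** Path by path and without a rate: [A U] is uniformly continuous, so the local errors are [o(h)],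
    and Gronwall sums them up. *)
Lemma euler_volterra_near (e : R) : 0 < e ->
  \forall N \near \oo, forall k, (k <= N)%N -> nrm (U (tk N k) - euler_volterra N k) <= e.
Proof.
move=> e0; pose L := n%:R * K.
have L0 : 0 <= L by rewrite mulr_ge0.
(* The added 1 keeps the divisor positive in dimension 0. *)
pose c := n%:R * T * expR (L * T) + 1.
have c0 : 0 < c by rewrite ltr_wpDl// !mulr_ge0 ?expR_ge0// ltW.
pose e' := e / c; have e'0 : 0 < e' by rewrite divr_gt0.
have H l : \forall N \near \oo, forall s t, 0 <= s <= T -> `|s - t| <= step T N ->
    `|(A s *m U s) l 0 - (A t *m U t) l 0| <= e'.
  have [d d0 Hd] := unif_cont 0 T (@AU l) e'0.
  have /cvgrPdist_lt/(_ d d0) := step_cvg0 T.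
  apply: filterS => N; rewrite sub0r normrN => sd s t sc st; apply: Hd => //.
  by apply: le_lt_trans sd; apply: le_trans st _; exact: ler_norm.
have {}H : \forall N \near \oo, forall l s t, 0 <= s <= T -> `|s - t| <= step T N ->
    `|(A s *m U s) l 0 - (A t *m U t) l 0| <= e'.
  exact: filter_forall.
near=> N => k kN.
have N0 : (0 < N)%N by near: N; exact: nbhs_infty_gt.
have s0 : 0 < step T N by rewrite divr_gt0// ltr0n.
have HN : forall l s t, 0 <= s <= T -> `|s - t| <= step T N -> `|(A s *m U s) l 0 - (A t *m U t) l 0| <= e'.
  by near: N.
have tT j : (j <= N)%N -> 0 <= tk N j <= T.
  by move=> jN; rewrite (tk_ge0 T0 N0 j (leqnn N)) (tk_le T0 N0 (leqnn N) jN).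
have tS j : tk N j <= tk N j.+1 by rewrite tkS lerDl ltW.
have step1 j : (j <= N)%N -> nrm (U (tk N j) - euler_volterra N j) <=
    n%:R * e' * T + step T N * L * \sum_(i < j) nrm (U (tk N i) - euler_volterra N i).
  move=> jN.
  have E : U (tk N j) - euler_volterra N j = \sum_(i < j) ((\col_l itg (tk N i) (tk N i.+1) (fun s => (A s *m U s) l 0 - (A (tk N i) *m U (tk N i)) l 0))
      + step T N *: (A (tk N i) *m (U (tk N i) - euler_volterra N i))).
    rewrite euler_volterra_sum opprD addrA; apply/colP => l.
    set S := \sum_(i < j) _; set S' := \sum_(i < j) _.
    have -> : (U (tk N j) - G (tk N j) - S) l 0 = itg 0 (tk N j) (fun s => (A s *m U s) l 0) - S l 0.
      by rewrite !mxE UE ?tT// [G _ _ _ + _]addrC addrK.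
    have := itg_cells 0 j (ltW s0) (@AU l); rewrite add0r => ->.
    rewrite /S /S' !summxE -sumrB; apply: eq_bigr => i _.
    have hE : tk N i.+1 - tk N i = step T N by rewrite tkS addrC addKr.
    have cc : continuous (fun _ : R => (A (tk N i) *m U (tk N i)) l 0) by move=> s; exact: cvg_cst.
    rewrite [RHS]mxE [X in _ = X + _]mxE itgB//.
    rewrite itg_cst// hE mulmxBr scalerBr [X in _ = _ + X]mxE !add0r.
    rewrite [X in _ = _ + (X + _)]mxE [X in _ = _ + (_ + X)]mxE; ring.
  rewrite E; apply: le_trans (nrm_sum _ _ _) _.
  apply: (@le_trans _ _ (\sum_(i < j) (n%:R * (e' * step T N) + step T N * (L * nrm (U (tk N i) - euler_volterra N i))))).
    apply: ler_sum => i _; have iN := leq_trans (ltn_ord i) jN.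
    apply: le_trans (nrmD _ _) _; rewrite lerD//.
      apply: nrm_le => l; rewrite mxE.
      have hE : tk N i.+1 - tk N i = step T N by rewrite tkS addrC addKr.
      rewrite [leRHS](_ : _ = e' * (tk N i.+1 - tk N i)); last by rewrite hE.
      apply: itg_bound; first exact: tS.
        by apply: continuous_sub; [exact: AU|move=> s; exact: cvg_cst].
      move=> s /andP[s1 s2]; apply: HN.
        have /andP[a0 _] := tT i (ltnW iN); have /andP[_ bT] := tT i.+1 iN.
        by rewrite (le_trans a0 s1) (le_trans s2 bT).
      by rewrite ger0_norm ?subr_ge0// lerBlDl -tkS.
    rewrite nrmZ (ger0_norm (ltW s0)) ler_wpM2l ?(ltW s0)// /L -mulrA.
    by apply: nrm_mulmx => *; exact: AK.
  rewrite big_split/= lerD//; last by rewrite -!mulr_sumr mulrA.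
  rewrite sumr_const card_ord -[_ *+ j]mulr_natl.
  rewrite [leLHS](_ : _ = n%:R * e' * (j%:R * step T N)); last by ring.
  by have /andP[_ jT] := tT j jN; rewrite ler_wpM2l// mulr_ge0// ltW.
have := gronwall_sum (mulr_ge0 (ltW s0) L0) step1 kN.
move/le_trans; apply.
have -> : step T N * L = L * T / N%:R by rewrite /step; ring.
apply: le_trans (gronwall_exp _ _ kN N0) _.
- by rewrite mulr_ge0// ltW.
- by rewrite mulr_ge0 ?(ltW T0)// mulr_ge0// ltW.
rewrite (_ : _ * _ * T * _ = (n%:R * T * expR (L * T)) * e'); last by ring.
rewrite /e' mulrA ler_pdivrMr// mulrC ler_wpM2l ?(ltW e0)// /c lerDl//.
Unshelve. all: by end_near. Qed.

Lemma euler_volterra_cvg t l : 0 <= t <= T ->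
  (fun N => euler_volterra N (cell_index T t N) l 0) @ \oo --> U t l 0.
Proof.
move=> tc; apply/cvgrPdist_le => e e0; have e2 : 0 < e / 2 by rewrite divr_gt0.
near=> N.
have N0 : (0 < N)%N by near: N; exact: nbhs_infty_gt.
have [iN _] := cell_indexP T0 tc N0.
have h1 : `|U t l 0 - U (tk N (cell_index T t N)) l 0| <= e / 2.
  by near: N; exact: (cell_index_near T0 (@cU l)).
have h2 : nrm (U (tk N (cell_index T t N)) - euler_volterra N (cell_index T t N)) <= e / 2.
  move: (cell_index T t N) (ltnW iN) => k kN; move: k kN; near: N; exact: euler_volterra_near.
have h3 := le_trans (coord_le_nrm _ l) h2; rewrite !mxE in h3.
rewrite (_ : _ - _ = (U t l 0 - U (tk N (cell_index T t N)) l 0) + (U (tk N (cell_index T t N)) l 0 - euler_volterra N (cell_index T t N) l 0)); last by ring.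
by apply: le_trans (ler_normD _ _) _; lra.
Unshelve. all: by end_near. Qed.

End EulerVolterra.

(** * Ito integrals of the Jacobian along the solution *)

Section ItoJacobian.
Context {R : realType} {disp : measure_display} {O : measurableType disp}.
Variables (P : probability O R) (T : R) (F : R -> set (set O)) (n m : nat).
Variables (b : 'cV[R]_n -> 'cV[R]_n) (sigma : 'M[R]_(n, m)) (K : R).
Variables (W : R -> O -> 'cV[R]_m) (X : R -> O -> 'cV[R]_n).
Hypotheses (K0 : 0 <= K) (bK : C3b_field b K) (T0 : 0 < T) (hF : filtration T F)
 (hW : brownian_motion P T F W) (cW : forall w i, continuous (fun s => W s w i 0))
 (cX : forall w l, continuous (fun s => X s w l 0))
 (aX : forall s l, 0 <= s -> s <= T -> smeas (F s) (fun w => X s w l 0))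
 (XE : forall w r s l, 0 <= r -> r <= s -> s <= T ->
  X s w l 0 = X r w l 0 + itg r s (fun u => b (X u w) l 0) + (sigma *m (W s w - W r w)) l 0).

Let cbX w l : continuous (fun s => b (X s w) l 0).
Proof. by apply: (@lipschitz_path _ _ (fun y => b y l 0) K) => // y z; have [_ [_ H]] := lipb_field bK l. Qed.

Lemma X_increment w s t : 0 <= s -> s <= t -> t <= T ->
  nrm (X t w - X s w) <= n%:R * (K * (t - s)) + sgn sigma * nrm (W t w - W s w).
Proof.
move=> s0 st tT.
have -> : X t w - X s w = (\col_l itg s t (fun u => b (X u w) l 0)) + sigma *m (W t w - W s w).
  apply/colP => l; rewrite !mxE (XE w l s0 st tT) [(sigma *m _) l 0]mxE.
  by ring.
apply: le_trans (nrmD _ _) _; rewrite lerD ?nrm_sigma//; apply: nrm_le => l; rewrite mxE.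
by apply: itg_bound; [by []|exact: cbX|move=> r _; have [_ [H _]] := lipb_field bK l].
Qed.

Let Phi l p s w : R := (Db b (X s w) *m sigma) l p.

Lemma Phi_smeas l p t : 0 <= t -> t <= T -> smeas (F t) (Phi l p t).
Proof.
move=> t0 tT; have [C H] := lipb_jacobian_sigma sigma bK l p.
by apply: (smeas_lipb H) => i; exact: aX.
Qed.

Lemma nrmW_sqr s t : 0 <= s -> s <= t -> t <= T -> Eb P (fun w => nrm (W t w - W s w) ^+ 2) (m%:R ^+ 2 * (t - s)).
Proof.
move=> s0 st tT.
have := @Eb_sqr_sum _ _ _ P 'I_m (fun i w => `|incr W s t i w|) (t - s) _ _.
rewrite card_ord => H; apply: Eb_ext (H _ _).
- by move=> w; congr (_ ^+ 2); apply: eq_bigr => i _; rewrite !mxE.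
- by move=> i; apply: measurableT_comp => //; exact: (meas_incr hF hW).
- move=> i; apply: Eb_ext (incr_sqr hF hW i s0 st tT) => w.
  by rewrite real_normK// num_real.
Qed.

(** The mean-square modulus of continuity that [ito_exists] asks of an integrand: the drift
    contributes [(t - s)^2 <= T (t - s)], the noise [t - s]. *)
Lemma Phi_increment l p : exists2 C, 0 <= C & forall s t, 0 <= s -> s <= t -> t <= T ->
  Eb P (fun w => (Phi l p t w - Phi l p s w) ^+ 2) (C * (t - s)).
Proof.
have [C HC] := lipb_jacobian_sigma sigma bK l p; have [C0 [_ HL]] := HC.
pose D := C ^+ 2 * (2 * (n%:R * K) ^+ 2 * T + 2 * sgn sigma ^+ 2 * m%:R ^+ 2).
exists D.
  apply: mulr_ge0; first exact: sqr_ge0.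
  by apply: addr_ge0; rewrite mulr_ge0 ?sqr_ge0 ?(ltW T0)// mulr_ge0 ?sqr_ge0.
move=> s t s0 st tT; have ts : 0 <= t - s by rewrite subr_ge0.
have H := Eb_scale (sqr_ge0 C) (Eb_add (Eb_cst P (_ : 0 <= 2 * (n%:R * (K * (t - s))) ^+ 2)) (Eb_scale (_ : 0 <= 2 * sgn sigma ^+ 2) (nrmW_sqr s0 st tT))).
apply: (Eb_weak _ (Eb_le _ _ _ (H _ _))).
- rewrite /D [leRHS](_ : _ = C ^+ 2 * (2 * (n%:R * K) ^+ 2 * (T * (t - s)) + 2 * sgn sigma ^+ 2 * (m%:R ^+ 2 * (t - s)))); last by ring.
  rewrite ler_wpM2l ?sqr_ge0// lerD2r.
  rewrite (_ : 2 * _ ^+ 2 = 2 * (n%:R * K) ^+ 2 * ((t - s) * (t - s))); last by ring.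
  rewrite ler_wpM2l ?mulr_ge0 ?sqr_ge0// ler_wpM2r//; lra.
- apply: measurable_funX; apply: measurable_funB.
    exact: smeas_meas (filt_meas hF (le_trans s0 st) tT) (Phi_smeas l p (le_trans s0 st) tT).
  exact: smeas_meas (filt_meas hF s0 (le_trans st tT)) (Phi_smeas l p s0 (le_trans st tT)).
- by move=> w; exact: sqr_ge0.
- move=> w; apply: (@le_trans _ _ ((C * nrm (X t w - X s w)) ^+ 2)).
    by rewrite -real_normK ?num_real// lerXn2r ?nnegrE ?mulr_ge0 ?nrm_ge0//; exact: HL.
  rewrite exprMn ler_wpM2l ?sqr_ge0//; have := X_increment w s0 st tT.
  set a := n%:R * _; set c := sgn sigma * _ => H1.
  apply: (@le_trans _ _ ((a + c) ^+ 2)).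
    by rewrite lerXn2r ?nnegrE ?nrm_ge0// (le_trans _ H1)// nrm_ge0.
  rewrite (_ : 2 * sgn sigma ^+ 2 * _ = 2 * c ^+ 2); last by rewrite /c; ring.
  rewrite -subr_ge0 (_ : _ - _ = (a - c) ^+ 2) ?sqr_ge0//; ring.
- by rewrite mulr_ge0 ?sqr_ge0.
- by rewrite mulr_ge0 ?sqr_ge0.
Qed.

Variable V : R -> O -> 'cV[R]_m.
Hypotheses (hV : brownian_motion P T F V) (cV : forall w i, continuous (fun s => V s w i 0)).

(** Entry by entry from [ito_exists], with the sum of all constants as a common one. The integrator
    [V] may differ from the motion driving [X]. *)
Lemma ito_jacobian : exists I : R -> O -> 'cV[R]_n,
  [/\ forall t l, 0 <= t -> t <= T -> mfT (fun w => I t w l 0),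
      forall w l, continuous (fun t => I t w l 0) &
      exists2 C, 0 <= C & forall N t l, (0 < N)%N -> 0 <= t -> t <= T ->
        Eb P (fun w => (I t w l 0 - \sum_p ito_sum T V p (Phi l p) N t w) ^+ 2) (C / N%:R)].
Proof.
have H l p : exists J : (R -> O -> R) * R,
  [/\ forall t, 0 <= t -> t <= T -> mfT (J.1 t),
      forall w, continuous (J.1 ^~ w), 0 <= J.2 &
      forall N t, (0 < N)%N -> 0 <= t -> t <= T -> Eb P (fun w => (J.1 t w - ito_sum T V p (Phi l p) N t w) ^+ 2) (J.2 / N%:R)].
  have [C C0 HC] := Phi_increment l p.
  have [J [mJ cJ HJ]] := ito_exists p T0 hF hV cV (fun t => @Phi_smeas l p t) C0 HC.
  exists (J, 4 * (C * T ^+ 2)); split => //=.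
  by rewrite mulr_ge0// mulr_ge0 ?sqr_ge0.
have {}H (lp : 'I_n * 'I_m) := H lp.1 lp.2.
have [J HJ] := choice H.
pose S := \sum_l \sum_p (J (l, p)).2.
have S0 l p : 0 <= (J (l, p)).2 by have [] := HJ (l, p).
have SJ l p : (J (l, p)).2 <= S.
  rewrite /S (bigD1 l)//= (bigD1 p)//= -addrA lerDl addr_ge0 ?sumr_ge0// => i _.
  by rewrite sumr_ge0.
exists (fun t w => \col_l \sum_p (J (l, p)).1 t w); split.
- move=> t l t0 tT; under eq_fun do rewrite mxE.
  by apply: measurable_sum => p; have [H1 _ _ _] := HJ (l, p); exact: H1.
- move=> w l; rewrite (_ : (fun t => _) = (fun t => \sum_p (J (l, p)).1 t w)); last by apply/funext => t; rewrite mxE.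
  by apply: continuous_bigsum => p; have [_ H1 _ _] := HJ (l, p); exact: H1.
exists (m%:R ^+ 2 * S).
  by rewrite mulr_ge0 ?sqr_ge0// sumr_ge0// => l _; rewrite sumr_ge0.
move=> N t l N0 t0 tT.
have := @Eb_sqr_sum _ _ _ P 'I_m (fun p w => (J (l, p)).1 t w - ito_sum T V p (Phi l p) N t w) (S / N%:R) _ _.
rewrite card_ord mulrA => HS; apply: Eb_ext (HS _ _).
- by move=> w; rewrite mxE -sumrB.
- move=> p; have [H1 _ _ _] := HJ (l, p); apply: measurable_funB; first exact: H1.
  exact: (ito_sum_meas p T0 hF hV (fun t => @Phi_smeas l p t) N t0 tT).
- move=> p; have [_ _ _ H1] := HJ (l, p); apply: Eb_weak (H1 N t N0 t0 tT).
  by rewrite ler_wpM2r ?invr_ge0.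
Qed.

End ItoJacobian.

(** * From the transferred recursion to the limit equation *)

Section LimitScheme.
Context {R : realType} {disp : measure_display} {O : measurableType disp}.
Variables (P : probability O R) (T : R) (N0 : nat) (F : R -> set (set O)) (n m : nat).
Variables (b : 'cV[R]_n -> 'cV[R]_n) (sigma : 'M[R]_(n, m)) (K : R) (x0 : 'cV[R]_n).
Variables (W : R -> O -> 'cV[R]_m) (X : R -> O -> 'cV[R]_n).
Hypotheses (K0 : 0 <= K) (bK : C3b_field b K) (T0 : 0 < T) (N00 : (0 < N0)%N) (hF : filtration T F)
 (hW : brownian_motion P T F W) (cW : forall w i, continuous (fun s => W s w i 0))
 (cX : forall w l, continuous (fun s => X s w l 0))
 (aX : forall s l, 0 <= s -> s <= T -> smeas (F s) (fun w => X s w l 0)) (X0 : forall w, X 0 w = x0)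
 (XE : forall w r s l, 0 <= r -> r <= s -> s <= T ->
  X s w l 0 = X r w l 0 + itg r s (fun u => b (X u w) l 0) + (sigma *m (W s w - W r w)) l 0).
Local Notation step := (@step R T).
Local Notation BU := (BU P T N0).
Local Notation tk N k := (k%:R * step N).
Let eul := eul T b sigma x0 W.
Let Phi l p s w : R := (Db b (X s w) *m sigma) l p.

Let BU_E : BU leq 1 (fun N k w => nrm (X (tk N k) w - eul N k w)).
Proof. exact/(BU_sqr T0 N00)/(euler_strong K0 bK T0 N00 hF hW cW cX X0 XE). Qed.

Let BU_E2 : BU leq 2 (fun N k w => nrm (X (tk N k) w - eul N k w) ^+ 2).
Proof. exact: (euler_strong K0 bK T0 N00 hF hW cW cX X0 XE). Qed.

(** Within a cell the solution stays within a multiple of [cellg] of its left value, which is within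
    the strong error of the Euler scheme. *)
Lemma riemann_gap g C : lipb g C ->
  BU leq 1 (fun N k w => \sum_(i < k) step N * g (eul N i w) - itg 0 (tk N k) (fun s => g (X s w))).
Proof.
move=> gC; have [C0 [_ gL]] := gC.
have cg w : continuous (fun s => g (X s w)) by exact: (lipschitz_path gL).
have H : BU ltn 3 (fun N k w => C * (step N * nrm (X (tk N k) w - eul N k w)) + C * (C1 sigma K * cellI T W N k w)).
  apply: BU_add; apply: BU_scale; first exact: (BU_step T0 N00 (BU_ltn BU_E)).
  by apply: BU_scale; exact: (BU_cellg_itg T0 N00 hF hW cW).
apply: (BU_le1 _ (BU_sumk T0 N00 H)) => N k w N0N kN; have s0 := step_gt0 T0 N00 N0N.
have := itg_cells 0 k (ltW s0) (cg w); rewrite add0r => ->.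
rewrite -sumrB; apply: le_trans (ler_norm_sum _ _ _) _; apply: ler_sum => i _.
have iN := leq_trans (ltn_ord i) kN; rewrite !add0r.
have hE : tk N i.+1 - tk N i = step N by rewrite tkS addrC addKr.
have ti : tk N i <= tk N i.+1 by rewrite tkS lerDl ltW.
have cc : continuous (fun _ : R => g (eul N i w)) by move=> s; exact: cvg_cst.
have -> : step N * g (eul N i w) = itg (tk N i) (tk N i.+1) (fun=> g (eul N i w)) by rewrite itg_cst// hE mulrC.
rewrite -itgB//.
have cd : continuous (fun s => g (eul N i w) - g (X s w)) by exact: continuous_sub.
apply: le_trans (itg_abs _ _ cd) _.
have cgw := @cellg_continuous _ _ _ T m W cW N i w.
have cn : continuous (fun _ : R => nrm (X (tk N i) w - eul N i w)) by move=> s; exact: cvg_cst.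
apply: (@le_trans _ _ (itg (tk N i) (tk N i.+1) (fun s => C * (nrm (X (tk N i) w - eul N i w) + C1 sigma K * cellg T W N i s w)))).
  apply: itg_le => [||s sc]; [exact: continuous_abs| |].
    by apply: continuous_scale; apply: continuous_add => //; exact: continuous_scale.
  apply: le_trans (gL _ _) _; rewrite ler_wpM2l// nrmC.
  apply: le_trans (nrm_sub_trans _ (X (tk N i) w) _) _; rewrite addrC lerD2l.
  exact: (X_cell K0 bK T0 N00 cX XE).
rewrite itgZ; last by apply: continuous_add => //; exact: continuous_scale.
rewrite itgD//; last exact: continuous_scale.
by rewrite itgZ// itg_cst// hE mulrDr [nrm _ * _]mulrC.
Qed.

Lemma ito_sum_grid (V : R -> O -> 'cV[R]_m) p f N k w : (N0 <= N)%N -> (k <= N)%N ->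
  ito_sum T V p f N (tk N k) w = \sum_(i < k) f (tk N i) w * dW T V N i p w.
Proof.
move=> N0N kN; have s0 := step_gt0 T0 N00 N0N.
rewrite /ito_sum -(big_mkord xpredT (fun i => f (tk N i) w * (V (Num.min (tk N i.+1) (tk N k)) w p 0 - V (Num.min (tk N i) (tk N k)) w p 0))).
rewrite (@big_cat_nat _ _ _ k)//= [X in _ + X]big_nat_cond [X in _ + X]big1 ?addr0; last first.
  move=> i /andP[/andP[ki _] _]; rewrite !(min_idPr _) ?subrr ?mulr0//.
    by rewrite ler_wpM2r ?ler_nat ?(ltW s0)// ltnW.
  by rewrite ler_wpM2r ?ler_nat ?(ltW s0)// (leq_trans ki).
rewrite big_mkord; apply: eq_bigr => i _; rewrite !(min_idPl _)//.
  by rewrite ler_wpM2r ?ler_nat ?(ltW s0)// ltnW.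
by rewrite ler_wpM2r ?ler_nat ?(ltW s0).
Qed.

Section ItoGap.
Variables (V I : R -> O -> 'cV[R]_m) (J : R -> O -> 'cV[R]_n).
Hypotheses (hV : brownian_motion P T F V)
 (HJ : exists2 C, 0 <= C & forall N t l, (0 < N)%N -> 0 <= t -> t <= T ->
  Eb P (fun w => (J t w l 0 - \sum_p ito_sum T V p (Phi l p) N t w) ^+ 2) (C / N%:R)).

(** Two replacements: coefficients along the Euler scheme by those along the solution, which is a
    martingale transform, then the sum by the integral, at the rate given in [HJ]. *)
Lemma ito_gap l :
  BU leq 1 (fun N k w => \sum_(i < k) \sum_p (Db b (eul N i w) *m sigma) l p * dW T V N i p w - J (tk N k) w l 0).
Proof.
have H1 : BU leq 1 (fun N k w => \sum_p \sum_(i < k) ((Db b (eul N i w) *m sigma) l p - Phi l p (tk N i) w) * dW T V N i p w).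
  apply: BU_bigsum => p; have [C Hp] := lipb_jacobian_sigma sigma bK l p; have [C0 [_ HL]] := Hp.
  apply: (BU_sqr T0 N00).
  apply: (@mart_BU _ _ _ P T N0 F T0 N00 hF 0 2 (fun N k w => dW T V N k p w)
     (fun N k w => (Db b (eul N k w) *m sigma) l p - Phi l p (tk N k) w)).
  - exact: (mart_dW T0 N00 hF hV).
  - move=> N k N0N kN; apply: smeasB; apply: (smeas_lipb Hp) => i.
      by apply: (eul_smeas sigma x0 bK T0 N00 hF hW) => //; exact: ltnW.
    by apply: aX; [exact: (tk_ge0 T0 N00 k N0N)|exact: (tk_le T0 N00 N0N (ltnW kN))].
  - apply: (BU_le (c := C ^+ 2)) (BU_ltn BU_E2) => N k w _ _.
    rewrite ger0_norm ?sqr_ge0// -exprMn -real_normK ?num_real// lerXn2r ?nnegrE ?mulr_ge0 ?nrm_ge0//.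
    by rewrite nrmC; exact: HL.
have H2 : BU leq 1 (fun N k w => J (tk N k) w l 0 - \sum_p ito_sum T V p (Phi l p) N (tk N k) w).
  have [C C0 HC] := HJ; apply: (BU_sqr T0 N00); exists (C / T); first by rewrite divr_ge0// ltW.
  move=> N k N0N kN; apply: Ub_weak (Ub_Eb (HC N (tk N k) l _ _ _)).
  - by rewrite -(step_rt T0 N00 N0N) /step mulrA divfK ?gt_eqF.
  - exact: leq_trans N0N.
  - exact: (tk_ge0 T0 N00 k N0N).
  - exact: (tk_le T0 N00 N0N kN).
apply: (BU_le1 _ (BU_add (BU_abs H1) (BU_abs H2))) => N k w N0N kN.
set A := \sum_p _; set B := _ - \sum_p _; set D := \sum_(i < k) _.
suff -> : D - J (tk N k) w l 0 = A - B by rewrite ler_normB.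
rewrite /A /B /D (eq_bigr (fun p => \sum_(i < k) (Db b (eul N i w) *m sigma) l p * dW T V N i p w - ito_sum T V p (Phi l p) N (tk N k) w)).
  by rewrite sumrB exchange_big/=; ring.
move=> p _; rewrite ito_sum_grid// -sumrB; apply: eq_bigr => i _; ring.
Qed.

End ItoGap.

Variables (V : R -> O -> 'cV[R]_m) (I J : R -> O -> 'cV[R]_n).
Hypotheses (hV : brownian_motion P T F V)
 (HI : exists2 C, 0 <= C & forall N t l, (0 < N)%N -> 0 <= t -> t <= T ->
  Eb P (fun w => (I t w l 0 - \sum_p ito_sum T W p (Phi l p) N t w) ^+ 2) (C / N%:R))
 (HJ : exists2 C, 0 <= C & forall N t l, (0 < N)%N -> 0 <= t -> t <= T ->
  Eb P (fun w => (J t w l 0 - \sum_p ito_sum T V p (Phi l p) N t w) ^+ 2) (C / N%:R)).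
Variables c1 c2 c : R.

(** Everything in the limit equation except the term linear in [U]; clamping the time makes the
    Lebesgue integrals continuous on the whole line. *)
Definition forcing (t : R) (w : O) : 'cV[R]_n :=
  c1 *: (\col_l itg 0 (clamp T t) (fun s => (Db b (X s w) *m b (X s w)) l 0) + I t w) + c *: J t w
  + c2 *: \col_l itg 0 (clamp T t) (fun s => diffusion_term b sigma (X s w) l 0).

Definition scaled_incs N w k : 'cV[R]_m := c *: incs T V N w k.
Definition limit_err : nat -> nat -> O -> 'cV[R]_n := err T b sigma x0 W c1 c2 scaled_incs.
Definition limit_euler N k w : 'cV[R]_n :=
  euler_volterra T (fun s => Db b (X s w)) (forcing ^~ w) N k.

Let noise N k w := error_noise b sigma (step N) c1 c2 (eul N k w) (incs T W N w k) (scaled_incs N w k).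

Lemma noise_gap : BU leq 1 (fun N k w => nrm (\sum_(i < k) noise N i w - forcing (tk N k) w)).
Proof.
apply: BU_nrm => l.
have [Cb Hb] := lipb_jacobian_field bK l; have [Cd Hd] := lipb_diffusion sigma bK l.
have H := BU_add (BU_add (BU_scale c1 (BU_add (riemann_gap Hb) (ito_gap hW HI l))) (BU_scale c (ito_gap hV HJ l))) (BU_scale c2 (riemann_gap Hd)).
apply: (BU_le1 _ (BU_abs H)) => N k w N0N kN; rewrite le_eqVlt; apply/orP; left; apply/eqP; congr `|_|.
have tc : 0 <= tk N k <= T by rewrite (tk_ge0 T0 N00 k N0N) (tk_le T0 N00 N0N kN).
have -> : (\sum_(i < k) noise N i w - forcing (tk N k) w) l 0 = \sum_(i < k) noise N i w l 0 - forcing (tk N k) w l 0.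
  by rewrite mxE summxE [X in _ + X]mxE.
have -> : forcing (tk N k) w l 0 = c1 * (itg 0 (tk N k) (fun s => (Db b (X s w) *m b (X s w)) l 0) + I (tk N k) w l 0)
   + c * J (tk N k) w l 0 + c2 * itg 0 (tk N k) (fun s => diffusion_term b sigma (X s w) l 0).
  by rewrite /forcing !mxE clamp_id.
set i1 := itg _ _ _; set i2 := itg _ _ _.
rewrite (eq_bigr (fun i : 'I_k => c1 * (step N * (Db b (eul N i w) *m b (eul N i w)) l 0)
   + (c1 * \sum_p (Db b (eul N i w) *m sigma) l p * dW T W N i p w + c * \sum_p (Db b (eul N i w) *m sigma) l p * dW T V N i p w)
   + c2 * (step N * diffusion_term b sigma (eul N i w) l 0))); last first.
  move=> i _; rewrite /noise error_noiseE; congr (_ + _ + _).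
  rewrite !mulr_sumr -big_split/=; apply: eq_bigr => p _.
  by rewrite -!incsE [scaled_incs _ _ _ _ _]mxE; ring.
rewrite !big_split/= -!mulr_sumr.
move: (\sum_(i < k) _) (\sum_(i < k) _) (\sum_(i < k) _) (\sum_(i < k) _) => s1 s2 s3 s4; ring.
Qed.

Lemma mart_scaled p : mart P T N0 F 0 (fun N k w => scaled_incs N w k p 0).
Proof.
have [C C0 H] := mart_scale c (mart_dW T0 N00 hF hV p).
exists C => // N A al N0N mA Aal k kN; apply: Ub_ext (H N A al N0N mA Aal k kN) => w.
by congr (_ ^+ 2); apply: eq_bigr => i _; rewrite [scaled_incs _ _ _ _ _]mxE incsE.
Qed.

(** Both recursions are linear. The difference of the Jacobians acts on [limit_err], whose second
    moment is bounded; the rest goes into Gronwall. *)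
Lemma limit_err_euler : BU leq 1 (fun N k w => nrm (limit_err N k w - limit_euler N k w)).
Proof.
have BV : BU ltn 0 (fun N k w => nrm (limit_err N k w) ^+ 2).
  by apply: BU_ltn; exact: (BU_err sigma x0 K0 bK T0 N00 hF hW c1 c2 mart_scaled).
have BEV := BU_sumk T0 N00 (BU_step T0 N00 (BU_mul T0 N00 (p := 1) (q := 0) (BU_ltn BU_E2) BV)).
apply: (BU_gronwall T0 N00 (lam := n%:R * K) (c := fun N k w => nrm (\sum_(i < k) noise N i w - forcing (tk N k) w)
   + n%:R * K * (\sum_(i < k) step N * (nrm (X (tk N i) w - eul N i w) * nrm (limit_err N i w))))).
- by rewrite mulr_ge0.
- move=> N k w N0N kN; rewrite ger0_norm ?nrm_ge0//; have s0 := step_gt0 T0 N00 N0N.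
  have -> : limit_err N k w - limit_euler N k w = (\sum_(i < k) noise N i w - forcing (tk N k) w)
     + (\sum_(i < k) (step N *: ((Db b (eul N i w) - Db b (X (tk N i) w)) *m limit_err N i w)
       + step N *: (Db b (X (tk N i) w) *m (limit_err N i w - limit_euler N i w)))).
    rewrite {1}/limit_err err_sum {1}/limit_euler euler_volterra_sum big_split/= -/eul.
    rewrite -/(limit_err _ _ _) opprD addrA.
    rewrite [X in _ = _ + X](_ : _ = \sum_(i < k) step N *: (Db b (eul N i w) *m limit_err N i w)
      - \sum_(i < k) step N *: (Db b (X (tk N i) w) *m limit_euler N i w)); last first.
      rewrite -sumrB; apply: eq_bigr => i _; rewrite -!scalerDr -scalerBr; congr (_ *: _).
      by rewrite mulmxBl mulmxBr addrA subrK.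
    rewrite /limit_err /limit_euler /noise.
    move: (\sum_(i < k) _) (\sum_(i < k) _) (\sum_(i < k) _) (forcing _ _) => u1 u2 u3 u4.
    by apply/colP => l; rewrite !mxE; ring.
  apply: le_trans (nrmD _ _) _; rewrite -addrA lerD2l; apply: le_trans (nrm_sum _ _ _) _.
  rewrite !mulr_sumr -big_split/=; apply: ler_sum => i _.
  apply: le_trans (nrmD _ _) _; rewrite !nrmZ (ger0_norm (ltW s0)); apply: lerD.
    rewrite [leRHS](_ : _ = step N * (n%:R * (K * nrm (X (tk N i) w - eul N i w) * nrm (limit_err N i w)))); last by ring.
    rewrite ler_wpM2l ?(ltW s0)//; apply: nrm_mulmx => l j.
    have [_ [_ H]] := lipb_jacobian bK l j; rewrite nrmC mxE [X in _ + X]mxE; exact: H.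
  rewrite (ger0_norm (nrm_ge0 _)) [leRHS](_ : _ = step N * (n%:R * (K * nrm (limit_err N i w - limit_euler N i w)))); last by ring.
  by rewrite ler_wpM2l ?(ltW s0)// nrm_jacobian.
- by apply: BU_add; [exact: noise_gap|exact: BU_scale BEV].
Qed.

End LimitScheme.

Section PiecewiseIntegral.
Context {R : realType}.
Local Notation leb := (@lebesgue_measure R).

Lemma integral_adjoin (a b c v : R) (f g : R -> R) : a <= b -> b <= c -> continuous g ->
  (forall s, b < s < c -> f s = g s) ->
  measurable_fun `[a, b] (EFin \o f) /\ (\int[leb]_(s in `[a, b]) (f s)%:E)%E = v%:E ->
  measurable_fun `[a, c] (EFin \o f) /\ (\int[leb]_(s in `[a, c]) (f s)%:E)%E = (v + itg b c g)%:E.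
Proof.
move=> ab; rewrite le_eqVlt => /predU1P[<- cg _|bc cg fg [mf fv]].
  by rewrite itg_point addr0.
have U : `[a, c]%classic = `[a, b] `|` `]b, c].
  by apply: itv_bndbnd_setU; rewrite bnd_simp// ltW.
have mo : measurable_fun `]b, c[ (EFin \o f).
  apply: (eq_measurable_fun (EFin \o g)).
    by move=> s; rewrite inE/= in_itv/= => sc; rewrite fg.
  by apply/measurable_EFinP; apply: measurable_funTS; exact: continuous_measurable_fun.
have mc : measurable_fun `]b, c] (EFin \o f) by exact/emeasurable_fun_itv_bndo_bndcP.
have mac : measurable_fun `[a, c] (EFin \o f) by rewrite U; apply/measurable_funU.
split => //; rewrite U integral_setU//=; last 2 first.
- by rewrite -U.
- rewrite disj_set2E; apply/eqP; rewrite -subset0 => s /= []; rewrite !in_itv/= => /andP[_ h1] /andP[h2 _].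
  by have := lt_le_trans h2 h1; rewrite ltxx.
rewrite fv EFinD; congr (_ + _)%E.
rewrite -integral_itv_bndo_bndc//.
transitivity (\int[leb]_(x in `]b, c[) (g x)%:E)%E.
  by apply: eq_integral => s; rewrite inE/= in_itv/= => sc; rewrite fg.
rewrite -(@integral_itv_bndoo _ b c _ true false)//; last first.
  by apply/measurable_EFinP; apply: measurable_funTS; exact: continuous_measurable_fun.
rewrite /itg /Rintegral fineK//; apply: integrable_fin_num => //; exact: itg_integrable.
Qed.

(** [f] agrees with a continuous function only inside each open cell; at the grid points, a null
    set, the conventions of simple integrands and of the interpolation may differ from it. *)
Lemma integral_cells (d : R) (M : nat) (f : R -> R) (g : nat -> R -> R) : 0 <= d ->
  (forall j, continuous (g j)) ->
  (forall j s, (j < M)%N -> j%:R * d < s < j.+1%:R * d -> f s = g j s) ->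
  measurable_fun `[0, M%:R * d] (EFin \o f) /\
  (\int[leb]_(s in `[0%R, (M%:R * d)%R]) (f s)%:E)%E = (\sum_(j < M) itg (j%:R * d) (j.+1%:R * d) (g j))%:E.
Proof.
move=> d0 cg; elim: M => [|M IH] fg.
  by rewrite mul0r big_ord0 set_itv1 integral_set1; split => //; exact: measurable_fun_set1.
rewrite big_ord_recr/=; apply: integral_adjoin => //.
- by rewrite mulr_ge0.
- by rewrite ler_wpM2r// ler_nat.
- by move=> s; exact: fg.
- by apply: IH => j s jM; apply: fg; exact: ltnW.
Qed.

End PiecewiseIntegral.

Lemma continuous_col (R : realType) (n : nat) (x : R -> 'cV[R]_n) :
  (forall l, continuous (fun t => x t l 0)) -> continuous x.
Proof.
move=> cx t; apply/cvgrPdist_le => e e0.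
have c : continuous (fun s => nrm (x t - x s)).
  apply: nrm_continuous => l; rewrite (_ : (fun s => _) = (fun s => x t l 0 - x s l 0)).
    by apply: continuous_sub => // s; exact: cvg_cst.
  by apply/funext => s; rewrite !mxE.
have /cvgrPdist_le/(_ e e0) := c t; apply: filterS => s.
rewrite subrr nrm0 sub0r normrN ger0_norm ?nrm_ge0//.
exact: le_trans (mx_norm_le_nrm _).
Qed.

(** * Simple integrands approximating the Jacobian *)

Section ItoWitness.
Context {R : realType} {disp : measure_display} {O : measurableType disp}.
Variables (P : probability O R) (T : R) (F : R -> set (set O)) (n m : nat).
Variables (b : 'cV[R]_n -> 'cV[R]_n) (sigma : 'M[R]_(n, m)) (K : R).
Variables (W : R -> O -> 'cV[R]_m) (X : R -> O -> 'cV[R]_n).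
Hypotheses (K0 : 0 <= K) (bK : C3b_field b K) (T0 : 0 < T) (hF : filtration T F)
 (hW : brownian_motion P T F W) (cX : forall w l, continuous (fun s => X s w l 0))
 (aX : forall s l, 0 <= s -> s <= T -> smeas (F s) (fun w => X s w l 0))
 (XE : forall w r s l, 0 <= r -> r <= s -> s <= T ->
  X s w l 0 = X r w l 0 + itg r s (fun u => b (X u w) l 0) + (sigma *m (W s w - W r w)) l 0).
Variables (V : R -> O -> 'cV[R]_m) (I : R -> O -> 'cV[R]_n).
Let Phi s w := Db b (X s w) *m sigma.
Hypotheses (mI : forall t l, 0 <= t -> t <= T -> mfT (fun w => I t w l 0))
 (cI : forall w l, continuous (fun t => I t w l 0))
 (HI : exists2 C, 0 <= C & forall N t l, (0 < N)%N -> 0 <= t -> t <= T ->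
  Eb P (fun w => (I t w l 0 - \sum_p ito_sum T V p (fun s w => Phi s w l p) N t w) ^+ 2) (C / N%:R)).
Local Notation step := (@step R T).

(** Left-point sampling on [k + 1] cells: its integral is, entry by entry, a sum of [ito_sum]. *)
Definition grid_integrand (k : nat) : @simple_integrand R disp O n m :=
  SimpleIntegrand k.+1 (fun j => j%:R * step k.+1) (fun j w => Phi (j%:R * step k.+1) w).

Let s0 k : 0 < step k.+1. Proof. by rewrite divr_gt0// ltr0n. Qed.

Let tT k j : (j <= k.+1)%N -> j%:R * step k.+1 <= T.
Proof. by move=> jk; apply: (@tk_le _ T 1) => //. Qed.

Lemma grid_integrand_simple k : is_simple_integrand T F (grid_integrand k).
Proof.
split; first by rewrite /= mul0r.
split; first by apply: (@N_step _ T 1) => //.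
move=> j /= jk; split; first by rewrite ler_wpM2r ?(ltW (s0 _))// ler_nat.
have t0 : 0 <= j%:R * step k.+1 by rewrite mulr_ge0// ltW.
have tj := tT (ltnW jk).
split.
  by move=> i p; apply/(smeasP _ (filt_sigma hF t0 tj)); exact: (Phi_smeas sigma bK aX).
have H (lp : 'I_n * 'I_m) : exists C, lipb (fun x => (Db b x *m sigma) lp.1 lp.2) C.
  exact: lipb_jacobian_sigma.
have [C HC] := choice H; exists (\sum_lp C lp) => w i p.
have [_ [Cb _]] := HC (i, p); apply: le_trans (Cb (X (j%:R * step k.+1) w)) _.
rewrite (bigD1 (i, p))//= lerDl sumr_ge0// => lp _.
by have [] := HC lp.
Qed.

Lemma grid_integrand_eval k j s w : (j < k.+1)%N -> j%:R * step k.+1 < s < j.+1%:R * step k.+1 ->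
  si_eval (grid_integrand k) s w = Phi (j%:R * step k.+1) w.
Proof.
move=> jk /andP[h1 h2]; rewrite /si_eval (bigD1 (Ordinal jk))/= ?h1 ?(ltW h2)//.
rewrite big1 ?addr0// => i /andP[/andP[i1 i2] ij].
exfalso; move/eqP: ij; apply; apply: val_inj => /=; apply/eqP; rewrite eqn_leq.
have := lt_le_trans h1 i2; have := lt_trans i1 h2.
by rewrite !ltr_pM2r ?s0// !ltr_nat !ltnS => -> ->.
Qed.

Lemma Eb_sqnorm_Phi : exists2 C, 0 <= C & forall s t, 0 <= s -> s <= t -> t <= T ->
  Eb P (fun w => sqnorm (Phi t w - Phi s w)) (C * (t - s)).
Proof.
have H (lp : 'I_n * 'I_m) : exists C, 0 <= C /\ forall s t, 0 <= s -> s <= t -> t <= T ->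
  Eb P (fun w => (Phi t w lp.1 lp.2 - Phi s w lp.1 lp.2) ^+ 2) (C * (t - s)).
  by have [C C0 HC] := Phi_increment K0 bK T0 hF hW cX aX XE lp.1 lp.2; exists C.
have [C HC] := choice H; exists (\sum_i \sum_j C (i, j)).
  by apply: sumr_ge0 => i _; apply: sumr_ge0 => j _; have [] := HC (i, j).
move=> s t s0' st tT'; rewrite mulr_suml; under eq_bigr do rewrite mulr_suml.
apply: (@Eb_ext _ _ _ _ (fun w => \sum_i \sum_j (Phi t w i j - Phi s w i j) ^+ 2)).
  by move=> w; apply: eq_bigr => i _; apply: eq_bigr => j _; rewrite [X in _ = X ^+ 2]mxE [X in _ = (_ + X) ^+ 2]mxE.
apply: (@Eb_sum _ _ _ P _ _ _ (fun i w => \sum_j (Phi t w i j - Phi s w i j) ^+ 2)) => i _.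
apply: (@Eb_sum _ _ _ P _ _ _ (fun j w => (Phi t w i j - Phi s w i j) ^+ 2)) => j _.
by have [_ /(_ s t s0' st tT')] := HC (i, j); exact.
Qed.

Lemma cvg0_bound (u : nat -> \bar R) (C : R) : (forall k, (0 <= u k)%E) ->
  (forall k, (u k <= (C / k.+1%:R)%:E)%E) -> u @ \oo --> 0%E.
Proof.
move=> u0 uC; apply: (@squeeze_cvge _ _ _ _ (fun=> 0%E) _ (fun k => (C / k.+1%:R)%:E)).
- by apply: nearW => k; rewrite u0 uC.
- exact: cvg_cst.
- apply: cvg_EFin; first exact: nearW.
  rewrite /= -[X in _ --> X](mulr0 C); apply: cvgM; first exact: cvg_cst.
  exact: cvg_harmonic.
Qed.

(** [integral_cells] turns the time integral of the squared error into integrals of continuous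
    functions, to which the moment bounds apply. *)
Lemma ito_integral_of : ito_integral P T F V Phi I.
Proof.
split; first by move=> t; rewrite in_itv/= => /andP[t0 tT'] l; exact: mI.
split.
  apply: aeW => w; apply: continuous_subspaceT.
  exact: continuous_col.
exists grid_integrand; split; first exact: grid_integrand_simple.
split.
  have [C C0 HC] := Eb_sqnorm_Phi.
  apply: (@cvg0_bound _ (C * T ^+ 2)) => k.
    by apply: integral_ge0 => w _; apply: integral_ge0 => s _; rewrite lee_fin; apply: sumr_ge0 => i _; apply: sumr_ge0 => j _; exact: sqr_ge0.
  pose q j s w := sqnorm (Phi s w - Phi (j%:R * step k.+1) w).
  have cq j w : continuous (q j ^~ w).
    apply: continuous_bigsum => i; apply: continuous_bigsum => p.
    have [D [_ [_ HD]]] := lipb_jacobian_sigma sigma bK i p.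
    have c : continuous (fun s => Phi s w i p) by exact: (lipschitz_path HD (fun l => @cX w l)).
    have cs : continuous (fun s => Phi s w i p - Phi (j%:R * step k.+1) w i p).
      by apply: continuous_sub => // s; exact: cvg_cst.
    have subE (A B : 'M[R]_(n, m)) : (A - B) i p = A i p - B i p by rewrite !mxE.
    rewrite (_ : (fun s => _) = (fun s => (Phi s w i p - Phi (j%:R * step k.+1) w i p) * (Phi s w i p - Phi (j%:R * step k.+1) w i p))).
      by move=> s; apply: cvgM; exact: cs.
    by apply/funext => s; rewrite subE expr2.
  have E w : (\int[lebesgue_measure]_(s in `[0%R, T]) (sqnorm (Phi s w - si_eval (grid_integrand k) s w))%:E)%E =
     (\sum_(j < k.+1) itg (j%:R * step k.+1) (j.+1%:R * step k.+1) (q j ^~ w))%:E.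
    have [_] := @integral_cells R (step k.+1) k.+1 (fun s => sqnorm (Phi s w - si_eval (grid_integrand k) s w)) (fun j => q j ^~ w)
      (ltW (s0 k)) (fun j => @cq j w) (fun j s jk sc => congr1 (fun M => sqnorm (Phi s w - M)) (@grid_integrand_eval k j s w jk sc)).
    by rewrite (@N_step _ T 1).
  under eq_integral do rewrite E.
  have H j : (j < k.+1)%N -> Eb P (fun w => itg (j%:R * step k.+1) (j.+1%:R * step k.+1) (q j ^~ w)) (step k.+1 * (C * step k.+1)).
    move=> jk; have hE : j.+1%:R * step k.+1 - j%:R * step k.+1 = step k.+1 by rewrite tkS addrC addKr.
    have le : j%:R * step k.+1 <= j.+1%:R * step k.+1 by rewrite ler_wpM2r ?(ltW (s0 _))// ler_nat.
    rewrite (_ : step k.+1 * (C * _) = (j.+1%:R * step k.+1 - j%:R * step k.+1) * (C * step k.+1)); last by rewrite hE.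
    apply: (Eb_itg le (cq j)) => s /andP[s1 s2].
    apply: Eb_weak (HC (j%:R * step k.+1) s _ _ _) => //.
    - by rewrite ler_wpM2l// lerBlDl -tkS.
    - by rewrite mulr_ge0// ltW.
    - exact: le_trans s2 (tT jk).
  have [_ _ HS] := @Eb_sum _ _ _ P 'I_k.+1 (index_enum _) xpredT (fun j w => itg (j%:R * step k.+1) (j.+1%:R * step k.+1) (q j ^~ w)) _ (fun j _ => H j (ltn_ord j)).
  apply: le_trans HS _; rewrite lee_fin sumr_const card_ord -[_ *+ k.+1]mulr_natl mulrA (@N_step _ T 1)//.
  by rewrite le_eqVlt; apply/orP; left; apply/eqP; rewrite /step; ring.
move=> t; rewrite in_itv/= => /andP[t0 tT'].
have [C C0 HC] := HI.
apply: (@cvg0_bound _ (n%:R * C)) => k.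
  by apply: integral_ge0 => w _; rewrite lee_fin; apply: sumr_ge0 => i _; apply: sumr_ge0 => j _; exact: sqr_ge0.
have [_ _ HS] := @Eb_sum _ _ _ P 'I_n (index_enum _) xpredT (fun l w => (I t w l 0 - \sum_p ito_sum T V p (fun s w => Phi s w l p) k.+1 t w) ^+ 2) _ (fun l _ => HC k.+1 t l isT t0 tT').
rewrite sumr_const card_ord -[_ *+ n]mulr_natl mulrA in HS.
apply: le_trans HS; rewrite le_eqVlt; apply/orP; left; apply/eqP; apply: eq_integral => w _; congr (_%:E).
apply: eq_bigr => l _; rewrite big_ord1 !mxE summxE; congr ((_ - _) ^+ 2).
rewrite exchange_big; apply: eq_bigr => j _; rewrite [LHS]mxE; apply: eq_bigr => p _.
have subE (u v : 'cV[R]_m) : (u - v) p ord0 = u p 0 - v p 0 by rewrite !mxE.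
by rewrite subE.
Qed.

End ItoWitness.

(** * Convergence in distribution *)

Section NonMeasurable.
Context {R : realType} {disp : measure_display} {O : measurableType disp}.
Variable P : probability O R.
Implicit Types f g : O -> R.

(* No measurability: the integral of a nonnegative function is the supremum
   of the integrals of the simple functions below it. *)
Lemma ge0_integral_mono (f g : O -> \bar R) : (forall w, (0 <= f w)%E) -> (forall w, (f w <= g w)%E) ->
  (\int[P]_w f w <= \int[P]_w g w)%E.
Proof.
move=> f0 fg; have g0 w : (0 <= g w)%E by exact: le_trans (fg w).
rewrite !ge0_integralTE//; apply: ereal_sup_le => _ [h hf <-].
by exists h => // w; exact: le_trans (hf w) (fg w).
Qed.

Lemma integral_mono f g : (forall w, f w <= g w) -> (\int[P]_w (f w)%:E <= \int[P]_w (g w)%:E)%E.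
Proof.
move=> fg; rewrite [leLHS]integralE [leRHS]integralE.
apply: leeB; apply: ge0_integral_mono => w //.
- by apply: (@funepos_le _ _ setT) => [x _|]; rewrite ?lee_fin ?inE.
- by apply: (@funeneg_le _ _ setT) => [x _|]; rewrite ?lee_fin ?inE.
Qed.

Lemma bounded_integral f C : (forall w, `|f w| <= C) -> (\int[P]_w (f w)%:E)%E = (Ex P f)%:E.
Proof.
move=> fC; rewrite /Ex /Rintegral fineK//.
have ub : (\int[P]_w (f w)%:E <= C%:E)%E.
  have := @integral_mono f (fun=> C) (fun w => le_trans (ler_norm _) (fC w)).
  by rewrite integral_cst//= probability_setT mule1.
have lb : ((- C)%:E <= \int[P]_w (f w)%:E)%E.
  have := @integral_mono (fun=> - C) f (fun w => _); rewrite integral_cst//= probability_setT mule1; apply=> w.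
  by have := fC w; rewrite ler_norml => /andP[].
by rewrite fin_numE; apply/andP; split; apply/eqP => E; rewrite E in ub lb.
Qed.

Lemma ExN f C : (forall w, `|f w| <= C) -> Ex P (fun w => - f w) = - Ex P f.
Proof.
move=> fC; rewrite /Ex /Rintegral (_ : (\int[P]_w (- f w)%:E)%E = - (\int[P]_w (f w)%:E))%E.
  by rewrite fineN.
rewrite -integralN; first by apply: eq_integral => w _; rewrite EFinN.
apply: fin_num_adde_defr; rewrite ge0_fin_numE; last exact: integral_ge0.
apply: (@le_lt_trans _ _ (\int[P]_w C%:E)%E); last by rewrite integral_cst//= probability_setT mule1 ltry.
apply: ge0_integral_mono => w //.
have C0 : 0 <= C by exact: le_trans (normr_ge0 _) (fC w).
by rewrite funeposE ge_max !lee_fin C0 andbT; exact: le_trans (ler_norm _) (fC w).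
Qed.

Lemma Ex_mono f g C D : (forall w, `|f w| <= C) -> (forall w, `|g w| <= D) -> (forall w, f w <= g w) -> Ex P f <= Ex P g.
Proof. by move=> fC gD fg; rewrite -lee_fin -(bounded_integral fC) -(bounded_integral gD); exact: integral_mono. Qed.

(** [f] stands for a test function of the scheme, possibly not measurable: it is only compared by
    monotonicity with [g + h] and [g - h]. *)
Lemma Ex_close f g C v : (forall w, `|f w| <= C) -> (forall w, `|g w| <= C) -> mfT g ->
  Ub P (fun w => f w - g w) v -> `|Ex P f - Ex P g| <= v.
Proof.
move=> fC gC mg [h fh hv].
have sg := summable_bounded P mg gC; have sh := Eb_summable hv; have hE := Eb_Ex hv.
have H1 : Ex P f <= Ex P g + Ex P h.
  rewrite -ExD// -lee_fin -(bounded_integral fC) -ExE; last exact: summableD.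
  by apply: integral_mono => w; have := fh w; rewrite ler_norml => /andP[_]; lra.
have H2 : Ex P g - Ex P h <= Ex P f.
  rewrite -Ex_sub// -lee_fin -(bounded_integral fC) -ExE; last exact: summable_sub.
  by apply: integral_mono => w; have := fh w; rewrite ler_norml => /andP[+ _]; lra.
by rewrite ler_norml; apply/andP; split; lra.
Qed.

End NonMeasurable.

(** * From Lipschitz to continuous test functions *)

Section InfConvolution.
Context {R : realType} {n : nat}.
Variables (f : 'cV[R]_n -> R) (C : R).
Hypotheses (cf : continuous f) (fC : forall x, `|f x| <= C).

(** The Pasch-Hausdorff envelope: for [k >= 0], the largest minorant of [f] that is [k]-Lipschitz
    for [nrm]. *)
Definition inf_conv (k : R) (x : 'cV[R]_n) : R := inf [set f y + k * nrm (x - y) | y in setT].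

Let lbC y : - C <= f y.
Proof. by have := fC y; rewrite ler_norml => /andP[]. Qed.

Let hasinf k x : 0 <= k -> has_inf [set f y + k * nrm (x - y) | y in setT].
Proof.
move=> k0; split; first by exists (f x + k * nrm (x - x)); exists x.
by exists (- C) => _ [y _ <-]; rewrite ler_wpDr ?mulr_ge0 ?nrm_ge0.
Qed.

Let inf_conv_lb k x y : 0 <= k -> inf_conv k x <= f y + k * nrm (x - y).
Proof. by move=> k0; apply: ge_inf; [exact: (hasinf x k0).2|exists y]. Qed.

Let inf_conv_glb k x c : (forall y, c <= f y + k * nrm (x - y)) -> c <= inf_conv k x.
Proof. by move=> H; apply: lb_le_inf; [exists (f x + k * nrm (x - x)); exists x|move=> _ [y _ <-]]. Qed.

Lemma inf_conv_le k x : 0 <= k -> inf_conv k x <= f x.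
Proof. by move=> k0; have := inf_conv_lb x x k0; rewrite subrr nrm0 mulr0 addr0. Qed.

Lemma inf_conv_bounded k x : 0 <= k -> `|inf_conv k x| <= C.
Proof.
move=> k0; rewrite ler_norml; apply/andP; split.
  by apply: inf_conv_glb => y; rewrite ler_wpDr ?mulr_ge0 ?nrm_ge0.
by apply: le_trans (inf_conv_le x k0) _; exact: le_trans (ler_norm _) (fC x).
Qed.

Lemma inf_conv_lipschitz k x y : 0 <= k -> `|inf_conv k x - inf_conv k y| <= k * nrm (x - y).
Proof.
move=> k0.
have H u v : inf_conv k u - k * nrm (u - v) <= inf_conv k v.
  apply: inf_conv_glb => w; rewrite lerBlDr -addrA; apply: le_trans (inf_conv_lb u w k0) _.
  by rewrite lerD2l -mulrDr ler_wpM2l// [leRHS]addrC nrm_sub_trans.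
have H1 := H x y; have H2 := H y x; rewrite [nrm (y - x)]nrmC in H2.
by rewrite ler_norml; apply/andP; split; lra.
Qed.

(** Points at distance at least [d] are penalised by [k d >= 2 C] and cannot bring the infimum below
    [f x]; for nearer ones [f] is within [e] of [f x]. *)
Lemma inf_conv_cvg x : (fun k : nat => inf_conv k%:R x) @ \oo --> f x.
Proof.
apply/cvgrPdist_le => e e0.
have /cvgrPdist_le/(_ e e0) := @cf x; rewrite /prop_near1/= => /nbhs_ballP[d /= d0 Hd].
have C0 : 0 <= C by exact: le_trans (normr_ge0 _) (fC x).
near=> k; rewrite ger0_norm ?subr_ge0 ?inf_conv_le//.
rewrite lerBlDl -lerBlDr; apply: inf_conv_glb => y.
have [nd|nd] := ltP (nrm (x - y)) d.
  have xy : ball x d y by rewrite -ball_normE /ball_/=; apply: le_lt_trans nd; exact: mx_norm_le_nrm.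
  have := Hd y xy; rewrite /= ler_norml => /andP[_ H].
  by rewrite ler_wpDr ?mulr_ge0 ?nrm_ge0//; lra.
have kd : 2 * C <= k%:R * d.
  rewrite -ler_pdivrMr//; near: k; exact: nbhs_infty_ger.
have h1 := lbC y; have h2 := le_trans (ler_norm _) (fC x).
have h3 : k%:R * d <= k%:R * nrm (x - y) by rewrite ler_wpM2l.
lra.
Unshelve. all: by end_near. Qed.

End InfConvolution.

Section Portmanteau.
Context {R : realType} {d1 d2 : measure_display} {O1 : measurableType d1} {O2 : measurableType d2}.
Variables (P1 : probability O1 R) (P2 : probability O2 R) (n : nat).
Variables (V : nat -> O1 -> 'cV[R]_n) (U : O2 -> 'cV[R]_n).
Hypotheses (mU : forall l, mfT (fun w => U w l 0))
 (lipVU : forall (f : 'cV[R]_n -> R) (L C : R), 0 <= L ->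
  (forall x y, `|f x - f y| <= L * nrm (x - y)) -> (forall x, `|f x| <= C) ->
  (fun N => Ex P1 (fun w => f (V N w))) @ \oo --> Ex P2 (fun w => f (U w))).

(** An envelope whose mean under [U] is close to that of [f] satisfies the convergence hypothesis,
    and it stays below [f] along [V]. *)
Let lower (f : 'cV[R]_n -> R) C (e : R) : continuous f -> (forall x, `|f x| <= C) -> 0 < e ->
  \forall N \near \oo, Ex P2 (fun w => f (U w)) - e <= Ex P1 (fun w => f (V N w)).
Proof.
move=> cf fC e0; have e2 : 0 < e / 2 by rewrite divr_gt0.
have mg (k : nat) : mfT (fun w => inf_conv f k%:R (U w)).
  have sm : measurable `<=` (measurable : set (set O2)) by [].
  apply: (smeas_meas sm); apply: (@smeas_lipschitz _ _ _ _ _ _ _ _ (fun x y => inf_conv_lipschitz fC x y (ler0n R k))) => l.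
  apply/smeasP; first exact: sigma_algebra_measurable.
  by move=> B mB; rewrite -[X in measurable X]setTI; exact: mU.
have H := Ex_bounded_cvg (P := P2) mg (fun k w => inf_conv_bounded fC (U w) (ler0n R k)) (fun w => @inf_conv_cvg _ _ f C cf fC (U w)).
have [k Hk] : exists k : nat, Ex P2 (fun w => f (U w)) - e / 2 <= Ex P2 (fun w => inf_conv f k%:R (U w)).
  have /cvgrPdist_le/(_ _ e2)[k _ /(_ k (leqnn k))] := H.
  by rewrite ler_norml => /andP[_ h]; exists k; lra.
have /cvgrPdist_le/(_ _ e2) := lipVU (ler0n R k) (fun x y => inf_conv_lipschitz fC x y (ler0n R k)) (fun x => inf_conv_bounded fC x (ler0n R k)).
apply: filterS => N; rewrite ler_norml => /andP[_ h].
have : Ex P1 (fun w => inf_conv f k%:R (V N w)) <= Ex P1 (fun w => f (V N w)).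
  apply: (@Ex_mono _ _ _ P1 _ _ C C) => w; [exact: inf_conv_bounded|exact: fC|exact: inf_conv_le].
lra.
Qed.

(** The one-sided bound [lower] is applied to [f] and to [- f]. *)
Lemma portmanteau : cvg_in_distribution P1 P2 V U.
Proof.
move=> f cf [C fC].
have E1 N : 'E_P1[fun w => f (V N w)]%E = (Ex P1 (fun w => f (V N w)))%:E.
  by rewrite unlock; apply: bounded_integral => w; exact: fC.
have E2 : 'E_P2[fun w => f (U w)]%E = (Ex P2 (fun w => f (U w)))%:E.
  by rewrite unlock; apply: bounded_integral => w; exact: fC.
rewrite E2 (_ : (fun N => _) = EFin \o (fun N => Ex P1 (fun w => f (V N w)))); last by apply/funext.
apply: cvg_EFin; first exact: nearW.
apply/cvgrPdist_le => e e0.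
have L := lower cf fC e0.
have cN : continuous (fun x => - f x) by move=> x; apply: (@continuous_comp _ _ _ f (fun y => - y)); [exact: cf|exact: opp_continuous].
have fN x : `|- f x| <= C by rewrite normrN.
have Lo := lower cN fN e0.
have EN (d : measure_display) (O : measurableType d) (P : probability O R) (Z : O -> 'cV[R]_n) : Ex P (fun w => - f (Z w)) = - Ex P (fun w => f (Z w)).
  by apply: ExN => w; exact: fC.
apply: filterS2 L Lo => N; rewrite !EN => h1 h2.
by rewrite ler_norml; apply/andP; split; rewrite /=; lra.
Qed.

End Portmanteau.

(** * Transfer of the recursion between the two spaces *)

Section SchemeContinuity.
Context {R : realType} {n m : nat}.
Variables (b : 'cV[R]_n -> 'cV[R]_n) (sigma : 'M[R]_(n, m)) (K : R) (x0 : 'cV[R]_n) (h c1 c2 : R).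
Hypothesis bK : C3b_field b K.

Definition ccvg p (u : nat -> 'cV[R]_p) (v : 'cV[R]_p) : Prop :=
  forall l, (fun q => u q l 0) @ \oo --> v l 0.

Lemma ccvg_lipschitz p (g : 'cV[R]_p -> R) L (u : nat -> 'cV[R]_p) v :
  (forall x y, `|g x - g y| <= L * nrm (x - y)) -> ccvg u v -> (fun q => g (u q)) @ \oo --> g v.
Proof.
move=> gL uv; apply/cvgrPdist_le => e e0.
have H : (fun q => L * nrm (v - u q)) @ \oo --> (0 : R).
  rewrite -[X in _ --> X](mulr0 L); apply: cvgM; first exact: cvg_cst.
  rewrite (_ : (fun q => _) = (fun q => \sum_l `|v l 0 - u q l 0|)); last first.
    by apply/funext => q; rewrite /nrm; apply: eq_bigr => l _; rewrite !mxE.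
  rewrite -[X in _ --> X](_ : \sum_(l < p) 0 = 0); last by rewrite big1.
  apply: cvg_bigsum => l; rewrite -[X in _ --> X](@normr0 _ R) -(subrr (v l 0)).
  by apply: cvg_norm; apply: cvgB; [exact: cvg_cst|exact: uv].
move/cvgrPdist_le: H => /(_ e e0); apply: filterS => q.
rewrite sub0r normrN => H; apply: le_trans (gL _ _) _; apply: le_trans H; exact: ler_norm.
Qed.

Lemma ccvg_lipb g C (u : nat -> 'cV[R]_n) v : lipb g C -> ccvg u v -> (fun q => g (u q)) @ \oo --> g v.
Proof. by move=> [_ [_ gL]]; exact: ccvg_lipschitz gL. Qed.

Variables (dl z : nat -> nat -> 'cV[R]_m) (dl' z' : nat -> 'cV[R]_m).
Hypotheses (dlc : forall j, ccvg (dl ^~ j) (dl' j)) (zc : forall j, ccvg (z ^~ j) (z' j)).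

Lemma euler_ccvg k : ccvg (fun q => euler b sigma x0 h (dl q) k) (euler b sigma x0 h dl' k).
Proof.
elim: k => [|k IH] l; first exact: cvg_cst.
rewrite (_ : (fun q => _) = (fun q => (euler b sigma x0 h (dl q) k) l 0 + h * b (euler b sigma x0 h (dl q) k) l 0 + \sum_p sigma l p * dl q k p 0)); last first.
  by apply/funext => q; rewrite /= !mxE.
rewrite [euler _ _ _ _ dl' k.+1]/= !mxE; apply: cvgD; last first.
  by apply: cvg_bigsum => p; apply: cvgM; [exact: cvg_cst|exact: dlc].
apply: cvgD; first exact: IH.
by apply: cvgM; [exact: cvg_cst|exact: (ccvg_lipb (lipb_field bK l))].
Qed.

Lemma error_scheme_ccvg k :
  ccvg (fun q => error_scheme b sigma x0 h c1 c2 (dl q) (z q) k) (error_scheme b sigma x0 h c1 c2 dl' z' k).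
Proof.
elim: k => [|k IH] l; first exact: cvg_cst.
pose stp (x v : 'cV[R]_n) (d y : 'cV[R]_m) := v l 0 + h * (\sum_j Db b x l j * v j 0) +
  (c1 * (h * (Db b x *m b x) l 0) + \sum_p (Db b x *m sigma) l p * (c1 * d p 0 + y p 0)
   + c2 * (h * diffusion_term b sigma x l 0)).
have E dd zz : error_scheme b sigma x0 h c1 c2 dd zz k.+1 l 0 =
    stp (euler b sigma x0 h dd k) (error_scheme b sigma x0 h c1 c2 dd zz k) (dd k) (zz k).
  by rewrite /stp [LHS]/= [LHS]mxE [X in X + _ = _]mxE [X in _ + X + _ = _]mxE [X in _ + h * X + _ = _]mxE error_noiseE.
rewrite (_ : (fun q => _) = (fun q => stp (euler b sigma x0 h (dl q) k) (error_scheme b sigma x0 h c1 c2 (dl q) (z q) k) (dl q k) (z q k))); last first.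
  by apply/funext => q; exact: E.
rewrite E /stp.
have ec := @euler_ccvg k.
have [Cb Hb] := lipb_jacobian_field bK l; have [Cd Hd] := lipb_diffusion sigma bK l.
apply: cvgD.
  apply: cvgD; first exact: IH.
  apply: cvgM; first exact: cvg_cst.
  by apply: cvg_bigsum => j; apply: cvgM; [exact: (ccvg_lipb (lipb_jacobian bK l j))|exact: IH].
apply: cvgD; last by apply: cvgM; [exact: cvg_cst|apply: cvgM; [exact: cvg_cst|exact: (ccvg_lipb Hd)]].
apply: cvgD; first by apply: cvgM; [exact: cvg_cst|apply: cvgM; [exact: cvg_cst|exact: (ccvg_lipb Hb)]].
apply: cvg_bigsum => p; have [C Hp] := lipb_jacobian_sigma sigma bK l p.
apply: cvgM; first exact: (ccvg_lipb Hp).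
by apply: cvgD; [apply: cvgM; [exact: cvg_cst|exact: dlc]|exact: zc].
Qed.

End SchemeContinuity.

Lemma error_scheme_ext (R : realType) n m (b : 'cV[R]_n -> 'cV[R]_n) (sigma : 'M[R]_(n, m)) x0 (h c1 c2 : R)
    (dl dl' z z' : nat -> 'cV[R]_m) k :
  (forall j, (j < k)%N -> dl j = dl' j /\ z j = z' j) ->
  error_scheme b sigma x0 h c1 c2 dl z k = error_scheme b sigma x0 h c1 c2 dl' z' k.
Proof.
have E j : (j <= k)%N -> (forall i, (i < k)%N -> dl i = dl' i /\ z i = z' i) -> euler b sigma x0 h dl j = euler b sigma x0 h dl' j.
  move=> + H; elim: j => [//|j IH] jk /=.
  by rewrite (IH (ltnW jk)); have [-> _] := H j jk.
elim: k E => [//|k IH] E H /=.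
have [dE zE] := H k (leqnn _).
rewrite (E k (leqnSn k) H) dE zE IH//; last by move=> j jk; apply: H; exact: ltnW.
move=> j jk _; apply: E => //; exact: leq_trans jk (leqnSn k).
Qed.

Section Transfer.
Context {R : realType} {d1 d2 : measure_display}.
Context {O1 : measurableType d1} {O2 : measurableType d2}.
Variables (P1 : probability O1 R) (P2 : probability O2 R) (T K : R) (n m : nat).
Variables (b : 'cV[R]_n -> 'cV[R]_n) (sigma : 'M[R]_(n, m)) (x0 : 'cV[R]_n).
Variables (F1 : R -> set (set O1)) (F2 : R -> set (set O2)).
Variables (W1 : R -> O1 -> 'cV[R]_m) (W2 W3 : R -> O2 -> 'cV[R]_m).
Hypotheses (bK : C3b_field b K) (T0 : 0 < T) (hF1 : filtration T F1) (hW1 : brownian_motion P1 T F1 W1)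
 (cW1 : forall w i, continuous (fun s => W1 s w i 0)) (hF2 : filtration T F2)
 (hW2 : brownian_motion P2 T F2 W2) (hW3 : brownian_motion P2 T F2 W3)
 (hind : independent_processes P2 T W2 W3).
Variable theta : R.
Let c1 : R := (1 - 2 * theta) * T / 2.
Let c2 : R := (1 - 2 * theta ^+ 2) * T / 4.

(** [increment_law] applied to the whole recursion, seen as one continuous functional of the
    increments and areas of all cells. *)
Lemma area_limit_law (f : 'cV[R]_n -> R) (L C : R) N k : (0 < N)%N -> (k <= N)%N ->
  (forall x y, `|f x - f y| <= L * nrm (x - y)) -> (forall x, `|f x| <= C) ->
  Ex P1 (fun w => f (area_err T b sigma x0 W1 theta N k w)) =
  Ex P2 (fun w => f (limit_err T b sigma x0 W2 W3 c1 c2 (Num.sqrt 3 / 6 * T) N k w)).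
Proof.
move=> N0 kN fL fC.
(* Sequences rebuilt from the finite family, with the default 0 beyond the last cell; the recursion
   up to [k <= N] never reaches it. *)
pose ext (c : bool) (y : ('I_N * 'I_m) * bool -> R) (j : nat) : 'cV[R]_m :=
  if insub j is Some i then \col_p y ((i, p), c) else 0.
pose g y := f (error_scheme b sigma x0 (step T N) c1 c2 (ext false y) (ext true y) k).
have cg : seq_continuous g.
  move=> u y uy; apply: (ccvg_lipschitz fL).
  have H c j : ccvg (fun q => ext c (u q) j) (ext c y j).
    rewrite /ext; case: insubP => [i _ _|_] l; last exact: cvg_cst.
    by rewrite mxE; under eq_fun do rewrite mxE; exact: uy.
  by apply: (@error_scheme_ccvg _ _ _ b sigma K x0 (step T N) c1 c2 bK (fun q => ext false (u q)) (fun q => ext true (u q)) (ext false y) (ext true y)) => j; exact: H.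
have s0 : 0 < step T N by exact: (step_gt0 T0 N0 (leqnn N)).
have := increment_law hF1 hW1 hF2 hW2 hW3 hind s0 (N_step T N0 (leqnn N)) cW1 cg (fun y => fC _).
have E c (O : Type) (A B : 'I_N * 'I_m -> O -> R) w (j : nat) (jN : (j < N)%N) :
    ext c (fun b => pairing A B b w) j = \col_p (if c then B (Ordinal jN, p) w else A (Ordinal jN, p) w).
  by rewrite /ext insubT/=; apply/colP => p; rewrite !mxE.
rewrite /g => H; congr (_ = _): H; congr (Ex _ _); apply/funext => w; congr f; apply: error_scheme_ext => j jk;
  have jN := leq_trans jk kN; rewrite !(E _ _ _ _ _ _ jN).
- split; apply/colP => p; rewrite !mxE; first by rewrite /cell_incr/= /incr.
  by rewrite /cell_area/=.
- split; apply/colP => p; rewrite !mxE; first by rewrite /cell_incr/= /incr.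
  by congr (_ * _); rewrite /cell_incr/= /incr.
Qed.

End Transfer.

Section SchemeMeasurability.
Context {R : realType} {disp : measure_display} {O : measurableType disp}.
Variables (P : probability O R) (T : R) (N0 : nat) (F : R -> set (set O)) (n m : nat).
Variables (b : 'cV[R]_n -> 'cV[R]_n) (sigma : 'M[R]_(n, m)) (K : R) (x0 : 'cV[R]_n).
Variable W : R -> O -> 'cV[R]_m.
Hypotheses (bK : C3b_field b K) (T0 : 0 < T) (N00 : (0 < N0)%N) (hF : filtration T F)
 (hW : brownian_motion P T F W).
Local Notation step := (@step R T).
Local Notation tk N k := (k%:R * step N).

Lemma smeas_measurableP (f : O -> R) : smeas measurable f <-> mfT f.
Proof.
split=> [mf|mf]; first exact: smeas_meas mf.
apply/smeasP; first exact: sigma_algebra_measurable.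
by move=> B mB; rewrite -[X in measurable X]setTI; exact: mf.
Qed.

Lemma measurable_lipb (g : 'cV[R]_n -> R) C (X : O -> 'cV[R]_n) : lipb g C ->
  (forall l, mfT (fun w => X w l 0)) -> mfT (fun w => g (X w)).
Proof. by move=> gC mX; apply/smeas_measurableP; apply: (smeas_lipb gC) => l; exact/smeas_measurableP. Qed.

Lemma eul_meas N k l : (N0 <= N)%N -> (k <= N)%N -> mfT (fun w => eul T b sigma x0 W N k w l 0).
Proof.
move=> N0N kN; apply: smeas_meas (eul_smeas sigma x0 bK T0 N00 hF hW l N0N kN).
by apply: (filt_meas hF); [exact: (tk_ge0 T0 N00 k N0N)|exact: (tk_le T0 N00 N0N kN)].
Qed.

Lemma err_meas c1 c2 (z : nat -> O -> nat -> 'cV[R]_m) N k l : (N0 <= N)%N -> (k <= N)%N ->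
  (forall j p, (j < N)%N -> mfT (fun w => z N w j p 0)) ->
  mfT (fun w => err T b sigma x0 W c1 c2 z N k w l 0).
Proof.
move=> N0N + mz; elim: k l => [|k IH] l kN; first exact: measurable_cst.
have me := fun j => @eul_meas N k j N0N (ltnW kN).
rewrite (_ : (fun w => _) = (fun w => err T b sigma x0 W c1 c2 z N k w l 0
   + step N * (\sum_j Db b (eul T b sigma x0 W N k w) l j * err T b sigma x0 W c1 c2 z N k w j 0)
   + (c1 * (step N * (Db b (eul T b sigma x0 W N k w) *m b (eul T b sigma x0 W N k w)) l 0)
   + \sum_p (Db b (eul T b sigma x0 W N k w) *m sigma) l p * (c1 * dW T W N k p w + z N w k p 0)
   + c2 * (step N * diffusion_term b sigma (eul T b sigma x0 W N k w) l 0)))); last first.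
  apply/funext => w; rewrite [LHS]mxE [X in X + _ = _]mxE [X in _ + X + _ = _]mxE [X in _ + _ * X + _ = _]mxE.
  rewrite error_noiseE; congr (_ + (_ + _ + _)).
  by apply: eq_bigr => p _; rewrite incsE.
have [Cb Hb] := lipb_jacobian_field bK l; have [Cd Hd] := lipb_diffusion sigma bK l.
apply: measurable_funD.
  apply: measurable_funD; first exact/IH/ltnW.
  apply: measurable_funM => //; apply: measurable_sum => j; apply: measurable_funM; last exact/IH/ltnW.
  exact: (measurable_lipb (lipb_jacobian bK l j)).
apply: measurable_funD; last by apply: measurable_funM => //; apply: measurable_funM => //; exact: (measurable_lipb Hd).
apply: measurable_funD; first by apply: measurable_funM => //; apply: measurable_funM => //; exact: (measurable_lipb Hb).
apply: measurable_sum => p; have [C Hp] := lipb_jacobian_sigma sigma bK l p.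
apply: measurable_funM; first exact: (measurable_lipb Hp).
apply: measurable_funD; last exact: mz.
apply: measurable_funM => //; apply: (meas_incr hF hW).
- exact: (tk_ge0 T0 N00 k N0N).
- by rewrite tkS lerDl ltW// (step_gt0 T0 N00).
- exact: (tk_le T0 N00 N0N kN).
Qed.

Hypothesis cW : forall w i, continuous (fun s => W s w i 0).

Lemma area_meas N k p : (N0 <= N)%N -> (k < N)%N -> mfT (fun w => area T W N w k p 0).
Proof.
move=> N0N kN; under eq_fun do rewrite mxE.
have le : tk N k <= tk N k.+1 by rewrite tkS lerDl ltW// (step_gt0 T0 N00).
have t0 := tk_ge0 T0 N00 k N0N; have tT := tk_le T0 N00 N0N kN.
apply: measurable_funB; apply: measurable_funM => //.
  apply: (itg_meas le) => [w|s /andP[s1 s2]]; first exact: incr_continuous.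
  by apply: (meas_incr hF hW) => //; exact: le_trans tT.
exact: (meas_incr hF hW).
Qed.

End SchemeMeasurability.

(** * Convergence for Lipschitz test functions *)

Section Core.
Context {R : realType} {d1 d2 : measure_display}.
Context {O1 : measurableType d1} {O2 : measurableType d2}.
Variables (P1 : probability O1 R) (P2 : probability O2 R) (T K : R) (N0 n m : nat).
Variables (b : 'cV[R]_n -> 'cV[R]_n) (sigma : 'M[R]_(n, m)) (x0 : 'cV[R]_n).
Hypotheses (K0 : 0 <= K) (bK : C3b_field b K) (T0 : 0 < T) (N00 : (0 < N0)%N).
Local Notation step := (@step R T).
Local Notation tk N k := (k%:R * step N).

Variables (F1 : R -> set (set O1)) (W1 : R -> O1 -> 'cV[R]_m) (X1 : R -> O1 -> 'cV[R]_n).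
Hypotheses (hF1 : filtration T F1) (hW1 : brownian_motion P1 T F1 W1)
 (cW1 : forall w i, continuous (fun s => W1 s w i 0)) (cX1 : forall w l, continuous (fun s => X1 s w l 0))
 (aX1 : forall s l, 0 <= s -> s <= T -> smeas (F1 s) (fun w => X1 s w l 0)) (X10 : forall w, X1 0 w = x0)
 (X1E : forall w r s l, 0 <= r -> r <= s -> s <= T ->
  X1 s w l 0 = X1 r w l 0 + itg r s (fun u => b (X1 u w) l 0) + (sigma *m (W1 s w - W1 r w)) l 0).

Variables (F2 : R -> set (set O2)) (W2 W3 : R -> O2 -> 'cV[R]_m) (X2 I J U : R -> O2 -> 'cV[R]_n).
Hypotheses (hF2 : filtration T F2) (hW2 : brownian_motion P2 T F2 W2) (hW3 : brownian_motion P2 T F2 W3)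
 (hind : independent_processes P2 T W2 W3) (cW2 : forall w i, continuous (fun s => W2 s w i 0))
 (cX2 : forall w l, continuous (fun s => X2 s w l 0))
 (aX2 : forall s l, 0 <= s -> s <= T -> smeas (F2 s) (fun w => X2 s w l 0)) (X20 : forall w, X2 0 w = x0)
 (X2E : forall w r s l, 0 <= r -> r <= s -> s <= T ->
  X2 s w l 0 = X2 r w l 0 + itg r s (fun u => b (X2 u w) l 0) + (sigma *m (W2 s w - W2 r w)) l 0)
 (mI : forall t l, 0 <= t -> t <= T -> mfT (fun w => I t w l 0))
 (mJ : forall t l, 0 <= t -> t <= T -> mfT (fun w => J t w l 0)).
Let Phi l p s w : R := (Db b (X2 s w) *m sigma) l p.
Hypotheses (HI : exists2 C, 0 <= C & forall N t l, (0 < N)%N -> 0 <= t -> t <= T ->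
  Eb P2 (fun w => (I t w l 0 - \sum_p ito_sum T W2 p (Phi l p) N t w) ^+ 2) (C / N%:R))
 (HJ : exists2 C, 0 <= C & forall N t l, (0 < N)%N -> 0 <= t -> t <= T ->
  Eb P2 (fun w => (J t w l 0 - \sum_p ito_sum T W3 p (Phi l p) N t w) ^+ 2) (C / N%:R)).

Variable theta : R.
Hypothesis th01 : 0 <= theta <= 1.
Let c1 : R := (1 - 2 * theta) * T / 2.
Let c2 : R := (1 - 2 * theta ^+ 2) * T / 4.
Let c : R := Num.sqrt 3 / 6 * T.

Variable y : nat -> nat -> O1 -> 'cV[R]_n.
Let Z N k w := theta *: y N k.+1 w + (1 - theta) *: y N k w.
Hypotheses (y0 : forall N w, (N0 <= N)%N -> y N 0 w = x0) (yS : forall N w k, (N0 <= N)%N -> (k < N)%N ->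
  y N k.+1 w = y N k w + step N *: b (Z N k w) + sigma *m incs T W1 N w k).

Local Notation forc := (forcing T b sigma X2 I J c1 c2 c).
Hypotheses (cU : forall w l, continuous (fun t => U t w l 0)) (UE : forall w t l, 0 <= t <= T ->
  U t w l 0 = forc t w l 0 + itg 0 t (fun s => (Db b (X2 s w) *m U s w) l 0)).

(** Inside a cell the solution and the interpolation share the same noise, so only a drift integral
    is added to the error at the left grid point. *)
Definition path_err t N w : 'cV[R]_n := let k := cell_index T t N in
  norm_err T X1 y N k w + N%:R *: \col_l itg (tk N k) t (fun s => b (X1 s w) l 0 - b (Z N k w) l 0).

Lemma mX2 s l : 0 <= s -> s <= T -> mfT (fun w => X2 s w l 0).
Proof. by move=> s0 sT; apply: smeas_meas (aX2 l s0 sT); exact: (filt_meas hF2). Qed.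

Lemma limit_euler_meas N k l : (N0 <= N)%N -> (k <= N)%N ->
  mfT (fun w => limit_euler T b sigma X2 I J c1 c2 c N k w l 0).
Proof.
move=> N0N.
have mG j : (j <= N)%N -> forall l, mfT (fun w => forc (tk N j) w l 0).
  move=> jN i; have t0 := tk_ge0 T0 N00 j N0N; have tT := tk_le T0 N00 N0N jN.
  have mi g C : lipb g C -> mfT (fun w => itg 0 (clamp T (tk N j)) (fun s => g (X2 s w))).
    move=> gC; rewrite clamp_id ?t0//; apply: (itg_meas t0) => [w|s /andP[s1 s2]].
      by have [_ [_ gL]] := gC; exact: (lipschitz_path gL).
    by apply: (measurable_lipb gC) => l'; apply: mX2 => //; exact: le_trans tT.
  have [Cb Hb] := lipb_jacobian_field bK i; have [Cd Hd] := lipb_diffusion sigma bK i.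
  rewrite (_ : (fun w => _) = (fun w => c1 * (itg 0 (clamp T (tk N j)) (fun s => (Db b (X2 s w) *m b (X2 s w)) i 0) + I (tk N j) w i 0)
     + c * J (tk N j) w i 0 + c2 * itg 0 (clamp T (tk N j)) (fun s => diffusion_term b sigma (X2 s w) i 0))); last first.
    by apply/funext => w; rewrite /forcing !mxE.
  apply: measurable_funD; last by apply: measurable_funM => //; exact: (mi _ _ Hd).
  apply: measurable_funD; last by apply: measurable_funM => //; exact: mJ.
  by apply: measurable_funM => //; apply: measurable_funD; [exact: (mi _ _ Hb)|exact: mI].
elim: k l => [|k IH] l kN; first by have := mG 0%N (leq0n N) l; rewrite mul0r.
rewrite (_ : (fun w => _) = (fun w => limit_euler T b sigma X2 I J c1 c2 c N k w l 0
   + step N * (\sum_j Db b (X2 (tk N k) w) l j * limit_euler T b sigma X2 I J c1 c2 c N k w j 0)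
   + (forc (tk N k.+1) w l 0 - forc (tk N k) w l 0))); last first.
  apply/funext => w; rewrite {1}/limit_euler [euler_volterra _ _ _ _ k.+1]/=.
  by rewrite [LHS]mxE [X in X + _ = _]mxE [X in _ + X + _ = _]mxE [X in _ + _ * X + _ = _]mxE [X in _ + X = _]mxE [X in _ + (_ + X) = _]mxE.
apply: measurable_funD; last by apply: measurable_funB; apply: mG => //; exact: ltnW.
apply: measurable_funD; first exact/IH/ltnW.
apply: measurable_funM => //; apply: measurable_sum => j; apply: measurable_funM; last exact/IH/ltnW.
apply: (measurable_lipb (lipb_jacobian bK l j)) => i.
by apply: mX2; [exact: (tk_ge0 T0 N00 k N0N)|exact: (tk_le T0 N00 N0N (ltnW kN))].
Qed.

Let index_lt t N : 0 <= t <= T -> (N0 <= N)%N -> (cell_index T t N < N)%N.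
Proof. by move=> tc N0N; have [] := cell_indexP T0 tc (leq_trans N00 N0N). Qed.

Lemma limit_euler_cvg t w l : 0 <= t <= T ->
  (fun N => limit_euler T b sigma X2 I J c1 c2 c N (cell_index T t N) w l 0) @ \oo --> U t w l 0.
Proof.
move=> tc; apply: (@euler_volterra_cvg _ _ T K (fun s => Db b (X2 s w)) (forc ^~ w) (U ^~ w) T0 K0) => //.
- by move=> i j; have [_ [_ HL]] := lipb_jacobian bK i j; apply: (lipschitz_path HL); exact: cX2.
- by move=> s i j; have [_ [H _]] := lipb_jacobian bK i j.
- by move=> u i uc; exact: UE.
Qed.

(** A pointwise limit of measurable Euler schemes; the shift by [N0] keeps the indices in the range
    where they are known to be measurable. *)
Lemma U_meas t l : 0 <= t <= T -> mfT (fun w => U t w l 0).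
Proof.
move=> tc; apply: (measurable_fun_cvg (h := fun N w => limit_euler T b sigma X2 I J c1 c2 c (N + N0) (cell_index T t (N + N0)) w l 0)).
  move=> N; apply: limit_euler_meas; first exact: leq_addl.
  by apply/ltnW/index_lt => //; exact: leq_addl.
move=> w _; have := @limit_euler_cvg t w l tc; rewrite -(cvg_shiftn N0).
by apply: cvg_trans; apply: near_eq_cvg; apply: nearW.
Qed.

Lemma rt_cvg0 : (fun N => rt T N) @ \oo --> (0 : R).
Proof.
have H : (fun N => Num.sqrt (step N)) @ \oo --> Num.sqrt (0 : R).
  by apply: (cvg_comp (step) Num.sqrt); [exact: step_cvg0|exact: sqrt_continuous].
by move: H; rewrite sqrtr0.
Qed.

Lemma Ub_lipschitz (d : measure_display) (O : measurableType d) (P : probability O R) (f : 'cV[R]_n -> R) L (u v : O -> 'cV[R]_n) e :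
  0 <= L -> (forall x y, `|f x - f y| <= L * nrm (x - y)) -> Ub P (fun w => nrm (u w - v w)) e ->
  Ub P (fun w => f (u w) - f (v w)) (L * e).
Proof. by move=> L0 fL H; apply: Ub_le (Ub_pscale L0 H) => w; exact: fL. Qed.

Lemma Ub_null (A : set O1) : measurable A -> P1 A = 0%E -> Ub P1 (fun w => \1_A w) 0.
Proof.
move=> mA A0; apply: Ub_Eb; apply: EbI => [|w|].
- apply: (summable_bounded P1 (C := 1)); first exact: measurable_indic.
  by move=> w; rewrite indicE; case: (_ \in _); rewrite ?normr1 ?normr0 ?ler01.
- by rewrite indicE.
- have E : (\int[P1]_w (\1_A w)%:E = 0)%E by rewrite integral_indic// setIT.
  by rewrite /Ex /Rintegral E.
Qed.

(* The negligible set [Nul] cannot be dropped afterwards, as [V] need not be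
   measurable. *)
Lemma lipschitz_convergence (V : nat -> O1 -> 'cV[R]_n) (Nul : set O1) (f : 'cV[R]_n -> R) (L C : R) t :
  measurable Nul -> P1 Nul = 0%E ->
  (forall N w, (N0 <= N)%N -> ~ Nul w -> V N w = path_err t N w) ->
  0 <= t <= T -> 0 <= L ->
  (forall x y, `|f x - f y| <= L * nrm (x - y)) -> (forall x, `|f x| <= C) ->
  (fun N => Ex P1 (fun w => f (V N w))) @ \oo --> Ex P2 (fun w => f (U t w)).
Proof.
move=> mN PN VE tc L0 fL fC.
have C0 : 0 <= C by exact: le_trans (normr_ge0 _) (fC 0).
have fm (d : measure_display) (O : measurableType d) (v : O -> 'cV[R]_n) : (forall l, mfT (fun w => v w l 0)) -> mfT (fun w => f (v w)).
  by move=> mv; apply/smeas_measurableP; apply: (smeas_lipschitz fL) => l; exact/smeas_measurableP.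
have [A A0 HA] : BU P1 T N0 ltn 1 (fun N k w => nrm (norm_err T X1 y N k w - area_err T b sigma x0 W1 theta N k w) + cell_err T sigma K W1 X1 y N k w).
  apply: BU_add; last exact: (BU_cell_err K0 bK T0 N00 hF1 hW1 cW1 cX1 X10 X1E th01 y0 yS).
  exact: BU_ltn (norm_err_area K0 bK T0 N00 hF1 hW1 cW1 cX1 aX1 X10 X1E th01 y0 yS).
have [B B0 HB] := limit_err_euler K0 bK T0 N00 hF2 hW2 cW2 cX2 aX2 X20 X2E hW3 HI HJ c1 c2 c.
(* Three comparisons: with the linear recursion on the first space, by equality of laws with its
   counterpart on the second, and there with the Euler scheme of the limit equation. *)
have S1 N : (N0 <= N)%N -> `|Ex P1 (fun w => f (V N w)) - Ex P2 (fun w => f (limit_euler T b sigma X2 I J c1 c2 c N (cell_index T t N) w))|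
    <= (L * A + L * B) * rt T N.
  move=> N0N; have kN := index_lt tc N0N.
  have [_ tk12] := cell_indexP T0 tc (leq_trans N00 N0N).
  set k := cell_index T t N in kN tk12 *.
  have law := area_limit_law sigma x0 bK T0 hF1 hW1 cW1 hF2 hW2 hW3 hind theta (leq_trans N00 N0N) (ltnW kN) fL fC.
  have e1 : `|Ex P1 (fun w => f (V N w)) - Ex P1 (fun w => f (area_err T b sigma x0 W1 theta N k w))| <= L * (A * rt T N ^+ 1).
    apply: (@Ex_close _ _ _ P1 _ _ C) => [w|w||]; [exact: fC|exact: fC| |].
      apply: fm => l; apply: (err_meas sigma x0 bK T0 N00 hF1 hW1) => //; first exact: ltnW.
      by move=> j p jN; apply: (area_meas T0 N00 hF1 hW1 cW1 p N0N jN).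
    rewrite -[L * _]addr0 -[in L * _ + 0](mulr0 (2 * C)).
    have C20 : 0 <= 2 * C by rewrite mulr_ge0.
    (* On [Nul] the difference is at most [2 C], which contributes nothing in mean. *)
    apply: Ub_le (Ub_add (Ub_pscale L0 (HA N k N0N kN)) (Ub_pscale C20 (Ub_null mN PN))) => w.
    have nA := nrm_ge0 (norm_err T X1 y N k w - area_err T b sigma x0 W1 theta N k w).
    have cA := cell_errP K0 bK T0 N00 cW1 cX1 X1E th01 y0 yS w N0N kN tk12.
    have [Aw|nAw] := pselect (Nul w).
      rewrite indicE mem_set// mulr1; apply: (@le_trans _ _ (2 * C)).
        by apply: le_trans (ler_normB _ _) _; have := fC (V N w); have := fC (area_err T b sigma x0 W1 theta N k w); lra.
      rewrite lerDr mulr_ge0// addr_ge0//; exact: le_trans (nrm_ge0 _) cA.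
    rewrite indicE memNset// mulr0 addr0 VE//; apply: le_trans (fL _ _) _; apply: ler_wpM2l => //.
    by rewrite /path_err -/k addrAC; apply: le_trans (nrmD _ _) _; rewrite lerD2l.
  have e2 : `|Ex P2 (fun w => f (limit_err T b sigma x0 W2 W3 c1 c2 c N k w)) - Ex P2 (fun w => f (limit_euler T b sigma X2 I J c1 c2 c N k w))| <= L * (B * rt T N ^+ 1).
    apply: (@Ex_close _ _ _ P2 _ _ C) => [w|w||]; [exact: fC|exact: fC| |].
      by apply: fm => l; apply: limit_euler_meas => //; exact: ltnW.
    by apply: Ub_lipschitz => //; exact: HB N k N0N (ltnW kN).
  rewrite law in e1; rewrite (_ : _ - _ = (Ex P1 (fun w => f (V N w)) - Ex P2 (fun w => f (limit_err T b sigma x0 W2 W3 c1 c2 c N k w)))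
    + (Ex P2 (fun w => f (limit_err T b sigma x0 W2 W3 c1 c2 c N k w)) - Ex P2 (fun w => f (limit_euler T b sigma X2 I J c1 c2 c N k w)))); last by ring.
  apply: le_trans (ler_normD _ _) _; rewrite mulrDl -!mulrA; apply: lerD; first by rewrite -[rt T N]expr1.
  by rewrite -[rt T N]expr1.
(* Here there is no rate: convergence holds path by path and passes to the means by boundedness. *)
have S2 : (fun N => Ex P2 (fun w => f (limit_euler T b sigma X2 I J c1 c2 c N (cell_index T t N) w))) @ \oo --> Ex P2 (fun w => f (U t w)).
  rewrite -(cvg_shiftn N0); apply: (@Ex_bounded_cvg _ _ _ P2 (fun N w => f (limit_euler T b sigma X2 I J c1 c2 c (N + N0) (cell_index T t (N + N0)) w)) _ C).
  - move=> N; apply: fm => l; apply: limit_euler_meas; first exact: leq_addl.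
    by apply/ltnW/index_lt => //; exact: leq_addl.
  - by move=> N w; exact: fC.
  - move=> w; apply: (ccvg_lipschitz fL) => l.
    have := @limit_euler_cvg t w l tc; rewrite -(cvg_shiftn N0).
    by apply: cvg_trans; apply: near_eq_cvg; apply: nearW.
have S3 : (fun N => (L * A + L * B) * rt T N) @ \oo --> (0 : R).
  rewrite -[X in _ --> X](mulr0 (L * A + L * B)); apply: cvgM; [exact: cvg_cst|exact: rt_cvg0].
apply/cvgrPdist_le => e e0; have e2 : 0 < e / 2 by rewrite divr_gt0.
have /cvgrPdist_le/(_ _ e2) H2 := S2; have /cvgrPdist_le/(_ _ e2) H3 := S3.
near=> N.
have N0N : (N0 <= N)%N by near: N; exact: nbhs_infty_ge.
have h2 : `|Ex P2 (fun w => f (U t w)) - Ex P2 (fun w => f (limit_euler T b sigma X2 I J c1 c2 c N (cell_index T t N) w))| <= e / 2 by near: N.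
have h3 : `|0 - (L * A + L * B) * rt T N| <= e / 2 by near: N.
have h1 := S1 N N0N; rewrite sub0r normrN in h3; have h3' := le_trans (ler_norm _) h3.
rewrite distrC in h1.
rewrite (_ : _ - _ = (Ex P2 (fun w => f (U t w)) - Ex P2 (fun w => f (limit_euler T b sigma X2 I J c1 c2 c N (cell_index T t N) w)))
   + (Ex P2 (fun w => f (limit_euler T b sigma X2 I J c1 c2 c N (cell_index T t N) w)) - Ex P1 (fun w => f (V N w)))); last by ring.
by apply: le_trans (ler_normD _ _) _; lra.
Unshelve. all: by end_near. Qed.

End Core.

(** * The extended probability space *)

Section Pullback.
Context {R : realType} {d1 d2 : measure_display}.
Context {O1 : measurableType d1} {O2 : measurableType d2}.
Variables (P : probability O1 R) (Q : probability O2 R) (T : R).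
Variable psi : O2 -> O1.

(** The preimages under [psi] of events form a sigma-algebra that contains the generators. *)
Lemma sigma_of_pullback (I : Type) (D : set I) (X : I -> O1 -> R) E :
  sigma_of D (fun i w => X i (psi w)) E -> exists2 E', sigma_of D X E' & E = psi @^-1` E'.
Proof.
have sS : sigma_algebra setT (sigma_of D X) by exact: smallest_sigma_algebra.
suff H : sigma_of D (fun i w => X i (psi w)) `<=` [set E | exists2 E', sigma_of D X E' & E = psi @^-1` E'] by exact: H.
case: sS => s0 sC sU; apply: smallest_sub.
  split.
  - by exists set0.
  - by move=> A [A' sA' ->]; exists (setT `\` A'); [exact: sC|].
  - move=> A HA; pose f k := sval (cid2 (HA k)).
    have fS k : sigma_of D X (f k) by rewrite /f; case: cid2.
    have fE k : A k = psi @^-1` (f k) by rewrite /f; case: cid2.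
    exists (\bigcup_k f k); first exact: sU.
    by rewrite preimage_bigcup; apply: eq_bigcupr => k _.
move=> A [i [Di [B mB ->]]]; exists (X i @^-1` B) => //.
by apply: sub_sigma_algebra; exists i; split => //; exists B.
Qed.

Variables (F1 : R -> set (set O1)) (F2 : R -> set (set O2)).
Hypotheses (hF1 : filtration T F1) (mpsi : forall B, measurable B -> measurable (psi @^-1` B))
 (Fpsi : forall t, t \in `[0, T] -> forall B, F1 t B -> F2 t (psi @^-1` B))
 (Ppsi : forall B, measurable B -> Q (psi @^-1` B) = P B)
 (ipsi : forall s, s \in `[0, T] -> forall E1 E2, measurable E1 -> F2 s E2 ->
  (forall B, F1 s B -> P (E1 `&` B) = (P E1 * P B)%E) ->
  Q (psi @^-1` E1 `&` E2) = (P E1 * Q E2)%E).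

Lemma negligible_pullback A : P.-negligible A -> Q.-negligible (psi @^-1` A).
Proof.
move=> [B [mB PB AB]]; exists (psi @^-1` B); split; [exact: mpsi|by rewrite Ppsi|].
by move=> w; exact: AB.
Qed.

Lemma ae_pullback (S : O1 -> Prop) : {ae P, forall w, S w} -> {ae Q, forall w, S (psi w)}.
Proof. by move=> /negligible_pullback. Qed.

Lemma adapted_pullback n (X : R -> O1 -> 'cV[R]_n) : adapted T F1 X -> adapted T F2 (fun t w => X t (psi w)).
Proof. by move=> aX t tT i B mB; apply: (Fpsi tT (B := (fun w => X t w i 0) @^-1` B)); exact: aX. Qed.

(** Serves for three maps: the two projections of a product and the redirection off a null set.
    Independence from the past is the one property that [Ppsi] and [Fpsi] do not transport; it goes
    through [ipsi]. *)
Lemma brownian_pullback m (W : R -> O1 -> 'cV[R]_m) : brownian_motion P T F1 W ->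
  brownian_motion Q T F2 (fun t w => W t (psi w)).
Proof.
move=> hW; have [aW [W0 [cW [lW iW]]]] := hW.
have mI s t : 0 <= s -> s < t -> t <= T -> forall i (B : set R), measurable B -> measurable [set w | B ((W t w - W s w) i 0)].
  move=> s0 st tT i B mB; have := meas_incr hF1 hW i s0 (ltW st) tT measurableT mB; rewrite setTI.
  by congr measurable; apply/seteqP; split => w; rewrite /preimage/= /incr !mxE.
split; first exact: adapted_pullback.
split; first exact: (ae_pullback W0).
split; first exact: (ae_pullback cW).
split=> s t s0 st tT.
  move=> B mB; rewrite -(lW s t s0 st tT B mB).
  have mE : measurable [set w | forall i, B i ((W t w - W s w) i 0)].
    apply: (sigma_forall (sigma_algebra_measurable O1) (A := fun i => [set w | B i ((W t w - W s w) i 0)])) => i.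
    exact: mI.
  exact: (Ppsi mE).
move=> E1 E2 /(sigma_of_pullback (X := fun (i : 'I_m) w => (W t w - W s w) i 0))[E1' sE1' ->] FE2.
have mE1 : measurable E1'.
  move: sE1'; apply: smallest_sub => [|A [i [_ [B mB ->]]]]; first exact: sigma_algebra_measurable.
  exact: mI.
have sT : s \in `[0, T] by rewrite in_itv/= s0 (le_trans (ltW st)).
rewrite (Ppsi mE1); apply: (ipsi sT) => // B FB; exact: (iW s t).
Qed.

End Pullback.

Lemma brownian_congr (R : realType) (d : measure_display) (O : measurableType d) (P : probability O R)
    (T : R) F m (V W : R -> O -> 'cV[R]_m) : 0 <= T -> (forall t w, 0 <= t <= T -> V t w = W t w) ->
  brownian_motion P T F V -> brownian_motion P T F W.
Proof.
move=> T0 VW [aV [V0 [cV [lV iV]]]].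
have E t : 0 <= t -> t <= T -> V t = W t by move=> t0 tT; apply/funext => w; apply: VW; rewrite t0.
split.
  by move=> t tc i; have := aV t tc i; rewrite E//; move: tc; rewrite in_itv => /andP[].
split; first by rewrite -E.
split.
  apply: filterS cV => w cV; apply: subspace_eq_continuous cV => t.
  by rewrite inE/= in_itv/= => tc; exact: VW.
by split=> s t s0 st tT; rewrite -(E s s0 (le_trans (ltW st) tT)) -(E t (le_trans s0 (ltW st)) tT); [exact: lV|exact: iV].
Qed.

Section ProductSpace.
Context {R : realType} {disp : measure_display} {O : measurableType disp}.
Variables (P : probability O R) (T : R) (F : R -> set (set O)).
Hypothesis hF : filtration T F.
Let Omega2 := (O * O)%type.
Let Q : probability Omega2 R := (P \x P)%E.

(** Each factor carries its own copy of the filtration, so that motions on either factor are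
    Brownian for a common one. *)
Definition product_filtration (t : R) : set (set Omega2) :=
  <<s [set C | exists A B, [/\ F t A, F t B & C = A `*` B]] >>.

Lemma filtrationT t : t \in `[0, T] -> F t setT.
Proof. by move=> tT; have [/(_ t tT)[s0 sC _] _] := hF; rewrite -[setT]setD0; exact: sC. Qed.

Lemma filtrationI t A B : t \in `[0, T] -> F t A -> F t B -> F t (A `&` B).
Proof.
move=> tT FA FB; have [/(_ t tT) sF _] := hF; have GE : <<s F t >> = F t by exact: sigma_algebra_id.
by rewrite -GE; apply: (@measurableI _ (g_sigma_algebraType (F t))); rewrite /measurable/= GE.
Qed.

Lemma filtration_measurable t : t \in `[0, T] -> F t `<=` measurable.
Proof. by move=> tT; have [_ [H _]] := hF; exact: H. Qed.

Lemma product_filtrationP : filtration T product_filtration.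
Proof.
split; first by move=> t _; exact: smallest_sigma_algebra.
split.
  move=> t tT; apply: smallest_sub; first exact: sigma_algebra_measurable.
  by move=> _ [A [B [FA FB ->]]]; apply: measurableX; exact: (filtration_measurable tT).
move=> s t s0 st tT; apply: smallest_sub; first exact: smallest_sigma_algebra.
move=> _ [A [B [FA FB ->]]]; apply: sub_sigma_algebra; exists A, B.
by have [_ [_ H]] := hF; split => //; exact: H FA || exact: H FB.
Qed.

Lemma fst_preimageE (B : set O) : (@fst O O) @^-1` B = B `*` setT.
Proof. by apply/seteqP; split => [[x y]//=|[x y] []]. Qed.

Lemma snd_preimageE (B : set O) : (@snd O O) @^-1` B = setT `*` B.
Proof. by apply/seteqP; split => [[x y]//=|[x y] []]. Qed.

Lemma rectangle_law A B : measurable A -> measurable B -> Q (A `*` B) = (P A * P B)%E.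
Proof. exact: product_measure1E. Qed.

Lemma fst_measurable B : measurable B -> measurable ((@fst O O) @^-1` B).
Proof. by move=> mB; rewrite fst_preimageE; exact: measurableX. Qed.

Lemma snd_measurable B : measurable B -> measurable ((@snd O O) @^-1` B).
Proof. by move=> mB; rewrite snd_preimageE; exact: measurableX. Qed.

Lemma fst_law B : measurable B -> Q ((@fst O O) @^-1` B) = P B.
Proof. by move=> mB; rewrite fst_preimageE rectangle_law// probability_setT mule1. Qed.

Lemma snd_law B : measurable B -> Q ((@snd O O) @^-1` B) = P B.
Proof. by move=> mB; rewrite snd_preimageE rectangle_law// probability_setT mul1e. Qed.

Lemma fst_filtration t : t \in `[0, T] -> forall B, F t B -> product_filtration t ((@fst O O) @^-1` B).
Proof.
move=> tT B FB; rewrite fst_preimageE; apply: sub_sigma_algebra; exists B, setT.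
by split => //; exact: filtrationT.
Qed.

Lemma snd_filtration t : t \in `[0, T] -> forall B, F t B -> product_filtration t ((@snd O O) @^-1` B).
Proof.
move=> tT B FB; rewrite snd_preimageE; apply: sub_sigma_algebra; exists setT, B.
by split => //; exact: filtrationT.
Qed.

(** Both sides are finite measures in [E] that agree on rectangles, a generating family stable under
    intersection. *)
Lemma product_indep s (r : \bar R) D E : s \in `[0, T] -> measurable D -> (0 <= r)%E -> r \is a fin_num ->
  (forall A B, F s A -> F s B -> Q (D `&` (A `*` B)) = (r * Q (A `*` B))%E) ->
  product_filtration s E -> Q (D `&` E) = (r * Q E)%E.
Proof.
move=> sT mD r0 rf H; have r0' : 0 <= fine r by exact: fine_ge0.
have reE C : mrestr Q mD C = Q (D `&` C) by rewrite /mrestr setIC.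
have scE C : mscale (NngNum r0') Q C = (r * Q C)%E by rewrite /mscale/= fineK.
move=> FE; have HH : mrestr Q mD E = mscale (NngNum r0') Q E; last by rewrite -scE -HH /mrestr setIC.
move: FE; apply: (@g_sigma_algebra_measure_unique _ R _ [set C | exists A B, [/\ F s A, F s B & C = A `*` B]] _ (fun=> setT) _ _ (mrestr Q mD) (mscale (NngNum r0') Q)).
- by move=> _ [A [B [FA FB ->]]]; apply: measurableX; exact: (filtration_measurable sT).
- by move=> _; exists setT, setT; rewrite setXTT; split => //; exact: filtrationT.
- by rewrite bigcup_const//; exists 0%N.
- move=> _ _ [A [B [FA FB ->]]] [A' [B' [FA' FB' ->]]]; exists (A `&` A'), (B `&` B').
  by rewrite setXI; split => //; exact: filtrationI.
- by move=> _ [A [B [FA FB ->]]]; exact: (etrans (reE _) (etrans (H _ _ FA FB) (esym (scE _)))).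
- have h : (Q (D `&` setT) <= 1)%E by apply: probability_le1; rewrite setIT.
  by rewrite -reE in h; move=> _; exact: le_lt_trans h (ltry _).
Qed.

Lemma fst_indep s : s \in `[0, T] -> forall E1 E2, measurable E1 -> product_filtration s E2 ->
  (forall B, F s B -> P (E1 `&` B) = (P E1 * P B)%E) ->
  Q (fst @^-1` E1 `&` E2) = (P E1 * Q E2)%E.
Proof.
move=> sT E1 E2 m1 m2 iE; apply: (product_indep sT) => //; [exact: fst_measurable|exact: fin_num_measure|].
move=> A B FA FB; have mA := filtration_measurable sT FA; have mB := filtration_measurable sT FB.
rewrite fst_preimageE -setXI setTI !rectangle_law//; last exact: measurableI.
by rewrite iE// muleA.
Qed.

Lemma snd_indep s : s \in `[0, T] -> forall E1 E2, measurable E1 -> product_filtration s E2 ->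
  (forall B, F s B -> P (E1 `&` B) = (P E1 * P B)%E) ->
  Q (snd @^-1` E1 `&` E2) = (P E1 * Q E2)%E.
Proof.
move=> sT E1 E2 m1 m2 iE; apply: (product_indep sT) => //; [exact: snd_measurable|exact: fin_num_measure|].
move=> A B FA FB; have mA := filtration_measurable sT FA; have mB := filtration_measurable sT FB.
rewrite snd_preimageE -setXI setTI !rectangle_law//; last exact: measurableI.
by rewrite iE// muleCA.
Qed.

Lemma brownian_fst m (W : R -> O -> 'cV[R]_m) : brownian_motion P T F W ->
  brownian_motion Q T product_filtration (fun t w => W t w.1).
Proof. exact: (brownian_pullback hF fst_measurable fst_filtration fst_law fst_indep). Qed.

Lemma brownian_snd m (W : R -> O -> 'cV[R]_m) : brownian_motion P T F W ->
  brownian_motion Q T product_filtration (fun t w => W t w.2).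
Proof. exact: (brownian_pullback hF snd_measurable snd_filtration snd_law snd_indep). Qed.

Lemma independent_fst_snd n n' (V : R -> O -> 'cV[R]_n) (V' : R -> O -> 'cV[R]_n') :
  adapted T F V -> adapted T F V' -> independent_processes Q T (fun t w => V t w.1) (fun t w => V' t w.2).
Proof.
have mS k (X : R -> O -> 'cV[R]_k) E : adapted T F X -> sigma_process T X E -> measurable E.
  move=> aX; apply: smallest_sub; first exact: sigma_algebra_measurable.
  move=> _ [[t i] [/= tT [B mB ->]]]; apply: (filtration_measurable tT); exact: aX.
move=> aV aV' A1 A2 /(sigma_of_pullback (psi := @fst O O) (X := fun p w => V p.1 w p.2 0))[E1 s1 ->].
move=> /(sigma_of_pullback (psi := @snd O O) (X := fun p w => V' p.1 w p.2 0))[E2 s2 ->].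
have m1 := mS _ _ _ aV s1; have m2 := mS _ _ _ aV' s2.
rewrite fst_law// snd_law// -rectangle_law// fst_preimageE snd_preimageE -setXI setIT setTI//.
Qed.

End ProductSpace.

Section NullSet.
Context {R : realType} {disp : measure_display} {O : measurableType disp}.
Variables (P : probability O R) (T : R) (F : R -> set (set O)) (A : set O) (w0 : O).
Hypotheses (hF : filtration T F) (mA : measurable A) (PA : P A = 0%E) (FA : forall t, t \in `[0, T] -> F t A)
 (Aw0 : ~ A w0).

(* Redirects the exceptional null set to a good point, so that almost sure
   properties become sure ones. *)
Definition off (w : O) : O := if w \in A then w0 else w.

Lemma off_notin w : ~ A (off w).
Proof. by rewrite /off; case: ifPn => // /negP H Aw; apply: H; exact: mem_set. Qed.

Lemma off_id w : ~ A w -> off w = w.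
Proof. by move=> Aw; rewrite /off memNset. Qed.

(** An event changes only within [A], so its preimage stays in any sigma-algebra containing [A]. *)
Let preimE B : off @^-1` B = (B `\` A) `|` (if w0 \in B then A else set0).
Proof.
apply/seteqP; split => w /=.
  have [Aw|Aw] := pselect (A w); last by rewrite off_id// => Bw; left.
  by rewrite /off mem_set// => Bw; right; rewrite mem_set.
move=> [[Bw Aw]|]; first by rewrite off_id.
by case: ifPn => // /set_mem Bw0 Aw; rewrite /off mem_set.
Qed.

Let gen_preim (G : set (set O)) : sigma_algebra setT G -> G A -> forall B, G B -> G (off @^-1` B).
Proof.
move=> sG GA B GB; have GE : <<s G >> = G by exact: sigma_algebra_id.
rewrite -GE preimE; apply: (@measurableU _ (g_sigma_algebraType G)).
  by apply: measurableD; rewrite /measurable/= GE.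
by case: ifP => _; [rewrite /measurable/= GE|exact: measurable0].
Qed.

Lemma off_measurable B : measurable B -> measurable (off @^-1` B).
Proof. by move=> mB; apply: gen_preim => //; exact: sigma_algebra_measurable. Qed.

Lemma off_filtration t : t \in `[0, T] -> forall B, F t B -> F t (off @^-1` B).
Proof. by move=> tT B FB; apply: gen_preim => //; [have [H _] := hF; exact: H|exact: FA]. Qed.

Lemma null_diff B C : measurable B -> measurable C -> (forall w, ~ A w -> B w <-> C w) -> P B = P C.
Proof.
have H B' C' : measurable B' -> measurable C' -> (forall w, ~ A w -> B' w -> C' w) -> (P B' <= P C')%E.
  move=> mB mC BC; apply: (@le_trans _ _ (P (C' `|` A))).
    apply: le_measure; rewrite ?inE//; first exact: measurableU.
    by move=> w Bw; have [Aw|Aw] := pselect (A w); [right|left; exact: BC].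
  have E : (P C' + P A = P C')%E by rewrite PA adde0.
  by rewrite -[leRHS]E; exact: measureU2.
by move=> mB mC BC; apply/eqP; rewrite eq_le; apply/andP; split; apply: H => // w /BC[].
Qed.

Lemma off_law B : measurable B -> P (off @^-1` B) = P B.
Proof.
by move=> mB; apply: null_diff => //; [exact: off_measurable|move=> w Aw; rewrite /= off_id].
Qed.

Lemma off_indep s : s \in `[0, T] -> forall E1 E2, measurable E1 -> F s E2 ->
  (forall B, F s B -> P (E1 `&` B) = (P E1 * P B)%E) ->
  P (off @^-1` E1 `&` E2) = (P E1 * P E2)%E.
Proof.
move=> sT E1 E2 m1 FE2 iE; have m2 := filtration_measurable hF sT FE2; rewrite -iE//.
apply: null_diff; [apply: measurableI => //; exact: off_measurable|exact: measurableI|].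
by move=> w Aw; rewrite /setI/= off_id.
Qed.

Lemma brownian_off m (W : R -> O -> 'cV[R]_m) : brownian_motion P T F W ->
  brownian_motion P T F (fun t w => W t (off w)).
Proof. exact: (brownian_pullback hF off_measurable off_filtration off_law off_indep). Qed.

End NullSet.

(** * Paths, interpolation and the limit equation on [[0, T]] *)

Section Paths.
Context {R : realType}.
Variable T : R.
Hypothesis T0 : 0 < T.
Local Notation step := (@step R T).
Local Notation tk N k := (k%:R * step N).

Lemma within_clamp_continuous n (f : R -> 'cV[R]_n) l : continuous_path T f ->
  continuous (fun s => f (clamp T s) l 0).
Proof.
move=> /subspace_continuousP cf s.
have cs : `[0, T]%classic (clamp T s).
  by rewrite /= in_itv/= clamp_ge0 clamp_le ?ltW.
apply: (@cvg_comp _ _ _ (fun s => f (clamp T s)) (fun M : 'cV[R]_n => M l 0) _ (nbhs (f (clamp T s)))); last exact: coord_continuous.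
move=> A HA; have H := cf _ cs A HA.
have H' : \forall u \near nbhs s, `[0, T]%classic (clamp T u) -> A (f (clamp T u)) := @clamp_continuous R T s _ H.
change (\forall u \near nbhs s, A (f (clamp T u))); apply: filterS H' => u; apply.
by rewrite /= in_itv/= clamp_ge0 clamp_le ?ltW.
Qed.

Lemma time_integralE n t (f : R -> 'cV[R]_n) l i : time_integral t f l i = itg 0 t (fun s => f s l 0).
Proof. by rewrite mxE. Qed.

Lemma sde_increment n m (b : 'cV[R]_n -> 'cV[R]_n) (sigma : 'M[R]_(n, m)) K x0 (x : R -> 'cV[R]_n) (w : R -> 'cV[R]_m) r s l :
  C3b_field b K -> continuous_path T x ->
  (forall t, t \in `[0, T] -> x t = x0 + time_integral t (fun s => b (x s)) + sigma *m w t) ->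
  0 <= r -> r <= s -> s <= T ->
  x s l 0 = x r l 0 + itg r s (fun u => b (x (clamp T u)) l 0) + (sigma *m (w s - w r)) l 0.
Proof.
move=> bK cx xE r0 rs sT; have rT := le_trans rs sT; have s0 := le_trans r0 rs.
have cb : continuous (fun u => b (x (clamp T u)) l 0).
  have [C [_ [_ HL]]] : exists C, lipb (fun x => b x l 0) C by exists K; exact: (lipb_field bK l).
  by apply: (lipschitz_path HL) => i; exact: within_clamp_continuous.
have E t : 0 <= t -> t <= T -> x t l 0 = x0 l 0 + itg 0 t (fun u => b (x (clamp T u)) l 0) + (sigma *m w t) l 0.
  move=> t0 tT; rewrite (xE t) ?in_itv/= ?t0// [LHS]mxE [X in X + _ = _]mxE time_integralE.
  congr (_ + _ + _); apply: itg_eq => u /andP[u0 ut].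
  by rewrite clamp_id// u0 (le_trans ut).
rewrite (E s s0 sT) (E r r0 rT) (itg_split r0 rs cb) mulmxBr.
have subE (u v : 'cV[R]_n) : (u - v) l ord0 = u l 0 - v l 0 by rewrite !mxE.
rewrite subE; ring.
Qed.

Section Interpolation.
Variables (theta : R) (n m : nat) (b : 'cV[R]_n -> 'cV[R]_n) (sigma : 'M[R]_(n, m)) (x0 : 'cV[R]_n) (N : nat).
Variables (w : R -> 'cV[R]_m) (y : nat -> 'cV[R]_n) (x : R -> 'cV[R]_n).
Hypotheses (N0 : (0 < N)%N) (xi : theta_interpolation T theta b sigma x0 N w y x).

Let s0 : 0 < step N. Proof. by rewrite divr_gt0// ltr0n. Qed.
Let Z k := theta *: y k.+1 + (1 - theta) *: y k.
Let g s := b (theta *: x (grid_right T N s) + (1 - theta) *: x (grid_left T N s)).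

(** Strictly inside a cell, floor and ceiling give its two ends; at a grid point they would
    coincide. *)
Let gE j s : (j < N)%N -> tk N j < s < tk N j.+1 -> g s = b (Z j).
Proof.
move=> jN /andP[h1 h2]; have [xy _] := xi.
have q1 : j%:R < s / step N by rewrite ltr_pdivlMr.
have q2 : s / step N < j.+1%:R by rewrite ltr_pdivrMr.
rewrite /g /grid_right /grid_left -/(step N).
have -> : Num.floor (s / step N) = j%:Z.
  by apply: floor_def; rewrite (_ : j%:Z + 1 = j.+1%:Z) -?[j.+1%:~R]/(j.+1%:R) -?[j%:~R]/(j%:R) ?(ltW q1)// -addn1 PoszD.
have -> : Num.ceil (s / step N) = j.+1%:Z.
  by apply: ceil_def; rewrite (_ : j.+1%:Z - 1 = j%:Z) -?[j.+1%:~R]/(j.+1%:R) -?[j%:~R]/(j%:R) ?q1 ?(ltW q2)// -addn1 PoszD addrK.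
by rewrite /= -[j%:~R]/(j%:R) -[j.+1%:~R]/(j.+1%:R) !xy// ltnW.
Qed.

(** The integral up to [t] is the one over the full cells plus that over the last, partial cell;
    subtracting the value at the grid point leaves the latter. *)
Lemma interpolation_cell k t l : (k < N)%N -> tk N k <= t <= tk N k.+1 ->
  x t l 0 = y k l 0 + itg (tk N k) t (fun=> b (Z k) l 0) + (sigma *m (w t - w (tk N k))) l 0.
Proof.
move=> kN /andP[t1 t2]; have [xy xE] := xi.
have k0 : 0 <= tk N k by rewrite mulr_ge0// ltW.
have NT : N%:R * step N = T by apply: (@N_step _ T N).
have kT j : (j <= N)%N -> tk N j <= T by move=> jN; rewrite -[leRHS]NT ler_wpM2r ?(ltW s0)// ler_nat.
have cc (c : R) : continuous (fun _ : R => c) by move=> s; exact: cvg_cst.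
have Ik := @integral_cells R (step N) k (fun s => g s l 0) (fun j _ => b (Z j) l 0) (ltW s0) (fun j => cc _)
   (fun j s jk sc => congr1 (fun v : 'cV[R]_n => v l 0) (@gE j s (ltn_trans jk kN) sc)).
have It := @integral_adjoin R 0 (tk N k) t _ (fun s => g s l 0) (fun=> b (Z k) l 0) k0 t1 (cc _) _ Ik.
have {}It := It _; case: It => [s /andP[u1 u2]|_ It].
  by rewrite (@gE k)// u1 (lt_le_trans u2).
have {}Ik := Ik.2.
have E u : 0 <= u -> u <= T -> x u l 0 = x0 l 0 + fine (\int[lebesgue_measure]_(s in `[0%R, u]) (g s l 0)%:E)%E + (sigma *m w u) l 0.
  by move=> u0 uT; rewrite (xE u) ?in_itv/= ?u0// [LHS]mxE [X in X + _ = _]mxE time_integralE.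
have tT : t <= T by exact: le_trans t2 (kT _ kN).
rewrite (E t (le_trans k0 t1) tT) -(xy k (ltnW kN)) (E (tk N k) k0 (kT _ (ltnW kN))) It Ik /= mulmxBr.
have subE (u v : 'cV[R]_n) : (u - v) l ord0 = u l 0 - v l 0 by rewrite !mxE.
rewrite subE; ring.
Qed.

End Interpolation.

(** Only times in [[0, T]] are seen: the nodes of a simple integrand increase from 0 to [T], and
    they are cut at [t]. *)
Lemma ito_integral_congr (d : measure_display) (O : measurableType d) (P : probability O R) F n m
    (V V' : R -> O -> 'cV[R]_m) (Phi Phi' : R -> O -> 'M[R]_(n, m)) (I : R -> O -> 'cV[R]_n) :
  (forall t w, 0 <= t <= T -> V t w = V' t w) -> (forall t w, 0 <= t <= T -> Phi t w = Phi' t w) ->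
  ito_integral P T F V Phi I -> ito_integral P T F V' Phi' I.
Proof.
move=> VE PE [mI [cI [phi [sphi [c1 c2]]]]]; split; first exact: mI.
split; first exact: cI.
exists phi; split; first exact: sphi.
have time k j : (j <= si_size (phi k))%N -> 0 <= si_time (phi k) j <= T.
  have [t0 [tT tm]] := sphi k; have mono i j' : (i <= j')%N -> (j' <= si_size (phi k))%N -> si_time (phi k) i <= si_time (phi k) j'.
    elim: j' => [|j' IH]; first by rewrite leqn0 => /eqP ->.
    rewrite leq_eqVlt => /predU1P[->//|]; rewrite ltnS => ij jk.
    by apply: le_trans (IH ij (ltnW jk)) _; have [] := tm j' jk.
  by move=> jk; rewrite -[X in X <= _ <= _]t0 -[X in _ <= _ <= X]tT !mono.
split.
  apply: cvg_trans c1; apply: near_eq_cvg; apply: nearW => k.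
  apply: eq_integral => w _; apply: eq_integral => s; rewrite inE/= in_itv/= => sc.
  by rewrite PE.
move=> t tc; have tc' : 0 <= t <= T by move: tc; rewrite in_itv.
apply: cvg_trans (c2 t tc); apply: near_eq_cvg; apply: nearW => k.
apply: eq_integral => w _; congr (sqnorm _)%:E; congr (_ - _).
apply: eq_bigr => j _; congr (_ *m (_ - _)).
  by rewrite VE//; have /andP[j0 _] := time k j.+1 (ltn_ord j); case/andP: tc' => t0 tT; rewrite le_min j0 t0 ge_min tT orbT.
by rewrite VE//; have /andP[j0 _] := time k j (ltnW (ltn_ord j)); case/andP: tc' => t0 tT; rewrite le_min j0 t0 ge_min tT orbT.
Qed.

Lemma limit_equation_path n m (b : 'cV[R]_n -> 'cV[R]_n) (sigma : 'M[R]_(n, m)) K (x x2 u : R -> 'cV[R]_n)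
    (i j f : 'cV[R]_n) (c1 c2 c t : R) :
  C3b_field b K -> (forall l, continuous (fun s => x2 s l 0)) -> 0 <= t <= T ->
  (forall s, 0 <= s <= T -> x2 s = x s) ->
  f = c1 *: (\col_l itg 0 (clamp T t) (fun s => (Db b (x2 s) *m b (x2 s)) l 0) + i) + c *: j
     + c2 *: \col_l itg 0 (clamp T t) (fun s => diffusion_term b sigma (x2 s) l 0) ->
  (forall l, u t l 0 = f l 0 + itg 0 t (fun s => (Db b (x2 s) *m u s) l 0)) ->
  u t = time_integral t (fun s => Db b (x s) *m u s)
    + c1 *: time_integral t (fun s => Db b (x s) *m b (x s)) + c1 *: i + c *: j
    + c2 *: \sum_(k < m) time_integral t (fun s => second_deriv b (x s) (col k sigma) (col k sigma)).
Proof.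
move=> bK cx2 tc xE fE uE; apply/colP => l; rewrite uE fE (clamp_id tc).
have /andP[t0 tT] := tc.
have tI (g g2 : R -> 'cV[R]_n) : (forall s, 0 <= s <= t -> g2 s = g s) -> time_integral t g l 0 = itg 0 t (fun s => g2 s l 0).
  by move=> gE; rewrite time_integralE; apply: itg_eq => s sc; rewrite gE.
have sT s : 0 <= s <= t -> 0 <= s <= T by move=> /andP[-> st]; exact: le_trans tT.
have addE (v w : 'cV[R]_n) : (v + w) l 0 = v l 0 + w l 0 by rewrite mxE.
have scE a (v : 'cV[R]_n) : (a *: v) l 0 = a * v l 0 by rewrite mxE.
have colE (g : 'I_n -> R) : (\col_l g l) l 0 = g l by rewrite mxE.
rewrite !(addE, scE) (colE (fun l => itg 0 t (fun s => (Db b (x2 s) *m b (x2 s)) l 0))).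
rewrite (colE (fun l => itg 0 t (fun s => diffusion_term b sigma (x2 s) l 0))).
rewrite (tI _ (fun s => Db b (x2 s) *m u s)); last by move=> s /sT/xE ->.
rewrite (tI _ (fun s => Db b (x2 s) *m b (x2 s))); last by move=> s /sT/xE ->.
have -> : (\sum_(k < m) time_integral t (fun s => second_deriv b (x s) (col k sigma) (col k sigma))) l 0 =
    itg 0 t (fun s => diffusion_term b sigma (x2 s) l 0).
  have E k : time_integral t (fun s => second_deriv b (x s) (col k sigma) (col k sigma)) l 0 =
      itg 0 t (fun s => second_deriv b (x2 s) (col k sigma) (col k sigma) l 0).
    by apply: (tI _ (fun s => second_deriv b (x2 s) (col k sigma) (col k sigma))) => s /sT/xE ->.
  rewrite summxE (eq_bigr _ (fun k _ => E k)) -itg_sum.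
    by apply: itg_eq => s _; rewrite /diffusion_term summxE.
  move=> k; have [C HC] : exists C, lipb (fun x => second_deriv b x (col k sigma) (col k sigma) l 0) C.
    exists (\sum_(i < n) \sum_(j < n) (K * `|sigma i k * sigma j k| + K * `|sigma i k * sigma j k|)).
    rewrite (_ : (fun x => _) = (fun x => \sum_i \sum_j hess b l i j x * (sigma i k * sigma j k))); last first.
      apply/funext => v; rewrite mxE; apply: eq_bigr => p _; apply: eq_bigr => q _.
      by rewrite [col k sigma p 0]mxE [col k sigma q 0]mxE mulrA.
    by apply: lipb_sum => p; apply: lipb_sum => q; apply: lipb_mul; [exact: (lipb_hess bK)|exact: lipb_cst].
  by have [_ [_ HL]] := HC; exact: (lipschitz_path HL).
ring.
Qed.

End Paths.

Section LimitProcess.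
Context {R : realType} {disp : measure_display} {O : measurableType disp}.
Variables (T K : R) (n m : nat).
Variables (b : 'cV[R]_n -> 'cV[R]_n) (sigma : 'M[R]_(n, m)).
Variables (X : R -> O -> 'cV[R]_n) (c1 c2 c : R).
Hypotheses (K0 : 0 <= K) (bK : C3b_field b K) (T0 : 0 < T) (cX : forall w l, continuous (fun s => X s w l 0)).
Variables (I J : R -> O -> 'cV[R]_n).
Hypotheses (cI : forall w l, continuous (fun t => I t w l 0))
 (cJ : forall w l, continuous (fun t => J t w l 0)).
Local Notation forc := (forcing T b sigma X I J c1 c2 c).

Lemma forcing_continuous w l : continuous (fun t => forc t w l 0).
Proof.
rewrite (_ : (fun t => _) = (fun t => c1 * (itg 0 (clamp T t) (fun s => (Db b (X s w) *m b (X s w)) l 0) + I t w l 0)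
  + c * J t w l 0 + c2 * itg 0 (clamp T t) (fun s => diffusion_term b sigma (X s w) l 0))); last first.
  by apply/funext => t; rewrite /forcing !mxE.
have cl g C : lipb g C -> continuous (fun s => g (X s w)).
  by move=> [_ [_ HL]]; exact: (lipschitz_path HL).
have [Cb Hb] := lipb_jacobian_field bK l; have [Cd Hd] := lipb_diffusion sigma bK l.
apply: continuous_add; last by apply: continuous_scale; apply: itg_clamp_continuous => //; exact: cl Hd.
apply: continuous_add; last by apply: continuous_scale; exact: cJ.
apply: continuous_scale; apply: continuous_add; last exact: cI.
by apply: itg_clamp_continuous => //; exact: cl Hb.
Qed.

Lemma limit_process_exists : exists U : R -> O -> 'cV[R]_n,
  (forall w l, continuous (fun t => U t w l 0)) /\
  forall w t l, 0 <= t <= T ->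
    U t w l 0 = forc t w l 0 + itg 0 t (fun s => (Db b (X s w) *m U s w) l 0).
Proof.
have cA w i j : continuous (fun s => Db b (X s w) i j).
  by have [_ [_ HL]] := lipb_jacobian bK i j; exact: (lipschitz_path HL (fun l => @cX w l)).
have AK w s i j : `|Db b (X s w) i j| <= K by have [_ [H _]] := lipb_jacobian bK i j.
exists (fun t w => volterra T (fun s => Db b (X s w)) (forc ^~ w) t); split.
  by move=> w l; apply: (volterra_continuous (K := K)) => // l'; exact: forcing_continuous.
by move=> w t l tc; apply: (volterra_eq (K := K)) => // l'; exact: forcing_continuous.
Qed.

End LimitProcess.

(** * Assembly on the product space *)

Section Assembly.
Context {R : realType} {disp : measure_display} {O : measurableType disp}.
Variables (P : probability O R) (T theta K : R) (F : R -> set (set O)) (n m N1 : nat).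
Variables (b : 'cV[R]_n -> 'cV[R]_n) (sigma : 'M[R]_(n, m)) (x0 : 'cV[R]_n).
Variables (W : R -> O -> 'cV[R]_m) (X : R -> O -> 'cV[R]_n).
Variables (Xhat : nat -> nat -> O -> 'cV[R]_n) (XN : nat -> R -> O -> 'cV[R]_n).
Variables (A : set O) (w0 : O).
Hypotheses (T0 : 0 < T) (K0 : 0 <= K) (bK : C3b_field b K) (th01 : 0 <= theta <= 1) (hF : filtration T F)
 (hW : brownian_motion P T F W) (aX : adapted T F X) (mA : measurable A) (PA : P A = 0%E)
 (FA : forall t, t \in `[0, T] -> F t A) (Aw0 : ~ A w0) (cW : forall w, ~ A w -> continuous_path T (W ^~ w))
 (W0 : forall w, ~ A w -> W 0 w = 0) (cX : forall w, ~ A w -> continuous_path T (X ^~ w))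
 (XE : forall w, ~ A w -> forall t, t \in `[0, T] ->
  X t w = x0 + time_integral t (fun s => b (X s w)) + sigma *m W t w)
 (hXhat : forall w N, ~ A w -> (N1 <= N)%N ->
  theta_scheme T theta b sigma x0 N (W ^~ w) (fun k => Xhat N k w))
 (hXN : forall w N, ~ A w -> (N1 <= N)%N ->
  theta_interpolation T theta b sigma x0 N (W ^~ w) (fun k => Xhat N k w) (fun t => XN N t w)).

Local Notation step := (@step R T).
Local Notation tk N k := (k%:R * step N).
Local Notation pr := (off A w0).

(** Versions whose paths are all continuous on the whole line: bad samples are redirected to [w0]
    and times are clamped. *)
Definition sureW t w := W (clamp T t) (pr w).
Definition sureX t w := X (clamp T t) (pr w).
Definition sureY N k w := Xhat N k (pr w).

Let Apr w : ~ A (pr w). Proof. exact: off_notin. Qed.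

Let zT : 0 \in `[0, T]. Proof. by rewrite in_itv/= lexx ltW. Qed.

Let sureWE t w : 0 <= t <= T -> W t (pr w) = sureW t w.
Proof. by move=> tc; rewrite /sureW clamp_id. Qed.

Let sureXE t w : 0 <= t <= T -> X t (pr w) = sureX t w.
Proof. by move=> tc; rewrite /sureX clamp_id. Qed.

Let hW1 : brownian_motion P T F sureW.
Proof.
apply: (@brownian_congr _ _ _ P T F m (fun t w => W t (pr w))); [exact: ltW|exact: sureWE|].
exact: (brownian_off w0 hF mA PA FA hW).
Qed.

Let cW1 w i : continuous (fun s => sureW s w i 0).
Proof. by apply: (within_clamp_continuous (f := W ^~ (pr w)) T0); exact: cW. Qed.

Let cX1 w i : continuous (fun s => sureX s w i 0).
Proof. by apply: (within_clamp_continuous (f := X ^~ (pr w)) T0); exact: cX. Qed.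

Let aXpr : adapted T F (fun t w => X t (pr w)).
Proof. exact: (adapted_pullback (off_filtration w0 hF FA) aX). Qed.

Let aX1 s l : 0 <= s -> s <= T -> smeas (F s) (fun w => sureX s w l 0).
Proof.
move=> s0 sT; have sc : 0 <= s <= T by rewrite s0.
have st : s \in `[0, T] by rewrite in_itv/=.
apply/(smeasP _ (filt_sigma hF s0 sT)); have := aXpr st l.
by congr sub_measurable; apply/funext => w; rewrite sureXE.
Qed.

Let X10 w : sureX 0 w = x0.
Proof.
rewrite -sureXE ?lexx ?ltW// (XE (@Apr w) zT) (W0 (@Apr w)) mulmx0 addr0.
by apply/colP => l; rewrite [LHS]mxE time_integralE itg_point addr0.
Qed.

Let X1E w r s l : 0 <= r -> r <= s -> s <= T ->
  sureX s w l 0 = sureX r w l 0 + itg r s (fun u => b (sureX u w) l 0) + (sigma *m (sureW s w - sureW r w)) l 0.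
Proof.
move=> r0 rs sT; have s0 := le_trans r0 rs; have rT := le_trans rs sT.
rewrite -!sureXE -?sureWE ?r0 ?s0//.
exact: (sde_increment (x := X ^~ (pr w)) (w := W ^~ (pr w)) T0 l bK (cX (@Apr w)) (XE (@Apr w)) r0 rs sT).
Qed.

(** The threshold is [N1.+1] rather than [N1], to have at least one cell. *)
Let y0 N w : (N1.+1 <= N)%N -> sureY N 0 w = x0.
Proof. by move=> N1N; have [] := hXhat (@Apr w) (ltnW N1N). Qed.

Let N10 : (0 < N1.+1)%N. Proof. by []. Qed.

Let yS N w k : (N1.+1 <= N)%N -> (k < N)%N -> sureY N k.+1 w =
  sureY N k w + step N *: b (theta *: sureY N k.+1 w + (1 - theta) *: sureY N k w) + sigma *m incs T sureW N w k.
Proof.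
move=> N1N kN; have [_ HS] := hXhat (@Apr w) (ltnW N1N).
rewrite {1}/sureY (HS k kN); congr (_ + sigma *m _).
have k0 j : 0 <= tk N j by exact: (tk_ge0 T0 N10 j N1N).
by rewrite /incs -!sureWE// k0/= (tk_le T0 N10 N1N)// ltnW.
Qed.

Let VE N w t : 0 <= t <= T -> (N1.+1 <= N)%N -> ~ A w ->
  N%:R *: (X t w - XN N t w) = path_err T b sureX theta sureY t N w.
Proof.
move=> tc N1N Aw; have N0 : (0 < N)%N by exact: leq_trans N1N.
have [kN /andP[tk1 tk2]] := cell_indexP T0 tc N0.
rewrite /path_err /norm_err; set k := cell_index T t N in kN tk1 tk2 *.
have prw : pr w = w by exact: off_id.
rewrite -scalerDr; congr (_ *: _); apply/colP => l.
have k0 : 0 <= tk N k by exact: (tk_ge0 T0 N10 k N1N).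
have /andP[t0 tT] := tc; have kT := le_trans tk1 tT.
have subE (u v : 'cV[R]_n) : (u - v) l ord0 = u l 0 - v l 0 by rewrite !mxE.
have addE (u v : 'cV[R]_n) : (u + v) l 0 = u l 0 + v l 0 by rewrite mxE.
have tkc : tk N k <= t <= tk N k.+1 by rewrite tk1.
have HN := interpolation_cell T0 N0 (hXN Aw (ltnW N1N)) l kN tkc.
have HX := X1E w l k0 tk1 tT.
rewrite [LHS]subE [RHS]addE [X in _ = X + _]subE [X in _ = _ + X]mxE HN -{1}prw sureXE// HX.
have cb : continuous (fun u => b (sureX u w) l 0).
  have [_ [_ HL]] := lipb_field bK l; exact: (lipschitz_path HL).
rewrite itgB//; last by move=> s; exact: cvg_cst.
rewrite -(@sureWE t)// -(@sureWE (tk N k)) ?k0// prw /sureY prw.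
move: (itg _ _ _) (itg _ _ _) (_ l 0) (sureX _ _ _ _) (Xhat _ _ _ _ _) => *; ring.
Qed.

Let Q : probability (O * O)%type R := (P \x P)%E.
Let F2 := product_filtration F.

Let hF2 : filtration T F2. Proof. exact: product_filtrationP. Qed.

(* The driving noise of the limit is a copy of [W] on a second factor. *)
Lemma theta_limit_exists :
  exists (disp' : measure_display) (Omega' : measurableType disp')
         (P' : probability Omega' R) (F' : R -> set (set Omega'))
         (proj : Omega' -> O)
         (W' : R -> Omega' -> 'cV[R]_m) (U : R -> Omega' -> 'cV[R]_n),
    space_extension P P' T F F' proj /\
    brownian_motion P' T F' (fun t w => W t (proj w)) /\
    brownian_motion P' T F' W' /\
    independent_processes P' T (fun t w => W t (proj w)) W' /\
    (forall t, t \in `[0, T] -> random_vector (U t)) /\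
    {ae P', forall w, continuous_path T (U ^~ w)} /\
    limit_equation P' T theta F' b sigma (fun t w => W t (proj w)) W'
      (fun t w => X t (proj w)) U /\
    forall t, t \in `[0, T] ->
      cvg_in_distribution P P'
        (fun N w => N%:R *: (X t w - XN N t w)) (U t).
Proof.
have tcP t : t \in `[0, T] -> 0 <= t <= T by rewrite in_itv.
pose W2 t (w : O * O) := sureW t w.1; pose W3 t (w : O * O) := sureW t w.2.
pose X2 t (w : O * O) := sureX t w.1.
have hW2 : brownian_motion Q T F2 W2 by exact: brownian_fst.
have hW3 : brownian_motion Q T F2 W3 by exact: brownian_snd.
have cW2 (w : O * O) i : continuous (fun s => W2 s w i 0) by exact: cW1.
have cW3 (w : O * O) i : continuous (fun s => W3 s w i 0) by exact: cW1.
have cX2 (w : O * O) i : continuous (fun s => X2 s w i 0) by exact: cX1.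
have aX2 s l : 0 <= s -> s <= T -> smeas (F2 s) (fun w => X2 s w l 0).
  move=> s0 sT; apply/(smeasP _ (filt_sigma hF2 s0 sT)) => B mB.
  have st : s \in `[0, T] by rewrite in_itv/= s0.
  apply: (fst_filtration hF st (B := (fun w => sureX s w l 0) @^-1` B)).
  by move: B mB; apply/(smeasP _ (filt_sigma hF s0 sT)); exact: aX1.
have X2E (w : O * O) r s l := @X1E w.1 r s l.
have hind : independent_processes Q T W2 W3.
  have aW1 : adapted T F sureW by have [] := hW1.
  by apply: (@independent_fst_snd _ _ _ P T F hF m m sureW sureW).
have [I [mI cI HI]] := ito_jacobian K0 bK T0 hF2 hW2 cX2 aX2 X2E hW2 cW2.
have [J [mJ cJ HJ]] := ito_jacobian K0 bK T0 hF2 hW2 cX2 aX2 X2E hW3 cW3.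
have [U [cU UE]] := limit_process_exists sigma ((1 - 2 * theta) * T / 2) ((1 - 2 * theta ^+ 2) * T / 4)
  (Num.sqrt 3 / 6 * T) K0 bK T0 cX2 cI cJ.
have mU t l : 0 <= t <= T -> mfT (fun w => U t w l 0).
  exact: (U_meas K0 bK T0 N10 hF2 cX2 aX2 mI mJ cU UE).
(* The projection is the first coordinate followed by the redirection, so that [W] and [X] seen from
   the extension have regular paths at every sample point. *)
exists _, (O * O)%type, Q, F2, (fun w => pr w.1), W3, U.
split.
  split.
    move=> _ B mB; rewrite setTI; apply: (fst_measurable (B := pr @^-1` B)); exact: off_measurable.
  split.
    move=> B mB; rewrite -(off_law w0 mA PA mB); apply: (fst_law P (B := pr @^-1` B)); exact: off_measurable.
  split; first exact: hF2.
  move=> t tT B FB; apply: (fst_filtration hF tT (B := pr @^-1` B)); exact: (off_filtration w0 hF FA tT).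
split.
  by apply: (@brownian_congr _ _ _ Q T F2 m W2) => //; [exact: ltW|move=> t w tc; rewrite sureWE].
split; first exact: hW3.
split.
  apply: (@independent_fst_snd _ _ _ P T F hF m m (fun t w => W t (pr w)) sureW); last by case: hW1.
  by have [] := brownian_off w0 hF mA PA FA hW.
split; first by move=> t tT l; apply: mU; exact: tcP.
split.
  by apply: aeW => w; apply: continuous_subspaceT; apply: continuous_col; exact: cU.
split.
  exists I, J; split.
    apply: (@ito_integral_congr _ T _ _ Q F2 n m W2 _ (fun s w => Db b (X2 s w) *m sigma)).
    - by move=> t w tc; rewrite sureWE.
    - by move=> t w tc; rewrite sureXE.
    - exact: (ito_integral_of K0 bK T0 hF2 hW2 cX2 aX2 X2E mI cI HI).
  split.
    apply: (@ito_integral_congr _ T _ _ Q F2 n m W3 _ (fun s w => Db b (X2 s w) *m sigma)) => //.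
    - by move=> t w tc; rewrite sureXE.
    - exact: (ito_integral_of K0 bK T0 hF2 hW2 cX2 aX2 X2E mJ cJ HJ).
  apply: aeW => w t /tcP tc.
  apply: (@limit_equation_path _ T n m b sigma K (fun s => X s (pr w.1)) (X2 ^~ w) (U ^~ w) (I t w) (J t w)
    _ _ _ _ t bK (fun l => @cX2 w l) tc _ erefl) => [s sc|l]; first by rewrite sureXE.
  exact: UE.
move=> t /tcP tc; apply: portmanteau => [l|f L C L0 fL fC]; first exact: mU.
exact: (lipschitz_convergence K0 bK T0 N10 hF hW1 cW1 cX1 aX1 X10 X1E hF2 hW2 hW3 hind cW2 cX2 aX2
  (fun w => X10 w.1) X2E mI mJ HI HJ th01 y0 yS cU UE mA PA (fun N w N1N Aw => VE tc N1N Aw) tc L0 fL fC).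
Qed.

End Assembly.

Theorem proposition2p6 (R : realType) (disp : measure_display)
    (Omega : measurableType disp) (P : probability Omega R)
    (T : R) (F : R -> set (set Omega)) (d m : nat)
    (W : R -> Omega -> 'cV[R]_m) (sigma : 'M[R]_(d + d, m))
    (H : 'cV[R]_(d + d) -> R) (theta : R) (x0 : 'cV[R]_(d + d))
    (X : R -> Omega -> 'cV[R]_(d + d))
    (Xhat : nat -> nat -> Omega -> 'cV[R]_(d + d))
    (XN : nat -> R -> Omega -> 'cV[R]_(d + d))
    (b := hamiltonian_field H)
    (hT : 0 < T) (hd : (0 < d)%N) (hm : (0 < m)%N)
    (hF : filtration T F) (hFu : usual_conditions P T F)
    (hW : brownian_motion P T F W)
    (hH : bounded_derivs_upto 4 H)
    (htheta : 0 <= theta <= 1)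
    (hX : sde_solution P T F b sigma x0 W X)
    (hXhat : \forall N \near \oo, {ae P, forall w,
       theta_scheme T theta b sigma x0 N (W ^~ w) (fun k => Xhat N k w)})
    (hXN : \forall N \near \oo, {ae P, forall w,
       theta_interpolation T theta b sigma x0 N (W ^~ w)
         (fun k => Xhat N k w) (fun t => XN N t w)}) :
  exists (disp' : measure_display) (Omega' : measurableType disp')
         (P' : probability Omega' R) (F' : R -> set (set Omega'))
         (proj : Omega' -> Omega)
         (W' : R -> Omega' -> 'cV[R]_m) (U : R -> Omega' -> 'cV[R]_(d + d)),
    space_extension P P' T F F' proj /\
    brownian_motion P' T F' (fun t w => W t (proj w)) /\
    brownian_motion P' T F' W' /\
    independent_processes P' T (fun t w => W t (proj w)) W' /\
    (forall t, t \in `[0, T] -> random_vector (U t)) /\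
    {ae P', forall w, continuous_path T (U ^~ w)} /\
    limit_equation P' T theta F' b sigma (fun t w => W t (proj w)) W'
      (fun t w => X t (proj w)) U /\
    forall t, t \in `[0, T] ->
      cvg_in_distribution P P'
        (fun N w => N%:R *: (X t w - XN N t w)) (U t).
Proof.
have [K [K0 bK]] := hamiltonian_C3b hH.
have [N1 _ HN] := filterI hXhat hXN.
have [aX [cX XE]] := hX; have [_ [W0 [cW _]]] := hW.
(* The schemes are given almost surely for each [N] separately; countably many exceptional sets are
   merged, to have one for all [N >= N1]. *)
have aeN : {ae P, forall w, forall N, (N1 <= N)%N ->
    theta_scheme T theta b sigma x0 N (W ^~ w) (fun k => Xhat N k w) /\
    theta_interpolation T theta b sigma x0 N (W ^~ w) (fun k => Xhat N k w) (fun t => XN N t w)}.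
  apply: ae_foralln => N; have [N1N|_] := boolP (N1 <= N)%N; last by apply: aeW => w.
  by have [HA HB] := HN N N1N; apply: filterS (filterI HA HB) => w AB _.
have [A [mA PA HA]] : P.-negligible (~` [set w | (W 0 w = 0 /\ continuous_path T (W ^~ w)) /\
    ((continuous_path T (X ^~ w) /\ forall t, t \in `[0, T] ->
     X t w = x0 + time_integral t (fun s => b (X s w)) + sigma *m W t w) /\ forall N, (N1 <= N)%N ->
    theta_scheme T theta b sigma x0 N (W ^~ w) (fun k => Xhat N k w) /\
    theta_interpolation T theta b sigma x0 N (W ^~ w) (fun k => Xhat N k w) (fun t => XN N t w))]).
  exact: (filterI (filterI W0 cW) (filterI (filterI cX XE) aeN)).
have {}HA w : ~ A w -> _ := fun nA => contrapT (fun nS => nA (HA w nS)).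
(* The usual conditions put null sets into [F 0], so that redirecting [A] respects the
   filtration. *)
have FA t : t \in `[0, T] -> F t A.
  rewrite in_itv/= => /andP[t0 tT]; have [_ [_ mono]] := hF; apply: (mono 0 t) => //.
  by have [_ [H0 _]] := hFu; apply: H0; exists A; split.
(* A null set is not the whole space, which leaves a good point to redirect to. *)
have [w0 Aw0] : exists w0, ~ A w0.
  apply: contrapT => H0; have : P setT = 0%E.
    by rewrite -PA; congr (P _); apply/seteqP; split => // w _; apply: contrapT => nA; apply: H0; exists w.
  by rewrite probability_setT => /eqP; rewrite onee_eq0.
apply: (@theta_limit_exists _ _ _ P T theta K F (d + d) m N1 b sigma x0 W X Xhat XN A w0) => //.
- by move=> w /HA[[]].
- by move=> w /HA[[]].
- by move=> w /HA[_ [[]]].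
- by move=> w /HA[_ [[]]].
- by move=> w N /HA[_ [_ H1]] /H1[].
- by move=> w N /HA[_ [_ H1]] /H1[].
Qed.
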